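(* Let $F_1$ and $F_2$ be rings with $1/2$ which are either both skewfields, or both integral domains (in the sense given in the context), or both commutative rings without central idempotents not equal to $1$ or $0$, or both local rings without central idempotents not equal to $1$ or $0$. Let $V_1$ and $V_2$ be free modules of infinite ranks $\varkappa_1$ and $\varkappa_2$ over $F_1$ and $F_2$, respectively, where $F_1$ has a maximal ideal generated by at most $\varkappa_1$ elements. Then the groups $\mathrm{Aut}_{F_1}(V_1)$ and $\mathrm{Aut}_{F_2}(V_2)$ are elementarily equivalent if and only if the theories $\mathrm{Th}_2^{\varkappa_1}(\langle \varkappa_1, F_1\rangle)$ and $\mathrm{Th}_2^{\varkappa_2}(\langle \varkappa_2, F_2\rangle)$ coincide.
   Context: Rings are associative with unit; ''with $1/2$'' means that $2$ is invertible in the ring; modules are left modules, and ideals serving as submodules of the ring are left ideals. In this paper a ring is called an integral domain if it has no zero divisors and each of its ideals is principal (generated by one element). A ring is local if the set of all its noninvertible elements is a left ideal. $\mathrm{Aut}_R(V)$ is the automorphism group of the $R$-module $V$; elementary equivalence of groups is with respect to the first order language of groups. For an infinite cardinal $\varkappa$ and a ring $R$, $\langle\varkappa,R\rangle$ is the two-sorted structure consisting of a set of cardinality $\varkappa$ (with equality only) and the ring $R$ with operations $+$ and $\cdot$. $\mathrm{Th}_2^{\varkappa}(\langle\varkappa,R\rangle)$ is the set of all true sentences of the following language: formulas are built by logical connectives from quantifiers over elements $\alpha\in\varkappa$ and over elements $r\in R$; atomic formulas $r_1=r_2+r_3$, $r_1=r_2\cdot r_3$, $r_1=r_2$, $\alpha_1=\alpha_2$;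 quantifiers $\forall$, $\exists$ over predicate variables $P(c_1,\dots,c_k;v_1,\dots,v_n)$, which range over the relations $P\subseteq\varkappa^k\times R^n$ of cardinality at most $\varkappa$; and atomic formulas $P(\alpha_1,\dots,\alpha_k;r_1,\dots,r_n)$. Sentences for different pairs $(\varkappa,R)$ are in the same formal language (with sort symbols for the set and for the ring), so that theories can be compared. *)

(* Defs.v *)
From HB Require Import structures.
From mathcomp Require Import all_boot all_order all_algebra.
From mathcomp Require Import boolp classical_sets functions cardinality.

Set Implicit Arguments.
Unset Strict Implicit.
Unset Printing Implicit Defensive.

Import GRing.Theory.

Local Open Scope classical_set_scope.
Local Open Scope card_scope.
Local Open Scope ring_scope.

Section Rings.
Variable R : nzRingType.

(* [GRing.unit] would require a [unitRingType]; rings here are not assumed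
   commutative, so invertibility is two-sided. *)
Definition invertible (x : R) : Prop := exists y : R, y * x = 1 /\ x * y = 1.

(* A left ideal is a submodule of the left module R^o. *)
Definition left_ideal (I : set R) : Prop :=
  submod_closed ([in I] : {pred R^o}).

Lemma left_idealE (I : set R) :
  left_ideal I <->
  [/\ I 0, forall x y, I x -> I y -> I (x + y) & forall a x, I x -> I (a * x)].
Proof.
split=> [[I0 IZ]|[I0 ID IM]].
  have {}I0 : I 0 by exact: (set_mem I0).
  have {}IZ (a x y : R) : I x -> I y -> I (a * x + y).
    by move=> Ix Iy; apply: set_mem; apply: IZ; apply: mem_set.
  split=> // [x y Ix Iy|a x Ix]; first by rewrite -[x]mul1r; apply: IZ.
  by rewrite -[a * x]addr0; apply: IZ.
split=> [|a x y]; first exact: (mem_set I0).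
by rewrite !in_setE => Ix Iy; apply: ID => //; apply: IM.
Qed.

Definition generated_left_ideal (S : set R) : set R := smallest left_ideal S.

Definition maximal_left_ideal (I : set R) : Prop :=
  [/\ left_ideal I, I <> setT
    & forall J, left_ideal J -> J <> setT -> I `<=` J -> J = I].

Definition skewfield : Prop := forall x : R, x <> 0 -> invertible x.

(* Commutativity is not required. *)
Definition principal_domain : Prop :=
  (forall x y : R, x * y = 0 -> x = 0 \/ y = 0) /\
  (forall I : set R, left_ideal I -> exists x, I = generated_left_ideal [set x]).

Definition no_nontrivial_central_idempotents : Prop :=
  forall e : R, e * e = e -> (forall x, e * x = x * e) -> e = 0 \/ e = 1.

Definition commutative_ring : Prop := forall x y : R, x * y = y * x.

Definition local_ring : Prop := left_ideal [set x | ~ invertible x].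

Definition has_maximal_left_ideal_generated_by_at_most (K : Type) : Prop :=
  exists I : set R, maximal_left_ideal I /\
    exists S : set R, S #<= [set: K] /\ I = generated_left_ideal S.

End Rings.

(* A cardinal is represented by a type K of that cardinality; a module is free
   of rank K when it has a basis indexed by K.  Finite linear combinations are
   given by a finite injective family s of indices. *)
Definition is_basis (R : nzRingType) (V : lmodType R) (K : Type)
    (b : K -> V) : Prop :=
  (forall (m : nat) (s : 'I_m -> K) (c : 'I_m -> R),
     injective s -> \sum_(i < m) c i *: b (s i) = 0 -> forall i, c i = 0) /\
  (forall v : V, exists (m : nat) (s : 'I_m -> K) (c : 'I_m -> R),
     injective s /\ v = \sum_(i < m) c i *: b (s i)).

Definition free_of_rank (R : nzRingType) (V : lmodType R) (K : Type) : Prop :=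
  exists b : K -> V, is_basis b.

Section Automorphisms.
Variables (R : nzRingType) (V : lmodType R).

Record module_aut : Type := ModuleAut {
  aut_val :> {linear V -> V};
  aut_bij : bijective aut_val
}.

Lemma module_aut_ext (f g : module_aut) : (forall x, f x = g x) -> f = g.
Proof.
case: f g => f fb [g gb] /= fg.
have efg : f = g.
  case: f g fg {fb gb} => [f fc] [g gc] /= /funext fg; subst g.
  congr GRing.Linear.Pack; case: fc gc => [[a] [b]] [[c] [d]].
  by rewrite (Prop_irrelevance a c) (Prop_irrelevance b d).
by subst g; rewrite (Prop_irrelevance fb gb).
Qed.

HB.instance Definition _ := gen_eqMixin module_aut.
HB.instance Definition _ := gen_choiceMixin module_aut.

Definition aut_one : module_aut :=
  @ModuleAut (@idfun V) (Bijective (fun=> erefl) (fun=> erefl)).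

Definition aut_mul (f g : module_aut) : module_aut :=
  @ModuleAut (aut_val f \o aut_val g) (bij_comp (aut_bij f) (aut_bij g)).

Lemma aut_inv_subproof (f : module_aut) :
  {g : module_aut | cancel f g /\ cancel g f}.
Proof.
apply: cid; case: (aut_bij f) => g fK gK.
have gl : linear g.
  by move=> a x y; apply: (can_inj fK); rewrite linearP !gK.
pose gL : {linear V -> V} :=
  HB.pack g (GRing.isLinear.Build R V V *:%R g gl).
have gb : bijective gL by exists f.
by exists (ModuleAut gb).
Qed.

Definition aut_inv (f : module_aut) : module_aut := sval (aut_inv_subproof f).

Lemma aut_invK (f : module_aut) : cancel f (aut_inv f).
Proof. by rewrite /aut_inv; case: (aut_inv_subproof f) => g []. Qed.

Lemma aut_Kinv (f : module_aut) : cancel (aut_inv f) f.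
Proof. by rewrite /aut_inv; case: (aut_inv_subproof f) => g []. Qed.

Lemma aut_mulA : associative aut_mul.
Proof. by move=> f g h; apply: module_aut_ext. Qed.

Lemma aut_mul1g : left_id aut_one aut_mul.
Proof. by move=> f; apply: module_aut_ext. Qed.

Lemma aut_mulg1 : right_id aut_one aut_mul.
Proof. by move=> f; apply: module_aut_ext. Qed.

Lemma aut_mulVg : left_inverse aut_one aut_inv aut_mul.
Proof. by move=> f; apply: module_aut_ext => x /=; rewrite aut_invK. Qed.

Lemma aut_mulgV : right_inverse aut_one aut_inv aut_mul.
Proof. by move=> f; apply: module_aut_ext => x /=; rewrite aut_Kinv. Qed.

HB.instance Definition _ := isGroup.Build module_aut
  aut_mulA aut_mul1g aut_mulg1 aut_mulVg aut_mulgV.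

End Automorphisms.

Definition Aut (R : nzRingType) (V : lmodType R) : groupType := module_aut V.

Inductive gterm : Type :=
| GVar of nat
| GOne
| GMul of gterm & gterm
| GInv of gterm.

Inductive gformula : Type :=
| GEq of gterm & gterm
| GNot of gformula
| GAnd of gformula & gformula
| GOr of gformula & gformula
| GImp of gformula & gformula
| GForall of nat & gformula
| GExists of nat & gformula.

Fixpoint gterm_vars_in (xs : seq nat) (t : gterm) : bool :=
  match t with
  | GVar i => i \in xs
  | GOne => true
  | GMul t1 t2 => gterm_vars_in xs t1 && gterm_vars_in xs t2
  | GInv t1 => gterm_vars_in xs t1
  end.

(* The free variables of the formula are all in xs. *)
Fixpoint gfree_in (xs : seq nat) (f : gformula) : bool :=
  match f with
  | GEq t1 t2 => gterm_vars_in xs t1 && gterm_vars_in xs t2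
  | GNot f1 => gfree_in xs f1
  | GAnd f1 f2 | GOr f1 f2 | GImp f1 f2 => gfree_in xs f1 && gfree_in xs f2
  | GForall i f1 | GExists i f1 => gfree_in (i :: xs) f1
  end.

Definition gsentence (f : gformula) : bool := gfree_in [::] f.

Section GroupSemantics.
Variable G : groupType.

Fixpoint geval (e : nat -> G) (t : gterm) : G :=
  match t with
  | GVar i => e i
  | GOne => 1%g
  | GMul t1 t2 => (geval e t1 * geval e t2)%g
  | GInv t1 => (geval e t1)^-1%g
  end.

Fixpoint gholds (e : nat -> G) (f : gformula) : Prop :=
  match f with
  | GEq t1 t2 => geval e t1 = geval e t2
  | GNot f1 => ~ gholds e f1
  | GAnd f1 f2 => gholds e f1 /\ gholds e f2
  | GOr f1 f2 => gholds e f1 \/ gholds e f2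
  | GImp f1 f2 => gholds e f1 -> gholds e f2
  | GForall i f1 => forall x : G, gholds [eta e with i |-> x] f1
  | GExists i f1 => exists x : G, gholds [eta e with i |-> x] f1
  end.

(* The valuation is irrelevant for a sentence. *)
Definition group_theory : set gformula :=
  [set f | gsentence f /\ forall e, gholds e f].

End GroupSemantics.

Definition elementarily_equivalent (G H : groupType) : Prop :=
  group_theory G = group_theory H.

(* The two-sorted language of the structures <K, R>.  Variables for elements of
   the set, variables for elements of the ring and predicate variables form
   three separate name spaces; the predicate variable (k, n, i) is the i-th one
   for relations with k arguments in the set and n arguments in the ring. *)

Definition pvar : eqType := (nat * nat * nat)%type.
Definition set_arity (p : pvar) : nat := p.1.1.
Definition ring_arity (p : pvar) : nat := p.1.2.

Inductive formula2 : Type :=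
| RAdd of nat & nat & nat
| RMul of nat & nat & nat
| REq of nat & nat
| SEq of nat & nat
| Rel (p : pvar) of (set_arity p).-tuple nat & (ring_arity p).-tuple nat
| FNot of formula2
| FAnd of formula2 & formula2
| FOr of formula2 & formula2
| FImp of formula2 & formula2
| SForall of nat & formula2
| SExists of nat & formula2
| RForall of nat & formula2
| RExists of nat & formula2
| PForall of pvar & formula2
| PExists of pvar & formula2.

(* The free set, ring and predicate variables are all in ss, rs and ps. *)
Fixpoint free_in2 (ss rs : seq nat) (ps : seq pvar) (f : formula2) : bool :=
  match f with
  | RAdd i j k | RMul i j k => [&& i \in rs, j \in rs & k \in rs]
  | REq i j => (i \in rs) && (j \in rs)
  | SEq i j => (i \in ss) && (j \in ss)
  | Rel p s r =>
      [&& p \in ps, all (fun i => i \in ss) s & all (fun i => i \in rs) r]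
  | FNot f1 => free_in2 ss rs ps f1
  | FAnd f1 f2 | FOr f1 f2 | FImp f1 f2 =>
      free_in2 ss rs ps f1 && free_in2 ss rs ps f2
  | SForall i f1 | SExists i f1 => free_in2 (i :: ss) rs ps f1
  | RForall i f1 | RExists i f1 => free_in2 ss (i :: rs) ps f1
  | PForall p f1 | PExists p f1 => free_in2 ss rs (p :: ps) f1
  end.

Definition sentence2 (f : formula2) : bool := free_in2 [::] [::] [::] f.

Section Semantics2.
Variables (K : Type) (R : nzRingType).

Definition relation2 (p : pvar) : Type :=
  set ((set_arity p).-tuple K * (ring_arity p).-tuple R).

(* [RAdd i j k] is r_i = r_j + r_k, and [RMul i j k] is r_i = r_j * r_k. *)
Fixpoint holds2 (es : nat -> K) (er : nat -> R)
    (ep : forall p : pvar, relation2 p) (f : formula2) : Prop :=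
  match f with
  | RAdd i j k => er i = er j + er k
  | RMul i j k => er i = er j * er k
  | REq i j => er i = er j
  | SEq i j => es i = es j
  | Rel p s r => ep p (map_tuple es s, map_tuple er r)
  | FNot f1 => ~ holds2 es er ep f1
  | FAnd f1 f2 => holds2 es er ep f1 /\ holds2 es er ep f2
  | FOr f1 f2 => holds2 es er ep f1 \/ holds2 es er ep f2
  | FImp f1 f2 => holds2 es er ep f1 -> holds2 es er ep f2
  | SForall i f1 => forall a : K, holds2 [eta es with i |-> a] er ep f1
  | SExists i f1 => exists a : K, holds2 [eta es with i |-> a] er ep f1
  | RForall i f1 => forall x : R, holds2 es [eta er with i |-> x] ep f1
  | RExists i f1 => exists x : R, holds2 es [eta er with i |-> x] ep f1
  | PForall p f1 => forall P : relation2 p,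
      P #<= [set: K] -> holds2 es er (@dfwith pvar relation2 ep p P) f1
  | PExists p f1 => exists P : relation2 p,
      P #<= [set: K] /\ holds2 es er (@dfwith pvar relation2 ep p P) f1
  end.

(* For inhabited K the valuations are irrelevant for a sentence. *)
Definition Th2 : set formula2 :=
  [set f | sentence2 f /\ forall es er ep, holds2 es er ep f].

End Semantics2.

(* Main.v *)
(* Both theories are interpretable in each other, uniformly in the ring, the cardinal
   and the module, so each determines the other.

   The group inside the two-sorted structure: an endomorphism is given by its matrix,
   a ternary relation of cardinality at most K with finitely supported rows, and the
   finite sums in a matrix product are expressed by partial sums along a chain.

   The two-sorted structure inside the group: G = Aut V is the unit group of E = End V,
   a ring with 1/2 and without nontrivial central idempotents.  A pair of anticommuting
   involutions makes E a ring of 2x2 matrices, the transvections 1 + a N code its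
   coefficients a, and commutators multiply them; since V is isomorphic to V + V the
   coefficient ring is again E, up to reversal of the product.  In E an infinite set of
   orthogonal primitive idempotents codes K, and the centraliser of finitely many
   elements codes R.  These elements come from countably many partial functions on a
   set of size K whose only common linear commutants are scalars; such families exist
   for every infinite K by a well-founded recursion on cardinals, where regular ones
   need a Fodor type argument on ladders.  A subset of K^k x R^n of size at most K is
   then listed by finitely many endomorphisms.  The opposite ring of E is excluded by a
   linear order without maximum on the idempotents for which rows have bounded support:
   functionals on a free module can have unbounded support, vectors cannot. *)

Require Import Defs.
From HB Require Import structures.
From mathcomp Require Import all_boot all_order all_algebra.
From mathcomp Require Import boolp classical_sets functions cardinality.
From mathcomp Require wochoice.
From mathcomp Require Import zify.
From Stdlib Require Ncring Ncring_tac.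
Set Implicit Arguments.
Unset Strict Implicit.
Unset Printing Implicit Defensive.
Import GRing.Theory.
Local Open Scope classical_set_scope.
Local Open Scope card_scope.
Local Open Scope ring_scope.

(** * Cardinals *)

(** Three obstacles shape the proof. The group formulas do not separate [endo V] from its opposite:
    commutators of coded transvections give [a b] or [b a] according to a sign which the parameters
    do not fix. So the sentence asks for parameters that also satisfy [rgood], and [rgood] has to
    fail in [(endo V)^c]. Next, only finitely many parameters can be named, while the index set may
    have any infinite size, and yet their centraliser has to act by scalars on the marked basis
    vectors. A countable family of operators is affordable, because a level coordinate in [nat] with
    two shifts packs it into one element; hence rigid families are countable. Finally, idempotents
    of rank one have to be recognised inside the ring. Over local rings and principal domains
    nonzero idempotents have free summands of rank one; over commutative rings images may be
    projective without being free, so another test is used. This is the flag [nc]. Ring elements are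
    decoded with reversed products, since modules are left modules and maps act on the left. *)

Definition emb (A B : Type) : Prop := exists f : A -> B, injective f.

Lemma ex_choice (A B : Type) (P : A -> B -> Prop) :
  (forall a, exists b, P a b) -> exists f, forall a, P a (f a).
Proof. by move=> /choice[f fP]; exists f. Qed.

Lemma emb_refl A : emb A A. Proof. by exists id. Qed.

Lemma emb_trans B A C : emb A B -> emb B C -> emb A C.
Proof. by move=> [f fi] [g gi]; exists (g \o f); apply: inj_comp. Qed.

Lemma emb_prod A B C D : emb A B -> emb C D -> emb (A * C) (B * D).
Proof.
move=> [f fi] [g gi]; exists (fun x => (f x.1, g x.2)) => -[a c] [a' c'] /= [].
by move=> /fi -> /gi ->.
Qed.

Lemma sval_inj (T : Type) (P : T -> Prop) (x y : {t | P t}) :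
  sval x = sval y -> x = y.
Proof. by apply: eq_sig_hprop => t p q; apply: Prop_irrelevance. Qed.

Lemma emb_card (T U : Type) : emb T U <-> [set: T] #<= [set: U].
Proof.
split=> [[f fi]|/card_leP[f]].
  apply/card_leP/injfunPex.
  exists (fun x => exist _ (f (set_val x)) (mem_set I)) => // x y _ _ [] /fi.
  exact: val_inj.
exists (fun x => set_val (f (exist _ x (mem_set I)))) => x y /val_inj.
by move=> /(inj (mem_set I) (mem_set I)) [].
Qed.

Lemma card_le_embP (T U : Type) (A : set T) :
  (A #<= [set: U]) <-> emb {x | A x} U.
Proof.
have AA : [set: {x | A x}] #= A.
  apply/Cantor_Bernstein.
    apply: (@card_le_trans _ _ _ [set: A]); last by rewrite (card_le_eql (card_setT A)).
    by apply/emb_card; exists (fun x => exist _ (sval x) (mem_set (svalP x))) => x y [] /sval_inj.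
  apply: (@card_le_trans _ _ _ [set: A]); first by rewrite (card_le_eqr (card_setT A)).
  by apply/emb_card; exists (fun x => exist _ (val x) (set_mem (valP x))) => x y [] /val_inj.
by rewrite emb_card (card_le_eql AA).
Qed.

Lemma emb_nat_infinite (K : Type) : infinite_set [set: K] -> emb nat K.
Proof. by move=> /infiniteP /emb_card. Qed.

Lemma emb_surj (A B : Type) : emb A B -> A -> exists g : B -> A, forall a, exists b, g b = a.
Proof.
move=> [f fi] a0.
exists (fun b => match pselect (exists a, f a = b) with left e => sval (cid e) | _ => a0 end).
move=> a; exists (f a); case: pselect => [e|[]]; last by exists a.
by case: (cid e) => /= a' /fi.
Qed.

(* Zorn's lemma, applied to partial injections. *)
Lemma emb_total (A B : Type) : emb A B \/ emb B A.
Proof.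
pose P : set (set (A * B)) := [set G | (forall a b b', G (a, b) -> G (a, b') -> b = b') /\
   (forall a a' b, G (a, b) -> G (a', b) -> a = a')].
have [|G [[Gf Gi] Gmax]] := @Zorn_bigcup _ P.
  move=> F FP Ftot; have two x y : (\bigcup_(X in F) X) x -> (\bigcup_(X in F) X) y ->
      exists2 X, F X & X x /\ X y.
    by move=> [X FX Xx] [Y FY Yy]; case: (Ftot X Y FX FY) => s;
      [exists Y|exists X] => //; split=> //; apply: s.
  split=> [a b b' /two h /h [X FX [x y]]|a a' b /two h /h [X FX [x y]]].
    exact: (FP _ FX).1 x y.
  exact: (FP _ FX).2 x y.
have [tot|/existsNP[a0 na0]] := pselect (forall a, exists b, G (a, b)).
  left; have [f fG] := choice tot; exists f => x y e.
  by apply: (Gi x y (f x)) => //; rewrite e.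
have [sur|/existsNP[b0 nb0]] := pselect (forall b, exists a, G (a, b)).
  right; have [f fG] := choice sur; exists f => x y e.
  by apply: (Gf (f x) x y) => //; rewrite e.
exfalso; apply: (Gmax (G `|` [set (a0, b0)])).
  split; first by move=> x; left.
  by move=> /(_ (a0, b0) (or_intror erefl)) h; apply: na0; exists b0.
split=> [a b b' [h|[ea eb]] [h'|[ea' eb']]|a a' b [h|[ea eb]] [h'|[ea' eb']]].
- exact: Gf h h'.
- by case: na0; exists b; rewrite -ea'.
- by case: na0; exists b'; rewrite -ea.
- by rewrite eb eb'.
- exact: Gi h h'.
- by case: nb0; exists a; rewrite -eb'.
- by case: nb0; exists a'; rewrite -eb.
- by rewrite ea ea'.
Qed.

Lemma emb_bool_square (K : Type) : emb nat K -> emb K (K * K) /\ emb (bool * K) (K * K).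
Proof.
move=> [f fi]; split; first by exists (fun x => (f 0%N, x)) => x y [].
exists (fun x => (f (nat_of_bool x.1), x.2)) => -[[] x] [[] y] /= [] //.
- by move=> ->.
- by move=> /fi.
- by move=> /fi.
- by move=> ->.
Qed.

Lemma emb_sum (A B C D : Type) : emb A C -> emb B D -> emb (A + B) (C + D).
Proof.
move=> [f fi] [g gi].
exists (fun x => match x with inl a => inl (f a) | inr b => inr (g b) end).
by move=> [a|b] [a'|b'] // [] => [/fi|/gi] ->.
Qed.

Lemma emb_sum_bool (A : Type) : emb (A + A) (bool * A).
Proof.
exists (fun x => match x with inl a => (true, a) | inr a => (false, a) end).
by move=> [a|a] [b|b] // [] ->.
Qed.

Lemma emb_split (K : Type) (D : set K) :
  emb K ({x | D x} + {x | ~ D x}).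
Proof.
exists (fun x => match pselect (D x) with
  | left p => inl (exist _ x p) | right p => inr (exist _ x p) end).
by move=> x y; case: pselect => p; case: pselect => q // [].
Qed.

(* Zorn's lemma yields a maximal set D together with an injection D x D -> D;
   were its complement at least as large as D, the injection would extend. *)
Lemma emb_square (K : Type) : emb nat K -> emb (K * K) K.
Proof.
move=> natK; have [nu nui] := natK.
pose dom (G : set (K * K * K)) := [set x | exists y z, G (x, y, z)].
pose good (G : set (K * K * K)) := [/\ forall x y z z', G (x, y, z) -> G (x, y, z') -> z = z',
  forall x y x' y' z, G (x, y, z) -> G (x', y', z) -> x = x' /\ y = y',
  forall x y, dom G x -> dom G y -> exists z, G (x, y, z) &
  forall x y z, G (x, y, z) -> dom G y /\ dom G z].
have [p pinj] : emb (nat * nat) nat.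
  by apply/emb_card; rewrite (card_le_eql card_nat2).
pose G0 : set (K * K * K) := [set t | exists m n, t = (nu m, nu n, nu (p (m, n)))].
(* Candidates are adjoined to the fixed [G0], a copy of the pairing on [nat]: their domains are
   infinite from the start, which the doubling [D2] of [D] needs. *)
pose P : set (set (K * K * K)) := [set G | good (G0 `|` G)].
have goodG0 : good G0.
  have domG0 n : dom G0 (nu n) by exists (nu n), (nu (p (n, n))), n, n.
  split.
  - by move=> x y z z' [m [n [-> -> ->]]] [m' [n' [/nui <- /nui <- ->]]].
  - by move=> x y x' y' z [m [n [-> -> ->]]] [m' [n' [-> -> /nui/pinj[-> ->]]]].
  - move=> x y [_ [_ [m [_ [-> _ _]]]]] [_ [_ [n [_ [-> _ _]]]]].
    by exists (nu (p (m, n))), m, n.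
  - by move=> x y z [m [n [_ -> ->]]].
have domS (G H : set (K * K * K)) : G `<=` H -> dom G `<=` dom H.
  by move=> s x [y [z h]]; exists y, z; apply: s.
have [|M [Mg Mmax]] := @Zorn_bigcup _ P.
  move=> F FP Ftot; rewrite /P /=.
  set U := (X in good X).
  have two x y : U x -> U y -> exists2 H, good H & [/\ H `<=` U, H x & H y].
    have one X x' y' : F X -> (G0 `|` X) x' -> (G0 `|` X) y' ->
        exists2 H, good H & [/\ H `<=` U, H x' & H y'].
      move=> FX hx hy; exists (G0 `|` X); first exact: FP.
      by split=> // t [h|h]; [left|right; exists X].
    move=> [h|[X FX Xx]] [h'|[Y FY Yy]].
    - by exists G0 => //; split=> // t; left.
    - by apply: (one Y) => //; [left|right].
    - by apply: (one X) => //; [right|left].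
    - by case: (Ftot X Y FX FY) => s; [apply: (one Y)|apply: (one X)] => //; right => //; apply: s.
  split.
  - by move=> x y z z' /two h /h [H [Hf _ _ _] [_ a b]]; apply: Hf a b.
  - by move=> x y x' y' z /two h /h [H [_ Hi _ _] [_ a b]]; apply: Hi a b.
  - move=> x y [x1 [x2 /two h]] [y1 [y2 /h [H [_ _ Ht _] [s a b]]]].
    by have [|| z /s] := Ht x y; [exists x1, x2|exists y1, y2|exists z].
  - move=> x y z /[dup] /two h /h [H [_ _ _ Hc] [s a _]].
    by case: (Hc _ _ _ a) => b c; split; apply: (domS _ _ s).
rewrite /P /= in Mg; set G := (X in good X) in Mg; have [Gf Gi Gt Gc] := Mg.
pose D := {x | dom G x}.
have DD : emb (D * D) D.
  have H (u : D * D) : exists z : D, G (sval u.1, sval u.2, sval z).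
    case: u => -[x Dx] [y Dy] /=; have [z Gz] := Gt x y Dx Dy.
    by exists (exist _ z (Gc _ _ _ Gz).2).
  have [f fG] := choice H; exists f => -[x y] [x' y'] e.
  have := fG (x', y'); rewrite -e => /(Gi _ _ _ _ _ (fG (x, y)))[/=].
  by move=> /sval_inj -> /sval_inj ->.
have natD : emb nat D.
  have h n : dom G (nu n) by exists (nu n), (nu (p (n, n))); left; exists n, n.
  by exists (fun n => exist _ (nu n) (h n)) => m n [] /nui.
have D2 : emb (bool * D) D := emb_trans (emb_bool_square natD).2 DD.
have [DN|ND] := emb_total D {x | ~ dom G x}; last first.
  have KD : emb K D.
    apply: emb_trans (emb_split (dom G)) _.
    exact: emb_trans (emb_sum (emb_refl _) ND) (emb_trans (emb_sum_bool D) D2).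
  apply: emb_trans (emb_prod KD KD) (emb_trans DD _).
  by exists sval => x y /sval_inj.
exfalso; have [g gi] := DN.
pose E : set K := [set x | exists d : D, x = sval (g d)].
have ED x : E x -> ~ dom G x by move=> [d ->]; apply: (svalP (g d)).
pose D' : set K := dom G `|` E.
have D'D : emb {x | D' x} D.
  apply: emb_trans D2.
  have H (x : {x | D' x}) : exists u : bool * D,
     sval x = if u.1 then sval u.2 else sval (g u.2).
    case: x => x [h|[d h]] /=; first by exists (true, exist _ x h).
    by exists (false, d).
  have [f fP] := choice H; exists f => x y e; apply: sval_inj.
  by rewrite !fP e.
have [q qi] : emb ({x | D' x} * {x | D' x}) D.
  exact: emb_trans (emb_prod D'D D'D) DD.
(* [E] is a copy of the domain inside its complement. New pairs have a coordinate in [E] and values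
   in [E], so they collide neither with the pairs nor with the values of [G]. *)
pose N : set (K * K * K) := [set t | exists (x y : {x | D' x}),
   [/\ E (sval x) \/ E (sval y), t.1.1 = sval x, t.1.2 = sval y & t.2 = sval (g (q (x, y)))]].
have GN x y z : G (x, y, z) -> ~ (E x \/ E y).
  move=> h [/ED|/ED]; first by apply; exists y, z.
  by apply; exact: (Gc _ _ _ h).1.
have eE (x : {x | D' x}) : E (sval x) -> ~ dom G (sval x) by exact: ED.
have gE d : E (sval (g d)) by exists d.
have dN x : dom (G `|` N) x -> D' x.
  case=> y [z [h|[u [v [_ /= -> _ _]]]]]; last exact: (svalP u).
  by left; exists y, z.
apply: (Mmax (M `|` N)).
  split; first by move=> t; left.
  have [d0] : exists d : D, True by case: natD => f _; exists (f 0%N).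
  move=> _ s; pose e0 : {x | D' x} := exist _ _ (or_intror (gE d0)).
  have : N (sval e0, sval e0, sval (g (q (e0, e0)))).
    by exists e0, e0; split=> //; left; exact: gE.
  move=> h; have : M (sval e0, sval e0, sval (g (q (e0, e0)))) by apply: s; right.
  by move=> h'; case: (GN _ _ _ (or_intror h')); left; exact: gE.
rewrite /P /= setUA -/G.
split.
- move=> x y z z' [h|[u [v [h /= eu ev ->]]]] [h'|[u' [v' [h' /= eu' ev' ->]]]].
  + exact: Gf h h'.
  + by case: (GN _ _ _ h); rewrite eu' ev'.
  + by case: (GN _ _ _ h'); rewrite eu ev.
  + by have [-> ->] : u = u' /\ v = v' by split; apply: sval_inj; congruence.
- move=> x y x' y' z [h|[u [v [h /= -> -> ->]]]] [h'|[u' [v' [h' /= -> -> e]]]].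
  + exact: Gi h h'.
  + by case: (ED z); rewrite ?e //; have [_] := Gc _ _ _ h; rewrite e.
  + by have [_ /(ED _ (gE _))] := Gc _ _ _ h'.
  + by move: e => /sval_inj/gi/qi[-> ->].
- move=> x y /dN Dx /dN Dy.
  have [h|/not_orP[nx ny]] := pselect (E x \/ E y).
    by exists (sval (g (q (exist _ x Dx, exist _ y Dy)))); right; exists (exist _ x Dx), (exist _ y Dy).
  have [|| z Gz] := Gt x y; [by case: Dx|by case: Dy|].
  by exists z; left.
- have dM : dom G `<=` dom (G `|` N) by apply: domS => t; left.
  have dE w : E w -> dom (G `|` N) w.
    move=> Ew; pose e : {x | D' x} := exist _ w (or_intror Ew).
    by exists w, (sval (g (q (e, e)))); right; exists e, e; split=> //; left.
  move=> x y z [/Gc[a b]|[u [v [h /= _ -> ->]]]]; first by split; apply: dM.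
  split; last exact: dE (gE _).
  by case: (svalP v) => [/dM|/dE].
Qed.

Lemma emb_seq (K : Type) : emb nat K -> emb (seq K) K.
Proof.
move=> natK; have [p pi] := emb_square natK; have [nu nui] := natK.
pose enc := fix enc (s : seq K) : K := if s is x :: s' then p (x, enc s') else nu 0%N.
(* [enc] is injective only on sequences of equal length, since [nu 0%N] may itself be a pair; the
   length is therefore stored too. *)
exists (fun s => p (nu (size s), enc s)) => s t /pi[/nui].
elim: s t => [|x s IH] [|y t] //= [] e /pi[-> /IH]; by move=> ->.
Qed.

Lemma emb_nat_prod (K A : Type) : emb nat K -> emb A K -> emb (A * nat) K.
Proof. by move=> nK AK; apply: emb_trans (emb_prod AK nK) (emb_square nK). Qed.

(** * Well-orders *)

Record is_wo (T : Type) (lt : T -> T -> Prop) : Prop := IsWo {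
  wo_wf : well_founded lt;
  wo_tr : forall x y z, lt x y -> lt y z -> lt x z;
  wo_tot : forall x y, [\/ lt x y, x = y | lt y x]
}.

Lemma wo_irr (T : Type) (lt : T -> T -> Prop) : is_wo lt -> forall x, ~ lt x x.
Proof.
by move=> wo x; elim/(well_founded_ind (wo_wf wo)): x => x IH h; apply: (IH x).
Qed.

Lemma wo_min (T : Type) (lt : T -> T -> Prop) (P : T -> Prop) : is_wo lt ->
  (exists x, P x) -> exists x, P x /\ forall y, P y -> ~ lt y x.
Proof.
move=> wo [x]; elim/(well_founded_ind (wo_wf wo)): x => x IH Px.
have [[y [Py yx]]|/forallNP h] := pselect (exists y, P y /\ lt y x).
  exact: (IH y).
by exists x; split=> // y Py yx; apply: (h y).
Qed.

Lemma wo_nlt (T : Type) (lt : T -> T -> Prop) : is_wo lt ->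
  forall x y, ~ lt x y -> y = x \/ lt y x.
Proof. by move=> wo x y; case: (wo_tot wo x y); auto. Qed.

(** A relation for which every nonempty subset has a unique least element is a well-order: subsets
    of one, two and three points give reflexivity, totality, antisymmetry and transitivity. *)
Lemma well_order_exists (T : Type) : exists lt : T -> T -> Prop, is_wo lt.
Proof.
suff eqT (U : eqType) : exists lt : U -> U -> Prop, is_wo lt.
  by have := eqT (HB.pack_for eqType T (gen_eqMixin T)).
have [R Rwo] := wochoice.well_ordering_principle U.
have Rmin (P : U -> Prop) : (exists x, P x) ->
    exists x, P x /\ forall y, P y -> R x y.
  move=> [x Px]; have [|z [[Pz lz] _]] := Rwo [pred x | `[< P x >]].
    by exists x; apply/asboolP.
  exists z; split; first exact/asboolP.
  by move=> y Py; apply: lz; apply/asboolP.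
have Ruq (P : U -> Prop) x y : P x -> P y -> (forall z, P z -> R x z) ->
    (forall z, P z -> R y z) -> x = y.
  move=> Px Py lx ly; have [|z [_ u]] := Rwo [pred x | `[< P x >]].
    by exists x; apply/asboolP.
  rewrite -(u x) ?(u y) //; split; try exact/asboolP.
    by move=> t /asboolP; apply: ly.
  by move=> t /asboolP; apply: lx.
have Rxx x : R x x.
  by have [|y [-> h]] := Rmin (fun y => y = x); [exists x|apply: h].
have Rtot x y : R x y \/ R y x.
  have [|z [[->|->] h]] := Rmin (fun z => z = x \/ z = y); first by exists x; left.
    by left; apply: h; right.
  by right; apply: h; left.
have Ranti x y : R x y -> R y x -> x = y.
  move=> xy yx; apply: (Ruq (fun z => z = x \/ z = y)); auto.
    by move=> z [->|->].
  by move=> z [->|->].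
exists (fun x y => R x y /\ x <> y); split.
- move=> x; apply: contrapT => nx.
  have [|y [ny h]] := Rmin (fun y => ~ Acc (fun x y => R x y /\ x <> y) y); first by exists x.
  apply: ny; split=> z [Rzy nzy]; apply: contrapT => nz.
  by apply: nzy; apply: Ranti => //; apply: h.
- move=> x y z [xy nxy] [yz nyz].
  have [|t [ht h]] := Rmin (fun t => [\/ t = x, t = y | t = z]); first by exists x; constructor 1.
  have hx := h x (Or31 _ _ erefl); have hy := h y (Or32 _ _ erefl); have hz := h z (Or33 _ _ erefl).
  case: ht => e; subst t.
  + split=> // e; subst z; exact: nyz (Ranti _ _ yz xy).
  + by case: nxy; apply: Ranti.
  + by case: nyz; apply: Ranti.
- move=> x y; have [->|nxy] := pselect (x = y); first by constructor 2.
  by case: (Rtot x y) => h; [constructor 1|constructor 3]; split=> // e; apply: nxy.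
Qed.

(** * Free modules *)

Section FreeModules.
Variables (R : nzRingType) (V : lmodType R) (X : eqType) (b : X -> V).
Hypothesis bB : is_basis b.

(** Indices may repeat, so that adding combinations is concatenating lists; [lincomb_group] returns
    to the injective families of [is_basis]. *)
Definition lincomb (W : lmodType R) (g : X -> W) (L : seq (R * X)) : W :=
  \sum_(p <- L) p.1 *: g p.2.

Lemma lincomb_cat (W : lmodType R) (g : X -> W) L M :
  lincomb g (L ++ M) = lincomb g L + lincomb g M.
Proof. by rewrite /lincomb big_cat. Qed.

Lemma lincombZ (W : lmodType R) (g : X -> W) a L :
  lincomb g [seq (a * p.1, p.2) | p <- L] = a *: lincomb g L.
Proof. by rewrite /lincomb big_map scaler_sumr; apply: eq_bigr => p _; rewrite scalerA. Qed.

Lemma lincomb_group (W : lmodType R) (g : X -> W) L :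
  lincomb g L = \sum_(x <- undup [seq p.2 | p <- L]) (\sum_(p <- L | p.2 == x) p.1) *: g x.
Proof.
rewrite /lincomb.
transitivity (\sum_(x <- undup [seq p.2 | p <- L]) \sum_(p <- L | p.2 == x) p.1 *: g p.2); last first.
  by apply: eq_bigr => x _; rewrite scaler_suml; apply: eq_bigr => p /eqP ->.
rewrite (exchange_big_dep xpredT) //= big_seq [RHS]big_seq; apply: eq_bigr => p pL.
rewrite [RHS]big_mkcond (bigD1_seq p.2) ?undup_uniq ?mem_undup ?map_f //=.
by rewrite eqxx /= big1 ?addr0 // => x /negbTE xp; rewrite eq_sym xp.
Qed.

(** This makes linear extension well defined: a relation among the [b x], once equal indices are
    collected, has zero coefficients, hence holds for every [g]. *)
Lemma lincomb0 (W : lmodType R) (g : X -> W) L : lincomb b L = 0 -> lincomb g L = 0.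
Proof.
rewrite !lincomb_group; set u := undup _ => h.
have uu : uniq u by rewrite undup_uniq.
pose c x := \sum_(p <- L | p.2 == x) p.1.
have c0 x : x \in u -> c x = 0.
  move=> xu; have x0 := x.
  pose s (i : 'I_(size u)) := nth x0 u i.
  have si : injective s.
    by move=> i j /eqP; rewrite /s nth_uniq // => /eqP /val_inj.
  have := bB.1 _ s (fun i => c (s i)) si; rewrite /s.
  have -> : \sum_(i < size u) c (nth x0 u i) *: b (nth x0 u i) = 0.
    by rewrite -[RHS]h (big_nth x0) big_mkord.
  move=> /(_ erefl) H; have ix : (index x u < size u)%N by rewrite index_mem.
  by have := H (Ordinal ix); rewrite /= nth_index.
by rewrite big_seq big1 // => x xu; rewrite -/(c x) c0 // scale0r.
Qed.

Lemma lincomb_span v : exists L, lincomb b L = v.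
Proof.
have [m [s [c [_ ->]]]] := bB.2 v.
exists [seq (c i, s i) | i <- enum 'I_m].
by rewrite /lincomb big_map big_enum.
Qed.

Lemma lift_exists (W : lmodType R) (g : X -> W) :
  exists f : V -> W, linear f /\ forall x, f (b x) = g x.
Proof.
have [rep repP] := choice lincomb_span.
exists (fun v => lincomb g (rep v)); split.
  move=> a u v /=; apply/eqP; rewrite -subr_eq0; apply/eqP.
  rewrite -[a *: lincomb _ _]lincombZ -lincomb_cat -scaleN1r -lincombZ -lincomb_cat.
  apply: lincomb0; rewrite !lincomb_cat !lincombZ lincomb_cat lincombZ !repP.
  by rewrite scaleN1r subrr.
move=> x; apply/eqP; rewrite -subr_eq0; apply/eqP.
have -> : - g x = lincomb g [:: (-1, x)] by rewrite /lincomb big_seq1 scaleN1r.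
rewrite -lincomb_cat; apply: lincomb0.
by rewrite lincomb_cat repP /lincomb big_seq1 scaleN1r subrr.
Qed.

Definition lift (W : lmodType R) (g : X -> W) : V -> W := sval (cid (lift_exists g)).

Lemma lift_linear (W : lmodType R) (g : X -> W) : linear (lift g).
Proof. by rewrite /lift; case: cid => f []. Qed.

Lemma lift_b (W : lmodType R) (g : X -> W) x : lift g (b x) = g x.
Proof. by rewrite /lift; case: cid => f []. Qed.

Definition coord (v : V) (x : X) : R := lift (fun y => (y == x)%:R : R^o) v.

Lemma coord_b x y : coord (b x) y = (x == y)%:R.
Proof. by rewrite /coord lift_b. Qed.

Lemma coordP a u v x : coord (a *: u + v) x = a * coord u x + coord v x.
Proof. by rewrite /coord lift_linear. Qed.

Lemma lin_sum (W : lmodType R) (f : V -> W) : linear f ->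
  forall I (r : seq I) (c : I -> R) (w : I -> V),
  f (\sum_(i <- r) c i *: w i) = \sum_(i <- r) c i *: f (w i).
Proof.
move=> fl I r c w.
have f0 : f 0 = 0 by have := fl (-1) 0 0; rewrite scaler0 addr0 scaleN1r addNr.
elim: r => [|i r IH]; first by rewrite !big_nil f0.
by rewrite !big_cons fl IH.
Qed.

Lemma coord_sum I (r : seq I) (c : I -> R) (w : I -> V) x :
  coord (\sum_(i <- r) c i *: w i) x = \sum_(i <- r) c i * coord (w i) x.
Proof. by rewrite /coord (lin_sum (@lift_linear _ _)). Qed.

Lemma coord0 x : coord 0 x = 0.
Proof. by have := coord_sum [::] (fun _ : bool => 0) (fun _ => 0) x; rewrite !big_nil. Qed.

Lemma coordD u v x : coord (u + v) x = coord u x + coord v x.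
Proof. by have := coordP 1 u v x; rewrite scale1r mul1r. Qed.

Lemma coordZ a v x : coord (a *: v) x = a * coord v x.
Proof. by have := coordP a v 0 x; rewrite !addr0 coord0 addr0. Qed.

Lemma basis_expand v : exists s : seq X, [/\ uniq s,
  v = \sum_(x <- s) coord v x *: b x & forall x, coord v x <> 0 -> x \in s].
Proof.
have [L Lv] := lincomb_span v.
exists (undup [seq p.2 | p <- L]).
pose c x := \sum_(p <- L | p.2 == x) p.1.
have E : v = \sum_(x <- undup [seq p.2 | p <- L]) c x *: b x.
  by rewrite -lincomb_group.
set s := undup _ in E *.
have us : uniq s by rewrite undup_uniq.
have C x : coord v x = if x \in s then c x else 0.
  rewrite {1}E coord_sum; case: ifP => xs.
    rewrite (bigD1_seq x) //= coord_b eqxx mulr1 big1 ?addr0 // => y yx.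
    by rewrite coord_b (negbTE yx) mulr0.
  rewrite big_seq big1 // => y ys; rewrite coord_b; case: eqP => [e|_]; last by rewrite mulr0.
  by rewrite -e ys in xs.
split=> //; last by move=> x; rewrite C; case: ifP.
by rewrite {1}E big_seq [RHS]big_seq; apply: eq_bigr => x xs; rewrite C xs.
Qed.

Lemma coord_inj u v : (forall x, coord u x = coord v x) -> u = v.
Proof.
move=> h; apply/eqP; rewrite -subr_eq0; apply/eqP.
have [s [_ -> _]] := basis_expand (u - v).
rewrite big1 // => x _; rewrite -scaleN1r coordD coordZ h mulN1r subrr scale0r //.
Qed.

Lemma linear_coord (W : lmodType R) (f : V -> W) v : linear f ->
  exists s : seq X, [/\ uniq s, forall x, coord v x <> 0 -> x \in s &
    f v = \sum_(x <- s) coord v x *: f (b x)].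
Proof.
move=> fl; have [s [us e h]] := basis_expand v; exists s; split=> //.
by rewrite {1}e (lin_sum fl).
Qed.

Lemma linear_ext (W : lmodType R) (f g : V -> W) : linear f -> linear g ->
  (forall x, f (b x) = g (b x)) -> f = g.
Proof.
move=> fl gl h; apply/funext => v; have [s [_ -> _]] := basis_expand v.
by rewrite (lin_sum fl) (lin_sum gl); apply: eq_bigr => x _; rewrite h.
Qed.

Lemma lin_zero (W : lmodType R) (f : V -> W) : linear f -> f 0 = 0.
Proof. by move=> fl; have := lin_sum fl [::] (fun _ : bool => 0) (fun _ => 0); rewrite !big_nil. Qed.

Lemma linZ (W : lmodType R) (f : V -> W) a v : linear f -> f (a *: v) = a *: f v.
Proof. by move=> fl; have := fl a v 0; rewrite (lin_zero fl) !addr0. Qed.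

Lemma linD (W : lmodType R) (f : V -> W) u v : linear f -> f (u + v) = f u + f v.
Proof. by move=> fl; have := fl 1 u v; rewrite !scale1r. Qed.

Definition opmap (o : X -> option X) : V -> V := lift (fun x => if o x is Some y then b y else 0).

Lemma opmap_linear o : linear (opmap o). Proof. exact: lift_linear. Qed.

Lemma opmap_b o x : opmap o (b x) = if o x is Some y then b y else 0.
Proof. exact: lift_b. Qed.

(** Only indices in the support of [v] compete for [z], so [o] may identify other points, as happens
    when the ladders of two limits meet. *)
Lemma coord_opmap o v x z : o x = Some z ->
  (forall y, o y = Some z -> coord v y <> 0 -> y = x) -> coord (opmap o v) z = coord v x.
Proof.
move=> ox uq; have [s [us sup ->]] := linear_coord v (opmap_linear o).
have H y : coord v y * coord (opmap o (b y)) z = if y == x then coord v y else 0.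
  rewrite opmap_b; case: eqP => [->|yx].
    by rewrite ox coord_b eqxx mulr1.
  case E : (o y) => [w|]; last by rewrite coord0 mulr0.
  rewrite coord_b; case: eqP => [e|_]; last by rewrite mulr0.
  rewrite e in E; have [->|/eqP n0] := eqVneq (coord v y) 0; first by rewrite mul0r.
  by case: yx; apply: uq.
rewrite coord_sum (eq_bigr _ (fun y _ => H y)).
have [xs|xs] := boolP (x \in s).
  by rewrite (bigD1_seq x) //= eqxx big1 ?addr0 // => y /negbTE ->.
rewrite big_seq big1 => [|y ys]; last by case: eqP => // e; rewrite -e ys in xs.
by apply/esym; apply: contrapT => /sup; rewrite (negbTE xs).
Qed.

Lemma coord_opmap0 o v z :
  (forall y, o y = Some z -> coord v y = 0) -> coord (opmap o v) z = 0.
Proof.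
move=> h; have [s [us sup ->]] := linear_coord v (opmap_linear o).
rewrite coord_sum big1 // => y _; rewrite opmap_b.
case E : (o y) => [w|]; last by rewrite coord0 mulr0.
rewrite coord_b; case: eqP => [e|_]; last by rewrite mulr0.
by rewrite h ?mul0r // -e.
Qed.

Lemma coord_opmap_neq0 o v z : coord (opmap o v) z <> 0 ->
  exists y, o y = Some z /\ coord v y <> 0.
Proof.
move=> h; apply: contrapT => /forallNP n; apply: h; apply: coord_opmap0 => y oy.
by apply: contrapT => c; apply: (n y).
Qed.

End FreeModules.

Section FreeModule.
Variables (R : nzRingType) (X : eqType).

(** A concrete free module on any index set; [rigid_apply] needs one on the points of a rigid
    structure, over a ring given in advance. *)
Definition finsupp_pred : {pred X -> R^o} :=
  [pred f : X -> R^o | `[< exists s : seq X, forall x, f x <> 0 -> x \in s >]].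

Lemma finsupp_submod : GRing.subsemimod_closed finsupp_pred.
Proof.
split; first split.
- by apply/asboolP; exists [::] => x /(_ erefl).
- move=> f g /asboolP[s sP] /asboolP[t tP]; apply/asboolP; exists (s ++ t) => x h.
  rewrite mem_cat; have [f0|/eqP/sP -> //] := eqVneq (f x) 0.
  by rewrite tP ?orbT // => g0; apply: h; have -> : (f + g) x = f x + g x by []; rewrite f0 g0 addr0.
- move=> a f /asboolP[s sP]; apply/asboolP; exists s => x h; apply: sP => f0.
  by apply: h; have -> : (a *: f) x = a * f x by []; rewrite f0 mulr0.
Qed.

HB.instance Definition _ := GRing.isSubSemiModClosed.Build R _ finsupp_pred finsupp_submod.

Definition freemod := {f : X -> R^o | finsupp_pred f}.
HB.instance Definition _ := [isSub of freemod for @sval _ _].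
HB.instance Definition _ := gen_eqMixin freemod.
HB.instance Definition _ := gen_choiceMixin freemod.
HB.instance Definition _ := [SubChoice_isSubLmodule of freemod by <:].

Lemma freemod_basis : exists b : X -> freemod, is_basis b.
Proof.
have bP x : finsupp_pred (fun y => (y == x)%:R).
  by apply/asboolP; exists [:: x] => y; rewrite inE; case: eqP.
pose b x : freemod := @exist (X -> R^o) (fun f => finsupp_pred f) _ (bP x).
have valZ m (c : 'I_m -> R) (w : 'I_m -> freemod) y :
    sval (\sum_(i < m) c i *: w i) y = \sum_(i < m) c i * sval (w i) y.
  by rewrite (big_morph (fun v : freemod => sval v y) (id1 := 0) (op1 := +%R)).
exists b; split=> [m s c si h i|[f fP]].
  have := congr1 (fun v => sval v (s i)) h; rewrite valZ (bigD1 i) //= eqxx mulr1.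
  rewrite big1 ?addr0 // => j ji; case: eqP => [/si e|_]; last by rewrite mulr0.
  by rewrite e eqxx in ji.
have /asboolP[s sP] := fP; exists (size (undup s)), (tnth (in_tuple (undup s))), (fun i => f (tnth (in_tuple (undup s)) i)).
split.
  by apply/tuple_uniqP; rewrite /= undup_uniq.
apply: val_inj; apply/funext => y; rewrite /= -[RHS]/(sval _ y) valZ /=.
rewrite -(big_tnth _ _ _ xpredT (fun x => f x * (y == x)%:R)) /=.
have [ys|ys] := boolP (y \in s).
  rewrite (bigD1_seq y) ?mem_undup ?undup_uniq //= eqxx mulr1 big1 ?addr0 // => x /negbTE.
  by rewrite eq_sym => ->; rewrite mulr0.
rewrite big_seq big1 => [|x]; first by apply: contrapT => /sP; rewrite (negbTE ys).
rewrite mem_undup; case: eqP => [<-|_]; first by rewrite (negbTE ys).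
by rewrite mulr0.
Qed.
End FreeModule.

Arguments coord_inj [R V X b] bB [u v] _.
Arguments coord_opmap [R V X b] bB [o v x z] _ _.
Arguments coord_opmap0 [R V X b] bB [o v z] _.
Arguments coord_opmap_neq0 [R V X b] bB [o v z] _.

(** * Rigid families of operators *)

(* A family of partial functions on a set X of size at most B whose only common
   linear commutants, over any ring, act as scalars on the points rz k. *)
Record rigid_struct (B K : Type) : Type := RigidStruct {
  rX : eqType;
  rop : nat -> rX -> option rX;
  rz : K -> rX;
  rz_inj : injective rz;
  rX_emb : emb rX B;
  rP : forall (R : nzRingType) (V : lmodType R) (b : rX -> V) (bB : is_basis b) (f : V -> V),
    linear f -> (forall n v, f (opmap bB (rop n) v) = opmap bB (rop n) (f v)) ->
    exists r, forall k, f (b (rz k)) = r *: b (rz k)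
}.

Definition rigid (B K : Type) : Prop := exists _ : rigid_struct B K, True.

Lemma rigid_emb (B K K' : Type) : rigid B K' -> emb K K' -> rigid B K.
Proof.
move=> [[X o z zi XB P] _] [g gi].
have zgi : injective (z \o g) by apply: inj_comp.
unshelve eexists (@RigidStruct B K X o (z \o g) zgi XB _); last by [].
by move=> R V b bB f fl fc; have [r h] := P R V b bB f fl fc; exists r => k; apply: h.
Qed.

(** Lowering kills [b 0%N], hence also its image under a commutant, which is then a multiple of
    [b 0%N]; raising carries the same scalar to all other points. *)
Lemma rigid_nat (B : Type) : emb nat B -> rigid B nat.
Proof.
move=> nB.
pose o (n : nat) (x : nat) := if n is 0 then Some x.+1 else if x is y.+1 then Some y else None.
unshelve eexists (@RigidStruct B nat nat o id (fun _ _ => id) nB _); last by [].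
move=> R V b bB f fl fc.
have S x : f (b x.+1) = opmap bB (o 0%N) (f (b x)) by rewrite -fc opmap_b.
exists (coord bB (f (b 0%N)) 0%N).
have f0 : f (b 0%N) = coord bB (f (b 0%N)) 0%N *: b 0%N.
  apply: (coord_inj bB) => -[|x]; rewrite coordZ coord_b ?mulr1 ?mulr0 //.
  rewrite -(coord_opmap bB (o := o 1%N) (x := x.+1) (z := x)) //.
    by rewrite -fc opmap_b /= (lin_zero fl) coord0.
  by move=> [|y] //= [->].
elim=> [//|k IH]; rewrite S IH (linZ _ _ (opmap_linear bB _)) opmap_b //.
Qed.

(* A rigid structure transported along i and j into the index set of a larger
   free module still forces a scalar matrix coefficient. *)
Lemma rigid_apply (B K : Type) (S : rigid_struct B K) (R : nzRingType) (V : lmodType R)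
    (X : eqType) (b : X -> V) (bB : is_basis b) (o : nat -> X -> option X) (f : V -> V)
    (i j : rX S -> X) :
  linear f -> (forall n v, f (opmap bB (o n) v) = opmap bB (o n) (f v)) ->
  injective j ->
  (forall n y, o n (i y) = omap i (rop n y)) ->
  (forall n y, o n (j y) = omap j (rop n y)) ->
  (forall n x y, o n x = Some (j y) -> exists y', x = j y') ->
  exists r, forall k y, coord bB (f (b (i (rz S k)))) (j y) = r * (rz S k == y)%:R.
Proof.
move=> fl fc ji oi oj ojx.
have [bY bYB] := freemod_basis R (rX S).
(* [sg] embeds along [i], [ro] projects along [j]. Both intertwine the operators, so [ro \o f \o sg]
   is a commutant on the rigid structure. For [ro] this uses that the complement of the image of [j]
   is stable, which is the last hypothesis. *)
pose sg : freemod R (rX S) -> V := lift bYB (fun y => b (i y)).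
pose ro : V -> freemod R (rX S) := lift bB (fun x =>
  if pselect (exists y, x = j y) is left h then bY (sval (cid h)) else 0).
have roj y : ro (b (j y)) = bY y.
  rewrite /ro lift_b; case: pselect => [h|[]]; last by exists y.
  by rewrite -(ji _ _ (svalP (cid h))).
have ro0 x : (forall y, x <> j y) -> ro (b x) = 0.
  by move=> h; rewrite /ro lift_b; case: pselect => [h'|//]; case: (h _ (svalP (cid h'))).
have sgl : linear sg by exact: lift_linear.
have rol : linear ro by exact: lift_linear.
have Tl n := opmap_linear bB (o n).
have TYl n := opmap_linear bYB (rop (r := S) n).
have lcomp (U1 U2 U3 : lmodType R) (g : U2 -> U3) (h : U1 -> U2) : linear g -> linear h -> linear (g \o h).
  by move=> gl hl a u v /=; rewrite hl gl.
have sgT n v : sg (opmap bYB (rop (r := S) n) v) = opmap bB (o n) (sg v).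
  suff E : sg \o opmap bYB (rop (r := S) n) = opmap bB (o n) \o sg by have := congr1 (fun h => h v) E.
  apply: (linear_ext bYB); [exact: lcomp|exact: lcomp|move=> y /=].
  rewrite opmap_b /sg lift_b opmap_b oi; case: (rop n y) => [w|] /=; first by rewrite lift_b.
  exact: (lin_zero sgl).
have roT n v : ro (opmap bB (o n) v) = opmap bYB (rop (r := S) n) (ro v).
  suff E : ro \o opmap bB (o n) = opmap bYB (rop (r := S) n) \o ro by have := congr1 (fun h => h v) E.
  apply: (linear_ext bB); [exact: lcomp|exact: lcomp|move=> x /=].
  rewrite opmap_b.
  have [[y ->]|/forallNP nx] := pselect (exists y, x = j y).
    rewrite roj opmap_b oj; case: (rop n y) => [w|] /=; first by rewrite roj.
    exact: (lin_zero rol).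
  rewrite (ro0 x) // (lin_zero (TYl n)).
  case E : (o n x) => [w|]; last exact: (lin_zero rol).
  by apply: ro0 => y e; rewrite e in E; have [y' e'] := ojx _ _ _ E; apply: (nx y').
have [||r rK] := @rP _ _ S R _ bY bYB (ro \o f \o sg).
- by apply: (lcomp _ _ _ ro (f \o sg)) => //; apply: lcomp.
- by move=> n v /=; rewrite sgT fc roT.
have cro v y : coord bYB (ro v) y = coord bB v (j y).
  have [s [us sup ->]] := linear_coord bB v rol; rewrite coord_sum.
  have H x : coord bB v x * coord bYB (ro (b x)) y = if x == j y then coord bB v x else 0.
    case: eqP => [->|nx]; first by rewrite roj coord_b eqxx mulr1.
    have [[y' e]|/forallNP n] := pselect (exists y, x = j y).
      by rewrite e roj coord_b; case: eqP => [e'|]; rewrite ?mulr0 //; case: nx; rewrite e e'.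
    by rewrite ro0 // coord0 mulr0.
  rewrite (eq_bigr _ (fun x _ => H x)).
  have [xs|xs] := boolP (j y \in s).
    by rewrite (bigD1_seq (j y)) //= eqxx big1 ?addr0 // => x /negbTE ->.
  rewrite big_seq big1 => [|x xs']; last by case: eqP => // e; rewrite -e xs' in xs.
  by apply/esym; apply: contrapT => /sup; rewrite (negbTE xs).
exists r => k y; have := congr1 (fun v => coord bYB v y) (rK k) => /=.
by rewrite cro coordZ coord_b /sg lift_b.
Qed.

(** The singular step of the recursion: [K] is covered by few blocks that are rigid already, and the
    set of block names is rigid. Each block yields its own scalar; the construction keeps the blocks
    apart and makes their scalars agree with the one of the names. *)
Lemma rigid_cover (B Th K : Type) (Q : Th -> K -> Prop) (tau : K -> Th) :
  emb nat B -> emb Th B -> rigid B Th -> (forall k, Q (tau k) k) ->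
  (forall t, rigid B {x | Q t x}) -> rigid B K.
Proof.
move=> natB ThB [S _] tauQ blk.
pose St t := sval (cid (blk t)).
pose e t : rX (St t) -> B := sval (cid (rX_emb (St t))).
have ei t : injective (e t) by rewrite /e; case: cid.
have b0 : B by case: (cid natB) => nu _; exact: (nu 0%N).
pose opB t n (u : B) : option B :=
  if pselect (exists x, u = e t x) is left h then omap (e t) (rop n (sval (cid h))) else None.
have opBe t n x : opB t n (e t x) = omap (e t) (rop n x).
  rewrite /opB; case: pselect => [h|[]]; last by exists x.
  by rewrite -(ei _ _ _ (svalP (cid h))).
pose Y := rX S; pose Q' := (Th * B)%type.
pose X0 : Type := (Y + Q' + Y * Q')%type.
pose X : eqType := HB.pack_for eqType X0 (gen_eqMixin X0).
pose iA (y : Y) : X := inl (inl y).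
pose iQ (q : Q') : X := inl (inr q).
pose iP (y : Y) (q : Q') : X := inr (y, q).
pose zB (t : Th) (k : K) : B :=
  if pselect (Q t k) is left h then e t (rz (St t) (exist _ k h)) else b0.
have zBe t k (h : Q t k) : zB t k = e t (rz (St t) (exist _ k h)).
  by rewrite /zB; case: pselect => // h'; rewrite (Prop_irrelevance h' h).
(* Operators 0, 1, 2 cut out the names, the points used by the blocks, and the pairs. Operator 3
   attaches to a point the name of its block, operator 4 sends a point coding some [k] to that name.
   From 5 on come the operators of the given structures, acting on all three sorts at once. *)
pose op n (x : X) : option X := match n with
  | 0 => if x is inl (inl y) then Some (iA y) else None
  | 1 => if x is inl (inr q) then
           if pselect (exists x, q.2 = e q.1 x) is left _ then Some (iQ q) else None else None
  | 2 => if x is inr (y, q) then Some (iP y q) else None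
  | 3 => if x is inl (inr q) then Some (iP (rz S q.1) q) else None
  | 4 => if x is inl (inr q) then
           if pselect (exists k, q.2 = zB q.1 k /\ Q q.1 k) is left _ then Some (iA (rz S q.1)) else None else None
  | n'.+4.+1 => match x with
     | inl (inl y) => omap iA (rop n' y)
     | inl (inr q) => omap (fun u => iQ (q.1, u)) (opB q.1 n' q.2)
     | inr (y, q) => omap (fun y' => iP y' q) (rop n' y) end
  end.
have XB : emb X B.
  have BB := emb_square natB; have B2 : emb (B + B) B.
    exact: emb_trans (emb_sum_bool B) (emb_trans (emb_bool_square natB).2 BB).
  have QB : emb Q' B by apply: emb_trans (emb_prod ThB (emb_refl B)) BB.
  have YB := rX_emb S.
  apply: emb_trans (emb_sum (emb_sum YB QB) (emb_trans (emb_prod YB QB) BB)) _.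
  exact: emb_trans (emb_sum B2 (emb_refl B)) B2.
pose z k : X := iQ (tau k, zB (tau k) k).
have zi : injective z.
  move=> k k' [et]; rewrite et (zBe _ _ (tauQ k')).
  have h : Q (tau k') k by rewrite -et.
  by rewrite (zBe _ _ h) => e1; have := congr1 (@sval _ _) (rz_inj (ei _ _ _ e1)).
unshelve eexists (@RigidStruct B K X op z zi XB _); last by [].
move=> R V b bB f fl fc.
have fc5 n v : f (opmap bB (op n.+4.+1) v) = opmap bB (op n.+4.+1) (f v) by exact: fc.
have [r rA] : exists r, forall t, f (b (iA (rz S t))) = r *: b (iA (rz S t)).
  have [||||r rA] := @rigid_apply _ _ S R V X b bB (fun n => op n.+4.+1) f iA iA fl fc5 => //.
  - by move=> y y' [].
  - move=> n [[y|q]|[y q]] y' /=; first by case: (rop n y) => //= w _; exists y.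
      by case: (opB _ _ _).
    by case: (rop _ _).
  exists r => t; apply: (coord_inj bB) => x; rewrite coordZ coord_b.
  case: x => [[y|q]|p].
  - rewrite -[inl (inl y)]/(iA y) rA; congr (_ * (nat_of_bool _)%:R).
    by apply/eqP/eqP => [->|[]].
  - have -> : (iA (rz S t) == inl (inr q) :> X) = false by apply/eqP.
    rewrite mulr0; apply: contrapT => h.
    have : coord bB (opmap bB (op 0%N) (f (b (iA (rz S t))))) (inl (inr q)) <> 0.
      by rewrite -fc opmap_b.
    by move=> /(coord_opmap_neq0 bB)[[[y|q']|p] []].
  - have -> : (iA (rz S t) == inr p :> X) = false by apply/eqP.
    rewrite mulr0; apply: contrapT => h.
    have : coord bB (opmap bB (op 0%N) (f (b (iA (rz S t))))) (inr p) <> 0.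
      by rewrite -fc opmap_b.
    by move=> /(coord_opmap_neq0 bB)[[[y|q']|p'] []].
(* Between the slices of pairs over [q] and [q'] a commutant is scalar by rigidity of the names.
   Operator 3 compares this scalar with the coefficient in question, which vanishes unless the names
   are equal. *)
have blkP q q' : coord bB (f (b (iQ q))) (iQ q') <> 0 -> q'.1 = q.1.
  move=> h.
  have [||||s sP] := @rigid_apply _ _ S R V X b bB (fun n => op n.+4.+1) f (iP^~ q) (iP^~ q') fl fc5 => //.
  - by move=> y y' [].
  - move=> n [[y|u]|[y u]] y' /=; first by case: (rop _ _).
      by case: (opB _ _ _).
    by case: (rop n y) => //= w [_ <-]; exists y.
  have h3 : coord bB (opmap bB (op 3%N) (f (b (iQ q)))) (iP (rz S q'.1) q') = coord bB (f (b (iQ q))) (iQ q').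
    apply: coord_opmap => //.
    by move=> [[y|u]|[y u]] //= [_ ->].
  rewrite -fc opmap_b /= sP in h3.
  rewrite -h3 in h; case: eqP h => [E|_]; first by rewrite (rz_inj E).
  by rewrite mulr0.
exists r => k.
set t := tau k; have Qt : Q t k by exact: tauQ.
have zE : z k = iQ (t, e t (rz (St t) (exist _ k Qt))) by rewrite /z (zBe _ _ Qt).
have [||||s sP] := @rigid_apply _ _ (St t) R V X b bB (fun n => op n.+4.+1) f
    (fun x => iQ (t, e t x)) (fun x => iQ (t, e t x)) fl fc5.
- by move=> x x' [/ei].
- by move=> n x /=; rewrite opBe; case: (rop _ _).
- by move=> n x /=; rewrite opBe; case: (rop _ _).
- move=> n [[y|[t' u]]|[y u]] x /=; first by case: (rop _ _).
    rewrite /opB; case: pselect => [h|] //=; have [x' eu] := h.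
    case: (rop _ _) => //= w [et _]; move: x' eu; rewrite et => x' ->; by exists x'.
  by case: (rop _ _).
have sz : f (b (z k)) = s *: b (z k).
  have sort1 x : coord bB (f (b (z k))) x <> 0 -> exists2 q : Q', x = iQ q & exists y, q.2 = e q.1 y.
    have zop : op 1%N (z k) = Some (z k).
      by rewrite zE /=; case: pselect => // -[]; exists (rz (St t) (exist _ k Qt)).
    move=> h; have : coord bB (opmap bB (op 1%N) (f (b (z k)))) x <> 0.
      by rewrite -fc opmap_b zop.
    move=> /(coord_opmap_neq0 bB)[[[y|q]|p] [] //=].
    by case: pselect => // hq [<-] _; exists q.
  apply: (coord_inj bB) => x; rewrite coordZ coord_b.
  have [[y ex]|nx] := pselect (exists y, x = iQ (t, e t y)).
    rewrite zE ex sP; congr (_ * (nat_of_bool _)%:R).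
    by apply/eqP/eqP => [->|[/ei]].
  have -> : (z k == x) = false.
    by apply/eqP => ex; apply: nx; rewrite -ex zE; eexists.
  rewrite mulr0; apply: contrapT => h; apply: nx.
  have [[t' u] ex ey] := sort1 _ h; rewrite ex in h.
  have /= et := blkP _ _ h; rewrite /= et in ey; have [y eu] := ey.
  by exists y; rewrite ex et eu.
(* Operator 4 carries the scalar [s] of the block to its name, where the scalar is [r]. *)
have := congr1 (opmap bB (op 4%N)) sz; rewrite -fc (linZ _ _ (opmap_linear bB _)) opmap_b.
have -> : op 4%N (z k) = Some (iA (rz S t)).
  by rewrite /z /=; case: pselect => // -[]; exists k.
move=> /(congr1 (fun v => coord bB v (iA (rz S t)))).
by rewrite rA !coordZ coord_b eqxx !mulr1 sz => ->.
Qed.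

(** * Regular well-orders *)

Section Regular.
Variables (S : Type) (lt : S -> S -> Prop).
Hypothesis wo : is_wo lt.
Hypothesis nomax : forall x, exists y, lt x y.
Hypothesis reg : forall j (g : S -> S), exists x, forall t, lt t j -> lt (g t) x.
Hypothesis regn : forall g : nat -> S, exists x, forall n, lt (g n) x.

Definition ladder (l : S) (eta : nat -> S) : Prop :=
  [/\ forall n, lt (eta n) (eta n.+1), forall n, lt (eta n) l &
      forall x, lt x l -> exists n, lt x (eta n)].

Definition eta0 (l : S) : nat -> S :=
  if pselect (exists eta, ladder l eta) is left h then sval (cid h) else fun _ => l.

Lemma eta0P l : (exists eta, ladder l eta) -> ladder l (eta0 l).
Proof. by rewrite /eta0; case: pselect => // h _; apply: (svalP (cid h)). Qed.

Definition closed_under (F : S -> S) (l : S) : Prop := forall j, lt j l -> lt (F j) l.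

(** Closure points of functions form closed unbounded sets; the condition says that the limits with
    [i] on their ladder meet all of these, that is, form a stationary set. *)
Definition caught (i : S) : Prop :=
  forall F : S -> S, exists l, [/\ exists eta, ladder l eta, closed_under F l & exists n, eta0 l n = i].

Let tr := wo_tr wo.

Lemma max2 x y : exists z, lt x z /\ lt y z.
Proof.
have [x' hx] := nomax x; have [y' hy] := nomax y.
case: (wo_tot wo x' y') => h; [exists y'|exists x'|exists x'].
- by split=> //; apply: tr h.
- by rewrite h in hx *.
- by split=> //; apply: tr h.
Qed.

Lemma ladder_mono l eta m n : ladder l eta -> (m <= n)%N -> m = n \/ lt (eta m) (eta n).
Proof.
move=> [inc _ _]; elim: n => [|n IH]; first by rewrite leqn0 => /eqP ->; left.
rewrite leq_eqVlt => /orP[/eqP -> |]; first by left.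
by rewrite ltnS => /IH [->|h]; right; [exact: inc|apply: tr (inc n)].
Qed.

(* Fodor's argument: otherwise each i > be has a function F i none of whose
   closed points has i in its ladder; a point closed under all earlier F i
   (a diagonal intersection) contradicts this. *)
Lemma caught_unbounded be : exists i, lt be i /\ caught i.
Proof.
apply: contrapT => /forallNP nc.
have {}nc i : exists F, lt be i -> forall l, (exists eta, ladder l eta) -> closed_under F l ->
    forall n, eta0 l n <> i.
  have [bi|nbi] := pselect (lt be i); last by exists id.
  have : ~ caught i by move=> c; apply: (nc i).
  move=> /existsNP[F nF]; exists F => _ l ll cl n e; apply: nF.
  by exists l; split=> //; exists n.
have [F FP] := choice nc.
have [G1 G1P] : exists G1 : S -> S -> S, forall g i j, lt j g -> lt (F i j) (G1 g i).
  have h (g : S) : exists h : S -> S, forall i j, lt j g -> lt (F i j) (h i).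
    by have H i := reg g (F i); exact: ex_choice H.
  exact: ex_choice h.
(* Regularity, used twice, bounds all [F i j] with [i] and [j] below [g]. Iterating past this bound
   leads to the point closed under all earlier [F i]. *)
have [G GP] : exists G : S -> S, forall g i j, lt i g -> lt j g -> lt (F i j) (G g).
  suff h (g : S) : exists x, forall i j, lt i g -> lt j g -> lt (F i j) x by exact: ex_choice h.
  have [x xP] := reg g (G1 g); exists x => i j ig jg; apply: tr _ (xP i ig).
  exact: G1P.
have [st stP] : exists st : S -> S, forall g, lt g (st g) /\ lt (G g) (st g).
  by apply: (ex_choice (P := fun g y => lt g y /\ lt (G g) y)) => g; apply: max2.
have [g0 bg0] := nomax be.
pose g n := iter n st g0.
have gS n : lt (g n) (g n.+1) by case: (stP (g n)).
have [x0 x0P] := regn g.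
have [|l [lP lmin]] := @wo_min _ _ (fun x => forall n, lt (g n) x) wo; first by exists x0.
have Ll x : lt x l -> exists n, lt x (g n).
  move=> xl; apply: contrapT => /forallNP n; apply: (lmin x) => // k.
  have [<-|h] := wo_nlt wo (n k.+1); first exact: gS.
  exact: tr h.
have gl : ladder l g by split.
have Lx : exists eta, ladder l eta by exists g.
have [inc el cof] := eta0P Lx.
have [|n hn] := cof be; first exact: tr bg0 (lP 0%N).
apply: (FP (eta0 l n) hn l Lx _ n) => // j jl.
have [n1 h1] := Ll _ (el n); have [n2 h2] := Ll _ jl.
have mono m k : (m <= k)%N -> forall x, lt x (g m) -> lt x (g k).
  by move=> /(ladder_mono gl)[->|h] x // xm; apply: tr h.
apply: tr (lP (maxn n1 n2).+1); apply: tr (stP _).2.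
by apply: GP; [apply: mono h1|apply: mono h2]; rewrite ?leq_maxl ?leq_maxr.
Qed.

(** Caught points are unbounded, so by regularity their increasing enumeration does not stop before
    all of [S]: there are enough of them to serve as the points [rz]. *)
Lemma caught_enum : exists h : S -> S, injective h /\ forall s, caught (h s).
Proof.
have E (s : S) (rec : forall t, lt t s -> S) :
    exists y, caught y /\ forall t (p : lt t s), lt (rec t p) y.
  have [x xP] := reg s (fun t => if pselect (lt t s) is left p then rec t p else s).
  have [y [xy cy]] := caught_unbounded x; exists y; split=> // t p.
  apply: tr xy; have := xP t p; case: pselect => // p'.
  by rewrite (Prop_irrelevance p' p).
pose body s rec := sval (cid (E s rec)).
pose h : S -> S := Fix (wo_wf wo) (fun _ => S) body.
have hE s : h s = body s (fun t _ => h t).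
  rewrite {1}/h Fix_eq // => x f g fg; congr body.
  by apply: functional_extensionality_dep => y; apply: functional_extensionality_dep.
have hlt s t : lt t s -> lt (h t) (h s).
  by move=> p; rewrite [h s]hE; exact: (svalP (cid (E s (fun t _ => h t)))).2.
exists h; split=> [s t e|s]; last by rewrite hE; exact: (svalP (cid (E _ _))).1.
by case: (wo_tot wo s t) => // /hlt; rewrite e => /(wo_irr wo).
Qed.

(** If [l] lies below [m], the ladder of [m] eventually passes [l], and with it the whole ladder of
    [l]. *)
Lemma ladder_sep l m : (exists eta, ladder l eta) -> (exists eta, ladder m eta) -> l <> m ->
  exists N, forall n, (N <= n)%N -> eta0 l n <> eta0 m n.
Proof.
move=> Ll Lm; have sym a c : (exists eta, ladder a eta) -> (exists eta, ladder c eta) ->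
    lt a c -> exists N, forall n, (N <= n)%N -> lt (eta0 a n) (eta0 c n).
  move=> /eta0P [_ ae _] /eta0P Lc ac; have [_ _ /(_ a ac) [N hN]] := Lc.
  exists N => n /(ladder_mono Lc)[<-|h]; first exact: tr hN.
  by apply: tr h; apply: tr hN.
move=> n; case: (wo_tot wo l m) => // h.
  have [N NP] := sym _ _ Ll Lm h; exists N => k /NP h' e.
  by move: h'; rewrite e; exact: wo_irr.
have [N NP] := sym _ _ Lm Ll h; exists N => k /NP h' e.
by move: h'; rewrite e; exact: wo_irr.
Qed.

(** Sequences grow at the head by ever smaller entries, so they form a well-founded tree in which
    the head of a node controls what can stand above it. *)
Fixpoint decr (s : seq S) : Prop :=
  if s is a :: s' then (if s' is c :: _ then lt a c else True) /\ decr s' else True.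

(** Points are the nodes of the tree [decr] and the limits. The operators project onto the two
    sorts, cut off the head of a node, and send a limit to the one-element nodes of its ladder. A
    commutant is diagonal at each limit closed under the support bound [F]; from there its scalar
    passes to the caught nodes and then to the root, which makes all scalars equal. *)
Lemma rigid_regular (B : Type) : emb nat B -> emb S B -> S -> rigid B S.
Proof.
move=> natB SB s0.
pose X0 : Type := (seq S + S)%type.
pose X : eqType := HB.pack_for eqType X0 (gen_eqMixin X0).
pose isL l := exists eta, ladder l eta.
pose op n (x : X) : option X := match n with
  | 0 => if x is inl s then if pselect (decr s) is left _ then Some (inl s) else None else None
  | 1 => if x is inl (a :: s) then if pselect (decr (a :: s)) is left _ then Some (inl s) else None else None
  | 2 => if x is inr l then if pselect (isL l) is left _ then Some (inr l) else None else None
  | m.+3 => if x is inr l then if pselect (isL l) is left _ then Some (inl [:: eta0 l m]) else None else None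
  end.
have [h [hi hc]] := caught_enum.
pose z (k : S) : X := inl [:: h k].
have zi : injective z by move=> k k' [] /hi.
have XB : emb X B.
  have B2 : emb (B + B) B.
    exact: emb_trans (emb_sum_bool B) (emb_trans (emb_bool_square natB).2 (emb_square natB)).
  have sB : emb (seq S) B.
    have [e ei] := SB; apply: emb_trans (emb_seq natB); exists (map e).
    exact: inj_map.
  exact: emb_trans (emb_sum sB SB) B2.
unshelve eexists (@RigidStruct B S X op z zi XB _); last by [].
move=> R V b bB f fl fc.
pose co v x := coord bB v x.
have fop n x y : op n x = Some y -> f (b y) = opmap bB (op n) (f (b x)).
  by move=> e; rewrite -fc opmap_b e.
have tree s t : decr s -> co (f (b (inl s))) t <> 0 -> exists2 u, t = inl u & decr u.
  move=> ds c; have e : op 0%N (inl s) = Some (inl s) by rewrite /=; case: pselect.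
  rewrite /co (fop _ _ _ e) in c; have [[u|l] [//=]] := coord_opmap_neq0 bB c.
  by case: pselect => // du [<-] _; exists u.
have lim l t : isL l -> co (f (b (inr l))) t <> 0 -> exists2 m, t = inr m & isL m.
  move=> Ll c; have e : op 2%N (inr l) = Some (inr l) by rewrite /=; case: pselect.
  rewrite /co (fop _ _ _ e) in c; have [[u|m] [//=]] := coord_opmap_neq0 bB c.
  by case: pselect => // Lm [<-] _; exists m.
(* A smaller head [c] would start an infinite descent: the node [c :: a :: s] is sent to [a :: s] by
   operator 1, so its image under [f] has a coefficient at a node with a still smaller head above
   [c]. *)
have height a s t u : decr (a :: s) -> co (f (b (inl (a :: s)))) t <> 0 ->
    forall c, t = inl (c :: u) -> ~ lt c a.
  elim/(well_founded_ind (wo_wf wo)): a s t u => a IH s t u da ct c et ca.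
  have e : op 1%N (inl [:: c, a & s]) = Some (inl (a :: s)).
    by rewrite /=; case: pselect => // -[].
  rewrite /co (fop _ _ _ e) et in ct; have [[[|c' u']|m] [//=]] := coord_opmap_neq0 bB ct.
  case: pselect => // -[cc' _] [eu] h'; rewrite eu in cc' h'.
  by apply: (IH c ca (a :: s) _ _ _ h' c' erefl).
have [F FP] : exists F : S -> S, forall i c, co (f (b (inl [:: i]))) (inl [:: c]) <> 0 -> lt c (F i).
  suff H (i : S) : exists x, forall c, co (f (b (inl [:: i]))) (inl [:: c]) <> 0 -> lt c x by exact: ex_choice H.
  have [s [_ _ sP]] := basis_expand bB (f (b (inl [:: i]))).
  have [x xP] : exists x, forall c, (inl [:: c] : X) \in s -> lt c x.
    elim: s {sP} => [|y s [x IH]]; first by exists s0.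
    have [c0 hc0] : exists c0, forall c, y = inl [:: c] -> c = c0.
      have [[c0 ->]|n] := pselect (exists c, y = inl [:: c]); first by exists c0 => c [].
      by exists s0 => c e; case: n; exists c.
    have [x' [xx' cx']] := max2 x c0; exists x' => c; rewrite inE => /orP[/eqP e|/IH h'].
      by rewrite (hc0 c).
    exact: tr xx'.
  by exists x => c /sP /xP.
have diag l : isL l -> closed_under F l -> f (b (inr l)) = co (f (b (inr l))) (inr l) *: b (inr l).
  move=> Ll cl; have [inc el cof] := eta0P Ll.
  apply: (coord_inj bB) => t; rewrite coordZ coord_b; case: eqP => [<-|tl]; first by rewrite mulr1.
  rewrite mulr0; apply: contrapT => ct; have [m et Lm] := lim _ _ Ll ct.
  have ml : m <> l by move=> e; apply: tl; rewrite et e.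
  have [s [_ _ sP]] := basis_expand bB (f (b (inr l))).
  have [N NP] : exists N, forall n, (N <= n)%N -> forall y, (inr y : X) \in s -> isL y -> y <> m ->
      eta0 y n <> eta0 m n.
    elim: s {sP} => [|y s [N IH]]; first by exists 0%N.
    have [N' NP'] : exists N', forall n, (N' <= n)%N -> forall y', y = inr y' -> isL y' -> y' <> m ->
       eta0 y' n <> eta0 m n.
      have [[y' [ey Ly ym]]|n] := pselect (exists y', [/\ y = inr y', isL y' & y' <> m]).
        have [N' h'] := ladder_sep Ly Lm ym; exists N' => n /h' e y2 ey2 _ _.
        by move: ey2; rewrite ey => -[<-].
      by exists 0%N => k _ y' ey Ly ym; case: n; exists y'.
    exists (maxn N N') => n; rewrite geq_max => /andP[n1 n2] y'; rewrite inE => /orP[/eqP e|h'].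
      by apply: NP' => //; rewrite e.
    exact: IH.
  (* The coefficient at [m] reappears between the nodes of the two ladders: from [N] on, no other
     limit in the support has the same ladder entry as [m], so nothing cancels. *)
  have cf n : (N <= n)%N -> co (f (b (inl [:: eta0 l n]))) (inl [:: eta0 m n]) <> 0.
    move=> Nn; have e : op n.+3 (inr l) = Some (inl [:: eta0 l n]) by rewrite /=; case: pselect.
    have e2 : op n.+3 (inr m) = Some (inl [:: eta0 m n]) by rewrite /=; case: pselect.
    rewrite /co (fop _ _ _ e) (coord_opmap bB e2) -?et //.
    move=> [//|y] /=; case: pselect => // Ly [ey] cy; rewrite et; congr inr.
    by apply: contrapT => ym; apply: (NP n Nn y _ Ly ym ey); apply: sP.
  have [incm elm cofm] := eta0P Lm.
  (* If [m] is below [l], the ladder of [l] passes [m], against [height]. If [l] is below [m], the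
     ladder of [m] passes [l], against the closure of [l] under [F]. *)
  case: (wo_tot wo m l) => // ml'.
    have [n1 h1] := cof m ml'.
    have hn : lt m (eta0 l (maxn N n1)).
      case: (ladder_mono (eta0P Ll) (leq_maxr N n1)) => [<- //|h2].
      exact: tr h1 h2.
    apply: (height _ [::] _ [::] _ (cf _ (leq_maxl N n1)) _ erefl) => //.
    exact: tr (elm _) hn.
  have [n1 h1] := cofm l ml'.
  have hn : lt l (eta0 m (maxn N n1)).
    case: (ladder_mono (eta0P Lm) (leq_maxr N n1)) => [<- //|h2].
    exact: tr h1 h2.
  have h3 := FP _ _ (cf _ (leq_maxl N n1)); have h4 := cl _ (el (maxn N n1)).
  exact: (wo_irr wo (tr hn (tr h3 h4))).
exists (co (f (b (inl [::]))) (inl [::])) => k.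
have [l [Ll cl [n en]]] := hc k F.
have dl := diag l Ll cl; set c := co _ _ in dl.
have e1 : op n.+3 (inr l) = Some (z k) by rewrite /= en; case: pselect.
have fz : f (b (z k)) = c *: b (z k).
  by rewrite (fop _ _ _ e1) dl (linZ _ _ (opmap_linear bB _)) opmap_b e1.
have e2 : op 1%N (z k) = Some (inl [::]) by rewrite /=; case: pselect => // -[].
rewrite fz (fop _ _ _ e2) fz (linZ _ _ (opmap_linear bB _)) opmap_b e2.
by rewrite /co coordZ coord_b eqxx mulr1.
Qed.

End Regular.

Lemma emb_drop_max (S : Type) (lt : S -> S -> Prop) (m : S) : is_wo lt ->
  (forall x, ~ lt m x) -> emb nat S -> emb S {j | lt j m}.
Proof.
move=> wo mx [nu nui].
have low x : x <> m -> lt x m.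
  by move=> xm; case: (wo_tot wo x m) => // /mx.
pose A := {j | lt j m}.
have [n0 hn0] : exists n0, forall n, nu (n0 + n)%N <> m.
  have [[n0 e]|/forallNP h] := pselect (exists n0, nu n0 = m).
    by exists n0.+1 => n; rewrite -e => /nui /eqP; rewrite addSn -addnS -{2}[n0]addn0 eqn_add2l.
  by exists 0%N => n; apply: h.
have natA : emb nat A.
  exists (fun n => exist _ (nu (n0 + n)%N) (low _ (hn0 n)) : A) => p q e.
  by have /nui/addnI := congr1 (@sval _ _) e.
have [p pi] := emb_square natA; have [na nai] := natA.
apply: (@emb_trans (A * A)%type); last by exists p.
exists (fun x => if pselect (x = m) is right h then (na 0%N, exist _ x (low _ h) : A) else (na 1%N, na 0%N)).
move=> x y; case: pselect => hx; case: pselect => hy //.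
- by rewrite hx hy.
- by move=> [/nai].
- by move=> [/nai].
- by move=> [].
Qed.

(** Case distinction on cofinality. Countable sets and orders with a maximum reduce to known cases.
    Otherwise a countable or a shorter family of initial segments is cofinal, as [rigid_cover]
    requires, or the order is regular of uncountable cofinality, as [rigid_regular] requires. *)
Lemma rigid_step (B S : Type) (lt : S -> S -> Prop) : is_wo lt -> emb nat B -> emb S B ->
  (forall i, rigid B {j | lt j i}) -> rigid B S.
Proof.
move=> wo nB SB seg.
have [Sn|nS] := emb_total S nat; first exact: rigid_emb (rigid_nat nB) Sn.
have [[m mx]|/forallNP nomax0] := pselect (exists m, forall x, ~ lt m x).
  exact: rigid_emb (seg m) (emb_drop_max wo mx nS).
have nomax x : exists y, lt x y by have /existsNP[y /contrapT] := nomax0 x; exists y.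
have [regn|/existsNP[g ng]] := pselect (forall g : nat -> S, exists x, forall n, lt (g n) x); last first.
  have H (x : S) : exists n, lt x (g n).
    have [y xy] := nomax x; apply: contrapT => /forallNP n; apply: ng; exists y => k.
    by case: (wo_tot wo (g k) x) => [h|->|/n//] //; exact: wo_tr h xy.
  have [tau tauP] := ex_choice H.
  by apply: (@rigid_cover B nat S (fun n x => lt x (g n)) tau) => //; exact: rigid_nat.
have [reg|/existsNP[j /existsNP[g ng]]] := pselect (forall j (g : S -> S), exists x, forall t, lt t j -> lt (g t) x); last first.
  have H (x : S) : exists t : {t | lt t j}, lt x (g (sval t)).
    have [y xy] := nomax x; apply: contrapT => /forallNP n; apply: ng; exists y => k kj.
    by case: (wo_tot wo (g k) x) => [h|->|/(n (exist _ k kj))//] //; exact: wo_tr h xy.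
  have [tau tauP] := ex_choice H.
  apply: (@rigid_cover B {t | lt t j} S (fun t x => lt x (g (sval t))) tau) => //.
  by apply: emb_trans SB; exists (@sval _ _) => x y /sval_inj.
have s0 : S by case: (cid nS) => nu _; exact: (nu 0%N).
exact: (rigid_regular wo nomax reg regn nB SB s0).
Qed.

Lemma sub_wo (S : Type) (lt : S -> S -> Prop) (P : S -> Prop) : is_wo lt ->
  is_wo (fun x y : {s | P s} => lt (sval x) (sval y)).
Proof.
move=> wo; split.
- move=> [x Px]; elim/(well_founded_ind (wo_wf wo)): x Px => x IH Px.
  by split=> -[y Py] /= h; apply: IH.
- by move=> x y z; exact: (wo_tr wo).
- move=> x y; case: (wo_tot wo (sval x) (sval y)) => h.
  + by constructor 1.
  + by constructor 2; apply: sval_inj.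
  + by constructor 3.
Qed.

(** The induction runs over the initial segments of a well-order, while the bound on the number of
    auxiliary points stays at [K]. *)
Theorem rigid_exists (K : Type) : emb nat K -> rigid K K.
Proof.
move=> nK; have [lt wo] := well_order_exists K.
have seg i : rigid K {j | lt j i}.
  elim/(well_founded_ind (wo_wf wo)): i => i IH.
  apply: (rigid_step (sub_wo (fun j => lt j i) wo) nK).
    by exists (@sval _ _) => x y /sval_inj.
  move=> [j ji]; apply: rigid_emb (IH j ji) _.
  exists (fun x => exist (fun k => lt k j) (sval (sval x)) (svalP x)) => x y e.
  by apply: sval_inj; apply: sval_inj; have := congr1 (@sval _ _) e.
exact: rigid_step wo nK (emb_refl K) seg.
Qed.

(** * Matrix units and transvections *)

Section NcRing.
Variable E : pzRingType.
#[local] Instance ncring_ops : @Ncring.Ring_ops E (@GRing.zero E) (@GRing.one E)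
  (@GRing.add E) (@GRing.mul E) (fun x y => x - y) (@GRing.opp E) (@eq E) := {}.
#[local] Instance ncring_ring : @Ncring.Ring E _ _ _ _ _ _ _ ncring_ops.
Proof.
split; try exact _.
- exact: add0r.
- exact: addrC.
- exact: addrA.
- exact: mul1r.
- exact: mulr1.
- exact: mulrA.
- by move=> x y z; exact: mulrDl.
- by move=> x y z; exact: mulrDr.
- by [].
- exact: subrr.
Qed.
End NcRing.

Existing Instance ncring_ops.
Existing Instance ncring_ring.

Ltac ncr := Ncring_tac.non_commutative_ring.

(* To prove x = y, exhibit x - y as a combination r of vanishing terms. *)
Lemma sub0_eq (E : pzRingType) (r x y : E) : x - y = r -> r = 0 -> x = y.
Proof. by move=> <- /eqP; rewrite subr_eq0 => /eqP. Qed.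

Ltac zs := rewrite ?(mul0r, mulr0, addr0, add0r, subr0, sub0r, oppr0).

Definition central (E : pzRingType) (x : E) : Prop := forall y, x * y = y * x.

Definition is_half (E : pzRingType) (k : E) : Prop := central k /\ k + k = 1.

Lemma eq_sub0 (E : pzRingType) (x y : E) : x = y -> x - y = 0.
Proof. by move=> ->; rewrite subrr. Qed.

Lemma eqN_add0 (E : pzRingType) (x y : E) : x = - y -> x + y = 0.
Proof. by move=> ->; rewrite addNr. Qed.

(** * Anticommuting involutions *)

Section Pauli.
Variables (E : pzRingType) (k : E).
Hypothesis kh : is_half k.

Lemma two_cancel (x y : E) : x + x = y + y -> x = y.
Proof.
move=> h; have [kc k2] := kh.
apply: (@sub0_eq E ((1 - (k + k)) * (x - y) + k * ((x + x) - (y + y)))); first by ncr.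
by rewrite k2 h !subrr mul0r mulr0 addr0.
Qed.

Lemma dbl0 (x : E) : x + x = 0 -> x = 0.
Proof. by move=> h; apply: two_cancel; rewrite h addr0. Qed.

Lemma halfE (x : E) : x = k * (x + x).
Proof. by rewrite mulrDr -mulrDl kh.2 mul1r. Qed.

(** With 1/2 such a pair amounts to 2x2 matrix units: [D] is diag(1, -1) and [W] exchanges the two
    coordinates. *)
Definition pauli (D W : E) : Prop := [/\ D * D = 1, W * W = 1 & D * W = - (W * D)].

Definition comm2 (D W x : E) : Prop := x * D = D * x /\ x * W = W * x.

(** Conjugation by [D] grades the ring by parity, and homogeneous parts are unique because 2 is
    invertible. *)
Lemma even_odd (D a b c d : E) : D * D = 1 -> a * D = D * a -> c * D = D * c ->
  b * D = - (D * b) -> d * D = - (D * d) -> a + b = c + d -> a = c /\ b = d.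
Proof.
move=> /eq_sub0 DD /eq_sub0 ha /eq_sub0 hc /eqN_add0 hb /eqN_add0 hd /[dup] e /eq_sub0 h.
suff h1 : a = c by split=> //; move: e; rewrite h1 => /addrI.
apply: two_cancel.
apply: (@sub0_eq E ((a + b - (c + d)) + D * (a + b - (c + d)) * D
   - D * (a * D - D * a) + D * (c * D - D * c) - D * (b * D + D * b) + D * (d * D + D * d)
   + (D * D - 1) * (b + c - a - d))); first by ncr.
by rewrite h ha hc hb hd DD; zs.
Qed.

(** Averaging over conjugation by [D] and by [W] writes [y] as a sum of four parts, each an element
    of the centraliser times a product of powers of [D] and [W]. *)
Lemma pauli_gen (D W : E) (P : E -> Prop) : pauli D W -> (forall x y, P x -> P y -> P (x + y)) ->
  (forall x y, P x -> P y -> P (x * y)) -> P D -> P W ->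
  (forall s, comm2 D W s -> P s) -> forall y, P y.
Proof.
move=> [/eq_sub0 DD /eq_sub0 WW /eqN_add0 DW] PA PM PD PW PS; have [kc k2] := kh.
have WD : W * D + D * W = 0 by rewrite addrC.
have Pk x : P (x + x) -> P x.
  by move=> h; rewrite (halfE x); apply: PM => //; apply: PS; split; apply: kc.
have PO x : P (x * D * D) -> P x.
  suff -> : x * D * D = x by [].
  apply: (@sub0_eq E (x * (D * D - 1))); first by ncr.
  by rewrite DD; zs.
have even y : y * D = D * y -> P y.
  move=> /eq_sub0 yD; apply: Pk.
  have -> : y + y = (y + W * y * W) + (y - W * y * W) by ncr.
  apply: PA.
    apply: PS; split.
      apply: (@sub0_eq E ((y * D - D * y) + W * y * (W * D + D * W) - (D * W + W * D) * y * W
         - W * (y * D - D * y) * W)); first by ncr.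
      by rewrite yD DW WD; zs.
    apply: (@sub0_eq E (W * y * (W * W - 1) - (W * W - 1) * y * W)); first by ncr.
    by rewrite WW; zs.
  apply: PO; apply: PM => //; apply: PS; split.
    apply: (@sub0_eq E (((y * D - D * y) - W * y * (W * D + D * W) + (D * W + W * D) * y * W
         + W * (y * D - D * y) * W) * D)); first by ncr.
    by rewrite yD DW WD; zs.
  apply: (@sub0_eq E ((y - W * y * W) * (D * W + W * D) + (W * y * (W * W - 1) + (W * W - 1) * y * W) * D)); first by ncr.
  by rewrite WW DW; zs.
move=> y; apply: Pk.
have -> : y + y = (y + D * y * D) + (y - D * y * D) by ncr.
apply: PA.
  apply: even; apply: (@sub0_eq E (D * y * (D * D - 1) - (D * D - 1) * y * D)); first by ncr.
  by rewrite DD; zs.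
have -> : y - D * y * D = ((y - D * y * D) * W) * W.
  apply: (@sub0_eq E (- (y - D * y * D) * (W * W - 1))); first by ncr.
  by rewrite WW; zs.
apply: PM => //; apply: even.
apply: (@sub0_eq E ((y - D * y * D) * (W * D + D * W)
   + ((D * D - 1) * y * D + D * y * (D * D - 1)) * W)); first by ncr.
by rewrite DD WD; zs.
Qed.

(* An element commuting with all units of a subring that contains an
   anticommuting pair of involutions commutes with the whole subring, which is
   generated by square-zero elements n, hence by the units 1 + n. *)
Lemma unit_comm (D W x : E) (P : E -> Prop) : pauli D W -> P D -> P W -> P 1 ->
  (forall y, P y -> P (- y)) -> (forall y z, P y -> P z -> P (y + z)) ->
  (forall y z, P y -> P z -> P (y * z)) ->
  (forall u v, P u -> P v -> u * v = 1 -> v * u = 1 -> x * u = u * x) ->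
  forall y, P y -> x * y = y * x.
Proof.
move=> [/eq_sub0 DD /eq_sub0 WW /eqN_add0 DW] PD PW P1 PN PA PM ux; have [kc k2] := kh.
have WD : W * D + D * W = 0 by rewrite addrC.
have sq n : P n -> n * n = 0 -> x * n = n * x.
  move=> Pn n0; have h : x * (1 + n) = (1 + n) * x.
    apply: (ux _ (1 - n)); [exact: PA|by apply: PA => //; exact: PN| |].
      by apply: (@sub0_eq E (- (n * n))); [ncr|rewrite n0; zs].
    by apply: (@sub0_eq E (- (n * n))); [ncr|rewrite n0; zs].
  by move: h; rewrite mulrDr mulrDl mulr1 mul1r => /addrI.
(* Twice two complementary idempotents, exchanged by [W]. Off-diagonal corners [e y f] and [f y e]
   have square zero; diagonal corners are, up to a factor 4, products of off-diagonal ones. *)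
pose e := 1 + D; pose f := 1 - D.
have Pe : P e by apply: PA. have Pf : P f by apply: PA => //; exact: PN.
have fe : f * e = 0.
  by rewrite /f /e; apply: (@sub0_eq E (- (D * D - 1))); [ncr|rewrite DD; zs].
have ef : e * f = 0.
  by rewrite /f /e; apply: (@sub0_eq E (- (D * D - 1))); [ncr|rewrite DD; zs].
have eW : e * W = W * f.
  by rewrite /f /e; apply: (@sub0_eq E (D * W + W * D)); [ncr|rewrite DW; zs].
have fW : f * W = W * e.
  by rewrite /f /e; apply: (@sub0_eq E (- (D * W + W * D))); [ncr|rewrite DW; zs].
have efx y : P y -> x * (e * y * f) = (e * y * f) * x.
  by move=> Py; apply: sq; [exact: (PM _ _ (PM _ _ Pe Py) Pf)|rewrite -!mulrA (mulrA f) fe; zs].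
have fex y : P y -> x * (f * y * e) = (f * y * e) * x.
  by move=> Py; apply: sq; [exact: (PM _ _ (PM _ _ Pf Py) Pe)|rewrite -!mulrA (mulrA e) ef; zs].
have prod a b : x * a = a * x -> x * b = b * x -> x * (a * b) = a * b * x.
  by move=> ha hb; rewrite mulrA ha -mulrA hb mulrA.
have sum a b : x * a = a * x -> x * b = b * x -> x * (a + b) = (a + b) * x.
  by move=> ha hb; rewrite mulrDr mulrDl ha hb.
have WW1 : W * W = 1 by apply/eqP; rewrite -subr_eq0 WW.
have ee : e * e = e + e.
  by rewrite /e; apply: (@sub0_eq E (D * D - 1)); [ncr|rewrite DD; zs].
have ff : f * f = f + f.
  by rewrite /f; apply: (@sub0_eq E (D * D - 1)); [ncr|rewrite DD; zs].
have eex y : P y -> x * (e * y * e) = (e * y * e) * x.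
  move=> Py; have E1 : (e * (y * W) * f) * (f * W * e) = (e * y * e) + (e * y * e) + ((e * y * e) + (e * y * e)).
    apply: (@sub0_eq E (e * y * W * (f * f - (f + f)) * W * e
      - (e * y * (e * W - W * f) * W * e + e * y * (e * W - W * f) * W * e)
      + (e * y * e * (W * W - 1) * e + e * y * e * (W * W - 1) * e)
      + (e * y * (e * e - (e + e)) + e * y * (e * e - (e + e))))); first by ncr.
    by rewrite ff ee eW WW !subrr; zs.
  have := prod _ _ (efx _ (PM _ _ Py PW)) (fex _ PW); rewrite E1 !mulrDr !mulrDl.
  by move=> /two_cancel /two_cancel.
have ffx y : P y -> x * (f * y * f) = (f * y * f) * x.
  move=> Py; have E1 : (f * (y * W) * e) * (e * W * f) = (f * y * f) + (f * y * f) + ((f * y * f) + (f * y * f)).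
    apply: (@sub0_eq E (f * y * W * (e * e - (e + e)) * W * f
      - (f * y * (f * W - W * e) * W * f + f * y * (f * W - W * e) * W * f)
      + (f * y * f * (W * W - 1) * f + f * y * f * (W * W - 1) * f)
      + (f * y * (f * f - (f + f)) + f * y * (f * f - (f + f))))); first by ncr.
    by rewrite ff ee fW WW !subrr; zs.
  have := prod _ _ (fex _ (PM _ _ Py PW)) (efx _ PW); rewrite E1 !mulrDr !mulrDl.
  by move=> /two_cancel /two_cancel.
move=> y Py; apply: two_cancel; apply: two_cancel.
have -> : x * y + x * y + (x * y + x * y) = x * (e * y * e + e * y * f + f * y * e + f * y * f) by rewrite /e /f; ncr.
have -> : y * x + y * x + (y * x + y * x) = (e * y * e + e * y * f + f * y * e + f * y * f) * x by rewrite /e /f; ncr.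
exact: (sum _ _ (sum _ _ (sum _ _ (eex y Py) (efx y Py)) (fex y Py)) (ffx y Py)).
Qed.

Hypothesis conn : forall z : E, central z -> z * z = z -> z = 0 \/ z = 1.

(** [k * (1 + z)] is a central idempotent. This is how the group singles out -1. *)
Lemma central_sq1 (z : E) : central z -> z * z = 1 -> z = 1 \/ z = - 1.
Proof.
move=> zc zz; have [kc k2] := kh.
have h : k * (1 + z) * (k * (1 + z)) = k * (1 + z).
  rewrite -mulrA (mulrA _ k) -(kc (1 + z)) -mulrA.
  have -> : (1 + z) * (1 + z) = (1 + z) + (1 + z).
    by apply: (@sub0_eq E (z * z - 1)); [ncr|rewrite zz subrr].
  by rewrite -halfE.
have cz : central (k * (1 + z)).
  move=> y; rewrite (mulrA y) -(kc y) -!mulrA; congr (k * _).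
  by rewrite mulrDl mulrDr mul1r mulr1 zc.
have [h0|h1] := conn cz h; [right|left].
  have : (1 + z) = 0 by rewrite (halfE (1 + z)) mulrDr h0 addr0.
  by move=> /eqP; rewrite addrC addr_eq0 => /eqP.
have : (1 + z) = 1 + 1 by rewrite (halfE (1 + z)) mulrDr h1.
by move=> /addrI.
Qed.
End Pauli.

Lemma centralD (E : pzRingType) (x y : E) : central x -> central y -> central (x + y).
Proof. by move=> cx cy z; rewrite mulrDl mulrDr cx cy. Qed.

Lemma centralM (E : pzRingType) (x y : E) : central x -> central y -> central (x * y).
Proof. by move=> cx cy z; rewrite -mulrA cy mulrA cx mulrA. Qed.

(** * Recognising transvections by group conditions *)

Section Transvection.
Variables (E : pzRingType) (k : E).
Hypothesis kh : is_half k.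
Hypothesis conn : forall z : E, central z -> z * z = z -> z = 0 \/ z = 1.
Hypothesis E10 : (1 : E) <> 0.

Lemma split_even (D T : E) : D * D = 1 -> exists a b : E, [/\ T = a + b, a * D = D * a,
  b * D = - (D * b) & forall x, x * T = T * x -> x * D = D * x \/ x * D = - (D * x) ->
    x * a = a * x /\ x * b = b * x].
Proof.
move=> /eq_sub0 DD; have [kc k2] := kh.
have kx x y : x * (k * y) = k * (x * y) by rewrite mulrA -kc mulrA.
exists (k * (T + D * T * D)), (k * (T - D * T * D)); split.
- rewrite -mulrDr; have -> : (T + D * T * D) + (T - D * T * D) = T + T by ncr.
  exact: halfE.
- have h : (T + D * T * D) * D = D * (T + D * T * D).
    apply: (@sub0_eq E (D * T * (D * D - 1) - (D * D - 1) * T * D)); first by ncr.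
    by rewrite DD; zs.
  by rewrite kx -[LHS]mulrA h.
- have h : (T - D * T * D) * D = - (D * (T - D * T * D)).
    apply: (@sub0_eq E (- (D * T * (D * D - 1)) - (D * D - 1) * T * D)); first by ncr.
    by rewrite DD; zs.
  by rewrite kx -[LHS]mulrA h mulrN.
- move=> x xT xD.
  have xDTD : x * (D * T * D) = D * T * D * x.
    move/eq_sub0: xT => xT; case: xD => [/eq_sub0 xD|/eqN_add0 xD].
      apply: (@sub0_eq E ((x * D - D * x) * T * D + D * (x * T - T * x) * D + D * T * (x * D - D * x))); first by ncr.
      by rewrite xD xT; zs.
    apply: (@sub0_eq E ((x * D + D * x) * T * D - D * (x * T - T * x) * D - D * T * (x * D + D * x))); first by ncr.
    by rewrite xD xT; zs.
  rewrite !kx; split.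
    by rewrite mulrDr xT xDTD -mulrDl mulrA.
  by rewrite mulrBr xT xDTD -mulrBl mulrA.
Qed.

Variables (D W D' W' T : E).
Hypotheses (P1 : pauli D W) (P2 : pauli D' W') (cD' : comm2 D W D') (cW' : comm2 D W W').
Hypothesis T_inv : T * (D * T * D) = 1.
Hypothesis T_comm : forall u v, comm2 D W u -> comm2 D W v -> u * v = 1 -> v * u = 1 -> T * u = u * T.
Hypothesis T_conj : forall u v, u * D = D * u -> v * D = D * v -> u * v = 1 -> v * u = 1 ->
  T * (u * T * v) = u * T * v * T.
Hypothesis T_sq : exists h h', [/\ h * h' = 1, h' * h = 1, h * D = D * h & h * T = T * T * h].
Hypothesis T_weyl : exists y, [/\ y * (W * T * W) = 1, W * T * W * y = 1 & T * y * T = D * W].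

Lemma comm2_opp (u : E) : comm2 D W u -> comm2 D W (- u).
Proof. by move=> [a b]; split; rewrite mulNr mulrN ?a ?b. Qed.

Lemma comm2_add (u v : E) : comm2 D W u -> comm2 D W v -> comm2 D W (u + v).
Proof. by move=> [a b] [c d]; split; rewrite mulrDr mulrDl ?a ?b ?c ?d. Qed.

Lemma comm2_mul (u v : E) : comm2 D W u -> comm2 D W v -> comm2 D W (u * v).
Proof. by move=> [a b] [c d]; split; rewrite -mulrA ?c ?d mulrA ?a ?b mulrA. Qed.

Lemma comm2_1 : comm2 D W 1.
Proof. by split; rewrite mul1r mulr1. Qed.

Lemma T_commS s : comm2 D W s -> T * s = s * T.
Proof.
exact: (unit_comm kh P2 cD' cW' comm2_1 comm2_opp comm2_add comm2_mul T_comm).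
Qed.

Lemma centralP z : z * D = D * z -> z * W = W * z -> (forall s, comm2 D W s -> z * s = s * z) -> central z.
Proof.
move=> zD zW zS; apply: (pauli_gen kh P1) => // [x y hx hy|x y hx hy].
  by rewrite mulrDr mulrDl hx hy.
by rewrite mulrA hx -mulrA hy mulrA.
Qed.

(** Split [T] into an even part [al + be * D], with [al] and [be] central, and an odd part [U].
    Commutation with conjugates gives [be * U = 0] and [U * U = 0]; the inversion condition makes
    [al * al] a central idempotent, and the Weyl condition excludes 0 for it. Being conjugate to its
    square forces [al = 1], so [T = 1 + U]. The Weyl condition then makes [U] and [W * U * W] matrix
    units, up to a sign [eps] that nothing here determines. *)
Lemma transvectionP : let N := T - 1 in
  [/\ N * N = 0, N * W * N * W + W * N * W * N = 1 &
   exists eps : E, [/\ eps = 1 \/ eps = -1, D * N = eps * N, N * D = - (eps * N) &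
     1 + eps * D = N * W * N * W + N * W * N * W /\ N * W = eps * (N * W * N * W)]].
Proof.
have [/[dup] DD1 /eq_sub0 DD /[dup] WW1 /eq_sub0 WW /eqN_add0 DW] := P1.
have WD : W * D + D * W = 0 by rewrite addrC.
have WDN : W * D = - (D * W) by apply/eqP; rewrite -addr_eq0 WD.
have [Te [U [TE TeD UD Tsp]]] := split_even T DD1.
have [al [b' [TeE alW b'W Tesp]]] := split_even Te WW1.
have [alD b'D] : D * al = al * D /\ D * b' = b' * D.
  by apply: Tesp; [rewrite TeD|right; case: P1].
have S_al s : comm2 D W s -> [/\ s * al = al * s, s * b' = b' * s & s * U = U * s].
  move=> ss; have [sD sW] := ss.
  have [h1 h2] := Tsp s (esym (T_commS ss)) (or_introl sD).
  by have [h3 h4] := Tesp s h1 (or_introl sW).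
have alc : central al.
  by apply: centralP => // s /S_al[].
pose be := b' * D.
have bec : central be.
  apply: centralP => [||s ss].
  - by rewrite /be mulrA b'D.
  - rewrite /be -mulrA; case: P1 => _ _ ->; by rewrite mulrN !mulrA b'W mulNr opprK.
  - by have [_ h _] := S_al s ss; rewrite /be -mulrA -(proj1 ss) mulrA -h mulrA.
have TeF : Te = al + be * D by rewrite /be -mulrA DD1 mulr1.
have UD0 := eqN_add0 UD.
(* The unit [1 + (1 + D) * x] commutes with [D], so [T] commutes with its conjugate by this unit;
   expanding the commutator leaves only the stated product, up to the factor 4. *)
have key x : comm2 D W x -> x * x = 0 -> x * (be * U - D * U * U) = 0.
  move=> xS /[dup] xx z0; have [xD xW] := xS; have xT := T_commS xS.
  pose n := (1 + D) * x.
  have nn : n * n = 0.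
    rewrite /n; apply: (@sub0_eq E ((1 + D) * (x * D - D * x) * x + (1 + D) * (1 + D) * (x * x))); first by ncr.
    by rewrite xD xx subrr; zs.
  have nD : n * D = D * n by rewrite /n -mulrA xD mulrA (mulrA D) mulrDl mulrDr mul1r mulr1.
  have cu : (1 + n) * D = D * (1 + n) by rewrite mulrDl mulrDr mul1r mulr1 nD.
  have cv : (1 - n) * D = D * (1 - n) by rewrite mulrBl mulrBr mul1r mulr1 nD.
  have uv : (1 + n) * (1 - n) = 1 by apply: (@sub0_eq E (- (n * n))); [ncr|rewrite nn; zs].
  have vu : (1 - n) * (1 + n) = 1 by apply: (@sub0_eq E (- (n * n))); [ncr|rewrite nn; zs].
  have := T_conj cu cv uv vu.
  move/esym/eq_sub0: xT => c0; move/eq_sub0: xD => d0; move/eq_sub0: TE => t0.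
  move/eq_sub0: TeF => a0; move/eq_sub0: TeD => q0.
  set c := x * T - T * x in c0; set d := x * D - D * x in d0; set t := T - (Te + U) in t0.
  set q := Te * D - D * Te in q0; set u := U * D + D * U in UD0; set z := x * x in z0.
  set a1 := Te - (al + be * D) in a0; set dd := D * D - 1 in DD.
  have A1 := eq_sub0 (alc (D * U)); have b10 := eq_sub0 (bec U); have b20 := eq_sub0 (bec D).
  set A := al * (D * U) - D * U * al in A1; set b1 := be * U - U * be in b10.
  set b2 := be * D - D * be in b20.
  have -> : (1 + n) * T * (1 - n) = T + (x * D * U + x * D * U).
    apply: (@sub0_eq E (c + c * D - d * T + T * d + x * (D * t - t * D - q - u)
      - (1 + D) * (z * (T + T * D) - x * (c + c * D + T * d)))).
      by rewrite /n /c /d /t /q /u /z; ncr.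
    by rewrite c0 d0 t0 q0 UD0 z0; zs.
  move=> /eq_sub0; set h := _ - _ => h0; apply: (two_cancel kh); apply: (two_cancel kh).
  rewrite !addr0.
  pose y := t + a1.
  pose w := x * (y * D * U - D * U * y + A + (be * dd * U + be * dd * U) - be * D * u + b2 * U * D
      + D * b1 * D + u * U).
  apply: (@sub0_eq E (h + (c * D * U + c * D * U) - (w + w))).
    by rewrite /h /w /c /y /t /a1 /A /dd /u /b2 /b1; ncr.
  by rewrite h0 /w /y c0 t0 a0 A1 DD UD0 b20 b10; zs.
(* The second pair supplies the square-zero elements [(1 + D') * W'] and [(1 - D') * W'], whose sum
   [W' + W'] is invertible. *)
have Q0 : be * U - D * U * U = 0.
  have [/eq_sub0 DD' /[dup] WW'1 /eq_sub0 WW' /eqN_add0 DW'] := P2.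
  have h1 : comm2 D W ((1 + D') * W').
    by apply: comm2_mul => //; apply: comm2_add => //; exact: comm2_1.
  have h2 : comm2 D W ((1 - D') * W').
    by apply: comm2_mul => //; apply: comm2_add; [exact: comm2_1|exact: comm2_opp].
  have k1 := key _ h1; have k2 := key _ h2.
  have e1 : (1 + D') * W' * ((1 + D') * W') = 0.
    apply: (@sub0_eq E (- (D' * D' - 1) * (W' * W') + (1 + D') * (W' * D' + D' * W') * W')); first by ncr.
    by rewrite (addrC (W' * D')) DW' DD'; zs.
  have e2 : (1 - D') * W' * ((1 - D') * W') = 0.
    apply: (@sub0_eq E (- (D' * D' - 1) * (W' * W') - (1 - D') * (W' * D' + D' * W') * W')); first by ncr.
    by rewrite (addrC (W' * D')) DW' DD'; zs.
  set Q := be * U - _ in k1 k2 *; have {}k1 := k1 e1; have {}k2 := k2 e2.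
  have : W' * (W' * Q + W' * Q) = 0.
    apply: (@sub0_eq E (W' * ((1 + D') * W' * Q + (1 - D') * W' * Q))); first by ncr.
    by rewrite k1 k2; zs.
  by rewrite mulrDr mulrA WW'1 mul1r; exact: (dbl0 kh).
have UDe := eqN_add0 UD.
have [bU0 DUU0] : be * U = 0 /\ D * U * U = 0.
  move/eqP: Q0; rewrite subr_eq0 => /eqP Q1.
  have [|||||h1 h2] := @even_odd E k kh D (D * U * U) 0 0 (be * U) DD1.
  - by rewrite -!mulrA; congr (D * _); rewrite !mulrA -(mulrA U) UD mulrN mulrA UD mulNr opprK.
  - by rewrite mul0r mulr0.
  - by rewrite mul0r mulr0 oppr0.
  - by rewrite -mulrA UD mulrN mulrA (bec D) -mulrA.
  - by rewrite addr0 add0r Q1.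
  - by split.
have UU0 : U * U = 0 by rewrite -[U * U]mul1r -DD1 -mulrA (mulrA D U) DUU0 mulr0.
have DUodd : D * U = - (U * D) by rewrite UD opprK.
have albe : al * al + be * be = 1 /\ al * be = 0.
  have DTD : D * T * D = Te - U.
    apply: (@sub0_eq E (D * (T - (Te + U)) * D + D * (Te * D - D * Te) + D * (U * D + D * U)
      + (D * D - 1) * (Te - U))); first by ncr.
    by rewrite (eq_sub0 TE) (eq_sub0 TeD) UDe DD; zs.
  have ee : Te * Te = 1 /\ U * Te - Te * U = 0.
    apply: (even_odd kh DD1).
    - by rewrite -mulrA TeD mulrA TeD mulrA.
    - by rewrite mul1r mulr1.
    - by rewrite mulrBl mulrBr -!mulrA TeD UD mulrN !mulrA UD TeD; rewrite mulNr opprB opprK addrC.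
    - by rewrite mul0r mulr0 oppr0.
    - move: T_inv; rewrite DTD {1}TE => h.
      apply: (@sub0_eq E (((Te + U) * (Te - U) - 1) + U * U)); first by ncr.
      by rewrite h UU0 subrr; zs.
  have [e1 _] := ee.
  have [|||||h1 h2] := @even_odd E k kh W (al * al + be * be) (al * be * D + al * be * D) 1 0 WW1.
  - by apply: centralD; apply: centralM.
  - by rewrite mul1r mulr1.
  - apply: (@sub0_eq E (al * be * (D * W + W * D) + al * be * (D * W + W * D) - (al * be * W - W * (al * be)) * D - (al * be * W - W * (al * be)) * D)); first by ncr.
    by rewrite (centralM alc bec W) DW subrr; zs.
  - by rewrite mul0r mulr0 oppr0.
  - apply: (@sub0_eq E ((Te * Te - 1) - (Te - (al + be * D)) * Te - (al + be * D) * (Te - (al + be * D))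
       + (al * (be * D) - be * D * al) - be * be * (D * D - 1) + be * (be * D - D * be) * D)); last first.
      by rewrite e1 -TeF DD (alc (be * D)) (bec D) !subrr; zs.
    by ncr.
  split=> //; rewrite -[LHS]mulr1 -DD1 mulrA; apply: (dbl0 kh).
  by rewrite -mulrDl h2 mul0r.
have [abe1 abe0] := albe.
have y_inv := T_weyl.
have [TU be0 al1] : [/\ T = al + U, be = 0 & al * al = 1].
  have alal : al * al * (al * al) = al * al.
    apply: (@sub0_eq E (al * al * (al * al + be * be - 1) - al * (al * be) * be)); first by ncr.
    by rewrite abe1 abe0 subrr; zs.
  have acc : central (al * al) by move=> z; rewrite -mulrA (alc z) mulrA (alc z) mulrA.
  (* If [al * al = 0], then [be] is invertible, [U] vanishes and [T] commutes with [D]. So does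
     [T * y * T], whereas [D * W] anticommutes with [D]. *)
  have [a0|a1] := conn acc alal; last first.
    have be0 : be = 0 by rewrite -[be]mul1r -a1 -mulrA abe0 mulr0.
    by split=> //; rewrite TE TeF be0 mul0r addr0.
  have b1 : be * be = 1 by rewrite -abe1 a0 add0r.
  have U0 : U = 0 by rewrite -[U]mul1r -b1 -mulrA bU0 mulr0.
  have TD : T * D = D * T by rewrite TE U0 addr0 TeD.
  have [y [y1 y2 y3]] := T_weyl.
  have WTWD : W * T * W * D = D * (W * T * W).
    by rewrite -mulrA WDN mulrN !mulrA -(mulrA W T) TD mulrA WDN !mulNr opprK.
  have yD : y * D = D * y.
    by rewrite -[y * D]mulr1 -y2 mulrA -(mulrA y D) -WTWD mulrA y1 mul1r.
  have DWD : D * W * D = D * (D * W) by rewrite -y3 -!mulrA TD (mulrA y) yD !mulrA TD.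
  case: E10; rewrite -[1]WW1; suff -> : W = 0 by rewrite mul0r.
  apply: (dbl0 kh); move: DWD; rewrite -mulrA WDN mulrN !mulrA DD1 mul1r => /eqP.
  by rewrite eqr_oppLR -addr_eq0 => /eqP.
have al_1 : al = 1.
  have [h [h' [hh h'h hD hT]]] := T_sq.
  have [|||||g1 _] := @even_odd E k kh D (al * h) (h * U) h (al * U * h + al * U * h) DD1.
  - by rewrite -mulrA hD !mulrA alD.
  - exact: hD.
  - by rewrite -mulrA UD mulrN mulrA hD mulrA.
  - rewrite !mulrDl mulrDr opprD; congr (_ + _);
    by rewrite -mulrA hD mulrA -(mulrA al) UD mulrN mulNr (mulrA al) -alD -!mulrA.
  - apply: (@sub0_eq E ((h * T - T * T * h) - h * (T - (al + U)) + (T - (al + U)) * T * h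
      + (al + U) * (T - (al + U)) * h + (al * al - 1) * h + U * U * h - (al * U - U * al) * h
      + (al * h - h * al))); first by ncr.
    by rewrite hT -TU al1 UU0 !alc !subrr; zs.
  by rewrite -[al]mulr1 -hh mulrA g1 hh.
have T1U : T = 1 + U by rewrite TU al_1.
have NU : T - 1 = U by rewrite T1U addrC addrA addNr add0r.
pose U' := W * U * W.
have U'U' : U' * U' = 0.
  rewrite /U'; apply: (@sub0_eq E (W * U * (W * W - 1) * U * W + W * (U * U) * W)); first by ncr.
  by rewrite WW UU0; zs.
have [y [y1 y2 y3]] := T_weyl.
have WTW : W * T * W = 1 + U'.
  by rewrite T1U mulrDr mulrDl mulr1 WW1.
have yE : y = 1 - U'.
  have h : W * T * W * (1 - U') = 1.
    by rewrite WTW; apply: (@sub0_eq E (- (U' * U'))); [ncr|rewrite U'U'; zs].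
  by rewrite -[LHS]mulr1 -[X in y * X]h mulrA y1 mul1r.
have U'D : U' * D = - (D * U').
  apply: (@sub0_eq E (W * U * (W * D + D * W) - W * (U * D + D * U) * W + (W * D + D * W) * U * W)).
    by rewrite /U'; ncr.
  by rewrite WD UDe; zs.
have U'De := eqN_add0 U'D.
have [e1 e2] : 1 - (U * U' + U' * U) = 0 /\ (U + U) - U' - U * U' * U = D * W.
  apply: (even_odd kh DD1).
  - apply: (@sub0_eq E (- (U * (U' * D + D * U') - (U * D + D * U) * U' + U' * (U * D + D * U)
       - (U' * D + D * U') * U))); first by ncr.
    by rewrite UDe U'De; zs.
  - by rewrite mul0r mulr0.
  - apply: (@sub0_eq E ((U * D + D * U) + (U * D + D * U) - (U' * D + D * U')
       - (U * U' * (U * D + D * U) - U * (U' * D + D * U') * U + (U * D + D * U) * U' * U))); first by ncr.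
    by rewrite UDe U'De; zs.
  - by rewrite -mulrA WDN mulrN mulrA.
  - apply: (@sub0_eq E ((T * y * T - D * W) - (T - (1 + U)) * y * T - (1 + U) * (y - (1 - U')) * T
       - (1 + U) * (1 - U') * (T - (1 + U)) - U * U)); first by ncr.
    by rewrite y3 -T1U yE UU0 !subrr; zs.
have {}e1 : U * U' + U' * U = 1 by apply/esym/eqP; rewrite -subr_eq0 e1.
have UUU : U * U' * U = U.
  apply: (@sub0_eq E ((U * U' + U' * U - 1) * U - U' * (U * U))); first by ncr.
  by rewrite e1 UU0 subrr; zs.
have UW : U * W - W * U = D.
  apply: (@sub0_eq E (((U + U) - U' - U * U' * U - D * W) * W + (U * U' * U - U) * W + D * (W * W - 1)
    + W * U * (W * W - 1))); first by rewrite /U'; ncr.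
  by rewrite e2 UUU WW !subrr; zs.
(* With [U] a matrix unit and [W] the exchange, this would be 1; in general it is only a central
   element of square 1, hence a sign. *)
pose eps := U * W + W * U.
have epc : central eps.
  apply: centralP.
  - apply: (@sub0_eq E (U * (W * D + D * W) - (U * D + D * U) * W + W * (U * D + D * U) - (W * D + D * W) * U)).
      by rewrite /eps; ncr.
    by rewrite UDe WD; zs.
  - by apply: (@sub0_eq E (U * (W * W - 1) - (W * W - 1) * U)); [rewrite /eps; ncr|rewrite WW; zs].
  - move=> s ss; have [_ _ /eq_sub0 sU] := S_al s ss; have [_ /eq_sub0 sW] := ss.
    apply: (@sub0_eq E (- (U * (s * W - W * s)) - (s * U - U * s) * W - W * (s * U - U * s) - (s * W - W * s) * U)).
      by rewrite /eps; ncr.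
    by rewrite sU sW; zs.
have ee1 : eps * eps = 1.
  rewrite /eps; apply: (@sub0_eq E ((U * (W * U * W) + W * U * W * U - 1) + U * (W * W - 1) * U
     + U * U + W * (U * U) * W)); first by ncr.
  by rewrite e1 UU0 WW subrr; zs.
have ed := central_sq1 kh conn epc ee1.
rewrite /= NU; split=> //; first by rewrite -[RHS]e1 /U' !mulrA.
exists eps; split=> //.
- rewrite -UW /eps; apply: (@sub0_eq E (- (W * (U * U) + W * (U * U)))); first by ncr.
  by rewrite UU0; zs.
- rewrite -UW /eps; apply: (@sub0_eq E (U * U * W + W * (U * U))); first by ncr.
  by rewrite UU0; zs.
split.
  rewrite -UW /eps; apply: (@sub0_eq E (- (U * (W * U * W) + W * U * W * U - 1) - U * (W * W - 1) * U - U * U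
     + W * (U * U) * W)); first by ncr.
  by rewrite e1 UU0 WW subrr; zs.
have -> : U * W * U * W = eps * (U * W).
  by rewrite /eps; apply: (@sub0_eq E (- W * (U * U) * W)); [ncr|rewrite UU0; zs].
by rewrite mulrA ee1 mul1r.
Qed.
End Transvection.

(** * Pairs of 2x2 matrix units and their centralisers *)

Section MatrixUnits.
Variables (E : pzRingType).
Implicit Types D W N M s x y z : E.

Lemma comm_add x y z : x * y = y * x -> x * z = z * x -> x * (y + z) = (y + z) * x.
Proof. by move=> a b; rewrite mulrDr mulrDl a b. Qed.

Lemma comm_sub x y z : x * y = y * x -> x * z = z * x -> x * (y - z) = (y - z) * x.
Proof. by move=> a b; rewrite mulrBr mulrBl a b. Qed.

Lemma comm_mul x y z : x * y = y * x -> x * z = z * x -> x * (y * z) = (y * z) * x.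
Proof. by move=> a b; rewrite mulrA a -mulrA b mulrA. Qed.

Lemma comm_1 x : x * 1 = 1 * x.
Proof. by rewrite mul1r mulr1. Qed.

(** The off-diagonal matrix units E12 and E21; [N * M] and [M * N] are the diagonal ones. The ring
    is then the ring of 2x2 matrices over the centraliser [comm2 N M]. *)
Definition munits N M : Prop := [/\ N * N = 0, M * M = 0 & N * M + M * N = 1].

Lemma munitsC N M : munits N M -> munits M N.
Proof. by move=> [? ? ?]; split=> //; rewrite addrC. Qed.

Section Units.
Variables N M : E.
Hypothesis NM : munits N M.

Lemma munits_NMN : N * M * N = N.
Proof.
have [NN MM e] := NM.
by apply: (@sub0_eq E (N * (N * M + M * N - 1) - N * N * M)); [ncr|rewrite e NN subrr; zs].
Qed.

Lemma munits_inj p : p * M = M * p -> p * N = 0 -> p = 0.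
Proof.
have [NN MM e] := NM; move=> pM pN.
by rewrite -[p]mulr1 -e mulrDr !mulrA pM -(mulrA M) pN; zs.
Qed.

(** As a matrix, [h] is upper triangular with equal diagonal entries, and [x] is its diagonal part.
    Both parts are built from [h], [N] and [M], so they inherit the commutations in the last
    clause. *)
Lemma munits_decomp h : h * N = N * h -> exists x y, [/\ h = x + y * N,
  comm2 N M x, comm2 N M y &
  forall s, s * N = N * s -> s * M = M * s -> s * h = h * s -> s * x = x * s /\ s * y = y * s].
Proof.
have [NN MM e] := NM; have NMN := munits_NMN; have MNM : M * N * M = M.
  by apply: (@sub0_eq E (M * (N * M + M * N - 1) - M * M * N)); [ncr|rewrite e MM subrr; zs].
move=> hN; have hN0 := eq_sub0 hN; pose x := h * N * M + M * h * N; pose z := h - x.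
have Nx : N * x = h * N.
  apply: (@sub0_eq E (- (h * N - N * h) * (N * M) + h * (N * N) * M - N * M * (h * N - N * h) *0 +
    N * M * (h * N - N * h) + (N * M * N - N) * h - (h * N - N * h))); first by rewrite /x; ncr.
  by rewrite hN0 NN NMN subrr; zs.
have xN : x * N = h * N.
  apply: (@sub0_eq E (h * (N * M * N - N) + M * h * (N * N))); first by rewrite /x; ncr.
  by rewrite NN NMN subrr; zs.
have xM : x * M = M * h * N * M.
  by apply: (@sub0_eq E (h * N * (M * M))); [rewrite /x; ncr|rewrite MM; zs].
have Mx : M * x = M * h * N * M.
  by apply: (@sub0_eq E (M * M * h * N)); [rewrite /x; ncr|rewrite MM; zs].
have Nz : N * z = 0 by rewrite /z mulrBr Nx hN subrr.
have zN : z * N = 0 by rewrite /z mulrBl xN subrr.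
have Ny : N * (M * z + z * M) = z.
  apply: (@sub0_eq E ((N * M + M * N - 1) * z - M * (N * z) + N * z * M)); first by ncr.
  by rewrite e Nz subrr; zs.
have yN : (M * z + z * M) * N = z.
  apply: (@sub0_eq E (z * (N * M + M * N - 1) - (z * N) * M + M * (z * N))); first by ncr.
  by rewrite e zN subrr; zs.
exists x, (M * z + z * M); split.
- by rewrite yN /z addrC subrK.
- by split; [rewrite Nx xN|rewrite xM Mx].
- split; first by rewrite Ny yN.
  by apply: (@sub0_eq E (z * (M * M) - M * M * z)); [ncr|rewrite MM; zs].
move=> s sN sM sh.
have sx : s * x = x * s by apply: comm_add; do !apply: comm_mul.
by split=> //; apply: comm_add; apply: comm_mul => //; apply: comm_sub.
Qed.

Lemma munits_uniq x y x' y' : comm2 N M x -> comm2 N M y -> comm2 N M x' -> comm2 N M y' ->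
  x + y * N = x' + y' * N -> x = x' /\ y = y'.
Proof.
have [NN MM e] := NM; move=> [xN xM] [yN yM] [x'N x'M] [y'N y'M] /[dup] h /eq_sub0 h0.
have ex : x = x'.
  apply/eqP; rewrite -subr_eq0; apply/eqP; apply: munits_inj; first by rewrite mulrBl mulrBr xM x'M.
  apply: (@sub0_eq E ((x + y * N - (x' + y' * N)) * N - (y - y') * (N * N))); first by ncr.
  by rewrite h0 NN; zs.
split=> //; apply/eqP; rewrite -subr_eq0; apply/eqP; apply: munits_inj; first by rewrite mulrBl mulrBr yM y'M.
by rewrite mulrBl; move: h; rewrite ex => /addrI ->; rewrite subrr.
Qed.
End Units.

(* The isomorphism of E = M_2(B) onto B, the centraliser of the matrix units,
   determined by an isomorphism of B with M_2(B). *)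
Section Shrink.
Variables (N M x1 x2 y1 y2 : E).
Hypotheses (NM : munits N M).
Hypotheses (x1S : comm2 N M x1) (x2S : comm2 N M x2) (y1S : comm2 N M y1) (y2S : comm2 N M y2).
Hypotheses (y1x1 : y1 * x1 = 1) (y1x2 : y1 * x2 = 0) (y2x1 : y2 * x1 = 0) (y2x2 : y2 * x2 = 1).
Hypothesis (xy1 : x1 * y1 + x2 * y2 = 1).

Let b := N * M * x1 + N * x2.
Let a := N * M * y1 + M * y2.

(** By [shrink_ab], [b * X * a] runs isomorphically over the corner cut out by [N * M]; the two
    summands place a copy of it at both diagonal positions. *)
Definition shrink (X : E) : E := N * M * b * X * a * N * M + M * b * X * a * N.

Lemma shrink_ab : a * b = 1 /\ b * a = N * M.
Proof.
have [NN MM e] := NM; have NMN := munits_NMN NM; have MNM := munits_NMN (munitsC NM).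
have [a1 a2] := x1S; have [a3 a4] := x2S; have [a5 a6] := y1S; have [a7 a8] := y2S.
have c1 := comm_mul a5 a6; have c2 := comm_mul a1 a2; have c3 := comm_mul a7 a8.
rewrite /a /b; split.
  transitivity (N * M * N * M * (y1 * x1) + N * M * N * (y1 * x2) + M * N * M * (y2 * x1) + M * N * (y2 * x2)).
    rewrite !mulrDr !mulrDl !addrA [X in X + _]addrAC.
    have r1 : N * M * y1 * (N * M * x1) = N * M * N * M * (y1 * x1).
      by rewrite -(mulrA (N * M)) (mulrA y1) c1 -!mulrA.
    have r2 : M * y2 * (N * M * x1) = M * N * M * (y2 * x1).
      by rewrite -(mulrA M y2) (mulrA y2) c3 -!mulrA.
    have r3 : N * M * y1 * (N * x2) = N * M * N * (y1 * x2).
      by rewrite -(mulrA (N * M)) (mulrA y1) a5 -!mulrA.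
    have r4 : M * y2 * (N * x2) = M * N * (y2 * x2).
      by rewrite -(mulrA M y2) (mulrA y2) a7 -!mulrA.
    by rewrite r1 r2 r3 r4.
  by rewrite y1x1 y1x2 y2x1 y2x2 NMN; zs; rewrite !mulr1.
transitivity (N * M * N * M * (x1 * y1) + N * M * M * (x1 * y2) + N * N * M * (x2 * y1) + N * M * (x2 * y2)).
  rewrite !mulrDr !mulrDl !addrA [X in X + _]addrAC.
  have r1 : N * M * x1 * (N * M * y1) = N * M * N * M * (x1 * y1).
    by rewrite -(mulrA (N * M)) (mulrA x1) c2 -!mulrA.
  have r2 : N * M * x1 * (M * y2) = N * M * M * (x1 * y2).
    by rewrite -(mulrA (N * M)) (mulrA x1) a2 -!mulrA.
  have r3 : N * x2 * (N * M * y1) = N * N * M * (x2 * y1).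
    by rewrite -(mulrA N x2) (mulrA x2) (comm_mul a3 a4) -!mulrA.
  have r4 : N * x2 * (M * y2) = N * M * (x2 * y2).
    by rewrite -(mulrA N x2) (mulrA x2) a4 -!mulrA.
  by rewrite r1 r2 r3 r4.
by rewrite NMN NN -(mulrA N M M) MM; zs; rewrite -mulrDr xy1 mulr1.
Qed.

Lemma shrink_a : a * (N * M) = a /\ N * M * b = b.
Proof.
have [ab ba] := shrink_ab.
by rewrite -ba mulrA ab mul1r -[b * a * b]mulrA ab mulr1.
Qed.

Lemma shrinkD X Y : shrink (X + Y) = shrink X + shrink Y.
Proof. by rewrite /shrink; ncr. Qed.

Lemma shrinkM X Y : shrink (X * Y) = shrink X * shrink Y.
Proof.
have [NN MM e] := NM; have NMN := munits_NMN NM; have MNM := munits_NMN (munitsC NM).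
have [ab ba] := shrink_ab; have [a1 b1] := shrink_a.
rewrite /shrink; apply: (@sub0_eq E (
  - (N * M * b * X * a * (N * M * N - N) * M * b * Y * a * N * M
    + N * M * b * X * (a * (N * M) - a) * b * Y * a * N * M
    + N * M * b * X * (a * b - 1) * Y * a * N * M
    + N * M * b * X * a * N * (M * M) * b * Y * a * N
    + M * b * X * a * (N * N) * M * b * Y * a * N * M
    + M * b * X * (a * (N * M) - a) * b * Y * a * N
    + M * b * X * (a * b - 1) * Y * a * N))); first by ncr.
by rewrite NMN MM NN a1 ab !subrr; zs.
Qed.

Lemma shrink_comm X : comm2 N M (shrink X).
Proof.
have [NN MM e] := NM; have NMN := munits_NMN NM; have MNM := munits_NMN (munitsC NM).
rewrite /shrink; split.
  apply: (@sub0_eq E (N * M * b * X * a * (N * M * N - N) + M * b * X * a * (N * N)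
     - N * N * M * b * X * a * N * M)); first by ncr.
  by rewrite NMN NN subrr; zs.
apply: (@sub0_eq E (N * M * b * X * a * N * (M * M) - (M * N * M - M) * b * X * a * N * M - M * M * b * X * a * N)); first by ncr.
by rewrite MNM MM subrr; zs.
Qed.

Lemma shrink_inj X Y : shrink X = shrink Y -> X = Y.
Proof.
have [NN MM e] := NM; have NMN := munits_NMN NM; have MNM := munits_NMN (munitsC NM).
have [ab ba] := shrink_ab; have [a1 b1] := shrink_a.
have Z X' : a * (N * M) * shrink X' * (N * M) * b = X'.
  rewrite /shrink; apply: (@sub0_eq E ((a * (N * M) - a) * (N * M) * b * X' * a * N * M * N * M * b
    + (a * (N * M) - a) * b * X' * a * N * M * N * M * b
    + (a * b - 1) * X' * a * N * M * N * M * b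
    + X' * a * (N * M * N - N) * M * b + X' * (a * (N * M) - a) * b + X' * (a * b - 1)
    + a * N * (M * M) * b * X' * a * N * (N * M) * b)); first by ncr.
  by rewrite a1 ab NMN MM !subrr; zs.
by move=> h; rewrite -(Z X) -(Z Y) h.
Qed.

Lemma shrink_surj z : comm2 N M z -> shrink (a * z * b) = z.
Proof.
have [NN MM e] := NM; have NMN := munits_NMN NM; have MNM := munits_NMN (munitsC NM).
have [ab ba] := shrink_ab => -[zN zM].
rewrite /shrink; apply: (@sub0_eq E (
   N * M * (b * a - N * M) * z * b * a * N * M + N * M * N * M * z * (b * a - N * M) * N * M
   + M * (b * a - N * M) * z * b * a * N + M * N * M * z * (b * a - N * M) * N
   + (N * M * N - N) * M * z * N * M * N * M + N * M * z * (N * M * N - N) * M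
   + N * M * (z * N - N * z) * M + (N * M * N - N) * z * M + N * (z * M - M * z) 
   + (M * N * M - M) * z * N * M * N + M * z * (N * M * N - N) + M * (z * N - N * z)
   + (N * M + M * N - 1) * z)); first by ncr.
by rewrite ba NMN MNM zN zM e !subrr; zs.
Qed.

Lemma shrink_compat s X : s * N = N * s -> s * M = M * s -> s * x1 = x1 * s -> s * x2 = x2 * s ->
  s * y1 = y1 * s -> s * y2 = y2 * s -> s * X = X * s -> s * shrink X = shrink X * s.
Proof. by move=> *; rewrite /shrink /a /b; do !(apply: comm_add || apply: comm_mul). Qed.

Lemma shrink_compat' s z : s * N = N * s -> s * M = M * s -> s * x1 = x1 * s -> s * x2 = x2 * s ->
  s * y1 = y1 * s -> s * y2 = y2 * s -> s * z = z * s -> s * (a * z * b) = a * z * b * s.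
Proof. by move=> *; rewrite /a /b; do !(apply: comm_add || apply: comm_mul). Qed.
End Shrink.
End MatrixUnits.

(** * Group formulas for the coefficients of transvections *)

Section GroupCoding.
Variable G : groupType.
Local Open Scope group_scope.
Implicit Types m d w t c g h u : G.

Definition gcm g h : Prop := g * h = h * g.
Definition gpauli m d w : Prop := [/\ d * d = 1, w * w = 1 & d * w = m * w * d].
Definition gpair d w g : Prop := gcm g d /\ gcm g w.
(* t = 1 + N, where N and w N w are matrix units. *)
Definition gtransv d w t : Prop :=
  [/\ t * (d * t * d) = 1,
      forall u, gpair d w u -> gcm t u,
      forall u, gcm u d -> gcm t (u * t * u^-1),
      exists h, gcm h d /\ h * t = t * t * h &
      t * (w * t * w)^-1 * t = d * w].
(** The elements 1 + a N: if h = x + y N, conjugating the inverse of h by d changes the sign of its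
    N-part, and the product is 1 + 2 y x^-1 N. Invertibility of 2 makes all coefficients occur. *)
Definition gY d t d' w' g : Prop :=
  exists h, [/\ gcm h t, gpair d' w' h & g = h * d * h^-1 * d].
(* Conjugation by c is the controlled-Z gate of the commuting pairs. *)
Definition gcz d1 w1 d2 w2 c : Prop :=
  [/\ c * c = 1, gcm c d1 /\ gcm c d2, c * w1 = w1 * d2 * c, c * w2 = w2 * d1 * c &
      forall u, gpair d1 w1 u -> gpair d2 w2 u -> gcm c u].
(** Let h = 1 + b N2 and g = 1 + a N1. Conjugation by c turns N1 into N1 d2 and N2 into N2 d1, so
    this is the commutator of 1 + b N2 (1 + d1) and 1 + a N1 (1 - d2). It equals 1 + 4 b a N1 N2 or
    1 - 4 a b N1 N2 if both transvections have the same sign, and 1 otherwise. *)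
Definition gK c h g : G :=
  let b := h * (c * h * c) in let a := g * (c * g * c)^-1 in b * a * b^-1 * a^-1.
(** The first equation transfers the coefficient of [g1] from N1 to N2, the second compares its
    product with the coefficient of [g2] to the coefficient of [g3]. *)
Definition gmul d1 w1 t1 d2 t2 c g1 g2 g3 : Prop :=
  exists h, [/\ gY d2 t2 d1 w1 h, gK c h t1 = gK c t2 g1 & gK c h g2 = gK c t2 g3].

(** The third pair lies in the centraliser of the first two, where [unit_comm] calls for one. The
    last condition excludes transvections of opposite signs, for which [gK] is trivial. *)
Definition ggood0 m d1 w1 t1 d2 w2 t2 d3 w3 c : Prop :=
  [/\ (forall g, gcm m g) /\ m <> 1, m * m = 1,
    [/\ gpauli m d1 w1, gpauli m d2 w2 & gpauli m d3 w3],
    [/\ gpair d1 w1 d2, gpair d1 w1 w2, gpair d1 w1 d3, gpair d1 w1 w3 & gpair d2 w2 d3 /\ gpair d2 w2 w3] &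
    [/\ gtransv d1 w1 t1, gtransv d2 w2 t2, gcz d1 w1 d2 w2 c & gK c t2 t1 <> 1]].

(* The coded ring is isomorphic to its ring of 2x2 matrices. *)
Definition gshrink d1 w1 t1 d2 w2 t2 c : Prop :=
  exists X1 X2 Z1 Z2 p q,
    let Y := gY d1 t1 d2 w2 in let M := gmul d1 w1 t1 d2 t2 c in
    [/\ [/\ Y X1, Y X2, Y Z1 & Y Z2], Y p /\ Y q, [/\ M Z1 X1 t1, M Z1 X2 1, M Z2 X1 1 & M Z2 X2 t1],
        M X1 Z1 p /\ M X2 Z2 q & p * q = t1].
End GroupCoding.

Definition unit_group (G : groupType) (E : pzRingType) (i : G -> E) : Prop :=
  [/\ injective i, forall g h, i (g * h)%g = i g * i h &
      forall u v, u * v = 1 -> v * u = 1 -> exists g, i g = u].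

(** * The group formulas read in the ring *)

Section Decode.
Variables (G : groupType) (E : pzRingType) (i : G -> E) (k : E) (D0 W0 : E).
Hypotheses (iu : unit_group i) (kh : is_half k) (P0 : pauli D0 W0).
Hypothesis conn : forall z : E, central z -> z * z = z -> z = 0 \/ z = 1.
Hypothesis E10 : (1 : E) <> 0.

Lemma ui_inj : injective i. Proof. by case: iu. Qed.
Lemma uiM g h : i (g * h)%g = i g * i h. Proof. by case: iu. Qed.
Lemma ui1 : i 1%g = 1.
Proof.
have [_ _ iS] := iu; have [g ig] := iS 1 1 (mulr1 1) (mulr1 1).
by rewrite -[LHS]mulr1 -ig -uiM mul1g.
Qed.
Lemma uiV g : i g^-1%g * i g = 1. Proof. by rewrite -uiM mulVg ui1. Qed.
Lemma uiVr g : i g * i g^-1%g = 1. Proof. by rewrite -uiM mulgV ui1. Qed.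
Lemma uiVE g y : i g * y = 1 -> i g^-1%g = y.
Proof. by move=> h; rewrite -[LHS]mulr1 -h mulrA uiV mul1r. Qed.

Lemma ui_cm g h : gcm g h <-> i g * i h = i h * i g.
Proof. by rewrite /gcm -!uiM; split=> [->//|/ui_inj]. Qed.
Lemma ui_pair d w g : gpair d w g <-> comm2 (i d) (i w) (i g).
Proof. by rewrite /gpair /comm2 !ui_cm. Qed.

(** Commuting with all units implies being central in [E] by [unit_comm], and a central element of
    square 1 is a sign. *)
Lemma ui_m m : (forall g, gcm m g) -> m <> 1%g -> (m * m)%g = 1%g -> i m = -1.
Proof.
move=> mc m1 mm; have [_ _ iS] := iu.
have mC : central (i m).
  move=> y; apply: (unit_comm kh P0 (P := fun=> True)) => // u v _ _ uv vu.
  by have [g <-] := iS u v uv vu; apply/ui_cm.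
have mm' : i m * i m = 1 by rewrite -uiM mm ui1.
have [h|//] := central_sq1 kh conn mC mm'.
by case: m1; apply: ui_inj; rewrite h ui1.
Qed.

Lemma ui_pauli m d w : i m = -1 -> gpauli m d w -> pauli (i d) (i w).
Proof.
move=> im [dd ww dw]; split; rewrite -?uiM ?dd ?ww ?ui1 //.
by rewrite dw !uiM im mulN1r mulNr.
Qed.

Definition tfacts (D W N M eps : E) : Prop :=
  [/\ munits N M, eps = 1 \/ eps = -1, D * N = eps * N /\ N * D = - (eps * N),
      W = eps * (N + M) & D = eps * (N * M + N * M - 1)] /\
  (forall s, comm2 N M s <-> comm2 D W s).

Lemma sgn_central (eps : E) : eps = 1 \/ eps = -1 -> central eps /\ eps * eps = 1.
Proof.
by case=> ->; split=> [z|]; rewrite ?(mul1r, mulr1, mulN1r, mulrN1, opprK).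
Qed.

Lemma ui_transv m d w t d' w' : i m = -1 -> gpauli m d w -> gpauli m d' w' ->
  gpair d w d' -> gpair d w w' -> gtransv d w t ->
  exists M eps, tfacts (i d) (i w) (i t - 1) M eps.
Proof.
move=> im pp pp' /ui_pair c1 /ui_pair c2 [t1 t2 t3 [h [hd ht]] t5].
have P := ui_pauli im pp; have P' := ui_pauli im pp'; have [_ _ iS] := iu.
have T_comm u v : comm2 (i d) (i w) u -> comm2 (i d) (i w) v -> u * v = 1 -> v * u = 1 -> i t * u = u * i t.
  move=> cu _ uv vu; have [g e] := iS u v uv vu; rewrite -e; apply/(ui_cm t g)/t2/ui_pair.
  by rewrite e.
have T_conj u v : u * i d = i d * u -> v * i d = i d * v -> u * v = 1 -> v * u = 1 ->
    i t * (u * i t * v) = u * i t * v * i t.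
  move=> cu _ uv vu; have [g e] := iS u v uv vu; move: cu uv; rewrite -e => /ui_cm cu /uiVE <-.
  by have /ui_cm := t3 _ cu; rewrite !uiM.
have T_inv : i t * (i d * i t * i d) = 1 by rewrite -!uiM t1 ui1.
have T_sq : exists h h', [/\ h * h' = 1, h' * h = 1, h * i d = i d * h & h * i t = i t * i t * h].
  exists (i h), (i h^-1%g); split; [exact: uiVr|exact: uiV|exact/ui_cm|by rewrite -!uiM ht].
have T_weyl : exists y, [/\ y * (i w * i t * i w) = 1, i w * i t * i w * y = 1 & i t * y * i t = i d * i w].
  exists (i (w * t * w)^-1%g); rewrite -!uiM t5; split=> //; first by rewrite uiM uiV.
  by rewrite uiM uiVr.
have [] := transvectionP kh conn E10 P P' c1 c2 T_inv T_comm T_conj T_sq T_weyl.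
have cT := T_commS kh P' c1 c2 T_comm.
set N := i t - 1; set D := i d; set W := i w => NN NM [eps [e1 DN ND [eD NW]]].
have [ec ee] := sgn_central e1; have [DD WW DW] := P.
have WW0 := eq_sub0 WW.
exists (W * N * W), eps; pose M := W * N * W; rewrite -/M.
have MM : M * M = 0.
  rewrite /M; apply: (@sub0_eq E (W * N * (W * W - 1) * N * W + W * (N * N) * W)); first by ncr.
  by rewrite WW0 NN; zs.
have NM' : N * M + M * N = 1 by rewrite /M !mulrA.
have mu : munits N M by split.
have NMN := munits_NMN mu; have MNM := munits_NMN (munitsC mu).
have NW' : N * W = eps * (N * M) by rewrite NW /M !mulrA.
have WE : W = eps * (N + M).
  apply: (@sub0_eq E (- (N * M + M * N - 1) * W + N * (W * N * (W * W - 1)) + M * (N * W - eps * (N * M))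
     + (M * eps - eps * M) * (N * M) + eps * (M * N * M - M)
     + (N * W - eps * (N * M)) * N + eps * (N * M * N - N)));
   first by rewrite /M; ncr.
  by rewrite NM' WW0 NW' -(ec M) NMN MNM !subrr; zs.
have DE : D = eps * (N * M + N * M - 1).
  have -> : N * M + N * M = 1 + eps * D by rewrite eD /M !mulrA.
  by rewrite [1 + _]addrC addrK mulrA ee mul1r.
split=> // s; split=> -[sN sM].
  have sd : s * eps = eps * s by rewrite ec.
  split; [rewrite DE|rewrite WE]; apply: comm_mul => //; last exact: comm_add.
  by apply: comm_sub; [apply: comm_add; apply: comm_mul|exact: comm_1].
have sN' : s * N = N * s.
  by rewrite /N; apply: comm_sub; [rewrite (cT s) //|exact: comm_1].
by split=> //; rewrite /M; do !apply: comm_mul.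
Qed.

Lemma ui_Y d w t d' w' M eps g : i d * i d = 1 -> tfacts (i d) (i w) (i t - 1) M eps ->
  gpair d w d' -> gpair d w w' ->
  gY d t d' w' g <-> exists a, [/\ comm2 (i t - 1) M a, comm2 (i d') (i w') a & i g = 1 + a * (i t - 1)].
Proof.
move=> DD [[mu e1 [DN ND] WE DE] cc] /ui_pair c1 /ui_pair c2; have [_ _ iS] := iu.
have tN x : x * i t = i t * x <-> x * (i t - 1) = (i t - 1) * x.
  split=> h; first by apply: comm_sub => //; exact: comm_1.
  by rewrite -[i t](subrK 1); apply: comm_add => //; exact: comm_1.
set N := i t - 1 in mu DN ND WE DE cc tN *; set D := i d in DN ND DE cc c1 c2 DD *.
have [NN MM _] := mu; have [ec ee] := sgn_central e1.
have [d'N d'M] := (cc _).2 c1; have [w'N w'M] := (cc _).2 c2.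
split=> [[h [/ui_cm /tN hN /ui_pair [hd' hw'] ->]]|[a [[aN aM] [ad aw] gE]]].
  have inv_cm z : z * i h = i h * z -> z * i h^-1%g = i h^-1%g * z.
    by move=> zh; rewrite -[LHS]mul1r -(uiV h) -mulrA (mulrA (i h)) -zh -!mulrA uiVr mulr1.
  have h'N : i h^-1%g * N = N * i h^-1%g by rewrite inv_cm.
  have [x [y [xy xS yS sxy]]] := munits_decomp mu hN.
  have [x' [y' [xy' xS' yS' sxy']]] := munits_decomp mu h'N.
  have [xd yd] := sxy _ (esym (esym d'N)) d'M (esym hd').
  have [xw yw] := sxy _ w'N w'M (esym hw').
  have [xd' yd'] := sxy' _ d'N d'M (inv_cm _ (esym hd')).
  have [xw' yw'] := sxy' _ w'N w'M (inv_cm _ (esym hw')).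
  have [xN xM] := xS; have [yN yM] := yS; have [xN' xM'] := xS'; have [yN' yM'] := yS'.
  have [_ sD] := cc x'; have [/esym xD' _] := (cc x').1 xS'; have [/esym yD' _] := (cc y').1 yS'.
  have hh : i h * i h^-1%g = 1 by exact: uiVr.
  have e0 : x * x' + (x * y' + y * x') * N = 1 + 0 * N.
    rewrite mul0r addr0 -hh xy xy'; apply: (@sub0_eq E (y * (x' * N - N * x') + y * (y' * N - N * y') * N - y * y' * (N * N))); first by ncr.
    by rewrite xN' yN' NN !subrr; zs.
  have c0 : comm2 N M 0 by split; rewrite mul0r mulr0.
  have c1' : comm2 N M 1 by split; rewrite mul1r mulr1.
  have cM u v : comm2 N M u -> comm2 N M v -> comm2 N M (u * v).
    by move=> [u1 u2] [v1 v2]; split; apply/esym/comm_mul.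
  have cA u v : comm2 N M u -> comm2 N M v -> comm2 N M (u + v).
    by move=> [u1 u2] [v1 v2]; split; apply/esym/comm_add.
  have [xx xyN] := munits_uniq mu (cM _ _ xS xS') (cA _ _ (cM _ _ xS yS') (cM _ _ yS xS')) c1' c0 e0.
  exists (y * x' + y * x'); split; first by apply: cA; apply: cM.
    by split; apply/esym/comm_add; apply/comm_mul.
  have DxD : D * (x' + y' * N) * D = x' - y' * N.
    apply: (@sub0_eq E ((D * x' - x' * D) * D + x' * (D * D - 1) + (D * y' - y' * D) * N * D + y' * (D * N - eps * N) * D
      + y' * eps * (N * D + eps * N) - y' * (eps * eps - 1) * N)); first by ncr.
    by rewrite xD' yD' DN (eqN_add0 ND) DD ee !subrr; zs.
  rewrite !uiM xy xy' -/D.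
  apply: (@sub0_eq E ((x + y * N) * (D * (x' + y' * N) * D - (x' - y' * N)) + (x * x' - 1)
     - (x * y' + y * x') * N - y * (x' * N - N * x') + y * (y' * N - N * y') * N - y * y' * (N * N))); first by ncr.
  by rewrite DxD xx xyN xN' yN' NN !subrr; zs.
have [kc k2] := kh.
pose n := k * a * N.
have nn : n * n = 0.
  rewrite /n; apply: (@sub0_eq E (k * a * ((N * k - k * N) * a + k * (N * a - a * N)) * N + k * a * k * a * (N * N))); first by ncr.
  by rewrite NN aN (kc N) !subrr; zs.
have uv : (1 + n) * (1 - n) = 1 by apply: (@sub0_eq E (- (n * n))); [ncr|rewrite nn; zs].
have vu : (1 - n) * (1 + n) = 1 by apply: (@sub0_eq E (- (n * n))); [ncr|rewrite nn; zs].
have [h ih] := iS _ _ uv vu.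
have ihV : i h^-1%g = 1 - n by apply: uiVE; rewrite ih.
have cn s : s * a = a * s -> s * N = N * s -> i h * s = s * i h.
  move=> sa sN; rewrite ih; apply/esym/comm_add; first exact: comm_1.
  by apply: comm_mul => //; apply: comm_mul => //.
exists h; split.
- apply/ui_cm; apply: cn; first by apply/esym/tN.
  exact: (tN (i t) : _).1.
- by apply/ui_pair; split; apply: cn.
apply: ui_inj; rewrite !uiM ih ihV gE -/D; have [/esym aD _] := (cc a).1 (conj aN aM).
apply: (@sub0_eq E ((1 + n) * (D * n * D + n) - (1 + n) * (D * D - 1) - n * n - (n + n - a * N))); first by ncr.
have -> : D * n * D = - n.
  rewrite /n; apply: (@sub0_eq E ((D * k - k * D) * a * N * D + k * (D * a - a * D) * N * D + k * a * (D * N - eps * N) * D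
    + k * a * eps * (N * D + eps * N) - k * a * (eps * eps - 1) * N)); first by ncr.
  by rewrite -(kc D) aD DN (eqN_add0 ND) ee !subrr; zs.
by rewrite DD addNr nn /n -!mulrDl k2 mul1r !subrr; zs.
Qed.
End Decode.
Definition four (E : pzRingType) (x : E) : E := (x + x) + (x + x).

(** * Multiplication of coded coefficients *)

Section DecodeMul.
Variables (G : groupType) (E : pzRingType) (i : G -> E) (k : E) (D0 W0 : E).
Hypotheses (iu : unit_group i) (kh : is_half k) (P0 : pauli D0 W0).
Hypothesis conn : forall z : E, central z -> z * z = z -> z = 0 \/ z = 1.
Hypothesis E10 : (1 : E) <> 0.
Variables (m d1 w1 t1 d2 w2 t2 d3 w3 c : G).
Hypothesis good : ggood0 m d1 w1 t1 d2 w2 t2 d3 w3 c.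

Let N1 := i t1 - 1.
Let N2 := i t2 - 1.

Definition inA a := comm2 (i d1) (i w1) a /\ comm2 (i d2) (i w2) a.

(** The signs of the two transvections agree, and [z] records their value: it decides whether [gmul]
    multiplies in the given order or in reverse. The last clause makes the coefficient ring [inA] a
    copy of all of [E]. *)
Theorem decode_core : exists z : bool, (i d1 * N1 = N1 -> z) /\
  [/\ forall g, gY d1 t1 d2 w2 g <-> exists a, inA a /\ i g = 1 + a * N1,
      (forall a, inA a -> exists g, i g = 1 + a * N1) /\
      forall a b, inA a -> inA b -> 1 + a * N1 = 1 + b * N1 -> a = b,
      (forall a, inA a -> a * N1 = N1 * a) /\ N1 * N1 = 0,
      forall g1 g2 g3 a1 a2 a3, inA a1 -> inA a2 -> inA a3 -> i g1 = 1 + a1 * N1 ->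
        i g2 = 1 + a2 * N1 -> i g3 = 1 + a3 * N1 ->
        gmul d1 w1 t1 d2 t2 c g1 g2 g3 <-> a3 = if z then a1 * a2 else a2 * a1 &
      forall x1 x2 y1 y2, inA x1 -> inA x2 -> inA y1 -> inA y2 -> y1 * x1 = 1 -> y1 * x2 = 0 ->
        y2 * x1 = 0 -> y2 * x2 = 1 -> x1 * y1 + x2 * y2 = 1 -> exists f : E -> E,
        [/\ forall x, inA (f x), forall x y, f (x + y) = f x + f y, forall x y, f (x * y) = f x * f y,
          injective f & forall a, inA a -> exists x, f x = a]].
Proof.
have [[mc m1] mm [p1 p2 p3] [c12 c1w2 c13 c1w3 [c23 c2w3]] [tr1 tr2 cz K1]] := good.
have im := ui_m iu kh P0 conn mc m1 mm.
have c21 : gpair d2 w2 d1 by case: c12 c1w2 => a _ [b _]; split; rewrite /gcm.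
have c2w1 : gpair d2 w2 w1 by case: c12 c1w2 => _ a [_ b]; split; rewrite /gcm.
have [M1 [e1 F1]] := ui_transv iu kh conn E10 im p1 p2 c12 c1w2 tr1.
have [M2 [e2 F2]] := ui_transv iu kh conn E10 im p2 p1 c21 c2w1 tr2.
have P1 := ui_pauli iu im p1; have P2 := ui_pauli iu im p2; have P3 := ui_pauli iu im p3.
have [DD1 _ _] := P1; have [DD2 _ _] := P2.
have Y1 := ui_Y iu kh _ DD1 F1 c12 c1w2; have Y2 := ui_Y iu kh _ DD2 F2 c21 c2w1.
have [[mu1 s1 [DN1 ND1] WE1 DE1] cc1] := F1; have [[mu2 s2 [DN2 ND2] WE2 DE2] cc2] := F2.
have toE := ui_pair iu.
move/toE: c12 => c12; move/toE: c1w2 => c1w2; move/toE: c13 => c13; move/toE: c1w3 => c1w3.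
move/toE: c23 => c23; move/toE: c2w3 => c2w3; move/toE: c21 => c21; move/toE: c2w1 => c2w1.
rewrite -/N1 -/N2 in Y1 Y2 mu1 mu2 DN1 ND1 DN2 ND2 WE1 WE2 DE1 DE2 cc1 cc2.
have [ec1 ee1] := sgn_central s1; have [ec2 ee2] := sgn_central s2.
have it1 : i t1 = 1 + 1 * N1 by rewrite mul1r /N1 addrC subrK.
have it2 : i t2 = 1 + 1 * N2 by rewrite mul1r /N2 addrC subrK.
have [[NN1 MM1 NM1] [NN2 MM2 NM2]] := (mu1, mu2).
pose A a := comm2 N1 M1 a /\ comm2 N2 M2 a.
have Y1' g : gY d1 t1 d2 w2 g <-> exists a, A a /\ i g = 1 + a * N1.
  rewrite Y1; split=> [[a [h1 h2 h3]]|[a [[h1 h2] h3]]]; exists a.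
    by split=> //; split=> //; apply/cc2.
  by split=> //; apply/cc2.
have Y2' g : gY d2 t2 d1 w1 g <-> exists a, A a /\ i g = 1 + a * N2.
  rewrite Y2; split=> [[a [h1 h2 h3]]|[a [[h1 h2] h3]]]; exists a.
    by split=> //; split=> //; apply/cc1.
  by split=> //; apply/cc1.
have A1 : A 1 by split; exact: comm2_1.
have A0 : A 0 by split; split; rewrite mul0r mulr0.
have AM x y : A x -> A y -> A (x * y) by move=> [a b] [a' b']; split; apply: comm2_mul.
have AD x y : A x -> A y -> A (x + y) by move=> [a b] [a' b']; split; apply: comm2_add.
have AN x : A x -> A (- x) by move=> [a b]; split; apply: comm2_opp.
have AD1 x : A x -> comm2 (i d1) (i w1) x by move=> [/cc1].
have AD2 x : A x -> comm2 (i d2) (i w2) x by move=> [_ /cc2].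
have [cc' [/(ui_cm iu) cd1 /(ui_cm iu) cd2] cw1 cw2 cS] := cz.
set C := i c in cd1 cd2; have CC : C * C = 1 by rewrite /C -(uiM iu) cc' (ui1 iu).
(* The third pair lies in [A], so commutation of [C] with the units of [A], which the group
   expresses, extends to all of [A]. *)
have AC x : A x -> C * x = x * C.
  apply: (unit_comm kh P3 (P := A)) => //.
  - by split; [apply/cc1|apply/cc2].
  - by split; [apply/cc1|apply/cc2].
  move=> u v Au Av uv vu; have [_ _ iS] := iu; have [g e] := iS u v uv vu.
  rewrite -e in Au *; apply/(ui_cm iu)/cS; apply/(ui_pair iu); [exact: AD1|exact: AD2].
have {}cw1 : C * i w1 = i w1 * i d2 * C by rewrite /C -!(uiM iu) cw1.
have {}cw2 : C * i w2 = i w2 * i d1 * C by rewrite /C -!(uiM iu) cw2.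
set D1 := i d1 in DN1 ND1 DE1 cd1 c21 c12 c1w2 cw2 DD1 cc1 AD1 P1.
set D2 := i d2 in DN2 ND2 DE2 cd2 c12 c21 c2w1 cw1 DD2 cc2 AD2 P2.
(* Twice [N] is [D * W + eps * W], so its conjugate by [C] follows from the behaviour of [D] and
   [W]. *)
have twoN (D W N M eps D' : E) : munits N M -> eps = 1 \/ eps = -1 -> W = eps * (N + M) ->
    D = eps * (N * M + N * M - 1) -> C * D = D * C -> C * W = W * D' * C -> D * D' = D' * D ->
    C * N * C = N * D'.
  move=> mu s WE DE CD CW DD'; have [ec ee] := sgn_central s; have [NN MM e] := mu.
  have NMN := munits_NMN mu.
  have NE : N + N = D * W + eps * W.
    rewrite WE DE; apply: (@sub0_eq E (- (eps * eps - 1) * (N + N)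
      + eps * ((eps * (N * M) - N * M * eps) *0) - (eps * eps) * ((N * M * N - N) + (N * M * N - N)
        + N * (M * M) + N * (M * M))
      - eps * ((N * M * eps - eps * (N * M)) + (N * M * eps - eps * (N * M))) * (N + M))).
      by ncr.
    by rewrite ee NMN MM -(ec (N * M)) !subrr; zs.
  apply: (two_cancel kh).
  have -> : C * N * C + C * N * C = C * (D * W + eps * W) * C by rewrite -NE; ncr.
  have -> : N * D' + N * D' = (D * W + eps * W) * D' by rewrite -NE; ncr.
  apply: (@sub0_eq E ((C * D - D * C) * W * C + D * (C * W - W * D' * C) * C
     + D * W * D' * (C * C - 1) + (C * eps - eps * C) * W * C + eps * (C * W - W * D' * C) * C
     + eps * W * D' * (C * C - 1))); first by ncr.
  by rewrite CD CW CC (ec C) !subrr; zs.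
have CN1 : C * N1 * C = N1 * D2 by apply: (twoN D1 (i w1) N1 M1 e1) => //; case: c21 => ->.
have CN2 : C * N2 * C = N2 * D1 by apply: (twoN D2 (i w2) N2 M2 e2) => //; case: c12 => ->.
have [N1D2 _] := (cc1 D2).2 c12; have [N2D1 _] := (cc2 D1).2 c21.
have [N1N2 _] : comm2 N2 M2 N1.
  by apply/cc2; have [? _] := (cc1 _).2 c12; have [? _] := (cc1 _).2 c1w2; split.
pose X1 a := a * N1 * (1 - D2); pose X2 b := b * N2 * (1 + D1).
have alE g a : A a -> i g = 1 + a * N1 -> i (g * (c * g * c)^-1)%g = 1 + X1 a.
  move=> Aa ig; have [[aN1 _] _] := Aa; have [aD2 _] := AD2 _ Aa.
  have e : i (c * g * c)%g = 1 + a * N1 * D2.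
    rewrite !(uiM iu) ig -/C; apply: (@sub0_eq E ((C * C - 1) + (C * a - a * C) * N1 * C + a * (C * N1 * C - N1 * D2))); first by ncr.
    by rewrite CC AC // CN1 !subrr; zs.
  have e' : i (c * g * c)^-1%g = 1 - a * N1 * D2.
    apply: (uiVE iu); rewrite e.
    apply: (@sub0_eq E (- (a * N1 * (D2 * a - a * D2) * N1 * D2 - a * N1 * a * (N1 * D2 - D2 * N1) * D2 
       + a * (N1 * a - a * N1) * N1 * D2 * D2 + a * a * (N1 * N1) * D2 * D2))); first by ncr.
    by rewrite aD2 N1D2 aN1 NN1 !subrr; zs.
  rewrite (uiM iu) e' ig /X1; apply: (@sub0_eq E (- a * (N1 * a - a * N1) * N1 * D2 - a * a * (N1 * N1) * D2)); first by ncr.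
  by rewrite aN1 NN1 subrr; zs.
have beE h b : A b -> i h = 1 + b * N2 -> i (h * (c * h * c))%g = 1 + X2 b.
  move=> Aa ig; have [_ [aN1 _]] := Aa; have [aD2 _] := AD1 _ Aa.
  have e : i (c * h * c)%g = 1 + b * N2 * D1.
    rewrite !(uiM iu) ig -/C; apply: (@sub0_eq E ((C * C - 1) + (C * b - b * C) * N2 * C + b * (C * N2 * C - N2 * D1))); first by ncr.
    by rewrite CC AC // CN2 !subrr; zs.
  rewrite (uiM iu) e ig /X2; apply: (@sub0_eq E (b * (N2 * b - b * N2) * N2 * D1 + b * b * (N2 * N2) * D1)); first by ncr.
  by rewrite aN1 NN2 subrr; zs.
have KE h g a b : A a -> A b -> i h = 1 + b * N2 -> i g = 1 + a * N1 ->
    i (gK c h g) = 1 + (1 + e1) * (1 + e2) * (b * a) * (N1 * N2) - (1 - e1) * (1 - e2) * (a * b) * (N1 * N2).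
  move=> Aa Ab ih ig; have ea := alE _ _ Aa ig; have eb := beE _ _ Ab ih.
  have [[aN1 _] [aN2 _]] := Aa; have [[bN1 _] [bN2 _]] := Ab.
  have [aD1 _] := AD1 _ Aa; have [aD2 _] := AD2 _ Aa; have [bD1 _] := AD1 _ Ab; have [bD2 _] := AD2 _ Ab.
  have D12 : D1 * D2 = D2 * D1 by case: c12 => ->.
  rewrite /gK; move: (g * _)%g (h * _)%g ea eb => al be ea eb.
  have qE : X1 a = a * N1 - a * N1 * D2 by rewrite /X1; ncr.
  have pq : X2 b * X1 a = (1 + e1) * (1 + e2) * (b * a) * (N1 * N2).
    rewrite /X1 /X2.
    apply: (@sub0_eq E (b * N2 * (D1 * a - a * D1) * N1 * (1 - D2) + b * (N2 * a - a * N2) * (1 + D1) * N1 * (1 - D2)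
      + b * a * N2 * (D1 * N1 - e1 * N1) * (1 - D2)
      + b * a * (N2 * (1 + e1) - (1 + e1) * N2) * N1 * (1 - D2)
      + (b * a * (1 + e1) - (1 + e1) * (b * a)) * N2 * N1 * (1 - D2)
      + (1 + e1) * (b * a) * (N2 * N1 - N1 * N2) * (1 - D2)
      - (1 + e1) * (b * a) * N1 * (N2 * D2 + e2 * N2)
      + (1 + e1) * (b * a) * (N1 * e2 - e2 * N1) * N2
      + (1 + e1) * (b * a * e2 - e2 * (b * a)) * N1 * N2)); first by ncr.
    have ce : central (1 + e1) by apply: centralD => // z; rewrite mul1r mulr1.
    by rewrite aD1 aN2 DN1 (ce N2) (ce (b * a)) N1N2 (eqN_add0 ND2) (ec2 N1) (ec2 (b * a)) !subrr; zs.
  have qp : X1 a * X2 b = (1 - e1) * (1 - e2) * (a * b) * (N1 * N2).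
    rewrite /X1 /X2.
    apply: (@sub0_eq E (a * N1 * (b * D2 - D2 * b) * N2 * (1 + D1) + a * (N1 * b - b * N1) * (1 - D2) * N2 * (1 + D1)
      - a * b * N1 * (D2 * N2 - e2 * N2) * (1 + D1)
      + (a * b * N1 * (1 - e2) - (1 - e2) * (a * b * N1)) * N2 * (1 + D1)
      + (1 - e2) * a * b * N1 * (N2 * D1 - D1 * N2)
      + (1 - e2) * a * b * (N1 * D1 + e1 * N1) * N2
      - ((1 - e2) * e1 - e1 * (1 - e2)) * a * b * N1 * N2
      - (1 - e2) * (a * b * e1 - e1 * (a * b)) * N1 * N2 *0
      - (1 - e2) * (a * b * e1 - e1 * (a * b)) * N1 * N2
       )).
      by ncr.
    have ce : central (1 - e2) by apply: centralD; [move=> z; rewrite mul1r mulr1|move=> z; rewrite mulNr mulrN ec2].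
    by rewrite bD2 bN1 DN2 -(ce (a * b * N1)) N2D1 (eqN_add0 ND1) (ce e1) -(ec1 (a * b)) !subrr; zs.
  have pp : X2 b * X2 b = 0.
    rewrite /X2; apply: (@sub0_eq E (b * N2 * (D1 * b - b * D1) * N2 * (1 + D1) + b * (N2 * b - b * N2) * (1 + D1) * N2 * (1 + D1)
       - b * b * N2 * (N2 * D1 - D1 * N2) * (1 + D1) + b * b * (N2 * N2) * (1 + D1) * (1 + D1))); first by ncr.
    by rewrite bD1 bN2 N2D1 NN2 !subrr; zs.
  have qq : X1 a * X1 a = 0.
    rewrite /X1; apply: (@sub0_eq E (a * N1 * (a * D2 - D2 * a) * N1 * (1 - D2) + a * (N1 * a - a * N1) * (1 - D2) * N1 * (1 - D2)
       + a * a * N1 * (N1 * D2 - D2 * N1) * (1 - D2) + a * a * (N1 * N1) * (1 - D2) * (1 - D2))); first by ncr.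
    by rewrite aD2 aN1 N1D2 NN1 !subrr; zs.
  have pqp : X2 b * X1 a * X2 b = 0.
    rewrite pq /X2 -!mulrA (mulrA N2 b) -bN2 -(mulrA b) (mulrA N2 N2) NN2.
    by rewrite mul0r !mulr0.
  have qpq : X1 a * X2 b * X1 a = 0.
    rewrite qp N1N2 /X1 -!mulrA (mulrA N1 a) -aN1 -(mulrA a) (mulrA N1 N1) NN1.
    by rewrite mul0r !mulr0.
  have iea : i al^-1%g = 1 - X1 a.
    by apply: (uiVE iu); rewrite ea; apply: (@sub0_eq E (- (X1 a * X1 a))); [ncr|rewrite qq; zs].
  have ieb : i be^-1%g = 1 - X2 b.
    by apply: (uiVE iu); rewrite eb; apply: (@sub0_eq E (- (X2 b * X2 b))); [ncr|rewrite pp; zs].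
  rewrite !(uiM iu) iea ieb ea eb -pq -qp; move: (X1 a) (X2 b) pp qq pqp qpq => q p pp qq pqp qpq.
  apply: (@sub0_eq E (- (p * p) + p * p * q - q * q + q * p * q - p * q * p - p * (q * q) + p * (q * p * q))); first by ncr.
  by rewrite pp qq pqp qpq; zs.
have four_inj x y : A x -> A y -> four x * (N1 * N2) = four y * (N1 * N2) -> x = y.
  have [_ N1M2] : comm2 N2 M2 N1.
    by apply/cc2; have [? _] := (cc1 _).2 c12; have [? _] := (cc1 _).2 c1w2; split.
  move=> Ax Ay /eq_sub0; rewrite -mulrBl => h; have Ad : A (four x - four y).
    by apply: (AD _ _ (AD _ _ (AD _ _ Ax Ax) (AD _ _ Ax Ax)) (AN _ (AD _ _ (AD _ _ Ay Ay) (AD _ _ Ay Ay)))). 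
  have [[_ z1] [_ z2]] := Ad; move: h; rewrite mulrA => h.
  have h2 := munits_inj mu2 (_ : _ * N1 * M2 = _) h.
  have /eqP : four x - four y = 0.
    apply: (munits_inj mu1 z1); apply: h2.
    by apply/esym/comm_mul; [rewrite z2|rewrite N1M2].
  by rewrite subr_eq0 => /eqP /(two_cancel kh) /(two_cancel kh).
(* [A] is the centraliser of two commuting pairs of matrix units, hence [shrink] is applied once for
   each of them. *)
have SH x1 x2 y1 y2 : A x1 -> A x2 -> A y1 -> A y2 -> y1 * x1 = 1 -> y1 * x2 = 0 ->
    y2 * x1 = 0 -> y2 * x2 = 1 -> x1 * y1 + x2 * y2 = 1 -> exists f : E -> E,
    [/\ forall x, A (f x), forall x y, f (x + y) = f x + f y, forall x y, f (x * y) = f x * f y,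
       injective f & forall a, A a -> exists x, f x = a].
  move=> [x11 x12] [x21 x22] [y11 y12] [y21 y22] r1 r2 r3 r4 r5.
  pose f1 := shrink N1 M1 x1 x2 y1 y2; pose f2 := shrink N2 M2 x1 x2 y1 y2.
  have cr s t : comm2 s t N1 -> comm2 s t M1 -> comm2 s t N1 by [].
  have [N2N1 N2M1] : comm2 N1 M1 N2.
    by apply/cc1; have [? _] := (cc2 _).2 c21; have [? _] := (cc2 _).2 c2w1; split.
  have [M2N1 M2M1] : comm2 N1 M1 M2.
    by apply/cc1; have [_ ?] := (cc2 _).2 c21; have [_ ?] := (cc2 _).2 c2w1; split.
  exists (fun x => f2 (f1 x)); split.
  - move=> x; split; last exact: shrink_comm.
    have [h1 h2] := shrink_comm x1 x2 y1 y2 mu1 x; case: x11 => ? ?; case: x21 => ? ?; case: y11 => ? ?; case: y21 => ? ?.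
    by split; apply/esym/shrink_compat.
  - by move=> x y; rewrite /f1 /f2 !shrinkD.
  - move=> x y; rewrite /f1 /f2 (shrinkM mu1 x11 x21 y11 y21 r1 r2 r3 r4 r5).
    exact: (shrinkM mu2 x12 x22 y12 y22 r1 r2 r3 r4 r5).
  - move=> x y /(shrink_inj mu2 x12 x22 y12 y22 r1 r2 r3 r4 r5).
    exact: (shrink_inj mu1 x11 x21 y11 y21 r1 r2 r3 r4 r5).
  move=> a [a1 a2].
  set z := (N2 * M2 * y1 + M2 * y2) * a * (N2 * M2 * x1 + N2 * x2).
  exists ((N1 * M1 * y1 + M1 * y2) * z * (N1 * M1 * x1 + N1 * x2)).
  rewrite /f1 (shrink_surj mu1 x11 x21 y11 y21 r1 r2 r3 r4 r5).
    exact: (shrink_surj mu2 x12 x22 y12 y22 r1 r2 r3 r4 r5).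
  case: x11 => ? ?; case: x21 => ? ?; case: y11 => ? ?; case: y21 => ? ?; case: a1 => ? ?.
  by split; apply/esym/shrink_compat'.
have codE a b : A a -> A b -> 1 + a * N1 = 1 + b * N1 -> a = b.
  move=> [[_ aM] _] [[_ bM] _] /addrI /eq_sub0; rewrite -mulrBl => h.
  apply/eqP; rewrite -subr_eq0; apply/eqP; apply: (munits_inj mu1) h.
  by rewrite mulrBl mulrBr aM bM.
have codex a : A a -> exists g, i g = 1 + a * N1.
  move=> [[aN aM] _]; have [_ _ iS] := iu; have z : a * N1 * (a * N1) = 0.
    by rewrite mulrA -(mulrA a) -aN mulrA -mulrA NN1 mulr0.
  have [||g ig] := iS (1 + a * N1) (1 - a * N1); last by exists g.
    by apply: (@sub0_eq E (- (a * N1 * (a * N1)))); [ncr|rewrite z; zs].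
  by apply: (@sub0_eq E (- (a * N1 * (a * N1)))); [ncr|rewrite z; zs].
have codex2 a : A a -> exists g, i g = 1 + a * N2.
  move=> [_ [aN aM]]; have [_ _ iS] := iu; have z : a * N2 * (a * N2) = 0.
    by rewrite mulrA -(mulrA a) -aN mulrA -mulrA NN2 mulr0.
  have [||g ig] := iS (1 + a * N2) (1 - a * N2); last by exists g.
    by apply: (@sub0_eq E (- (a * N2 * (a * N2)))); [ncr|rewrite z; zs].
  by apply: (@sub0_eq E (- (a * N2 * (a * N2)))); [ncr|rewrite z; zs].
have it0 : i 1%g = 1 + 0 * N1 by rewrite mul0r addr0 (ui1 iu).
have cases : (forall a b h g, A a -> A b -> i h = 1 + b * N2 -> i g = 1 + a * N1 ->
      i (gK c h g) = 1 + four (b * a) * (N1 * N2)) \/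
    (D1 * N1 <> N1 /\ forall a b h g, A a -> A b -> i h = 1 + b * N2 -> i g = 1 + a * N1 ->
      i (gK c h g) = 1 - four (a * b) * (N1 * N2)).
  move: s1 s2 KE DN1 => [->|->] [->|->] KE DN1.
  - by left=> a b h g Aa Ab ih ig; rewrite (KE _ _ _ _ Aa Ab ih ig) subrr !mul0r subr0 /four; ncr.
  - by case: K1; apply: (ui_inj iu); rewrite (KE _ _ _ _ A1 A1 it2 it1) (ui1 iu) !(subrr, mulr0, mul0r) subr0 addr0.
  - by case: K1; apply: (ui_inj iu); rewrite (KE _ _ _ _ A1 A1 it2 it1) (ui1 iu) !(subrr, mulr0, mul0r) subr0 addr0.
  - right; split=> [h|a b h g Aa Ab ih ig].
      have N10 : N1 = 0 by apply: (dbl0 kh); rewrite -{1}h DN1 mulN1r addNr.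
      by apply: E10; rewrite -NM1 N10 mul0r mulr0 addr0.
    by rewrite (KE _ _ _ _ Aa Ab ih ig) subrr !mul0r addr0 opprK /four; ncr.
pose op (z : bool) (x y : E) := if z then x * y else y * x.
have [z [zD mulE]] : exists z : bool, (D1 * N1 = N1 -> z) /\ forall g1 g2 g3 a1 a2 a3, A a1 -> A a2 -> A a3 -> i g1 = 1 + a1 * N1 ->
    i g2 = 1 + a2 * N1 -> i g3 = 1 + a3 * N1 -> gmul d1 w1 t1 d2 t2 c g1 g2 g3 <-> a3 = op z a1 a2.
  case: cases => [KK|[nD KK]]; [exists true; split=> //|exists false; split=> //] => g1 g2 g3 a1 a2 a3 Aa1 Aa2 Aa3 ig1 ig2 ig3; rewrite /op.
    split=> [[h [/Y2' [b [Ab ih]] h1 h2]]|e].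
      have {}h1 := congr1 i h1; have {}h2 := congr1 i h2; move: h1 h2.
      rewrite (KK _ _ _ _ A1 Ab ih it1) (KK _ _ _ _ Aa1 A1 it2 ig1) (KK _ _ _ _ Aa2 Ab ih ig2) (KK _ _ _ _ Aa3 A1 it2 ig3).
      rewrite !mul1r mulr1 => /addrI /(four_inj _ _ Ab Aa1) <- /addrI /four_inj.
      by move=> ->//; exact: AM.
    have [h ih] := codex2 _ Aa1; exists h; split; first by apply/Y2'; exists a1.
      apply: (ui_inj iu).
      by rewrite (KK _ _ _ _ A1 Aa1 ih it1) (KK _ _ _ _ Aa1 A1 it2 ig1) mul1r mulr1.
    apply: (ui_inj iu).
    by rewrite (KK _ _ _ _ Aa2 Aa1 ih ig2) (KK _ _ _ _ Aa3 A1 it2 ig3) mul1r e.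
  split=> [[h [/Y2' [b [Ab ih]] h1 h2]]|e].
    have {}h1 := congr1 i h1; have {}h2 := congr1 i h2; move: h1 h2.
    rewrite (KK _ _ _ _ A1 Ab ih it1) (KK _ _ _ _ Aa1 A1 it2 ig1) (KK _ _ _ _ Aa2 Ab ih ig2) (KK _ _ _ _ Aa3 A1 it2 ig3).
    rewrite !mulr1 mul1r => /addrI /oppr_inj /(four_inj _ _ Ab Aa1) <- /addrI /oppr_inj /four_inj.
    by move=> ->//; exact: AM.
  have [h ih] := codex2 _ Aa1; exists h; split; first by apply/Y2'; exists a1.
    apply: (ui_inj iu).
    by rewrite (KK _ _ _ _ A1 Aa1 ih it1) (KK _ _ _ _ Aa1 A1 it2 ig1) mul1r mulr1.
  apply: (ui_inj iu).
  by rewrite (KK _ _ _ _ Aa2 Aa1 ih ig2) (KK _ _ _ _ Aa3 A1 it2 ig3) mulr1 e.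
have AE a : inA a <-> A a.
  split=> [[h1 h2]|h]; last by split; [exact: AD1|exact: AD2].
  by split; [apply/cc1|apply/cc2].
exists z; split=> //; split.
- by move=> g; rewrite Y1'; split=> -[a [/AE h1 h2]]; exists a.
- by split=> [a /AE/codex//|a b /AE Aa /AE]; exact: codE.
- by split=> // a /AE[[]].
- by move=> g1 g2 g3 a1 a2 a3 /AE h1 /AE h2 /AE h3 e1' e2' e3'; rewrite (mulE _ _ _ _ _ _ h1 h2 h3 e1' e2' e3').
move=> x1 x2 y1 y2 /AE h1 /AE h2 /AE h3 /AE h4 r1 r2 r3 r4 r5.
have [f [fA fD fM fI fS]] := SH _ _ _ _ h1 h2 h3 h4 r1 r2 r3 r4 r5.
by exists f; split=> // [x|a /AE/fS//]; apply/AE.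
Qed.

Hypothesis shr : gshrink d1 w1 t1 d2 w2 t2 c.

(** [gshrink] supplies elements identifying the coefficients with [E]. If [gmul] reverses products,
    the same equations hold with [x1], [x2] and [y1], [y2] exchanged, and the coded ring is the
    opposite of [E]. *)
Theorem decode_mul : exists f : E -> G, [/\ injective f,
  forall g, gY d1 t1 d2 w2 g <-> exists x, g = f x,
  forall x y, f (x + y) = (f x * f y)%g &
  (forall x y z, gmul d1 w1 t1 d2 t2 c (f x) (f y) (f z) <-> z = x * y) \/
  (i d1 * N1 <> N1 /\ forall x y z, gmul d1 w1 t1 d2 t2 c (f x) (f y) (f z) <-> z = y * x)].
Proof.
have [z [zD [Y1' [codex codE] [AN1 NN1] mulE SH]]] := decode_core.
have A1 : inA 1 by split; exact: comm2_1.
have A0 : inA 0 by split; split; rewrite mul0r mulr0.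
have AD x y : inA x -> inA y -> inA (x + y) by move=> [a b] [a' b']; split; apply: comm2_add.
have it1 : i t1 = 1 + 1 * N1 by rewrite mul1r /N1 addrC subrK.
have it0 : i 1%g = 1 + 0 * N1 by rewrite mul0r addr0 (ui1 iu).
have [f [fA fD fM fI fS]] : exists f : E -> E,
    [/\ forall x, inA (f x), forall x y, f (x + y) = f x + f y, forall x y, f (x * y) = f x * f y,
       injective f & forall a, inA a -> exists x, f x = a].
  move: shr => [G1 [G2 [H1 [H2 [p [q [[/Y1' [x1 [Ax1 x1E]] /Y1' [x2 [Ax2 x2E]] /Y1' [y1 [Ay1 y1E]] /Y1' [y2 [Ay2 y2E]]]
    [/Y1' [a [Aa aE]] /Y1' [b [Ab bE]]] [r1 r2 r3 r4] [r5 r6] r7]]]]]]].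
  move/(mulE _ _ _ _ _ _ Ay1 Ax1 A1 y1E x1E it1): r1 => r1.
  move/(mulE _ _ _ _ _ _ Ay1 Ax2 A0 y1E x2E it0): r2 => r2.
  move/(mulE _ _ _ _ _ _ Ay2 Ax1 A0 y2E x1E it0): r3 => r3.
  move/(mulE _ _ _ _ _ _ Ay2 Ax2 A1 y2E x2E it1): r4 => r4.
  move/(mulE _ _ _ _ _ _ Ax1 Ay1 Aa x1E y1E aE): r5 => r5.
  move/(mulE _ _ _ _ _ _ Ax2 Ay2 Ab x2E y2E bE): r6 => r6.
  have ab : a + b = 1.
    apply: codE => //; first exact: AD.
    rewrite -it1 -r7 (uiM iu) aE bE; have bN := AN1 _ Ab.
    by apply: (@sub0_eq E (a * (b * N1 - N1 * b) * N1 - a * b * (N1 * N1))); [ncr|rewrite bN NN1 subrr; zs].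
  by case: z zD mulE r1 r2 r3 r4 r5 r6 => _ _ /= r1 r2 r3 r4 r5 r6; [apply: (SH x1 x2 y1 y2)|apply: (SH y1 y2 x1 x2)];
    rewrite // -?r1 -?r2 -?r3 -?r4 -?r5 -?r6.
have [F FE] := ex_choice (fun x => codex _ (fA x)).
exists F; split.
- by move=> x y e; apply: fI; apply: codE => //; rewrite -!FE e.
- move=> g; rewrite Y1'; split=> [[a [Aa ig]]|[x ->]]; last by exists (f x).
  by have [x fx] := fS _ Aa; exists x; apply: (ui_inj iu); rewrite FE fx.
- move=> x y; apply: (ui_inj iu); rewrite (uiM iu) !FE fD; have bN := AN1 _ (fA y).
  by apply: (@sub0_eq E (f x * (f y * N1 - N1 * f y) * N1 - f x * f y * (N1 * N1))); [ncr|rewrite bN NN1 subrr; zs].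
case: z mulE zD => mulE zD; [left|right; split; first by move/zD] => x y z; rewrite (mulE _ _ _ _ _ _ (fA x) (fA y) (fA z)) // -fM.
  by split=> [/fI|->].
by split=> [/fI|->].
Qed.
End DecodeMul.

(** * Existence of parameters in the unit group *)

Section StandardParameters.
Variables (G : groupType) (E : pzRingType) (i : G -> E) (k : E).
Hypotheses (iu : unit_group i) (kh : is_half k).
Hypothesis conn : forall z : E, central z -> z * z = z -> z = 0 \/ z = 1.
Hypothesis E10 : (1 : E) <> 0.

Let D_ N M : E := N * M + N * M - 1.
Let W_ N M : E := N + M.

Lemma munits_pauli N M : munits N M -> pauli (D_ N M) (W_ N M).
Proof.
move=> mu; have [NN MM e] := mu; have NMN := munits_NMN mu; rewrite /D_ /W_; split.
- apply: (@sub0_eq E ((N * M * N - N) * (M + M) + (N * M * N - N) * (M + M))); first by ncr.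
  by rewrite NMN subrr; zs.
- apply: (@sub0_eq E (N * N + M * M + (N * M + M * N - 1))); first by ncr.
  by rewrite NN MM e subrr; zs.
apply: (@sub0_eq E (((N * M * N - N) + (N * M * N - N) + N * (M * M) + N * (M * M))
   + (N * N * M + N * N * M) + (M * (N * M + M * N - 1) - M * M * N + M * (N * M + M * N - 1) - M * M * N))); first by ncr.
by rewrite NMN NN MM e !subrr; zs.
Qed.

Lemma munits_2N N M : munits N M -> N = k * (D_ N M * W_ N M + W_ N M).
Proof.
move=> mu; have [NN MM e] := mu; have NMN := munits_NMN mu; rewrite [LHS](halfE kh); congr (k * _).
rewrite /D_ /W_; apply: (@sub0_eq E (- ((N * M * N - N) + (N * M * N - N) + N * (M * M) + N * (M * M)))); first by ncr.
by rewrite NMN MM subrr; zs.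
Qed.

Lemma comm2_munits N M s : munits N M -> comm2 (D_ N M) (W_ N M) s <-> comm2 N M s.
Proof.
move=> mu; have [kc _] := kh; split=> -[h1 h2].
  have sN : s * N = N * s.
    by rewrite (munits_2N mu); apply: comm_mul; [rewrite -kc|apply: comm_add => //; apply: comm_mul].
  split=> //; have -> : M = W_ N M - N by rewrite /W_ addrAC subrr add0r.
  exact: comm_sub.
split; last by rewrite /W_; exact: comm_add.
by rewrite /D_; apply: comm_sub; [apply: comm_add; apply: comm_mul|exact: comm_1].
Qed.

Lemma std_gtransv N M d w t : munits N M -> i d = D_ N M -> i w = W_ N M -> i t = 1 + N ->
  gtransv d w t.
Proof.
move=> mu dE wE tE; have [NN MM e] := mu; have NMN := munits_NMN mu; have MNM := munits_NMN (munitsC mu).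
have [DD WW _] := munits_pauli mu; have [kc k2] := kh; have [_ _ iS] := iu.
have DND : D_ N M * N * D_ N M = - N.
  rewrite /D_; apply: (@sub0_eq E ((N * M * N - N) * (N * M + N * M - 1) + (N * M * N - N) * (N * M + N * M - 1)
     + N * N * M + N * N * M)); first by ncr.
  by rewrite NMN NN subrr; zs.
have NME : N * M = k * (1 + D_ N M) by rewrite [LHS](halfE kh) /D_ [1 + _]addrC subrK.
have NuN u : u * D_ N M = D_ N M * u -> N * u * N = 0.
  move=> uD; have h : u * (N * M) = N * M * u.
    by rewrite NME; apply: comm_mul; [rewrite -kc|apply: comm_add => //; exact: comm_1].
  apply: (@sub0_eq E (- N * u * (N * M * N - N) + N * (u * (N * M) - N * M * u) * N + N * N * M * u * N)); first by ncr.
  by rewrite NMN h NN !subrr; zs.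
split.
- apply: (ui_inj iu); rewrite !(uiM iu) (ui1 iu) dE tE.
  have -> : D_ N M * (1 + N) * D_ N M = 1 - N.
    apply: (@sub0_eq E ((D_ N M * D_ N M - 1) + (D_ N M * N * D_ N M - (- N)))); first by ncr.
    by rewrite DD DND !subrr; zs.
  by apply: (@sub0_eq E (- (N * N))); [ncr|rewrite NN; zs].
- move=> u /(ui_pair iu); rewrite dE wE => /(comm2_munits _ mu)[uN _]; apply/(ui_cm iu); rewrite tE.
  by apply/esym/comm_add => //; exact: comm_1.
- move=> u /(ui_cm iu); rewrite dE => uD; apply/(ui_cm iu); rewrite !(uiM iu) tE.
  set v := i u^-1%g; have uv : i u * v = 1 by exact: (uiVr iu).
  have vu : v * i u = 1 by exact: (uiV iu).
  have vD : v * D_ N M = D_ N M * v.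
    by rewrite -[LHS]mulr1 -uv mulrA -(mulrA v) -uD !mulrA vu mul1r.
  apply: (@sub0_eq E ((N * (i u * v - 1) - (i u * v - 1) * N) + N * i u * N * v - i u * (N * v * N))); first by ncr.
  by rewrite uv subrr (NuN _ uD) (NuN _ vD); zs.
(* This is diag(2, 1), invertible thanks to 1/2; it conjugates [1 + N] into its square. *)
- have [||h ih] := iS (1 + N * M) (1 - k * (N * M)).
  + apply: (@sub0_eq E (- k * ((N * M * N - N) * M) - (k + k - 1) * (N * M) - (N * M * k - k * (N * M)) * (N * M) *0
       - (N * M * k - k * (N * M)) * (N * M))); first by ncr.
    by rewrite NMN k2 -(kc (N * M)) !subrr; zs.
  + apply: (@sub0_eq E (- k * ((N * M * N - N) * M) - (k + k - 1) * (N * M))); first by ncr.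
    by rewrite NMN k2 !subrr; zs.
  exists h; split; first by apply/(ui_cm iu); rewrite ih dE /D_; ncr.
  apply: (ui_inj iu); rewrite !(uiM iu) ih tE.
  apply: (@sub0_eq E ((N * M * N - N) - N * N - (N * N) * N * M - (N * N * M + N * N * M))); first by ncr.
  by rewrite NMN NN subrr; zs.
have iV : i (w * t * w)^-1%g = 1 - M.
  apply: (uiVE iu); rewrite !(uiM iu) wE tE /W_.
  apply: (@sub0_eq E ((N * N + M * M + (N * M + M * N - 1)) * (1 - M) + (N * N * N + M * (N * N) + N * N * M) * (1 - M) +
     (M * N * M - M) * (1 - M) - M * M)); first by ncr.
  by rewrite NN MM e MNM !subrr; zs.
apply: (ui_inj iu); rewrite !(uiM iu) iV tE dE wE.
apply: (@sub0_eq E (N * N - (N * M + M * N - 1) - (N * M * N - N) - (N * M * N - N) - (N * M * N - N) - N * (M * M) - N * (M * M))).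
  by rewrite /D_ /W_; ncr.
by rewrite NMN NN MM e !subrr; zs.
Qed.

Variables x1 x2 y1 y2 : E.
Hypotheses (y1x1 : y1 * x1 = 1) (y1x2 : y1 * x2 = 0) (y2x1 : y2 * x1 = 0) (y2x2 : y2 * x2 = 1).
Hypothesis (xy1 : x1 * y1 + x2 * y2 = 1).

(** The diagonal embedding of [E] into its 2x2 matrices, that is, into [E] again. Iterating it
    yields pairs of matrix units commuting with all earlier ones. *)
Let sg z := x1 * z * y1 + x2 * z * y2.

Lemma sgD a b : sg (a + b) = sg a + sg b. Proof. by rewrite /sg; ncr. Qed.
Lemma sgM a b : sg (a * b) = sg a * sg b.
Proof.
rewrite /sg; apply: (@sub0_eq E (- (x1 * a * (y1 * x1 - 1) * b * y1 + x1 * a * (y1 * x2) * b * y2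
  + x2 * a * (y2 * x1) * b * y1 + x2 * a * (y2 * x2 - 1) * b * y2))); first by ncr.
by rewrite y1x1 y1x2 y2x1 y2x2 !subrr; zs.
Qed.
Lemma sg1 : sg 1 = 1. Proof. by rewrite /sg !mulr1. Qed.
Lemma sg0 : sg 0 = 0. Proof. by rewrite /sg !mulr0 !mul0r addr0. Qed.

Lemma std_munits : munits (x1 * y2) (x2 * y1).
Proof.
split.
- by rewrite mulrA -(mulrA x1) y2x1 mulr0 mul0r.
- by rewrite mulrA -(mulrA x2) y1x2 mulr0 mul0r.
by rewrite !mulrA -(mulrA x1 y2) y2x2 -(mulrA x2 y1) y1x1 !mulr1.
Qed.

Lemma sg_munits N M : munits N M -> munits (sg N) (sg M).
Proof. by move=> [NN MM e]; split; rewrite -!sgM -?sgD ?NN ?MM ?e ?sg0 ?sg1. Qed.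

Lemma sg_comm z : comm2 (x1 * y2) (x2 * y1) (sg z).
Proof.
rewrite /sg; split.
  apply: (@sub0_eq E (x1 * z * (y1 * x1 - 1) * y2 + x2 * z * (y2 * x1) * y2 - x1 * (y2 * x1) * z * y1
     - x1 * (y2 * x2 - 1) * z * y2)); first by ncr.
  by rewrite y1x1 y2x1 y2x2 !subrr; zs.
apply: (@sub0_eq E (x1 * z * (y1 * x2) * y1 + x2 * z * (y2 * x2 - 1) * y1 - x2 * (y1 * x1 - 1) * z * y1
   - x2 * (y1 * x2) * z * y2)); first by ncr.
by rewrite y1x1 y1x2 y2x2 !subrr; zs.
Qed.

Theorem std_params : exists m d1 w1 t1 d2 w2 t2 d3 w3 c : G,
  [/\ ggood0 m d1 w1 t1 d2 w2 t2 d3 w3 c, gshrink d1 w1 t1 d2 w2 t2 c & i d1 * (i t1 - 1) = i t1 - 1].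
Proof.
have [_ _ iS] := iu; have [kc k2] := kh.
pose N1 := x1 * y2; pose M1 := x2 * y1; have mu1 : munits N1 M1 := std_munits.
have mu2 := sg_munits mu1; have mu3 := sg_munits mu2.
pose N2 := sg N1; pose M2 := sg M1; rewrite -/N2 -/M2 in mu2 mu3.
pose N3 := sg N2; pose M3 := sg M2; rewrite -/N3 -/M3 in mu3.
have P1 := munits_pauli mu1; have P2 := munits_pauli mu2; have P3 := munits_pauli mu3.
pose S z := comm2 N1 M1 z /\ comm2 N2 M2 z.
have sgS z : S (sg (sg z)).
  split; first exact: sg_comm.
  by have [h1 h2] := sg_comm z; split; rewrite -!sgM ?h1 ?h2.
have c12 : comm2 N1 M1 N2 /\ comm2 N1 M1 M2 by split; exact: sg_comm.
have [[m im] [[d1 d1E] [w1 w1E]] [[d2 d2E] [w2 w2E]] [[d3 d3E] [w3 w3E]]] : [/\ exists m, i m = -1,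
   (exists d, i d = D_ N1 M1) /\ exists d, i d = W_ N1 M1, (exists d, i d = D_ N2 M2) /\ exists d, i d = W_ N2 M2 &
   (exists d, i d = D_ N3 M3) /\ exists d, i d = W_ N3 M3].
  case: P1 P2 P3 => [a1 b1 _] [a2 b2 _] [a3 b3 _].
  by split; [apply: (iS _ (-1)); rewrite mulN1r opprK|split; [exact: (iS _ _ a1 a1)|exact: (iS _ _ b1 b1)]|split; [exact: (iS _ _ a2 a2)|exact: (iS _ _ b2 b2)]|split; [exact: (iS _ _ a3 a3)|exact: (iS _ _ b3 b3)]].
have exT N M : munits N M -> exists t, i t = 1 + N.
  move=> [NN _ _]; apply: (iS _ (1 - N)).
    by apply: (@sub0_eq E (- (N * N))); [ncr|rewrite NN; zs].
  by apply: (@sub0_eq E (- (N * N))); [ncr|rewrite NN; zs].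
have [t1 t1E] := exT _ _ mu1; have [t2 t2E] := exT _ _ mu2.
have toD N M N' M' : munits N M -> comm2 N M N' -> comm2 N M M' ->
    comm2 (D_ N M) (W_ N M) (D_ N' M') /\ comm2 (D_ N M) (W_ N M) (W_ N' M').
  move=> mu [a b] [a' b']; split; apply/(comm2_munits _ mu); split; apply/esym.
  - by rewrite /D_; apply: comm_sub; [apply: comm_add; apply: comm_mul|exact: comm_1].
  - by rewrite /D_; apply: comm_sub; [apply: comm_add; apply: comm_mul|exact: comm_1].
  - by rewrite /W_; exact: comm_add.
  - by rewrite /W_; exact: comm_add.
have [e12 e1w2] := toD _ _ _ _ mu1 c12.1 c12.2.
have [e13 e1w3] := toD _ _ _ _ mu1 (sgS N1).1 (sgS M1).1.
have [e23 e2w3] := toD _ _ _ _ mu2 (sgS N1).2 (sgS M1).2.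
have [DD1 WW1 DW1] := P1; have [DD2 WW2 DW2] := P2; have [DD3 WW3 DW3] := P3.
(* On the joint eigenspaces of the two commuting involutions this is 1, except for -1 where both
   take the value -1: the controlled-Z gate. *)
pose C := k * (1 + D_ N1 M1 + D_ N2 M2 - D_ N1 M1 * D_ N2 M2).
have [D21 W1D2] := e12; have [D1W2 W21] := e1w2.
have kC x : x * C = k * (x * (1 + D_ N1 M1 + D_ N2 M2 - D_ N1 M1 * D_ N2 M2)) by rewrite /C mulrA -kc mulrA.
set D1 := D_ N1 M1 in d1E P1 DD1 DW1 C D21 W1D2 D1W2 kC e12 e13 e1w2 e1w3; set W1 := W_ N1 M1 in w1E P1 WW1 DW1 W1D2 W21 e12 e13 e1w2 e1w3.
set D2 := D_ N2 M2 in d2E P2 DD2 DW2 C D21 W1D2 kC e12 e23 e2w3; set W2 := W_ N2 M2 in w2E P2 WW2 DW2 D1W2 W21 e1w2 e23 e2w3.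
set c4 := 1 + D1 + D2 - D1 * D2 in C kC.
have CC : C * C = 1.
  rewrite kC /C -mulrA.
  have k11 : k * (1 + 1) = 1 by rewrite mulrDr !mulr1.
  have -> : c4 * c4 = (1 + 1) * (1 + 1).
    rewrite /c4; apply: (@sub0_eq E ((D1 * D1 - 1) - (D1 * D1 - 1) * D2 - (D1 * D1 - 1) * D2
      + (1 - D1) * (D2 * D1 - D1 * D2) + (D1 * D1 - 1) + (1 + 1 - D1 - D1 + (D1 * D1 - 1)) * (D2 * D2 - 1)
      - (1 - D1) * (D2 * D1 - D1 * D2) * D2)); first by ncr.
    by rewrite DD1 DD2 D21 !subrr; zs.
  by rewrite (mulrA k (1 + 1)) k11 mul1r k11.
have CW1 : C * W1 = W1 * D2 * C.
  rewrite kC /C -!mulrA; congr (k * _); rewrite /c4.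
  apply: (@sub0_eq E ((D1 * W1 + W1 * D1) + (D2 * W1 - W1 * D2) - D1 * (D2 * W1 - W1 * D2) - (D1 * W1 + W1 * D1) * D2
     - W1 * (D2 * D1 - D1 * D2) - W1 * (D2 * D2 - 1) + W1 * D1 * (D2 * D2 - 1) + W1 * (D2 * D1 - D1 * D2) * D2)); first by ncr.
  by rewrite (eqN_add0 DW1) DD2 D21 W1D2 !subrr; zs.
have CW2 : C * W2 = W2 * D1 * C.
  rewrite kC /C -!mulrA; congr (k * _); rewrite /c4.
  apply: (@sub0_eq E ((D1 * W2 - W2 * D1) + (D2 * W2 + W2 * D2) - D1 * (D2 * W2 + W2 * D2) + (D1 * W2 - W2 * D1) * D2
     - W2 * (D1 * D1 - 1) + W2 * (D1 * D1 - 1) * D2)); first by ncr.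
  by rewrite (eqN_add0 DW2) DD1 D1W2 !subrr; zs.
have cC x : x * D1 = D1 * x -> x * D2 = D2 * x -> x * C = C * x.
  move=> h1 h2; apply: comm_mul; first by rewrite -kc.
  by apply: comm_sub; [apply: comm_add => //; apply: comm_add => //; exact: comm_1|exact: comm_mul].
have [c cE] := iS _ _ CC CC.
have CN N M D W D' : munits N M -> D = D_ N M -> W = W_ N M -> C * D = D * C -> C * W = W * D' * C -> C * N * C = N * D'.
  move=> mu DE WE CD CW; rewrite (munits_2N mu) -DE -WE.
  apply: (@sub0_eq E ((C * k - k * C) * (D * W + W) * C + k * ((C * D - D * C) * W * C + D * (C * W - W * D' * C) * C
    + D * W * D' * (C * C - 1) + (C * W - W * D' * C) * C + W * D' * (C * C - 1)))); first by ncr.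
  by rewrite -(kc C) CD CW CC !subrr; zs.
have CD1 : C * D1 = D1 * C by apply/esym/cC.
have CD2 : C * D2 = D2 * C by apply/esym/cC.
have CN1 : C * N1 * C = N1 * D2 by apply: (CN N1 M1 D1 W1).
have CN2 : C * N2 * C = N2 * D1 by apply: (CN N2 M2 D2 W2).
have N21 : N2 * N1 = N1 * N2 by case: c12 => -[].
have K1 : gK c t2 t1 <> 1%g.
  rewrite /gK; set be := (t2 * _)%g; set al := (t1 * _)%g => e.
  have gen b a : (b * a * b^-1 * a^-1 = 1)%g -> i b * i a = i a * i b.
    move=> /(congr1 i); rewrite !(uiM iu) (ui1 iu) => {}e.
    apply: (@sub0_eq E ((i b * i a * i b^-1%g * i a^-1%g - 1) * i a * i b
      - i b * i a * (i b^-1%g * (i a^-1%g * i a - 1) * i b + (i b^-1%g * i b - 1)))); first by ncr.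
    by rewrite e !(uiV iu) !subrr; zs.
  move/gen: e => e.
  have [NN1 MM1 e1] := mu1; have [NN2 MM2 e2] := mu2; have NMN1 := munits_NMN mu1; have NMN2 := munits_NMN mu2.
  have DN N M : munits N M -> D_ N M * N = N /\ N * D_ N M = - N.
    move=> mu; have [NN _ _] := mu; have NMN := munits_NMN mu; rewrite /D_; split.
      by apply: (@sub0_eq E ((N * M * N - N) + (N * M * N - N))); [ncr|rewrite NMN subrr; zs].
    by apply: (@sub0_eq E (N * N * M + N * N * M)); [ncr|rewrite NN; zs].
  have [DN1 ND1] := DN _ _ mu1; have [DN2 ND2] := DN _ _ mu2; rewrite -/D1 -/D2 in DN1 ND1 DN2 ND2.
  have N1D2 : N1 * D2 = D2 * N1 by have [] := (comm2_munits _ mu1).1 e12.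
  have N2D1 : N2 * D1 = D1 * N2.
    by case: c12 => -[h1 h2] [h3 h4]; rewrite /D1 /D_; apply: comm_sub; [apply: comm_add; apply: comm_mul|exact: comm_1].
  have beE : i be = 1 + N2 * (1 + D1).
    rewrite /be !(uiM iu) cE t2E.
    apply: (@sub0_eq E ((1 + N2) * (C * C - 1) + (1 + N2) * (C * N2 * C - N2 * D1) + N2 * N2 * D1)); first by ncr.
    by rewrite CC CN2 NN2 !subrr; zs.
  have alE : i al = 1 + N1 * (1 - D2).
    have h : i (c * t1 * c)^-1%g = 1 - N1 * D2.
      apply: (uiVE iu); rewrite !(uiM iu) cE t1E.
      apply: (@sub0_eq E ((C * C - 1) * (1 - N1 * D2) + (C * N1 * C - N1 * D2) * (1 - N1 * D2) + N1 * (N1 * D2 - D2 * N1) * D2 - N1 * N1 * D2 * D2)); first by ncr.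
      by rewrite CC CN1 N1D2 NN1 !subrr; zs.
    rewrite /al (uiM iu) h t1E; apply: (@sub0_eq E (- (N1 * N1) * D2)); first by ncr.
    by rewrite NN1; zs.
  have h : four (N1 * N2) = 0.
    move: e; rewrite beE alE => /eq_sub0 e.
    apply: (@sub0_eq E (((1 + N2 * (1 + D1)) * (1 + N1 * (1 - D2)) - (1 + N1 * (1 - D2)) * (1 + N2 * (1 + D1)))
      - N2 * (D1 * N1 - N1) * (1 - D2) - ((N2 * N1 - N1 * N2) + (N2 * N1 - N1 * N2)) * (1 - D2)
      + N1 * (N2 * D2 + N2) + N1 * (N2 * D2 + N2) - N1 * (D2 * N2 - N2) * (1 + D1))); first by rewrite /four; ncr.
    by rewrite e DN1 N21 (eqN_add0 ND2) DN2 !subrr; zs.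
  have {}h : N1 * N2 = 0 by apply: (dbl0 kh); apply: (dbl0 kh).
  have N1M2 : N1 * M2 = M2 * N1 by case: c12 => _ [].
  have N10 := munits_inj mu2 N1M2 h.
  by apply: E10; rewrite -e1 N10 mul0r mulr0 addr0.
have cmE (a b : G) A B : i a = A -> i b = B -> A * B = B * A -> gcm a b.
  by move=> <- <- h; apply/(ui_cm iu).
have prE (a b g : G) A B g' : i a = A -> i b = B -> i g = g' -> comm2 A B g' -> gpair a b g.
  by move=> <- <- <- h; apply/(ui_pair iu).
have paE (a b : G) A B : i a = A -> i b = B -> pauli A B -> gpauli m a b.
  move=> aE bE [AA BB AB]; split; apply: (ui_inj iu); rewrite !(uiM iu) ?(ui1 iu) ?im ?aE ?bE //.
  by rewrite AB mulN1r mulNr.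
have good : ggood0 m d1 w1 t1 d2 w2 t2 d3 w3 c.
  split.
  - split=> [g|h]; first by apply/(ui_cm iu); rewrite im mulN1r mulrN1.
    by apply: E10; apply: (dbl0 kh); rewrite -[X in X + _]opprK -im h (ui1 iu) addNr.
  - by apply: (ui_inj iu); rewrite (uiM iu) im (ui1 iu) mulN1r opprK.
  - by split; [apply: (paE d1 w1 D1 W1)|apply: (paE d2 w2 D2 W2)|apply: (paE d3 w3 _ _ d3E w3E)].
  - split; [exact: (prE _ _ _ _ _ _ d1E w1E d2E)|exact: (prE _ _ _ _ _ _ d1E w1E w2E)|
      exact: (prE _ _ _ _ _ _ d1E w1E d3E)|exact: (prE _ _ _ _ _ _ d1E w1E w3E)|split].
      exact: (prE _ _ _ _ _ _ d2E w2E d3E).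
    exact: (prE _ _ _ _ _ _ d2E w2E w3E).
  split=> //; [exact: (std_gtransv mu1)|exact: (std_gtransv mu2)|].
  split.
  - by apply: (ui_inj iu); rewrite (uiM iu) cE CC (ui1 iu).
  - by split; [exact: (cmE _ _ _ _ cE d1E)|exact: (cmE _ _ _ _ cE d2E)].
  - by apply: (ui_inj iu); rewrite !(uiM iu) cE w1E d2E CW1.
  - by apply: (ui_inj iu); rewrite !(uiM iu) cE w2E d1E CW2.
  move=> u /(ui_pair iu); rewrite d1E w1E => -[h1 _] /(ui_pair iu); rewrite d2E w2E => -[h2 _].
  by apply/(ui_cm iu); rewrite cE; apply/esym/cC.
have N1E : i t1 - 1 = N1 by rewrite t1E addrC addrA addNr add0r.
exists m, d1, w1, t1, d2, w2, t2, d3, w3, c; split=> //; last first.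
  rewrite N1E d1E /D1 /D_; have [NN _ _] := mu1; have NMN := munits_NMN mu1.
  by apply: (@sub0_eq E ((N1 * M1 * N1 - N1) + (N1 * M1 * N1 - N1))); [ncr|rewrite NMN subrr; zs].
have [z [_ [Y' [codex _] _ mulE _]]] := decode_core iu kh P1 conn E10 good.
have inS a : S a -> inA i d1 w1 d2 w2 a.
  by move=> [h1 h2]; split; [rewrite d1E w1E|rewrite d2E w2E]; apply/comm2_munits.
have A1 : inA i d1 w1 d2 w2 1 by apply: inS; split; exact: comm2_1.
have A0 : inA i d1 w1 d2 w2 0 by apply: inS; split; split; rewrite mul0r mulr0.
have it1 : i t1 = 1 + 1 * (i t1 - 1) by rewrite mul1r addrC subrK.
have it0 : i 1%g = 1 + 0 * (i t1 - 1) by rewrite mul0r addr0 (ui1 iu).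
have ss a b : sg (sg a) * sg (sg b) = sg (sg (a * b)) by rewrite !sgM.
have main :
   (forall g1 g2 g3 u v w, i g1 = 1 + sg (sg u) * (i t1 - 1) ->
      i g2 = 1 + sg (sg v) * (i t1 - 1) -> i g3 = 1 + sg (sg w) * (i t1 - 1) ->
      w = u * v -> gmul d1 w1 t1 d2 t2 c g1 g2 g3) \/
   (forall g1 g2 g3 u v w, i g1 = 1 + sg (sg u) * (i t1 - 1) ->
      i g2 = 1 + sg (sg v) * (i t1 - 1) -> i g3 = 1 + sg (sg w) * (i t1 - 1) ->
      w = v * u -> gmul d1 w1 t1 d2 t2 c g1 g2 g3).
  case: z mulE => mulE; [left|right] => g1 g2 g3 u v w h1 h2 h3 e;
  by apply/(mulE _ _ _ _ _ _ (inS _ (sgS u)) (inS _ (sgS v)) (inS _ (sgS w))); rewrite // e !sgM.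
have it1' : i t1 = 1 + sg (sg 1) * (i t1 - 1) by rewrite !sg1.
have it0' : i 1%g = 1 + sg (sg 0) * (i t1 - 1) by rewrite !sg0.
have code u : exists g, gY d1 t1 d2 w2 g /\ i g = 1 + sg (sg u) * (i t1 - 1).
  have uA := inS _ (sgS u); have [g ig] := codex _ uA; exists g; split=> //.
  by apply/Y'; exists (sg (sg u)).
have [X1 [YX1 X1E]] := code x1; have [X2 [YX2 X2E]] := code x2.
have [Z1 [YZ1 Z1E]] := code y1; have [Z2 [YZ2 Z2E]] := code y2.
have [p1 [Yp1 p1E]] := code (x1 * y1); have [p2 [Yp2 p2E]] := code (x2 * y2).
have p12 : (p1 * p2)%g = t1.
  apply: (ui_inj iu); rewrite (uiM iu) p1E p2E N1E t1E; have [NN1 _ _] := mu1.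
  have [[sN _] _] := sgS (x2 * y2); have h : sg (sg (x1 * y1)) + sg (sg (x2 * y2)) = 1.
    by rewrite -(sgD (sg (x1 * y1)) (sg (x2 * y2))) -(sgD (x1 * y1) (x2 * y2)) xy1 !sg1.
  apply: (@sub0_eq E ((sg (sg (x1 * y1)) + sg (sg (x2 * y2)) - 1) * N1 - sg (sg (x1 * y1)) * (sg (sg (x2 * y2)) * N1 - N1 * sg (sg (x2 * y2))) * N1
     + sg (sg (x1 * y1)) * sg (sg (x2 * y2)) * (N1 * N1))); first by ncr.
  by rewrite h sN NN1 !subrr; zs.
(* When products are read in reverse, the roles of [x1], [x2] and [y1], [y2] are exchanged to
   satisfy the same formula. *)
case: main => M.
  exists X1, X2, Z1, Z2, p1, p2; split=> //.
    by split; [apply: (M _ _ _ _ _ _ Z1E X1E it1')|apply: (M _ _ _ _ _ _ Z1E X2E it0')|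
      apply: (M _ _ _ _ _ _ Z2E X1E it0')|apply: (M _ _ _ _ _ _ Z2E X2E it1')].
  by split; [apply: (M _ _ _ _ _ _ X1E Z1E p1E)|apply: (M _ _ _ _ _ _ X2E Z2E p2E)].
exists Z1, Z2, X1, X2, p1, p2; split=> //.
  by split; [apply: (M _ _ _ _ _ _ X1E Z1E it1')|apply: (M _ _ _ _ _ _ X1E Z2E it0')|
    apply: (M _ _ _ _ _ _ X2E Z1E it0')|apply: (M _ _ _ _ _ _ X2E Z2E it1')].
by split; [apply: (M _ _ _ _ _ _ Z1E X1E p1E)|apply: (M _ _ _ _ _ _ Z2E X2E p2E)].
Qed.
End StandardParameters.
(** * Endomorphism rings of free modules *)

Section Endo.
Variables (R : nzRingType) (V : lmodType R).

Definition endo : Type := {linear V -> V}.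
HB.instance Definition _ := gen_eqMixin endo.
HB.instance Definition _ := gen_choiceMixin endo.

Definition mk_endo (f : V -> V) (fl : linear f) : endo :=
  HB.pack f (GRing.isLinear.Build R V V *:%R f fl).

Definition app (f : endo) : V -> V := f.

Lemma app_lin (f : endo) : linear (app f). Proof. by move=> a x y; rewrite /app linearP. Qed.
Lemma app_mk (f : V -> V) (fl : linear f) : app (mk_endo fl) = f. Proof. by []. Qed.

Lemma endo_ext (f g : endo) : (forall x, app f x = app g x) -> f = g.
Proof.
case: f g => f fc [g gc] fg; have {fg} e : f = g by apply/funext.
subst g; congr GRing.Linear.Pack; case: fc gc => [[a] [b]] [[c] [d]].
by rewrite (Prop_irrelevance a c) (Prop_irrelevance b d).
Qed.

Lemma endo_zero_lin : linear (fun _ : V => 0 : V).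
Proof. by move=> a x y; rewrite scaler0 addr0. Qed.
Lemma endo_opp_lin (f : endo) : linear (fun x : V => - app f x).
Proof. by move=> a x y; rewrite app_lin opprD scalerN. Qed.
Lemma endo_add_lin (f g : endo) : linear (fun x : V => app f x + app g x).
Proof. by move=> a x y; rewrite !app_lin scalerDr !addrA; congr (_ + _); rewrite -!addrA; congr (_ + _); exact: addrC. Qed.
Lemma endo_one_lin : linear (fun x : V => x). Proof. by []. Qed.
Lemma endo_mul_lin (f g : endo) : linear (fun x : V => app f (app g x)).
Proof. by move=> a x y; rewrite !app_lin. Qed.

Let zero := mk_endo endo_zero_lin.
Let opp f := mk_endo (endo_opp_lin f).
Let add f g := mk_endo (endo_add_lin f g).
Let one := mk_endo endo_one_lin.
Let mul f g := mk_endo (endo_mul_lin f g).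

Lemma endo_addA : associative add. Proof. by move=> f g h; apply: endo_ext => x; exact: addrA. Qed.
Lemma endo_addC : commutative add. Proof. by move=> f g; apply: endo_ext => x; exact: addrC. Qed.
Lemma endo_add0 : left_id zero add. Proof. by move=> f; apply: endo_ext => x; exact: add0r. Qed.
Lemma endo_addN : left_inverse zero opp add. Proof. by move=> f; apply: endo_ext => x; exact: addNr. Qed.
HB.instance Definition _ := GRing.isZmodule.Build endo endo_addA endo_addC endo_add0 endo_addN.

Lemma endo_mulA : associative mul. Proof. by move=> f g h; apply: endo_ext. Qed.
Lemma endo_mul1 : left_id one mul. Proof. by move=> f; apply: endo_ext. Qed.
Lemma endo_mulr1 : right_id one mul. Proof. by move=> f; apply: endo_ext. Qed.
Lemma endo_mulDl : left_distributive mul add. Proof. by move=> f g h; apply: endo_ext. Qed.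
Lemma endo_mulDr : right_distributive mul add.
Proof. by move=> f g h; apply: endo_ext => x; exact: (linD _ _ (app_lin f)). Qed.
HB.instance Definition _ := GRing.Zmodule_isPzRing.Build endo
  endo_mulA endo_mul1 endo_mulr1 endo_mulDl endo_mulDr.

Lemma appD (f g : endo) x : app (f + g) x = app f x + app g x. Proof. by []. Qed.
Lemma appM (f g : endo) x : app (f * g) x = app f (app g x). Proof. by []. Qed.
Lemma app1 x : app (1 : endo) x = x. Proof. by []. Qed.
Lemma app0 x : app (0 : endo) x = 0. Proof. by []. Qed.
Lemma appN (f : endo) x : app (- f) x = - app f x. Proof. by []. Qed.

Lemma aut_unit_group : unit_group (fun g : Aut V => aut_val g : endo).
Proof.
split.
- move=> g h e; apply: module_aut_ext => x.
  by have := congr1 (fun f : endo => app f x) e.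
- by move=> g h; apply: endo_ext.
move=> u v uv vu; have ub : bijective (u : {linear V -> V}).
  exists (app v) => x.
    by have := congr1 (fun f : endo => app f x) vu.
  by have := congr1 (fun f : endo => app f x) uv.
by exists (ModuleAut ub).
Qed.
End Endo.
Arguments app {R V} f _ : simpl never.
Arguments mk_endo {R V f} fl : simpl never.

Section EndoFree.
Variables (R : nzRingType) (V : lmodType R) (X : eqType) (b : X -> V).
Hypothesis bB : is_basis b.
Notation E := (endo V).

Definition lifte (g : X -> V) : E := mk_endo (lift_linear bB g).
Lemma lifteE g x : app (lifte g) (b x) = g x. Proof. exact: lift_b. Qed.

Lemma endo_extb (f g : E) : (forall x, app f (b x) = app g (b x)) -> f = g.
Proof.
by move=> h; apply: endo_ext => v; rewrite (linear_ext bB (app_lin f) (app_lin g) h).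
Qed.

Lemma basis_neq0 x : b x <> 0.
Proof.
move=> h; have := coord_b bB x x; rewrite h coord0 eqxx => /esym/eqP.
by rewrite oner_eq0.
Qed.

Lemma endo_one_neq0 (x : X) : (1 : E) <> 0.
Proof. by move=> /(congr1 (fun f : E => app f (b x))); exact: basis_neq0. Qed.

Definition delta (x : X) (v : V) : E := lifte (fun y => if y == x then v else 0).

Lemma app_delta x v w : app (delta x v) w = coord bB w x *: v.
Proof.
have [s [us sup ->]] := linear_coord bB w (app_lin (delta x v)).
have [xs|xs] := boolP (x \in s).
  rewrite (bigD1_seq x) //=; rewrite /delta lifteE eqxx big1 ?addr0 // => y yx.
  by rewrite lifteE (negbTE yx) scaler0.
have -> : coord bB w x = 0 by apply: contrapT => /sup; rewrite (negbTE xs).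
rewrite scale0r big_seq big1 // => y ys; rewrite lifteE.
by case: eqP ys => [->|]; rewrite ?(negbTE xs) ?scaler0.
Qed.

Lemma central_scalar (z : E) (x0 : X) : central z ->
  exists r, (forall a, r * a = a * r) /\ forall v, app z v = r *: v.
Proof.
move=> zc; pose r := coord bB (app z (b x0)) x0.
have zb x v : app z v = coord bB (app z (b x)) x *: v.
  have := congr1 (fun f : E => app f (b x)) (zc (delta x v)).
  by rewrite /= !appM !app_delta coord_b eqxx scale1r.
exists r; split=> [a|v]; last exact: zb.
have := zb x0 (a *: b x0); rewrite (linZ _ _ (app_lin z)) -/r (zb x0) -/r !scalerA.
by move=> /(congr1 (fun v => coord bB v x0)); rewrite !coordZ coord_b eqxx !mulr1.
Qed.

Lemma scalar_lin (r : R) : (forall a, r * a = a * r) -> linear (fun v : V => r *: v).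
Proof. by move=> rc a x y; rewrite scalerDr !scalerA rc. Qed.

Lemma scalar_central (r : R) (rc : forall a, r * a = a * r) : central (mk_endo (scalar_lin rc) : E).
Proof. by move=> f; apply: endo_ext => v; rewrite !appM !app_mk (linZ _ _ (app_lin f)). Qed.

Lemma endo_conn (x0 : X) : (forall r : R, r * r = r -> r = 0 \/ r = 1) ->
  forall z : E, central z -> z * z = z -> z = 0 \/ z = 1.
Proof.
move=> nR z /(central_scalar x0)[r [_ zr]] zz.
have : r * r = r.
  have := congr1 (fun f : E => coord bB (app f (b x0)) x0) zz.
  by rewrite /= appM !zr scalerA !coordZ coord_b eqxx !mulr1.
case/nR => r0; [left|right]; apply: endo_ext => v; rewrite zr r0 ?scale0r ?scale1r //.
Qed.

Lemma endo_half : invertible (2%:R : R) -> exists k : E, is_half k.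
Proof.
move=> [h [h2 _]]; have hc a : h * a = a * h.
  have two (c : R) : 2%:R * c = c * 2%:R by rewrite mulr_natl mulr_natr.
  have h2' : 2%:R * h = 1 by rewrite two.
  by rewrite -[h * a]mulr1 -h2' mulrA -(mulrA h) -two mulrA h2 mul1r.
exists (mk_endo (scalar_lin hc)); split; first exact: scalar_central.
apply: endo_ext => v; rewrite appD !app_mk -scalerDl.
have -> : h + h = 1 by rewrite -mulr2n -mulr_natr.
by rewrite scale1r.
Qed.

Lemma emb_bij (A B : Type) : emb A B -> emb B A -> exists f : A -> B, bijective f.
Proof.
move=> /emb_card AB /emb_card BA.
have : [set: A] #= [set: B] by rewrite card_eq_le AB BA.
move=> /card_bijP[f [g fK gK]]; exists (fun x => sval (f (to_setT x))).
have s (z : [set: A]) : to_setT (sval z) = z by apply: val_inj.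
have s' (z : [set: B]) : to_setT (sval z) = z by apply: val_inj.
by exists (fun y => sval (g (to_setT y))) => x; rewrite ?s ?s' ?fK ?gK.
Qed.

(** A bijection of [bool * X] with [X] splits the basis into two copies of itself, hence V into two
    copies of V. *)
Lemma endo_split : emb nat X -> exists x1 x2 y1 y2 : E,
  [/\ y1 * x1 = 1, y1 * x2 = 0, y2 * x1 = 0, y2 * x2 = 1 & x1 * y1 + x2 * y2 = 1].
Proof.
move=> nX; have [g [h gK hK]] : exists (f : (bool * X) -> X) , bijective f.
  apply: emb_bij; last by exists (fun x => (true, x)) => x y [].
  by have [_ /emb_trans] := emb_bool_square nX; apply; exact: emb_square.
pose x_ c := lifte (fun x => b (g (c, x))).
pose y_ c := lifte (fun x => if (h x).1 == c then b (h x).2 else 0).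
have yx c d : y_ c * x_ d = if d == c then 1 else 0.
  apply: endo_extb => x; rewrite appM !lifteE gK /=.
  by case: eqP.
exists (x_ true), (x_ false), (y_ true), (y_ false); split; rewrite ?yx //.
apply: endo_extb => x; rewrite appD !appM !lifteE app1.
rewrite -{5}(hK x); case: (h x) => -[] y /=; rewrite (lin_zero (app_lin _)) ?addr0 ?add0r lifteE //.
Qed.
End EndoFree.
(** * Coefficient rings *)

(** All idempotents, not only central ones. It holds in local rings and in domains, and in
    commutative rings the two notions agree. It leaves 0 and 1 as diagonal entries of idempotents in
    [std_EE]. *)
Definition noidem (R : nzRingType) : Prop := forall r : R, r * r = r -> r = 0 \/ r = 1.

(** Bounds the number of orthogonal idempotents of rank one whose images live on finitely many basis
    vectors: their vectors and functionals factor an identity matrix through that finite set. *)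
Definition rank_prop (R : nzRingType) : Prop :=
  forall (I L : finType) (A : I -> L -> R) (B : L -> I -> R),
  (forall i j, \sum_l A i l * B l j = (i == j)%:R) -> (#|I| <= #|L|)%N.

(** [f] maps the image of [e] onto [R a], a free module of rank one; so the image of a nonzero
    idempotent has a free summand of rank one. *)
Definition cyc_prop (R : nzRingType) : Prop :=
  forall (V : lmodType R) (X : eqType) (b : X -> V), is_basis b ->
  forall e : endo V, e * e = e -> e <> 0 ->
  exists (f : V -> R^o) (a : R), [/\ linear f, forall v, exists r, f (app e v) = r * a,
    exists v0, f (app e v0) = a & forall r : R, r * a = 0 -> r = 0].

Section LocalRings.
Variable R : nzRingType.
Hypothesis loc : local_ring R.

Let J (x : R) : Prop := ~ invertible x.

Lemma loc_J : [/\ J 0, forall x y, J x -> J y -> J (x + y) & forall a x, J x -> J (a * x)].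
Proof. exact: (left_idealE _).1 loc. Qed.

Lemma inv1 : invertible (1 : R). Proof. by exists 1; rewrite mulr1. Qed.

Lemma loc_1J x : J x -> invertible (1 - x).
Proof.
have [_ JD _] := loc_J; move=> Jx; apply: contrapT => J1.
by case: (JD _ _ J1 Jx); rewrite subrK; exact: inv1.
Qed.

Lemma loc_noidem : noidem R.
Proof.
move=> r rr; have [[s [sr _]]|Jr] := pselect (invertible r).
  by right; rewrite -[r]mul1r -sr -mulrA rr sr.
left; have [s [s1 _]] := loc_1J Jr.
by rewrite -[r]mul1r -s1 -mulrA mulrBl mul1r rr subrr mulr0.
Qed.

(** If [d] inverts [a * c], then [c * d * a] is idempotent, hence 0 or 1; either value is absurd for
    a noninvertible [a]. *)
Lemma loc_Jr a c : J a -> J (a * c).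
Proof.
move=> Ja [d [_ d2]]; have h : a * (c * d) = 1 by rewrite mulrA.
have idem : c * d * a * (c * d * a) = c * d * a by rewrite -(mulrA _ a) (mulrA a) h mul1r.
have [h0|h1] := loc_noidem idem; last by apply: Ja; exists (c * d).
have : a * (c * d) * (a * (c * d)) = 0 by rewrite mulrA -(mulrA a) h0 mulr0 mul0r.
by rewrite h mulr1 => /eqP; rewrite oner_eq0.
Qed.

Lemma loc_Jsum (I : Type) (r : seq I) (P : pred I) (F : I -> R) :
  (forall i, P i -> J (F i)) -> J (\sum_(i <- r | P i) F i).
Proof. by have [J0 JD _] := loc_J => h; apply: big_ind. Qed.

(** Gaussian elimination: noninvertible elements form a two-sided ideal, so a row of [A] whose
    product with a column of [B] is 1 has an invertible entry, and pivoting on it removes one row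
    and one column. *)
Lemma loc_rank_sets (I L : finType) (n : nat) : forall (S : {set I}) (T : {set L}) (A : I -> L -> R) (B : L -> I -> R),
  (#|T| <= n)%N -> (forall i j, i \in S -> j \in S -> \sum_(l in T) A i l * B l j = (i == j)%:R) ->
  (#|S| <= #|T|)%N.
Proof.
have find (S : {set I}) (T : {set L}) (A : I -> L -> R) (B : L -> I -> R) p :
    (forall i j, i \in S -> j \in S -> \sum_(l in T) A i l * B l j = (i == j)%:R) -> p \in S ->
    exists2 q, q \in T & invertible (A p q).
  move=> AB pS; apply: contrapT => h; have Jl : J (\sum_(l in T) A p l * B l p).
    by apply: loc_Jsum => l lT; apply: loc_Jr => Al; apply: h; exists l.
  by apply: Jl; rewrite AB // eqxx; exact: inv1.
elim: n => [|n IH] S T A B Tn AB.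
  have [->|/finset.set0Pn[p pS]] := eqVneq S finset.set0; first by rewrite cards0.
  have [q qT _] := find _ _ _ _ p AB pS.
  by move: Tn; rewrite leqn0 cards_eq0 => /eqP T0; rewrite T0 inE in qT.
have [->|/finset.set0Pn[p pS]] := eqVneq S finset.set0; first by rewrite cards0.
have [q qT Aq] := find _ _ _ _ p AB pS.
have [u [u1 u2]] := Aq.
rewrite (cardsD1 p) pS (cardsD1 q T) qT leq_add2l.
apply: (IH _ _ (fun i l => A i l - A i q * u * A p l) B).
  by move: Tn; rewrite (cardsD1 q T) qT.
have D1 i j : i \in S -> j \in S -> \sum_(l in T :\ q) A i l * B l j = (i == j)%:R - A i q * B q j.
  by move=> iS jS; rewrite -(AB i j iS jS) (big_setD1 q qT) /= [X in _ = X - _]addrC addrK.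
move=> i j; rewrite !inE => /andP[ip iS] /andP[jp jS].
under eq_bigr => l _ do rewrite mulrBl -(mulrA (A i q * u)).
rewrite sumrB -mulr_sumr !D1 // [p == j]eq_sym (negbTE jp) sub0r.
by rewrite mulrN opprK -mulrA (mulrA u) u1 mul1r subrK.
Qed.

Lemma loc_rank : rank_prop R.
Proof.
move=> I L A B AB; rewrite -!cardsT; apply: (loc_rank_sets (leqnn _) (A := A) (B := B)) => i j _ _.
by rewrite -AB; apply: eq_bigl => l; rewrite inE.
Qed.

(* Nakayama's lemma for a vector c with c = c M, M having entries in J. *)
Lemma loc_nak (X : eqType) (s : seq X) : forall (c : X -> R) (M : X -> X -> R), (forall x y, J (M x y)) ->
  (forall y, y \in s -> c y = \sum_(x <- s) c x * M x y) -> forall y, y \in s -> c y = 0.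
Proof.
have [_ JD JM] := loc_J.
elim: s => // z s IH c M MJ h.
have [u [u1 u2]] := loc_1J (MJ z z).
have cz : c z = \sum_(x <- s) c x * (M x z * u).
  have := h z; rewrite inE eqxx big_cons => /(_ isT) hz.
  rewrite -[c z]mulr1 -u2 mulrA mulrBr mulr1 {1}hz addrC addKr mulr_suml.
  by apply: eq_bigr => x _; rewrite mulrA.
have IHs : forall y, y \in s -> c y = 0.
  apply: (IH c (fun x y => M x z * u * M z y + M x y)) => [x y|y ys].
    by apply: JD => //; apply: JM.
  rewrite h ?inE ?ys ?orbT // big_cons cz mulr_suml -big_split /=.
  by apply: eq_bigr => x _; rewrite mulrDr !mulrA.
move=> y; rewrite inE => /orP[/eqP->|]; last exact: IHs.
by rewrite cz big_seq big1 // => x xs; rewrite IHs ?mul0r.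
Qed.

(** Some vector in the image has an invertible coordinate, so [a = 1] will do: otherwise each vector
    fixed by [e] would vanish by [loc_nak]. *)
Lemma loc_cyc : cyc_prop R.
Proof.
move=> V X b bB e ee e0.
have [v [x [u [uv _]]]] : exists v x, invertible (coord bB (app e v) x).
  apply: contrapT => h; apply: e0; apply: endo_ext => w; rewrite app0.
  have ME x y : J (coord bB (app e (b x)) y) by move=> i; apply: h; exists (b x), y.
  set v := app e w; have ev : app e v = v by rewrite /v -appM ee.
  have [s [us vE sup]] := basis_expand bB v.
  have c0 : forall y, y \in s -> coord bB v y = 0.
    apply: (loc_nak ME) => y ys.
    by rewrite -[in LHS]ev {1}vE (lin_sum (app_lin e)) coord_sum.
  by rewrite vE big_seq big1 // => y ys; rewrite c0 ?scale0r.
exists (fun w => coord bB w x), 1; split.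
- by move=> a w w'; rewrite coordP.
- by move=> w; exists (coord bB (app e w) x); rewrite mulr1.
- by exists (u *: v); rewrite (linZ _ _ (app_lin e)) coordZ.
- by move=> r; rewrite mulr1.
Qed.
End LocalRings.

Lemma skewfield_local (R : nzRingType) : skewfield R -> local_ring R.
Proof.
move=> sk; apply/left_idealE; have n0 (x : R) : ~ invertible x -> x = 0.
  by move=> nx; apply: contrapT => /sk.
have i0 : ~ invertible (0 : R).
  by move=> [y [y0 _]]; move/eqP: y0; rewrite mulr0 eq_sym oner_eq0.
by split=> [//|x y /n0-> /n0->|a x /n0->]; rewrite ?addr0 ?mulr0.
Qed.

Section PrincipalDomains.
Variable R : nzRingType.
Hypothesis pd : principal_domain R.

Lemma pd_mul0 (x y : R) : x * y = 0 -> x = 0 \/ y = 0. Proof. by case: pd => h _; exact: h. Qed.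

Lemma pd_gen (I : set R) : left_ideal I -> exists d, I d /\ forall x, I x -> exists c, x = c * d.
Proof.
move=> lI; have [_ /(_ I lI)[d Id]] := pd; exists d; split.
  by rewrite Id => J [_]; apply.
move=> x; rewrite Id => /(_ [set y | exists c, y = c * d]); apply; split.
  apply/left_idealE; split=> [|y z [c ->] [c' ->]|a y [c ->]]; first by exists 0; rewrite mul0r.
    by exists (c + c'); rewrite mulrDl.
  by exists (a * c); rewrite mulrA.
by move=> y /= ->; exists 1; rewrite mul1r.
Qed.

Lemma pd_noidem : noidem R.
Proof.
move=> r rr; have : r * (r - 1) = 0 by rewrite mulrBr rr mulr1 subrr.
by move=> /pd_mul0[->|/eqP]; [left|rewrite subr_eq0 => /eqP ->; right].
Qed.

(** Let [d = x a + y b] generate the left ideal of [a] and [b], with [a = a' d] and [b = b' d]. Then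
    [x a' + y b' = 1], whence [a' y b' = (1 - a' x) a']; multiplying by [d] on the right gives the
    common multiple. *)
Lemma pd_ore (a b : R) : a <> 0 -> exists r s, r <> 0 /\ r * b = s * a.
Proof.
move=> a0; have lI : left_ideal [set z | exists x y, z = x * a + y * b].
  apply/left_idealE; split=> [|z w [x [y ->]] [x' [y' ->]]|c z [x [y ->]]].
  - by exists 0, 0; rewrite !mul0r addr0.
  - by exists (x + x'), (y + y'); rewrite !mulrDl addrACA.
  - by exists (c * x), (c * y); rewrite mulrDr !mulrA.
have [d [[x [y dE]] dI]] := pd_gen lI.
have [a' aE] := dI a (ex_intro _ 1 (ex_intro _ 0 (esym (eq_trans (f_equal2 +%R (mul1r a) (mul0r b)) (addr0 a))))).
have [b' bE] := dI b (ex_intro _ 0 (ex_intro _ 1 (esym (eq_trans (f_equal2 +%R (mul0r a) (mul1r b)) (add0r b))))).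
have d0 : d <> 0 by move=> d0; apply: a0; rewrite aE d0 mulr0.
have a'0 : a' <> 0 by move=> h; apply: a0; rewrite aE h mul0r.
have e1 : x * a' + y * b' = 1.
  have : (x * a' + y * b' - 1) * d = 0.
    by rewrite mulrBl mulrDl -!mulrA -aE -bE mul1r -dE subrr.
  by move=> /pd_mul0[/eqP|//]; rewrite subr_eq0 => /eqP.
have [y0|y0] := pselect (y = 0).
  exists 1, (b' * x); split; first by apply/eqP; exact: oner_neq0.
  move: e1; rewrite y0 mul0r addr0 => e1.
  by rewrite mul1r aE -mulrA (mulrA x) e1 mul1r.
exists (a' * y), (1 - a' * x); split; first by move=> /pd_mul0[].
rewrite {1}bE aE !mulrA; congr (_ * d).
by apply/eqP; rewrite -subr_eq0 mulrBl mul1r opprB addrA addrC -!mulrA -mulrDr (addrC (y * _)) e1 mulr1 addrC subrr.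
Qed.

(** Elimination without division: the multipliers [r i], [s i] of the Ore condition replace
    quotients, and the coefficient of the pivot row is recovered at the end. *)
Lemma pd_dep (I L : finType) (n : nat) : forall (S : {set I}) (T : {set L}) (A : I -> L -> R),
  (#|T| <= n)%N -> (#|T| < #|S|)%N ->
  exists c : I -> R, (exists2 i, i \in S & c i <> 0) /\ forall l, l \in T -> \sum_(i in S) c i * A i l = 0.
Proof.
elim: n => [|n IH] S T A Tn TS.
  have /finset.set0Pn[p pS] : S != finset.set0 by rewrite -cards_eq0 -lt0n; apply: leq_ltn_trans TS.
  exists (fun i => 1); split; first by exists p => //; apply/eqP; exact: oner_neq0.
  by move: Tn; rewrite leqn0 cards_eq0 => /eqP -> l; rewrite inE.
have [T0|/finset.set0Pn[q qT]] := eqVneq T finset.set0.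
  have /finset.set0Pn[p pS] : S != finset.set0 by rewrite -cards_eq0 -lt0n; apply: leq_ltn_trans TS.
  exists (fun i => 1); split; first by exists p => //; apply/eqP; exact: oner_neq0.
  by move=> l; rewrite T0 inE.
have Tq : (#|T :\ q| <= n)%N by move: Tn; rewrite (cardsD1 q T) qT.
have [[p pS Ap]|nA] := pselect (exists2 p, p \in S & A p q <> 0); last first.
  have [|c [c0 cT]] := IH S (T :\ q) A Tq.
    by apply: ltn_trans TS; rewrite (cardsD1 q T) qT.
  exists c; split=> // l lT; have [->|lq] := eqVneq l q; last by apply: cT; rewrite !inE lq.
  rewrite big1 // => i iS; suff -> : A i q = 0 by rewrite mulr0.
  by apply: contrapT => h; apply: nA; exists i.
have [r rP] := ex_choice (fun i => pd_ore (A i q) Ap).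
have [s {}rP] := ex_choice rP.
have [|c [[i]]] := IH (S :\ p) (T :\ q) (fun i l => r i * A i l - s i * A p l) Tq.
  by move: TS; rewrite (cardsD1 q T) qT (cardsD1 p S) pS.
rewrite !inE => /andP[ip iS] ci cT.
exists (fun j => if j == p then - \sum_(k in S :\ p) c k * s k else c j * r j); split.
  by exists i => //; rewrite (negbTE ip) => /pd_mul0[//|]; have [] := rP i.
have E l : \sum_(j in S) (if j == p then - \sum_(k in S :\ p) c k * s k else c j * r j) * A j l =
    \sum_(j in S :\ p) c j * (r j * A j l - s j * A p l).
  rewrite (big_setD1 p) //= eqxx mulNr mulr_suml -sumrN -big_split /=.
  apply: eq_bigr => j; rewrite !inE => /andP[jp _]; rewrite (negbTE jp) mulrBr !mulrA.
  by rewrite addrC.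
move=> l lT; rewrite E; have [->|lq] := eqVneq l q; last by apply: cT; rewrite !inE lq.
by rewrite big1 // => j _; have [_ ->] := rP j; rewrite subrr mulr0.
Qed.

Lemma pd_rank : rank_prop R.
Proof.
move=> I L A B AB; rewrite -!cardsT leqNgt; apply/negP => lt.
have [c [[j _ cj] cT]] := pd_dep A (leqnn _) lt.
apply: cj; have -> : c j = \sum_i c i * \sum_l A i l * B l j.
  rewrite (bigD1 j) //= AB eqxx mulr1 big1 ?addr0 // => i ij.
  by rewrite AB (negbTE ij) mulr0.
under eq_bigr => i _ do rewrite mulr_sumr.
rewrite exchange_big big1 //= => l _.
under eq_bigr => i _ do rewrite mulrA.
have := cT l; rewrite inE => /(_ isT) h; rewrite -mulr_suml.
have -> : \sum_i c i * A i l = 0 by rewrite -[RHS]h; apply: eq_bigl => i; rewrite inE.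
by rewrite mul0r.
Qed.

(** For a fixed basis index, the coordinates of the vectors in the image of [e] form a left ideal,
    hence a principal one. *)
Lemma pd_cyc : cyc_prop R.
Proof.
move=> V X b bB e ee e0.
have [v [x vx]] : exists v x, coord bB (app e v) x <> 0.
  apply: contrapT => h; apply: e0; apply: endo_ext => v; rewrite app0; apply: (coord_inj bB) => x.
  by rewrite coord0; apply: contrapT => h'; apply: h; exists v, x.
have lI : left_ideal [set z | exists w, z = coord bB (app e w) x].
  apply/left_idealE; split=> [|z z' [w ->] [w' ->]|a z [w ->]].
  - by exists 0; rewrite (lin_zero (app_lin e)) coord0.
  - by exists (w + w'); rewrite (linD _ _ (app_lin e)) coordD.
  - by exists (a *: w); rewrite (linZ _ _ (app_lin e)) coordZ.
have [d [[w dE] dI]] := pd_gen lI.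
exists (fun v => coord bB v x), d; split.
- by move=> a u u'; rewrite coordP.
- by move=> u; apply: dI; exists u.
- by exists w.
move=> r /pd_mul0[//|d0]; have [c] := dI _ (ex_intro _ v erefl).
by rewrite d0 mulr0 => /vx.
Qed.
End PrincipalDomains.

(** Padding with zeros makes both factors square with determinant 0. The diagonal entries only need
    a nonzero product, because the pairings to which this is applied are not units in general. *)
Lemma comm_diag (R : comNzRingType) (m n : nat) (A : 'M[R]_(m, n)) (B : 'M[R]_(n, m)) (a : 'I_m -> R) :
  (forall i j, \sum_l A i l * B l j = if i == j then a i else 0) -> \prod_i a i <> 0 -> (m <= n)%N.
Proof.
move=> AB a0; rewrite leqNgt; apply/negP => nm; apply: a0.
have [p mE] : exists p, m = (n + p.+1)%N.
  by exists (m - n).-1; rewrite prednK ?subn_gt0 // subnKC // ltnW.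
subst m.
have AB' : A *m B = diag_mx (\row_i a i).
  apply/matrixP => i j; rewrite !mxE AB; case: eqP => [->|_]; rewrite ?mulr1n ?mulr0n //.
have : \det (row_mx A (0 : 'M_(_, p.+1)) *m col_mx B 0) = \prod_i a i.
  rewrite mul_row_col mul0mx addr0 AB' det_diag.
  by apply: eq_bigr => i _; rewrite mxE.
move=> <-; rewrite det_mulmx (expand_det_col _ (rshift n ord0)) big1 ?mul0r // => i _.
by rewrite row_mxEr mxE mul0r.
Qed.

(** * Idempotents with finitely generated image *)

Section SmallIdempotents.
Variables (R : nzRingType) (V : lmodType R) (X : eqType) (b : X -> V).
Hypothesis bB : is_basis b.
Hypothesis nX : emb nat X.
Notation E := (endo V).

Lemma expandF (F : seq X) v : uniq F -> (forall x, coord bB v x <> 0 -> x \in F) ->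
  v = \sum_(x <- F) coord bB v x *: b x.
Proof.
move=> uF vF; apply: (coord_inj bB) => y; rewrite coord_sum.
have [yF|yF] := boolP (y \in F).
  rewrite (bigD1_seq y) //= coord_b eqxx mulr1 big1 ?addr0 // => x xy.
  by rewrite coord_b (negbTE xy) mulr0.
have -> : coord bB v y = 0 by apply: contrapT => /vF; rewrite (negbTE yF).
rewrite big_seq big1 // => x xF; rewrite coord_b.
by case: eqP xF => [->|]; rewrite ?(negbTE yF) ?mulr0.
Qed.

Definition spanned (G : seq V) (v : V) : Prop :=
  exists L : seq (R * V), (forall q, q \in L -> q.2 \in G) /\ v = \sum_(q <- L) q.1 *: q.2.

Lemma spanned_lin G a u v : spanned G u -> spanned G v -> spanned G (a *: u + v).
Proof.
move=> [L [LG ->]] [M [MG ->]]; exists ([seq (a * q.1, q.2) | q <- L] ++ M); split.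
  by move=> q; rewrite mem_cat => /orP[/mapP[q' /LG h ->]//|/MG].
rewrite big_cat big_map /= scaler_sumr; congr (_ + _).
by apply: eq_bigr => q _; rewrite scalerA.
Qed.

Lemma spanned0 G : spanned G 0.
Proof. by exists [::]; split=> //; rewrite big_nil. Qed.

Lemma spannedZ G a v : v \in G -> spanned G (a *: v).
Proof. by move=> vG; exists [:: (a, v)]; split=> [q|]; rewrite ?big_seq1 // inE => /eqP ->. Qed.

Definition primitive (e : E) : Prop :=
  [/\ e * e = e, e <> 0 & forall g : E, g * g = g -> g * e = g -> e * g = g -> g = 0 \/ g = e].

Definition rank1 (e : E) (G : seq V) : Prop :=
  exists (phi : V -> R^o) (v0 : V), [/\ G = [:: v0], linear phi, app e v0 = v0, phi v0 = 1 &
    forall v, app e v = phi v *: v0].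

(** [cyc_prop] yields an idempotent [g] of rank one with [g * e = g = e * g], and primitivity forces
    [g = e]. *)
Lemma primitive_rank1 e : cyc_prop R -> primitive e -> exists G, rank1 e G.
Proof.
move=> cyc [ee e0 ep]; have [f [a [fl fe [v0 fv0] a0]]] := cyc _ _ _ bB e ee e0.
have [phi phiE] := ex_choice fe.
have uq r r' : r * a = r' * a -> r = r'.
  by move=> /eqP; rewrite -subr_eq0 -mulrBl => /eqP/a0/eqP; rewrite subr_eq0 => /eqP.
have eev v : app e (app e v) = app e v by rewrite -appM ee.
have phl : linear (phi : V -> R^o).
  move=> c x y; apply: uq; rewrite -phiE app_lin fl /= mulrDl -!phiE.
  by congr (_ + _); rewrite phiE; exact: mulrA.
have phe v : phi (app e v) = phi v by apply: uq; rewrite -!phiE eev.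
have ph0 : phi (app e v0) = 1 by rewrite phe; apply: uq; rewrite -phiE fv0 mul1r.
have gl : linear (fun v => phi v *: app e v0).
  by move=> c x y; rewrite phl scalerDl scalerA.
pose g : E := mk_endo gl.
have gE v : app g v = phi v *: app e v0 by [].
have [||| g0|ge] := ep g.
- apply: endo_ext => v; rewrite appM !gE -[phi (_ *: _)]/(phi _).
  by rewrite (linZ _ _ phl) ph0 -[_ *: 1]/(_ * 1) mulr1.
- by apply: endo_ext => v; rewrite appM !gE phe.
- by apply: endo_ext => v; rewrite appM !gE (linZ _ _ (app_lin e)) eev.
- have : app g (app e v0) = 0 by rewrite g0.
  rewrite gE ph0 scale1r => h; move: ph0; rewrite h (lin_zero phl) => /esym/eqP.
  by rewrite oner_eq0.
exists [:: app e v0], phi, (app e v0); split=> // v.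
by rewrite -gE ge.
Qed.

Lemma rank1_spanned e G v : rank1 e G -> spanned G (app e v).
Proof. by move=> [phi [v0 [-> _ _ _ ->]]]; apply: spannedZ; rewrite inE. Qed.

Lemma rank1_bound (I : finType) (e : I -> E) (G : I -> seq V) (F : seq X) : rank_prop R ->
  (forall i, rank1 (e i) (G i)) -> (forall i j, i <> j -> e i * e j = 0) -> uniq F ->
  (forall i v x, v \in G i -> coord bB v x <> 0 -> x \in F) -> (#|I| <= size F)%N.
Proof.
move=> rk r1 orth uF GF; have [phi {}r1] := ex_choice r1; have [v0 {}r1] := ex_choice r1.
have -> : size F = #|'I_(size F)| by rewrite card_ord.
apply: (rk _ _ (fun i l => coord bB (v0 i) (tnth (in_tuple F) l)) (fun l j => phi j (b (tnth (in_tuple F) l)))).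
move=> i j; have [GE phl ev ph1 eE] := r1 j; have [GE' _ ev' _ _] := r1 i.
have -> : \sum_l coord bB (v0 i) (tnth (in_tuple F) l) * phi j (b (tnth (in_tuple F) l)) = phi j (v0 i).
  have vE : v0 i = \sum_(x <- F) coord bB (v0 i) x *: b x.
    by apply: expandF => // x; apply: (GF i); rewrite GE' inE.
  rewrite [in RHS]vE (lin_sum phl) [RHS]big_tnth; exact: eq_bigr.
have [->|ij] := eqVneq i j; first by rewrite ph1.
have : app (e j) (v0 i) = 0.
  by rewrite -ev' -appM orth ?app0 // => ji; move: ij; rewrite ji eqxx.
by rewrite eE => /(congr1 (phi j)); rewrite (linZ _ _ phl) (lin_zero phl) ph1 -[_ *: 1]/(_ * 1) mulr1.
Qed.

Section Commutative.
Hypothesis comR : commutative_ring R.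

(** Over a commutative ring the image can be projective of rank one without being free. Several
    generators [x l] and functionals [h l], with the values [h l (x l)] summing to 1, then replace a
    single dual pair. *)
Definition crank1 (e : E) (G : seq V) : Prop :=
  [/\ e * e = e, forall x y : E, e * x * e * (e * y * e) = e * y * e * (e * x * e) &
  exists (n : nat) (x : 'I_n -> V) (h : 'I_n -> V -> R^o),
    [/\ G = [seq x l | l <- enum 'I_n], forall l, linear (h l), forall l, app e (x l) = x l,
      forall l v, h l (app e v) = h l v & \sum_l h l (x l) = 1]].

(** The image of [T] is I V, where I is the ideal generated by the matrix entries of [e]. Every
    [Z * e] factors through [T], so the hypothesis makes [T] surjective, and 1 lies in I. *)
Lemma trace_crank1 (e : E) (x0 : X) : e * e = e ->
  (forall x y : E, e * x * e * (e * y * e) = e * y * e * (e * x * e)) ->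
  (forall T : E, (forall Z : E, exists S, Z * e = T * S) -> exists S, 1 = T * S) -> exists G, crank1 e G.
Proof.
move=> ee ec tr; have [t tP] : exists t : X -> X * X * X, forall y, exists x, t x = y.
  apply: emb_surj; last exact: (x0, x0, x0).
  by apply: emb_trans (emb_prod (emb_square nX) (emb_refl _)) (emb_square nX).
pose T : E := lifte bB (fun x => coord bB (app e (b (t x).1.1)) (t x).1.2 *: b (t x).2).
have TE x : app T (b x) = coord bB (app e (b (t x).1.1)) (t x).1.2 *: b (t x).2 by exact: lifteE.
have eev v : app e (app e v) = app e v by rewrite -appM ee.
pose im v := exists w, app T w = v.
have imL a u v : im u -> im v -> im (a *: u + v).
  by move=> [u' <-] [v' <-]; exists (a *: u' + v'); rewrite app_lin.
have im0 : im 0 by exists 0; rewrite (lin_zero (app_lin T)).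
have imS (I : Type) (s : seq I) (F : I -> V) : (forall i, im (F i)) -> im (\sum_(i <- s) F i).
  by move=> h; apply: big_ind => // u v hu hv; rewrite -[u]scale1r; exact: imL.
have [Z|S TS] := tr T.
  have imZ x : im (app (Z * e) (b x)).
    rewrite appM; set w := app e (b x).
    have [s [_ sup ->]] := linear_coord bB w (app_lin Z); apply: (imS) => j.
    have [s' [_ -> _]] := basis_expand bB (app Z (b j)).
    rewrite scaler_sumr; apply: (imS) => l; have [y ty] := tP (x, j, l).
    exists (coord bB (app Z (b j)) l *: b y); rewrite (linZ _ _ (app_lin T)) TE ty /= !scalerA.
    by rewrite comR.
  have [g gP] := ex_choice imZ; exists (lifte bB g); apply: (endo_extb bB) => x.
  by rewrite [RHS]appM lifteE gP.
have e1 : b x0 = app T (app S (b x0)) by rewrite -appM -TS app1.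
set w := app S (b x0) in e1.
have [s [_ _ TwE]] := linear_coord bB w (app_lin T).
have := coord_b bB x0 x0; rewrite {1}e1 TwE eqxx coord_sum => sum1.
pose y l := tnth (in_tuple s) l.
pose h (l : 'I_(size s)) v := if (t (y l)).2 == x0 then coord bB w (y l) * coord bB (app e v) (t (y l)).1.2 else 0.
exists [seq app e (b (t (y l)).1.1) | l <- enum 'I_(size s)]; split=> //.
exists (size s), (fun l => app e (b (t (y l)).1.1)), h; split=> //.
- move=> l a u v; rewrite /h; case: eqP => _; last by rewrite scaler0 addr0.
  rewrite app_lin coordP mulrDr; congr (_ + _).
  by rewrite -[_ *: _]/(_ * _) !mulrA (comR _ a).
- by move=> l v; rewrite /h eev.
rewrite -[RHS]sum1 [RHS]big_tnth; apply: eq_bigr => l _; rewrite /h -/(y l) TE coordZ coord_b eev.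
by case: eqP => _; rewrite ?mulr1 ?mulr0.
Qed.

(** In the binomial expansion of [(x + y) ^+ (m + n)] each term contains [x ^+ m] or [y ^+ n]. *)
Lemma rad_sum (Z : R -> Prop) : Z 0 -> (forall x y, Z x -> Z y -> Z (x + y)) -> (forall a x, Z x -> Z (a * x)) ->
  forall (I : Type) (s : seq I) (a : I -> R), (forall i, exists n, Z (a i ^+ n)) ->
  exists n, Z ((\sum_(i <- s) a i) ^+ n).
Proof.
move=> Z0 ZD ZM I s a ha; apply: (big_ind (fun x => exists n, Z (x ^+ n))) => [|x y [m mx] [n ny]|//].
  by exists 1%N; rewrite expr1.
exists (m + n)%N; rewrite exprDn_comm; last exact: comR.
apply: big_ind => // i _.
have [mi|im] := leqP m (m + n - i).
  have -> : x ^+ (m + n - i) * y ^+ i *+ 'C(m + n, i) = (y ^+ i * x ^+ (m + n - i - m) *+ 'C(m + n, i)) * x ^+ m.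
    by rewrite -[in LHS](subnK mi) exprD (comR _ (y ^+ i)) mulrA mulrnAl.
  exact: ZM.
have ni : (n <= i)%N by move: im; case: i => i /= _; lia.
have -> : x ^+ (m + n - i) * y ^+ i *+ 'C(m + n, i) = (x ^+ (m + n - i) * y ^+ (i - n) *+ 'C(m + n, i)) * y ^+ n.
  by rewrite mulrnAl -mulrA -exprD subnK.
exact: ZM.
Qed.

(** Commutativity of the corner, applied to the maps [h l] times [x l] and [h l] times [y], shows
    that the square of [h l (x l)] multiplies [y] into the span. These scalars sum to 1, so
    [rad_sum] puts [y] itself there. *)
Lemma crank1_spanned e G v : crank1 e G -> spanned G (app e v).
Proof.
move=> [ee ec [n [x [h [-> hl ex he h1]]]]]; set G' := [seq _ | _ <- _]; set y := app e v.
have ey : app e y = y by rewrite /y -appM ee.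
have phl l u : linear (fun p => h l p *: (u : V)).
  by move=> a p q; rewrite hl scalerDl scalerA.
have comm l p : h l p *: (h l (x l) *: y) = h l p *: (h l y *: x l).
  pose f : E := mk_endo (phl l (x l)); pose g : E := mk_endo (phl l y).
  have fe : e * f * e = f.
    by apply: endo_ext => q; rewrite !appM /f !app_mk he (linZ _ _ (app_lin e)) ex.
  have ge : e * g * e = g.
    by apply: endo_ext => q; rewrite !appM /g !app_mk he (linZ _ _ (app_lin e)) ey.
  have := congr1 (fun f : E => app f p) (ec f g); rewrite fe ge /= !appM /f /g !app_mk.
  rewrite !(linZ _ _ (hl l)) -![_ *: h l _]/(_ * _) -!scalerA => ->.
  by rewrite !scalerA.
pose Z r := spanned G' (r *: y).
suff : exists m, Z ((\sum_(l <- enum 'I_n) h l (x l)) ^+ m).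
  by move=> [m]; rewrite /Z big_enum /= h1 expr1n scale1r.
apply: rad_sum => [|r r' hr hr'|a r hr|l].
- by rewrite /Z scale0r; exact: spanned0.
- by rewrite /Z scalerDl -[r *: y]scale1r; exact: spanned_lin.
- by rewrite /Z -scalerA -[_ *: _]addr0; apply: spanned_lin => //; exact: spanned0.
exists 2%N; rewrite /Z expr2 -scalerA comm scalerA; apply: spannedZ.
by apply: map_f; rewrite mem_enum.
Qed.

Lemma prod_nonzero (I : eqType) (s : seq I) (n : I -> nat) (a : forall i, 'I_(n i) -> R) (z : R) :
  (forall i, \sum_l a i l = 1) -> z <> 0 -> uniq s ->
  exists f : forall i, 'I_(n i), z * \prod_(i <- s) a i (f i) <> 0.
Proof.
move=> a1; have f0 : forall i, exists l : 'I_(n i), True.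
  move=> i; have := a1 i; case: (n i) (a i) => [|k] ai; last by exists ord0.
  by rewrite big_ord0 => /esym/eqP; rewrite oner_eq0.
elim: s z => [|i s IH] z z0 us.
  have [f _] : exists f : forall i, 'I_(n i), True by exists (fun i => sval (cid (f0 i))).
  by exists f; rewrite big_nil mulr1.
have [l al] : exists l, z * a i l <> 0.
  apply: contrapT => /forallNP h; apply: z0; rewrite -[z]mulr1 -(a1 i) mulr_sumr big1 // => l _.
  by apply: contrapT => /h.
move: us => /andP[si us]; have [f fP] := IH _ al us.
exists (fun j => if pselect (i = j) is left ij then eq_rect i (fun i => 'I_(n i)) l j ij else f j).
rewrite big_cons; case: pselect => // ii; rewrite (Prop_irrelevance ii erefl) /= mulrA.
move: fP; congr (z * a i l * _ <> 0); rewrite big_seq [RHS]big_seq.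
apply: eq_bigr => j js; case: pselect => // ij; exfalso; move: si; rewrite {}ij js.
by [].
Qed.

(** One dual pair is chosen for each idempotent such that the product of all pairings is nonzero. By
    orthogonality the matrix of pairings is diagonal, and it factors through [F]. *)
Lemma crank1_bound (I : finType) (e : I -> E) (G : I -> seq V) (F : seq X) :
  (forall i, crank1 (e i) (G i)) -> (forall i j, i <> j -> e i * e j = 0) -> uniq F ->
  (forall i v x, v \in G i -> coord bB v x <> 0 -> x \in F) -> (#|I| <= size F)%N.
Proof.
move=> r1 orth uF GF.
pose CR : comNzRingType := HB.pack_for comNzRingType (GRing.NzRing.sort R) (GRing.NzRing.class R) (GRing.PzRing_hasCommutativeMul.Build R comR).
have r2 i : exists n : nat, exists x : 'I_n -> V, exists h : 'I_n -> V -> R^o,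
    [/\ G i = [seq x l | l <- enum 'I_n], forall l, linear (h l), forall l, app (e i) (x l) = x l,
      forall l v, h l (app (e i) v) = h l v & \sum_l h l (x l) = 1] by case: (r1 i).
pose n i := sval (cid (r2 i)); pose x i := sval (cid (svalP (cid (r2 i)))).
pose h i := sval (cid (svalP (cid (svalP (cid (r2 i)))))).
have P i : [/\ G i = [seq x i l | l <- enum 'I_(n i)], forall l, linear (h i l), forall l, app (e i) (x i l) = x i l,
      forall l v, h i l (app (e i) v) = h i l v & \sum_l h i l (x i l) = 1].
  exact: (svalP (cid (svalP (cid (svalP (cid (r2 i))))))).
have [f] := @prod_nonzero I (enum I) n (fun i l => h i l (x i l)) 1 (fun i => let: And5 _ _ _ _ p := P i in p)
   (fun h => (elimN eqP (oner_neq0 R)) h) (enum_uniq I).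
move=> nz.
pose en (i : 'I_#|I|) := enum_val i.
apply: (@comm_diag CR _ _ (\matrix_(i, l) coord bB (x (en i) (f (en i))) (tnth (in_tuple F) l))
  (\matrix_(l, j) h (en j) (f (en j)) (b (tnth (in_tuple F) l))) (fun i => h (en i) (f (en i)) (x (en i) (f (en i))))); last first.
  move=> z; apply: nz; rewrite mul1r -[RHS]z.
  transitivity (\prod_(i : I) (h i (f i) (x i (f i)) : CR)); first by rewrite enumT.
  by rewrite (reindex en) //=; exists enum_rank => i _; [exact: enum_valK|exact: enum_rankK].
move=> i j; under eq_bigr => l _ do rewrite !mxE.
have [GE hl ex he _] := P (en j); have [GE' _ ex' _ _] := P (en i).
set v := x (en i) _; have vE : v = \sum_(x <- F) coord bB v x *: b x.
  by apply: expandF => // y; apply: (GF (en i)); rewrite GE'; apply: map_f; rewrite mem_enum.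
transitivity (h (en j) (f (en j)) v).
  rewrite [in RHS]vE (lin_sum (hl _)) [RHS]big_tnth; exact: eq_bigr.
case: eqP => [->//|ij].
have ev : app (e (en i)) v = v by exact: ex'.
have ee : app (e (en j)) v = 0.
  by rewrite -ev -appM orth ?app0 // => /enum_val_inj ji; exact: ij.
by rewrite -[LHS](he (f (en j))) ee (lin_zero (hl _)).
Qed.
End Commutative.
End SmallIdempotents.
(** * Coding the two-sorted structure in an endomorphism ring *)

Section RingCoding.
Variables (O : pzRingType) (nc : bool) (s s' o p tau T1 T2 : O).
Implicit Types e c f x y : O.

Definition rD f : Prop := [/\ f * s = s * f, f * s' = s' * f, f * o = o * f & f * p = p * f].
(* The primitive idempotents of rEE code the infinite set, the elements of rCC the ring. *)
Definition rEE e : Prop :=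
  [/\ exists f, rD f /\ e = f * p, e * e = e, e <> 0 &
      forall g, g * g = g -> g * e = g -> e * g = g -> g = 0 \/ g = e].
Definition rCC c : Prop :=
  if nc then exists f, [/\ rD f, f * tau = tau * f & c = f * p] else central c.
(** [T1] and [T2] carry the graph of the order: [i] stands for a pair, whose entries are the
    idempotents with [e * T1 * i] and [e' * T2 * i] nonzero. *)
Definition rlt e e' : Prop := exists i, [/\ rEE i, e * T1 * i <> 0 & e' * T2 * i <> 0].

(** For [nc] the corner of [e] is identified with the coded ring [rCC]. In the commutative case the
    corner is commutative, and the second clause forces the matrix entries of [e] to generate the
    unit ideal. *)
Definition rclass e : Prop :=
  if nc then (forall c, rCC c -> c * e = e * c /\ (c * e = 0 -> c = 0)) /\
    (forall x, exists c, rCC c /\ e * x * e = c * e)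
  else (forall x y, e * x * e * (e * y * e) = e * y * e * (e * x * e)) /\
    (forall T, (forall Z, exists S, Z * e = T * S) -> exists S, 1 = T * S).

(* The last clause fails in the opposite of an endomorphism ring, see rgood_converse. *)
Definition rorder : Prop :=
  [/\ [/\ forall e, rEE e -> ~ rlt e e,
        forall e1 e2 e3, rEE e1 -> rEE e2 -> rEE e3 -> rlt e1 e2 -> rlt e2 e3 -> rlt e1 e3,
        forall e1 e2, rEE e1 -> rEE e2 -> [\/ rlt e1 e2, e1 = e2 | rlt e2 e1] &
        forall e1, rEE e1 -> exists e2, rEE e2 /\ rlt e1 e2],
      exists e, rEE e,
      forall e1 e2, rEE e1 -> rEE e2 -> e1 <> e2 -> e1 * e2 = 0,
      forall e1 e2, rEE e1 -> rEE e2 -> exists u v, u * v = e1 /\ v * u = e2 &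
      forall x e0, rEE e0 -> x * e0 = x ->
        exists k, rEE k /\ forall e, rEE e -> rlt k e -> e * x = 0].

(** The third clause expresses that the images of the idempotents span the image of [p], the fourth
    that [p] has the full rank of V. Together they make the idempotents as many as the basis
    vectors. *)
Definition rgood : Prop :=
  [/\ p * p = p, forall e, rEE e -> rclass e,
      forall T, (forall e, rEE e -> exists S, e = T * S) -> exists S, p = T * S,
      exists u v, u * v = p /\ v * u = 1 & rorder].
End RingCoding.

(** By the last two clauses one element of [O] carries any family, indexed by [K], of points of [K]
    or of ring elements. This turns quantifiers over relations of size at most [K] into quantifiers
    over finitely many elements. *)
Definition decoded (O : pzRingType) (EE CC : O -> Prop) (K : Type) (R : nzRingType) : Prop :=
  exists (io : K -> O) (ka : R -> O),
  [/\ (forall e, EE e <-> exists k, e = io k) /\ (forall c, CC c <-> exists r, c = ka r),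
      (forall x y, ka (x + y) = ka x + ka y) /\ (forall x y, ka (x * y) = ka y * ka x),
      [/\ forall k, io k * io k = io k, forall k, io k <> 0 & forall k l, k <> l -> io k * io l = 0],
      forall k x y, ka x * io k = ka y * io k -> x = y &
      (forall a : K -> K, exists T, forall k, io (a k) * T * io k = T * io k /\ T * io k <> 0) /\
      (forall r : K -> R, exists D, forall k, D * io k = ka (r k) * io k)].

(* The flag nc separates local rings and principal domains from commutative rings. *)
Definition rclass_ok (nc : bool) (R : nzRingType) : Prop :=
  if nc then cyc_prop R /\ rank_prop R else commutative_ring R.

(** * Decoding set and ring from good elements of the endomorphism ring *)

Section Soundness.
Variables (R : nzRingType) (V : lmodType R) (X : eqType) (b : X -> V).
Hypothesis bB : is_basis b.
Hypothesis nX : emb nat X.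
Notation E := (endo V).
Variables (nc : bool) (s s' o p tau T1 T2 : E).
Hypothesis cls : rclass_ok nc R.
Hypothesis good : rgood nc s s' o p tau T1 T2.

Let EE := rEE s s' o p.
Let EEt := {e | EE e}.
Let Q (e : E) G := if nc then rank1 e G else crank1 e G.

Lemma EE_small e : EE e -> exists G, Q e G.
Proof.
have [_ cl _ _ _] := good; move=> /[dup] he [_ ee e0 ep]; have := cl _ he.
have [y0 _] : exists y0 : X, True by case: nX => f _; exists (f 0%N).
rewrite /Q /rclass; case: nc cls => [[cyc _] _|comR [c1 c2]]; first exact: (primitive_rank1 bB).
exact: (trace_crank1 bB nX comR y0).
Qed.

Lemma EE_gens : exists G : E -> seq V, forall e, EE e -> Q e (G e).
Proof.
have /ex_choice[G GP] : forall e : E, exists G, EE e -> Q e G; last by exists G.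
move=> e; have [he|he] := pselect (EE e); last by exists [::].
by have [g gP] := EE_small he; exists g.
Qed.

Lemma EE_spanned e G v : Q e G -> spanned G (app e v).
Proof. by rewrite /Q; case: nc cls => [_|comR]; [exact: rank1_spanned|exact: crank1_spanned]. Qed.

Lemma EE_bound (I : finType) (e : I -> E) (G : I -> seq V) (F : seq X) :
  (forall i, Q (e i) (G i)) -> (forall i j, i <> j -> e i * e j = 0) -> uniq F ->
  (forall i v x, v \in G i -> coord bB v x <> 0 -> x \in F) -> (#|I| <= size F)%N.
Proof.
rewrite /Q; case: nc cls => [[_ rk]|comR]; first exact: rank1_bound.
exact: crank1_bound.
Qed.

Let orth e1 e2 : EE e1 -> EE e2 -> e1 <> e2 -> e1 * e2 = 0.
Proof. by have [_ _ _ _ [_ _ h _ _]] := good; exact: h. Qed.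

(** Each idempotent determines the finite support of its generators. By [EE_bound] finitely many
    orthogonal idempotents share a given support, and there are no more finite supports than
    elements of [X]. *)
Lemma EE_emb : emb EEt X.
Proof.
have [G GP] := EE_gens.
have /ex_choice[F FP] : forall e : E, exists F, uniq F /\ forall v x, v \in G e -> coord bB v x <> 0 -> x \in F.
  move=> e; elim: (G e) => [|v G' [F [uF FP]]]; first by exists [::].
  have [s0 [us _ sup]] := basis_expand bB v; exists (undup (s0 ++ F)); split; first exact: undup_uniq.
  move=> w x; rewrite inE mem_undup mem_cat => /orP[/eqP -> /sup -> //|wG /(FP _ _ wG) ->].
  by rewrite orbT.
have fib (F0 : seq X) : exists idx : E -> nat, forall e e', EE e -> EE e' -> F e = F0 -> F e' = F0 -> idx e = idx e' -> e = e'.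
  pose D := {e | EE e /\ F e = F0}.
  have [[g gi]|[g gi]] := emb_total nat D.
    have uF0 : uniq F0 by have [_ <-] := svalP (g 0%N); have [] := FP (sval (g 0%N)).
    pose e (i : 'I_(size F0).+1) := sval (g i).
    suff : ((size F0).+1 <= size F0)%N by rewrite ltnn.
    rewrite -[X in (X <= _)%N]card_ord; apply: (@EE_bound _ e (G \o e) F0) => //.
    - by move=> i; apply: GP; have [] := svalP (g i).
    - move=> i j ij; apply: orth; [by have [] := svalP (g i)|by have [] := svalP (g j)|].
      by move=> /sval_inj/gi/val_inj.
    - move=> i v x vG vx; have [_ FF] := svalP (g i); have [_ /(_ v x vG vx)] := FP (e i).
      by rewrite /e FF.
  exists (fun e => if pselect (EE e /\ F e = F0) is left h then g (exist _ e h) else 0%N).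
  move=> e e' he he' Fe Fe'; case: pselect => [h|[]//]; case: pselect => [h'|[]//].
  by move=> /gi [].
have [idx idxP] := ex_choice fib.
apply: emb_trans (emb_nat_prod nX (emb_seq nX)).
exists (fun e => (F (sval e), idx (F (sval e)) (sval e))) => -[e he] [e' he'] /= [Fe ie].
by apply: sval_inj => /=; apply: (idxP (F e)) => //; rewrite ie Fe.
Qed.

(** [T0] lists the vectors [e (b y)] for all idempotents at once, so each of these factors through
    it, and [rgood] extends this to [p]. *)
Lemma span_map : exists (t : X -> EEt * X) (T0 S0 : E),
  [/\ forall y, exists x, t x = y, forall x, app T0 (b x) = app (sval (t x).1) (b (t x).2) & p = T0 * S0].
Proof.
have [_ _ sp _ [_ [e0 he0] _ _ _]] := good.
have [y0 _] : exists y0 : X, True by case: nX => f _; exists (f 0%N).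
have [t tP] : exists t : X -> EEt * X, forall y, exists x, t x = y.
  apply: emb_surj; last exact: (exist _ e0 he0, y0).
  exact: emb_trans (emb_prod EE_emb (emb_refl _)) (emb_square nX).
pose T0 := lifte bB (fun x => app (sval (t x).1) (b (t x).2)).
have T0E x : app T0 (b x) = app (sval (t x).1) (b (t x).2) by exact: lifteE.
have [e he|S0 S0P] := sp T0; last by exists t, T0, S0.
have [g gP] := ex_choice (fun k => tP (exist _ e he, k)).
exists (lifte bB (fun k => b (g k))); apply: (endo_extb bB) => k.
by rewrite appM lifteE T0E gP.
Qed.

Let pe e : EE e -> p * e = e.
Proof.
have [pp _ _ _ _] := good.
by move=> [[f [[_ _ _ fp] eE]] _ _ _]; rewrite eE mulrA -fp -mulrA pp.
Qed.

(** The map is defined on the indices listing the vectors [e (b y)], not on the vectors, so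
    relations among them do no harm; the factorisation of [p] brings it back to V, and orthogonality
    isolates the block of [e]. *)
Lemma block_map (g : E -> E) : exists T, forall e, EE e -> T * e = g e * e.
Proof.
have [t [T0 [S0 [tP T0E pE]]]] := span_map.
pose G := lifte bB (fun x => app (g (sval (t x).1)) (app (sval (t x).1) (b (t x).2))).
have GE x : app G (b x) = app (g (sval (t x).1)) (app (sval (t x).1) (b (t x).2)) by exact: lifteE.
have key y e0 : EE e0 -> exists L : seq E, [/\ uniq L, e0 \in L, forall e, e \in L -> EE e &
    app G y = \sum_(e <- L) app (g e) (app e (app T0 y))].
  move=> he0; have [s0 [us yE _]] := basis_expand bB y.
  pose L := undup (e0 :: [seq sval (t x).1 | x <- s0]).
  have LE e : e \in L -> EE e.
    rewrite mem_undup inE => /orP[/eqP -> //|/mapP[x _ ->]]; exact: svalP.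
  exists L; split=> //; [exact: undup_uniq|by rewrite mem_undup inE eqxx|].
  have T0y : app T0 y = \sum_(x <- s0) coord bB y x *: app T0 (b x) by rewrite {1}yE (lin_sum (app_lin T0)).
  have Gy : app G y = \sum_(x <- s0) coord bB y x *: app G (b x) by rewrite {1}yE (lin_sum (app_lin G)).
  have ey e : app (g e) (app e (app T0 y)) = \sum_(x <- s0) coord bB y x *: app (g e) (app e (app T0 (b x))).
    by rewrite T0y (lin_sum (app_lin e)) (lin_sum (app_lin (g e))).
  rewrite Gy (eq_bigr _ (fun e _ => ey e)).
  rewrite exchange_big /= big_seq [RHS]big_seq; apply: eq_bigr => x xs; rewrite GE -scaler_sumr; congr (_ *: _).
  have xL : sval (t x).1 \in L by rewrite mem_undup inE (map_f (fun x => sval (t x).1) xs) orbT.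
  rewrite (bigD1_seq (sval (t x).1)) ?undup_uniq //= T0E.
  have -> : app (sval (t x).1) (app (sval (t x).1) (b (t x).2)) = app (sval (t x).1) (b (t x).2).
    by have [_ ee _ _] := svalP (t x).1; rewrite -appM ee.
  rewrite big_seq_cond big1 ?addr0 // => e /andP[eL ne].
  have oe : e * sval (t x).1 = 0.
    by apply: orth; [exact: LE|exact: (svalP (t x).1)|move=> h; rewrite h eqxx in ne].
  by rewrite -(appM e) oe app0 (lin_zero (app_lin (g e))).
exists (G * S0) => e he; apply: endo_ext => v; rewrite !appM.
have [L [uL eL LE ->]] := key (app S0 (app e v)) _ he.
rewrite -(appM T0) -pE -appM pe // (bigD1_seq e) //= -(appM e).
have [_ -> _ _] := he; rewrite big_seq_cond big1 ?addr0 // => e' /andP[e'L ne].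
have oe : e' * e = 0 by apply: orth => //; [exact: LE|move=> h; rewrite h eqxx in ne].
by rewrite -(appM e') oe app0 (lin_zero (app_lin (g e'))).
Qed.

Lemma nat_EE : emb nat EEt.
Proof.
have [_ _ _ _ [[irr tr _ nomax] [e0 he0] _ _ _]] := good.
have /ex_choice[f fP] : forall e : EEt, exists e' : EEt, rlt s s' o p T1 T2 (sval e) (sval e').
  move=> [e he]; have [e' [he' h]] := nomax e he.
  by exists (exist _ e' he').
pose x0 : EEt := exist _ e0 he0; pose u n := iter n f x0.
have inc m n : (m < n)%N -> rlt s s' o p T1 T2 (sval (u m)) (sval (u n)).
  elim: n => // n IH; rewrite ltnS leq_eqVlt => /orP[/eqP ->|mn]; first exact: fP.
  apply: tr (IH mn) (fP _); exact: svalP.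
exists u => m n h; case: (ltngtP m n) => // /inc; rewrite h => /irr; case; exact: svalP.
Qed.

(** [v] maps the image of [p] onto V, so the images of the generators under [v] span V and every
    basis index occurs in the support of one of them. The index is coded by the idempotent, the
    number of the generator and the place in the support. *)
Lemma emb_EE : emb X EEt.
Proof.
have [_ _ _ [u [v [uv vu]]] _] := good; have [t [T0 [S0 [tP T0E pE]]]] := span_map.
have [G GP] := EE_gens.
have /ex_choice[sp spP] : forall w : V, exists sp : seq X, forall x, coord bB w x <> 0 -> x \in sp.
  by move=> w; have [s0 [_ _ h]] := basis_expand bB w; exists s0.
pose P (q : EEt * (nat * nat)) := sp (app v (nth 0 (G (sval q.1)) q.2.1)).
have wit k : exists q, nth k (P q) q.2.2 = k /\ (q.2.2 < size (P q))%N.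
  suff [e [g [gG gk]]] : exists (e : EEt) g, g \in G (sval e) /\ coord bB (app v g) k <> 0.
    exists (e, (index g (G (sval e)), index k (sp (app v g)))); rewrite /P /= nth_index //.
    by rewrite nth_index ?index_mem ?spP.
  apply: contrapT => no.
  have vg0 e g : EE e -> g \in G e -> coord bB (app v g) k = 0.
    move=> he gG; apply: contrapT => h; apply: no; exists (exist _ e he), g; split=> //.
  have ve0 e w : EE e -> coord bB (app v (app e w)) k = 0.
    move=> he; have [L [LG ->]] := EE_spanned w (GP e he).
    rewrite (lin_sum (app_lin v)) coord_sum big_seq big1 // => q /LG qG.
    by rewrite (vg0 e) ?mulr0.
  have := coord_b bB k k; have -> : b k = app v (app p (app u (b k))).
    by rewrite -!appM -uv -!mulrA vu mulr1 vu app1.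
  rewrite pE appM; set w := app S0 _; have [s0 [_ _ ->]] := linear_coord bB w (app_lin T0).
  rewrite (lin_sum (app_lin v)) coord_sum big1 => [/esym/eqP|x _]; first by rewrite eqxx oner_eq0.
  by rewrite T0E ve0 ?mulr0 //; exact: svalP.
have [q qP] := ex_choice wit.
apply: emb_trans (emb_nat_prod nat_EE (emb_nat_prod nat_EE (emb_refl _))).
exists (fun k => ((q k).1, (q k).2.1, (q k).2.2)) => k k' [e1 e2 e3].
have qq : q k = q k' by case: (q k) (q k') e1 e2 e3 => a [c d] [a' [c' d']] /= -> -> ->.
have [h1 sz] := qP k; have [h2 _] := qP k'.
by rewrite -h1 -h2 -qq; exact: set_nth_default.
Qed.

Theorem ring_decode : decoded (rEE s s' o p) (rCC nc s s' o p tau) X R.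
Proof.
have [f [g fK gK]] := emb_bij emb_EE EE_emb.
have [pp cl _ _ [_ [e0 he0] _ iso _]] := good.
pose io k := sval (f k).
have ioE k : EE (io k) by exact: svalP.
have EEio e : rEE s s' o p e <-> exists k, e = io k.
  split=> [he|[k ->]]; last exact: ioE.
  by exists (g (exist _ e he)); rewrite /io gK.
have ioP : [/\ forall k, io k * io k = io k, forall k, io k <> 0 & forall k l, k <> l -> io k * io l = 0].
  split=> [k|k|k l kl]; try by case: (ioE k).
  by apply: orth => // /sval_inj /(congr1 g); rewrite !fK.
have gio k : g (f k) = k by exact: fK.
(* Isomorphisms between the images of the idempotents, supplied by the order clause, are glued by
   [block_map]. *)
have F1 (a : X -> X) : exists T, forall k, io (a k) * T * io k = T * io k /\ T * io k <> 0.
  have /ex_choice[u uP] : forall e : E, exists u, forall he : EE e,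
      io (a (g (exist _ e he))) * (u * e) = u * e /\ u * e <> 0.
    move=> e; have [he|he] := pselect (EE e); last by exists 0 => /[dup] /he.
    have [u [v [uv vu]]] := iso _ _ (ioE (a (g (exist _ e he)))) he.
    exists u => he'; rewrite (Prop_irrelevance he' he); split.
      have [_ ee _ _] := he.
      by rewrite -uv -mulrA (mulrA v) vu ee.
    move=> ue0; have [_ ee e1 _] := he; apply: e1; by rewrite -ee -{1}vu -mulrA ue0 mulr0.
  have [T TP] := block_map u; exists T => k.
  have [h1 h2] := uP _ (ioE k); rewrite -mulrA TP //; split=> //.
  move: h1; have -> : exist _ (io k) (ioE k) = f k by apply: sval_inj.
  by rewrite fK.
have F2 (ka : R -> E) (r : X -> R) : exists D, forall k, D * io k = ka (r k) * io k.
  have [D DP] := block_map (fun e => if pselect (EE e) is left he then ka (r (g (exist _ e he))) else 0).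
  exists D => k; rewrite DP //; case: pselect => // he.
  have -> : exist _ (io k) he = f k by apply: sval_inj.
  by rewrite fK.
have [ka [kaC kaD kaM kaI]] : exists ka : R -> E, [/\ forall c, rCC nc s s' o p tau c <-> exists r, c = ka r,
    forall x y, ka (x + y) = ka x + ka y, forall x y, ka (x * y) = ka y * ka x &
    forall k x y, ka x * io k = ka y * io k -> x = y]; last first.
  by exists io, ka; split=> //; split=> //; exact: F2.
have QE := EE_small; have cl' := cl; move: QE cl'; rewrite /Q /rclass /rCC.
case: nc cls => [_|comR] QE cl'; last first.
  have rc r a : r * a = a * r :> R by exact: comR.
  exists (fun r => mk_endo (scalar_lin (rc r))); split.
  - move=> c; split=> [/(central_scalar bB (g (exist _ e0 he0)))[r [_ cE]]|[r ->]].
      by exists r; apply: endo_ext => v; rewrite cE app_mk.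
    exact: scalar_central.
  - by move=> x y; apply: endo_ext => v; rewrite appD !app_mk scalerDl.
  - by move=> x y; apply: endo_ext => v; rewrite appM !app_mk scalerA comR.
  move=> k x y exy; have [_ [_ _ [n [z [h [_ hl ez he h1]]]]]] := QE _ (ioE k).
  have zE l : x *: z l = y *: z l.
    by have := congr1 (fun w : E => app w (z l)) exy; rewrite /= !appM !app_mk ez.
  rewrite -[x]mulr1 -[y]mulr1 -h1 !mulr_sumr; apply: eq_bigr => l _.
  by have := congr1 (h l) (zE l); rewrite !(linZ _ _ (hl l)).
(* For an idempotent of rank one the corner consists of the maps [m r]. The scalar [r] stands to the
   right of [phi v], so composition reverses products. *)
have [G [phi [v0 [_ phl ev0 ph1 eE]]]] := QE _ he0.
have ml r : linear (fun v : V => (phi v * r) *: v0).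
  move=> a x y; rewrite phl -[a *: phi x]/(a * phi x) mulrDl scalerDl scalerA mulrA //.
pose m r : E := mk_endo (ml r).
have mE r v : app (m r) v = (phi v * r) *: v0 by [].
have phe v : phi (app e0 v) = phi v by rewrite eE (linZ _ _ phl) ph1 -[_ *: 1]/(_ * 1) mulr1.
have em r : e0 * m r = m r by apply: endo_ext => v; rewrite appM !mE (linZ _ _ (app_lin e0)) ev0.
have me r : m r * e0 = m r by apply: endo_ext => v; rewrite appM !mE phe.
have [cl1 cl2] := cl' _ he0.
have CCB c c' : (exists f, [/\ rD s s' o p f, f * tau = tau * f & c = f * p]) ->
   (exists f, [/\ rD s s' o p f, f * tau = tau * f & c' = f * p]) -> c * e0 = c' * e0 -> c = c'.
  move=> [f1 [[a1 a2 a3 a4] a5 a6]] [f2 [[b1 b2 b3 b4] b5 b6]] h.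
  apply/eqP; rewrite -subr_eq0; apply/eqP; have [|_] := cl1 (c - c').
    exists (f1 - f2); split; [split| |by rewrite a6 b6 mulrBl];
    by rewrite mulrBl mulrBr ?a1 ?a2 ?a3 ?a4 ?a5 ?b1 ?b2 ?b3 ?b4 ?b5.
  by apply; rewrite mulrBl h subrr.
have /ex_choice[ka kaP] : forall r, exists c, (exists f, [/\ rD s s' o p f, f * tau = tau * f & c = f * p]) /\ c * e0 = m r.
  by move=> r; have [c [h1 h2]] := cl2 (m r); exists c; split=> //; rewrite -h2 em me.
exists ka; split.
- move=> c; split=> [cC|[r ->]]; last by case: (kaP r).
  have [ce _] := cl1 c cC; exists (phi (app c v0)); apply: CCB => //; first by case: (kaP (phi (app c v0))).
  have [_ ->] := kaP (phi (app c v0)); apply: endo_ext => v; rewrite mE appM eE (linZ _ _ (app_lin c)).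
  by rewrite -scalerA -eE -appM -ce appM ev0.
- move=> x y; apply: CCB; first by case: (kaP (x + y)).
    have [[f1 [[a1 a2 a3 a4] a5 a6]] _] := kaP x; have [[f2 [[b1 b2 b3 b4] b5 b6]] _] := kaP y.
    exists (f1 + f2); split; [split| |by rewrite a6 b6 mulrDl];
    by rewrite mulrDl mulrDr ?a1 ?a2 ?a3 ?a4 ?a5 ?b1 ?b2 ?b3 ?b4 ?b5.
  rewrite mulrDl; have [_ ->] := kaP x; have [_ ->] := kaP y; have [_ ->] := kaP (x + y).
  by apply: endo_ext => v; rewrite appD !mE mulrDr scalerDl.
- move=> x y; apply: CCB; first by case: (kaP (x * y)).
    have [[f1 [[a1 a2 a3 a4] a5 a6]] _] := kaP y; have [[f2 [[b1 b2 b3 b4] b5 b6]] _] := kaP x.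
    have cm z : f1 * z = z * f1 -> f2 * z = z * f2 -> f1 * f2 * z = z * (f1 * f2).
      by move=> h1 h2; rewrite -mulrA h2 mulrA h1 mulrA.
    exists (f1 * f2); split; [split; exact: cm|exact: cm|].
    by rewrite a6 b6 mulrA -(mulrA f1 p f2) -b4 -!mulrA pp.
  rewrite -mulrA; have [_ ->] := kaP x; rewrite -em mulrA; have [_ ->] := kaP y; have [_ ->] := kaP (x * y).
  by apply: endo_ext => v; rewrite appM !mE (linZ _ _ phl) ph1 -[_ *: 1]/(_ * 1) mulr1 mulrA.
move=> k x y h; have [kx1 kx2] := kaP x; have [ky1 ky2] := kaP y.
have [[f1 [[a1 a2 a3 a4] a5 a6]] [f2 [[b1 b2 b3 b4] b5 b6]]] := (kx1, ky1).
have {}h : ka x = ka y.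
  apply/eqP; rewrite -subr_eq0; apply/eqP; have [cl3 _] := cl' _ (ioE k); have [|_] := cl3 (ka x - ka y).
    exists (f1 - f2); split; [split| |by rewrite a6 b6 mulrBl];
    by rewrite mulrBl mulrBr ?a1 ?a2 ?a3 ?a4 ?a5 ?b1 ?b2 ?b3 ?b4 ?b5.
  by apply; rewrite mulrBl h subrr.
have := congr1 (fun w : E => phi (app w v0)) (_ : m x = m y); rewrite /= !mE ph1 !mul1r !(linZ _ _ phl) ph1.
by rewrite -![_ *: 1]/(_ * 1) !mulr1; apply; rewrite -kx2 -ky2 h.
Qed.
End Soundness.
(** Ordering [X * nat] lexicographically removes a possible maximum of the well-order on [X]. *)
Lemma order_exists (X : Type) : emb nat X -> exists lt : X -> X -> Prop,
  [/\ forall x, ~ lt x x, forall x y z, lt x y -> lt y z -> lt x z,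
      forall x y, [\/ lt x y, x = y | lt y x] & forall x, exists y, lt x y].
Proof.
move=> nX; have [lt0 wo] := well_order_exists X.
have [f [g fK gK]] : exists f : X -> X * nat, bijective f.
  apply: emb_bij; last exact: emb_nat_prod nX (emb_refl _).
  by exists (fun x => (x, 0%N)) => x y [].
exists (fun x y => lt0 (f x).1 (f y).1 \/ (f x).1 = (f y).1 /\ ((f x).2 < (f y).2)%N); split.
- by move=> x [/(wo_irr wo)//|[_]]; rewrite ltnn.
- move=> x y z [h1|[h1 h1']] [h2|[h2 h2']].
  + by left; exact: wo_tr wo _ _ _ h1 h2.
  + by left; rewrite -h2.
  + by left; rewrite h1.
  + by right; rewrite h1 h2; split=> //; exact: ltn_trans h1' h2'.
- move=> x y; case: (wo_tot wo (f x).1 (f y).1) => [h|h|h]; [by constructor 1; left| |by constructor 3; left].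
  case: (ltngtP (f x).2 (f y).2) => h'; [by constructor 1; right|by constructor 3; right|].
  by constructor 2; rewrite -(fK x) -(fK y); congr g; case: (f x) (f y) h h' => a c [a' c'] /= -> ->.
- by move=> x; exists (g ((f x).1, (f x).2.+1)); right; rewrite gK /=.
Qed.

Lemma basis_reindex (R : nzRingType) (V : lmodType R) (X Y : eqType) (b : X -> V) (f : Y -> X) :
  is_basis b -> bijective f -> is_basis (b \o f).
Proof.
move=> bB [g fK gK]; split.
  move=> m s c si h i; apply: (bB.1 m (f \o s) c) => //.
  by apply: inj_comp => //; exact: can_inj fK.
move=> v; have [m [s [c [si ->]]]] := bB.2 v.
exists m, (g \o s), c; split; first by apply: inj_comp => //; exact: can_inj gK.
by apply: eq_bigr => i _ /=; rewrite gK.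
Qed.

(** * Existence of good elements in the endomorphism ring *)

Section StandardRingParameters.
Variables (R : nzRingType) (V : lmodType R) (X : eqType) (S : rigid_struct X X).
Notation Y := (rX S * nat * X)%type.
Variables (b : Y -> V) (lt : X -> X -> Prop).
Hypothesis bB : is_basis b.
Hypothesis nX : emb nat X.
Hypothesis nR : noidem R.
Hypothesis lt_irr : forall x, ~ lt x x.
Hypothesis lt_tr : forall x y z, lt x y -> lt y z -> lt x z.
Hypothesis lt_tot : forall x y, [\/ lt x y, x = y | lt y x].
Hypothesis lt_nomax : forall x, exists y, lt x y.
Variables (nc : bool) (k0 : X).
Hypothesis cls : rclass_ok nc R.
Notation E := (endo V).

Let d (k : X) : Y := (rz S k, 0%N, k).
Let isd (y : Y) : bool := y == d y.2.
Let os (y : Y) : option Y := Some (y.1.1, y.1.2.+1, y.2).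
Let os' (y : Y) : option Y := if y.1.2 is n.+1 then Some (y.1.1, n, y.2) else None.
Let oo (y : Y) : option Y := omap (fun x => (x, 0%N, y.2)) (rop y.1.2 y.1.1).
Let op (y : Y) : option Y := if isd y then Some y else None.
Let otau (y : Y) : option Y := if isd y then Some (y.1.1, 0%N, k0) else None.
Let me (q : Y -> option Y) : E := mk_endo (opmap_linear bB q).

Let meE q y : app (me q) (b y) = if q y is Some z then b z else 0.
Proof. by rewrite app_mk opmap_b. Qed.

Let dI k l : d k = d l -> k = l. Proof. by case. Qed.
Let isdd k : isd (d k). Proof. by rewrite /isd /= eqxx. Qed.
Let isdP y : isd y -> y = d y.2. Proof. by move/eqP. Qed.

Let s := me os.
Let s' := me os'.
Let o := me oo.
Let p := me op.
Let tau := me otau.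
Let dl k : E := delta bB (d k) (b (d k)).

Let dlE k v : app (dl k) v = coord bB v (d k) *: b (d k). Proof. exact: app_delta. Qed.
Let pd k : app p (b (d k)) = b (d k). Proof. by rewrite meE /op isdd. Qed.
Let pnd y : ~~ isd y -> app p (b y) = 0. Proof. by move=> h; rewrite meE /op (negbTE h). Qed.

Let coord_p v y : ~~ isd y -> coord bB (app p v) y = 0.
Proof.
move=> ny; rewrite app_mk; apply: coord_opmap0 => z; rewrite /op; case: ifP => // zd [zy].
by rewrite -zy zd in ny.
Qed.

Let sn n (x : rX S) m k : app (s ^+ n) (b (x, m, k)) = b (x, (m + n)%N, k).
Proof.
elim: n m => [|n IH] m; first by rewrite addn0.
by rewrite exprSr appM meE /= IH addSnnS.
Qed.

Let expr_comm (f g : E) n : f * g = g * f -> f * g ^+ n = g ^+ n * f.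
Proof. by move=> h; elim: n => [|n IH]; rewrite ?mulr1 ?mul1r // exprS mulrA h -mulrA IH mulrA. Qed.

(* The rigid operators are recovered at level 0 as o s^n (1 - s s'). *)
Let rDP f : rD s s' o p f -> exists r : X -> R, forall k,
  app f (b (d k)) = r k *: b (d k) /\
  forall x, coord bB (app f (b (rz S x, 0%N, k))) (rz S x, 0%N, k) = r k.
Proof.
move=> [fs fs' fo fp].
pose on n (y : Y) : option Y := if y.1.2 is 0%N then omap (fun x => (x, 0%N, y.2)) (rop n y.1.1) else None.
have onE n : me (on n) = o * (s ^+ n * (1 - s * s')).
  apply: (endo_extb bB) => -[[x m] k]; rewrite !appM appD appN app1 appM !meE /on /os' /=.
  case: m => [|m]; last by rewrite meE /= subrr (lin_zero (app_lin (s ^+ n))) (lin_zero (app_lin o)).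
  by rewrite (lin_zero (app_lin s)) subr0 sn add0n meE /oo /=; case: (rop n x).
have fon n : f * me (on n) = me (on n) * f.
  rewrite onE; apply: comm_mul => //; apply: comm_mul; first exact: expr_comm.
  by apply: comm_sub; [exact: comm_1|exact: comm_mul].
have app_on n v : app f (opmap bB (on n) v) = opmap bB (on n) (app f v).
  by have := congr1 (fun g : E => app g v) (fon n); rewrite /= !appM !app_mk.
have rA k l : exists r, forall x y, coord bB (app f (b (rz S x, 0%N, k))) (y, 0%N, l) = r * (rz S x == y)%:R.
  have [||||r rP] := @rigid_apply X X S R V _ b bB on (app f) (fun x => (x, 0%N, k)) (fun x => (x, 0%N, l)) (app_lin f) app_on;
    last by exists r => x y; exact: rP.
  - by move=> x y [].
  - by [].
  - by [].
  - move=> n [[x m] k'] y; rewrite /on /=; case: m => // ; case: (rop n x) => //= z [zy kl].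
    by exists x; rewrite kl.
have /ex_choice[r rP] := fun k => rA k k.
exists r => k; split; last by move=> x; rewrite rP eqxx mulr1.
apply: (coord_inj bB) => y; rewrite coordZ coord_b.
have fpd : app f (b (d k)) = app p (app f (b (d k))) by rewrite -appM -fp appM pd.
have [yd|yd] := boolP (isd y); last first.
  by rewrite fpd coord_p //; case: eqP => [ky|]; rewrite ?mulr0 // -ky isdd in yd *.
rewrite (isdP yd); have [->|kl] := eqVneq k y.2; first by rewrite eqxx mulr1 rP eqxx mulr1.
have [q qP] := rA k y.2; rewrite /d qP.
have -> : (rz S k == rz S y.2) = false by apply/negbTE; apply: contra_neq kl; exact: rz_inj.
have -> : ((rz S k, 0%N, k) == (rz S y.2, 0%N, y.2) :> Y) = false.
  by apply/negbTE; apply: contra_neq kl => -[].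
by rewrite !mulr0.
Qed.

Let scal r : E := lifte bB (fun y => r *: b y).
Let scal_me r q : scal r * me q = me q * scal r.
Proof.
apply: (endo_extb bB) => y; rewrite !appM lifteE meE (linZ _ _ (app_lin _)) meE.
by case: (q y) => [z|]; rewrite ?lifteE // (lin_zero (app_lin _)) scaler0.
Qed.

Let blk k : E := lifte bB (fun y => if y.2 == k then b y else 0).
Let blk_me k q : (forall y z, q y = Some z -> z.2 = y.2) -> blk k * me q = me q * blk k.
Proof.
move=> h; apply: (endo_extb bB) => y; rewrite !appM lifteE meE.
case qy: (q y) => [z|].
  by rewrite lifteE (h _ _ qy); case: eqP => yk; rewrite ?(lin_zero (app_lin _)) // meE qy.
by rewrite (lin_zero (app_lin _)); case: eqP => _; rewrite ?(lin_zero (app_lin _)) // meE qy.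
Qed.

Let dl_neq0 k : dl k <> 0.
Proof.
move=> /(congr1 (fun f : E => app f (b (d k)))); rewrite /= dlE coord_b eqxx scale1r app0.
exact: basis_neq0.
Qed.

Let dl_mul f k : app f (b (d k)) = b (d k) -> f * dl k = dl k.
Proof. by move=> h; apply: endo_ext => v; rewrite appM dlE (linZ _ _ (app_lin f)) h. Qed.

Let dldl k : dl k * dl k = dl k.
Proof. by apply: dl_mul; rewrite dlE coord_b eqxx scale1r. Qed.

Let dl_orth k l : k <> l -> dl k * dl l = 0.
Proof.
move=> kl; apply: endo_ext => v; rewrite appM !dlE coordZ coord_b.
by case: eqP => [/dI/esym//|_]; rewrite mulr0 scale0r.
Qed.

Let dl_x k (x : E) : dl k * x * dl k = scal (coord bB (app x (b (d k))) (d k)) * dl k.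
Proof.
apply: endo_ext => v; rewrite !appM !dlE (linZ _ _ (app_lin x)) (linZ _ _ (app_lin (scal _))) lifteE.
by rewrite coordZ scalerA.
Qed.

Let scal_dl r k : scal r * dl k = dl k * scal r.
Proof.
apply: (endo_extb bB) => y; rewrite !appM !lifteE (linZ _ _ (app_lin _)) lifteE.
by case: eqP => _; rewrite ?(lin_zero (app_lin _)) ?scaler0 // lifteE.
Qed.

(** By [rDP], [f * p] is diagonal on the marked points and 0 on the others. The entries of an
    idempotent of this form are idempotents of [R], hence 0 or 1, and primitivity leaves a single
    1. *)
Lemma std_EE e : rEE s s' o p e <-> exists k, e = dl k.
Proof.
split=> [[[f [fD ef]] ee e0 ep]|[k ->]].
  have [r rP] := rDP fD.
  have ed k : app e (b (d k)) = r k *: b (d k) by rewrite ef appM pd; case: (rP k).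
  have en y : ~~ isd y -> app e (b y) = 0 by move=> /pnd h; rewrite ef appM h (lin_zero (app_lin f)).
  have rr k : r k * r k = r k.
    have := congr1 (fun f : E => coord bB (app f (b (d k))) (d k)) ee.
    by rewrite /= appM !ed (linZ _ _ (app_lin e)) ed scalerA !coordZ coord_b eqxx !mulr1.
  have [k rk] : exists k, r k <> 0.
    apply: contrapT => /forallNP h; apply: e0; apply: (endo_extb bB) => y; rewrite app0.
    have [/isdP ->|/en//] := boolP (isd y); rewrite ed.
    by have /contrapT -> := h y.2; rewrite scale0r.
  have {}rk : r k = 1 by case: (nR (rr k)).
  exists k; have [||h|h] := ep (dl k) (dldl k).
  - apply: (endo_extb bB) => y; rewrite appM !dlE.
    have [/isdP ->|yd] := boolP (isd y).
      rewrite ed coordZ coord_b; case: eqP => [/dI yk|_]; last by rewrite mulr0.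
      by rewrite yk rk mulr1.
    rewrite en // coord0 coord_b; case: eqP => // yk; by rewrite yk isdd in yd.
  - by apply: dl_mul; rewrite ed rk scale1r.
  - by case: (dl_neq0 h).
  - by rewrite h.
split; [|exact: dldl|exact: dl_neq0|].
  exists (blk k); split.
    split; apply: blk_me => -[[x m] l] z; rewrite /os /os' /oo /op /=.
    - by case=> <-.
    - by case: m => // m [<-].
    - by case: (rop m x) => //= y [<-].
    - by case: ifP => // _ [<-].
  apply: (endo_extb bB) => y; rewrite appM dlE coord_b.
  have [/isdP yd|nd] := boolP (isd y).
    rewrite [in RHS]yd pd lifteE /=; case: (eqVneq y.2 k) => [<-|yk]; first by rewrite -yd eqxx scale1r.
    case: eqP => [yk'|_]; last by rewrite scale0r.
    by rewrite yk' eqxx in yk.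
  rewrite (pnd nd) (lin_zero (app_lin _)); case: eqP => [yk|_]; last by rewrite scale0r.
  by rewrite yk isdd in nd.
move=> g gg gd dg; have gE : g = scal (coord bB (app g (b (d k))) (d k)) * dl k.
  by rewrite -dl_x dg gd.
set r := coord _ _ _ in gE; have rr : r * r = r.
  have gdk : app g (b (d k)) = r *: b (d k).
    by rewrite gE appM dlE coord_b eqxx scale1r lifteE.
  rewrite {3}/r -gg appM gdk (linZ _ _ (app_lin g)) gdk !coordZ coord_b eqxx !mulr1 //.
case: (nR rr) => r0; [left|right]; rewrite gE r0; apply: endo_ext => v; rewrite appM dlE (linZ _ _ (app_lin _)) lifteE.
  by rewrite scale0r scaler0.
by rewrite scale1r.
Qed.

Lemma std_CC c : nc -> rCC nc s s' o p tau c <-> exists r, c = scal r * p.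
Proof.
rewrite /rCC => ->; split=> [[f [fD ft ->]]|[r ->]]; last first.
  by exists (scal r); split=> //; [split|]; exact: scal_me.
have [r rP] := rDP fD; exists (r k0).
have rk k : r k = r k0.
  have [h1 _] := rP k; have [_ /(_ k) h2] := rP k0.
  have := congr1 (fun g : E => coord bB (app g (b (d k))) (rz S k, 0%N, k0)) ft.
  rewrite /= !appM h1 (linZ _ _ (app_lin tau)) meE /otau isdd /= h2 coordZ coord_b eqxx mulr1.
  by move->.
apply: (endo_extb bB) => y; rewrite !appM.
have [/isdP ->|/pnd ->] := boolP (isd y); last by rewrite !(lin_zero (app_lin _)).
by rewrite pd lifteE; have [-> _] := rP y.2; rewrite rk.
Qed.

Lemma std_rclass e : rEE s s' o p e -> rclass nc s s' o p tau e.
Proof.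
move=> /std_EE[k ->]; have pdl : p * dl k = dl k by apply: dl_mul; exact: pd.
have dlp : dl k * p = dl k.
  apply: (endo_extb bB) => y; rewrite appM; have [/isdP ->|nd] := boolP (isd y); first by rewrite pd.
  rewrite pnd // (lin_zero (app_lin _)) dlE coord_b; case: eqP => [yk|_]; last by rewrite scale0r.
  by rewrite yk isdd in nd.
rewrite /rclass; case ncE: nc; last first.
  have comR : commutative_ring R by move: cls; rewrite ncE.
  split=> [x y|T h].
    rewrite !dl_x !mulrA -!(mulrA _ (dl k)) -!scal_dl !mulrA -!(mulrA _ (dl k)) dldl.
    congr (_ * dl k); apply: (endo_extb bB) => z; rewrite !appM !lifteE !(linZ _ _ (app_lin _)) !lifteE !scalerA.
    by rewrite comR.
  have /ex_choice[w wP] : forall y, exists w, app T w = b y.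
    move=> y; have [Sx hS] := h (delta bB (d k) (b y)); exists (app Sx (b (d k))).
    by rewrite -appM -hS appM dlE coord_b eqxx scale1r app_delta coord_b eqxx scale1r.
  by exists (lifte bB w); apply: (endo_extb bB) => y; rewrite appM lifteE wP.
split=> [c cC|x].
  have [r ->] : exists r, c = scal r * p by apply/(std_CC c ncE); move: cC; rewrite /rCC ncE.
  split; first by rewrite -mulrA pdl [RHS]mulrA -scal_dl -mulrA dlp.
  rewrite -mulrA pdl => /(congr1 (fun g : E => coord bB (app g (b (d k))) (d k))).
  rewrite /= appM dlE coord_b eqxx scale1r lifteE coordZ coord_b eqxx mulr1 app0 coord0 => r0.
  by apply: (endo_extb bB) => y; rewrite appM meE; case: (op y) => [z|]; rewrite ?(lin_zero (app_lin _)) // lifteE r0 scale0r.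
exists (scal (coord bB (app x (b (d k))) (d k)) * p); split.
  suff : rCC nc s s' o p tau (scal (coord bB (app x (b (d k))) (d k)) * p) by rewrite /rCC ncE.
  by apply/(std_CC _ ncE); eexists.
by rewrite -[RHS]mulrA pdl dl_x.
Qed.

Theorem std_rgood : exists T1 T2, rgood nc s s' o p tau T1 T2.
Proof.
have EEd k : rEE s s' o p (dl k) by apply/std_EE; exists k.
have [t tP] : exists t : X -> X * X, forall q, exists i, t i = q.
  by apply: emb_surj (emb_square nX) (k0, k0).
have ltD : exists c : X * X -> bool, forall q, c q <-> lt q.1 q.2.
  by exists (fun q => `[< lt q.1 q.2 >]) => q; split=> /asboolP.
have [c cP] := ltD.
(* [t] lists all pairs, so the marked point [d i] stands for the pair [t i]. [T1] and [T2] send it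
   to the two entries, or to 0 if the pair is not in the order. *)
pose T1 := lifte bB (fun y => if isd y && c (t y.2) then b (d (t y.2).1) else 0).
pose T2 := lifte bB (fun y => if isd y && c (t y.2) then b (d (t y.2).2) else 0).
have dTd (w : X -> X) (T := lifte bB (fun y => if isd y && c (t y.2) then b (d (w y.2)) else 0)) a i :
    dl a * T * dl i <> 0 <-> lt (t i).1 (t i).2 /\ w i = a.
  have E1 : app (dl a * T * dl i) (b (d i)) = coord bB (if c (t i) then b (d (w i)) else 0) (d a) *: b (d a).
    by rewrite !appM [app (dl i) _]dlE coord_b eqxx scale1r lifteE isdd /= dlE.
  split=> [h|[h1 h2] h].
    have hc : c (t i).
      apply: contrapT => /negP nci; apply: h; apply: endo_ext => v.
      rewrite !appM [app (dl i) v]dlE !(linZ _ _ (app_lin _)) lifteE isdd /= (negbTE nci).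
      by rewrite (lin_zero (app_lin _)) scaler0.
    split; first by apply/cP.
    apply: contrapT => wa; apply: h; apply: endo_ext => v.
    rewrite !appM [app (dl i) v]dlE !(linZ _ _ (app_lin _)) lifteE isdd /= hc dlE coord_b.
    by case: eqP => [/dI//|_]; rewrite scale0r scaler0.
  move: E1; rewrite h app0; have -> : c (t i) by apply/cP.
  by rewrite h2 coord_b eqxx scale1r => /esym; exact: basis_neq0.
have D1 a i : dl a * T1 * dl i <> 0 <-> lt (t i).1 (t i).2 /\ (t i).1 = a := dTd (fun i => (t i).1) a i.
have D2 a i : dl a * T2 * dl i <> 0 <-> lt (t i).1 (t i).2 /\ (t i).2 = a := dTd (fun i => (t i).2) a i.
have ltE a a' : rlt s s' o p T1 T2 (dl a) (dl a') <-> lt a a'.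
  split=> [[e [/std_EE[i ->] /D1[h1 h2] /D2[_ h3]]]|h]; first by rewrite -h2 -h3.
  by have [i ti] := tP (a, a'); exists (dl i); split; [exact: EEd|apply/D1; rewrite ti|apply/D2; rewrite ti].
exists T1, T2; split.
- apply: (endo_extb bB) => y; rewrite appM; have [/isdP ->|/pnd ->] := boolP (isd y).
    by rewrite !pd.
  by rewrite (lin_zero (app_lin _)).
- exact: std_rclass.
- move=> T hT; have /ex_choice[w wP] : forall k, exists w, app T w = b (d k).
    move=> k; have [Sx hS] := hT _ (EEd k); exists (app Sx (b (d k))).
    by rewrite -appM -hS dlE coord_b eqxx scale1r.
  exists (lifte bB (fun y => if isd y then w y.2 else 0)); apply: (endo_extb bB) => y; rewrite appM lifteE.
  have [/isdP yd|/pnd ->] := boolP (isd y); last by rewrite (lin_zero (app_lin _)).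
  by rewrite wP -yd yd; exact: pd.
- have [f [g fK gK]] : exists f : Y -> X, bijective f.
    apply: emb_bij; last by exists d => k l /dI.
    apply: emb_trans (emb_prod (emb_nat_prod nX (rX_emb S)) (emb_refl _)) (emb_square nX).
  exists (lifte bB (fun y => b (d (f y)))), (lifte bB (fun y => if isd y then b (g y.2) else 0)); split.
    apply: (endo_extb bB) => y; rewrite appM !lifteE.
    have [/isdP yd|/pnd ->] := boolP (isd y); last by rewrite (lin_zero (app_lin _)).
    by rewrite lifteE gK -yd yd; apply/esym; exact: pd.
  by apply: (endo_extb bB) => y; rewrite appM !lifteE isdd /= fK app1.
split.
- split.
  + by move=> e /std_EE[a ->] /ltE/lt_irr.
  + by move=> e1 e2 e3 /std_EE[a1 ->] /std_EE[a2 ->] /std_EE[a3 ->] /ltE h1 /ltE h2; apply/ltE; exact: lt_tr h1 h2.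
  + move=> e1 e2 /std_EE[a1 ->] /std_EE[a2 ->].
    by case: (lt_tot a1 a2) => [h|->|h]; [constructor 1|constructor 2|constructor 3] => //; apply/ltE.
  + by move=> e1 /std_EE[a1 ->]; have [a2 h] := lt_nomax a1; exists (dl a2); split=> //; apply/ltE.
- by exists (dl k0).
- move=> e1 e2 /std_EE[a1 ->] /std_EE[a2 ->] h; apply: dl_orth => a12; by apply: h; rewrite a12.
- move=> e1 e2 /std_EE[a1 ->] /std_EE[a2 ->].
  exists (delta bB (d a2) (b (d a1))), (delta bB (d a1) (b (d a2))).
  split; apply: endo_ext => v; rewrite appM !app_delta coordZ coord_b eqxx mulr1 //.
move=> x e /std_EE[a ->] xa.
(* As [x = x * dl a], only the finite support of this one vector matters; [m] bounds the blocks
   meeting it. *)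
have [sq [_ _ sup]] := basis_expand bB (app x (b (d a))).
have [m mP] : exists m, forall y, y \in sq -> ~ lt m y.2.
  elim: sq {sup} => [|y sq [m IH]]; first by exists k0.
  case: (lt_tot m y.2) => h; [exists y.2|exists m|exists m] => z; rewrite inE => /orP[/eqP ->|/IH] //.
  - by move=> h1 h2; apply: h1; exact: lt_tr h h2.
  - by rewrite h.
  - by move=> h1; apply: (lt_irr (lt_tr h h1)).
exists (dl m); split=> // e' /std_EE[a' ->] /ltE ma'.
apply: endo_ext => v; rewrite -xa !appM [app (dl a) v]dlE (linZ _ _ (app_lin x)) (linZ _ _ (app_lin (dl a'))) dlE.
have -> : coord bB (app x (b (d a))) (d a') = 0.
  by apply: contrapT => /sup/mP; apply.
by rewrite scale0r scaler0.
Qed.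
End StandardRingParameters.

Theorem rgood_exists (R : nzRingType) (V : lmodType R) (X : eqType) (b : X -> V) (nc : bool) :
  is_basis b -> emb nat X -> noidem R -> rclass_ok nc R ->
  exists s s' o p tau T1 T2 : endo V, rgood nc s s' o p tau T1 T2.
Proof.
move=> bB nX nR cls; have [S _] := rigid_exists nX.
have k0 : X by apply: (sval (cid (_ : exists _ : X, True))); case: nX => f _; exists (f 0%N).
have [f fb] : exists f : rX S * nat * X -> X, bijective f.
  apply: emb_bij; last by exists (fun k => (rz S k, 0%N, k)) => k l [].
  apply: emb_trans (emb_prod (emb_nat_prod nX (rX_emb S)) (emb_refl _)) (emb_square nX).
have [lt [l1 l2 l3 l4]] := order_exists nX.
have [T1 [T2 h]] := std_rgood (basis_reindex bB fb) nX nR l1 l2 l3 l4 k0 cls.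
by do 5 eexists; exists T1, T2; exact: h.
Qed.

(** * Excluding the opposite ring *)

Lemma wf_choice (T B : Type) (b0 : B) (lt : T -> T -> Prop) (Q : T -> (T -> B) -> B -> Prop) : is_wo lt ->
  (forall x (h h' : T -> B) c, (forall y, lt y x -> h y = h' y) -> Q x h c -> Q x h' c) ->
  (forall x h, exists c, Q x h c) -> exists h : T -> B, forall x, Q x h (h x).
Proof.
move=> wo Qext QE.
have /ex_choice[q qP] : forall z : T * (T -> B), exists c, Q z.1 z.2 c by move=> [x h]; exact: QE.
pose F x (rec : forall y, lt y x -> B) := q (x, fun y => if pselect (lt y x) is left yx then rec y yx else b0).
pose h := Fix (wo_wf wo) (fun _ => B) F.
have hE x : h x = F x (fun y _ => h y).
  rewrite /h Fix_eq // => y f g fg; rewrite /F; congr (q (_, _)); apply/funext => z.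
  by case: pselect.
exists h => x; rewrite hE /F.
apply: Qext (qP (x, _)) => y yx /=; by case: pselect.
Qed.

Section UnboundedSelection.
Variables (T X : Type) (P : T -> T -> Prop) (i : T -> X).
Hypothesis P_irr : forall x, ~ P x x.
Hypothesis P_tr : forall x y z, P x y -> P y z -> P x z.
Hypothesis P_tot : forall x y, [\/ P x y, x = y | P y x].
Hypothesis P_nomax : forall x, exists y, P x y.

Let unb (C : T -> Prop) : Prop := forall k, exists t, C t /\ P k t.

Let bdd (C : T -> Prop) : ~ unb C -> exists m, forall t, C t -> P t m.
Proof.
move=> /existsNP[k /forallNP kC]; have [m km] := P_nomax k; exists m => t Ct.
case: (P_tot t k) => [tk|->|kt]; [exact: P_tr tk km|exact: km|by case: (kC t)].
Qed.

(** Take a cofinal family indexed by a shortest possible initial segment [D] of a well-order and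
    make it increasing. If no label occurs cofinally, keep the first point of each label. Were these
    bounded within [D], minimality of [D] would bound the bounds of all labels, hence the whole
    family. *)
Lemma unbounded_selection (t0 : T) : exists C : T -> Prop, unb C /\
  ((exists x, forall t, C t -> i t = x) \/ (forall t t', C t -> C t' -> i t = i t' -> t = t')).
Proof.
have [lt wo] := well_order_exists T.
pose im (D : T -> Prop) (f : T -> T) : T -> Prop := fun t => exists q, D q /\ f q = t.
have [D [f [Df Dinit]]] : exists (D : T -> Prop) (f : T -> T), unb (im D f) /\
    forall q, D q -> forall g, ~ unb (im (fun r => lt r q) g).
  have [[p pP]|np] := pselect (exists p, exists f, unb (im (fun r => lt r p) f)).
    have [q [[f qf] qmin]] := wo_min wo (ex_intro (fun p => exists f, unb (im (fun r => lt r p) f)) p pP).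
    by exists (fun r => lt r q), f; split=> // r rq g gu; apply: (qmin r) => //; exists g.
  exists (fun _ => True), id; split.
    by move=> k; have [t kt] := P_nomax k; exists t; split=> //; exists t.
  by move=> q _ g gu; apply: np; exists q, g.
have above x y : exists z, P x z /\ P y z.
  case: (P_tot x y) => [xy|->|yx]; [have [z h] := P_nomax y|have [z h] := P_nomax y|have [z h] := P_nomax x];
  by exists z; split=> //; exact: P_tr h.
have [||h hP] := @wf_choice T T t0 lt (fun q h c => D q -> P (f q) c /\ forall r, lt r q -> P (h r) c) wo.
- by move=> x h h' c hh' Q Dx; have [q1 q2] := Q Dx; split=> // r rx; rewrite -hh'; [exact: q2|].
- move=> q h; have [Dq|nD] := pselect (D q); last by exists t0.
  have [m mP] := bdd (Dinit q Dq h); have [z [z1 z2]] := above m (f q).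
  by exists z => _; split=> // r rq; apply: P_tr z1; apply: mP; exists r.
pose Fib x q := D q /\ i (h q) = x.
have [[x xu]|nx] := pselect (exists x, unb (im (Fib x) h)).
  by exists (im (Fib x) h); split=> //; left; exists x => t [q [[_ <-] <-]].
have /ex_choice[u uP] : forall x, exists m, forall q, Fib x q -> P (h q) m.
  move=> x; have [|m mP] := @bdd (im (Fib x) h); first by move=> xu; apply: nx; exists x.
  by exists m => q qF; apply: mP; exists q.
pose sel q := Fib (i (h q)) q /\ forall r, Fib (i (h q)) r -> ~ lt r q.
have selE x q : Fib x q -> exists q', sel q' /\ i (h q') = x.
  move=> xq; have [q' [[Dq' iq'] qm]] := wo_min wo (ex_intro (Fib x) q xq).
  by exists q'; split=> //; split; rewrite iq'.
have cof q : D q -> exists q', sel q' /\ ~ lt q' q.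
  move=> Dq; apply: contrapT => no; have low q' : sel q' -> lt q' q.
    by move=> sq; apply: contrapT => nl; apply: no; exists q'.
  have [m mP] := bdd (Dinit q Dq (fun r => u (i (h r)))).
  have [t [[r [Dr <-]] mt]] := Df m.
  have [r' [sr' ir']] := selE _ r (conj Dr erefl).
  have h1 : P (h r) (u (i (h r))) by apply: uP.
  have h2 : P (u (i (h r))) m by apply: mP; exists r'; rewrite ir'; split=> //; exact: low.
  have [h3 _] := hP r Dr.
  by apply: (P_irr (P_tr mt (P_tr h3 (P_tr h1 h2)))).
exists (im sel h); split; last first.
  right=> _ _ [q [[[Dq _] sq] <-]] [r [[[Dr _] sr] <-]] e; congr h.
  by case: (wo_tot wo q r) => // l; [case: (sr q)|case: (sq r)].
move=> k; have [t [[q [Dq <-]] kq]] := Df k; have [q' [sq' nl]] := cof q Dq.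
exists (h q'); split; first by exists q'.
have [h1 _] := hP q Dq; have kh := P_tr kq h1.
have [<-//|ql] := wo_nlt wo nl; have [[Dq' _] _] := sq'.
by have [_ /(_ q ql)] := hP q' Dq'; exact: P_tr.
Qed.
End UnboundedSelection.

Section NoOpposite.
Variables (R : nzRingType) (V : lmodType R) (X : eqType) (b : X -> V).
Hypothesis bB : is_basis b.
Notation E := (endo V).
Variables (EE : E -> Prop) (P : E -> E -> Prop) (nc : bool) (e0 : E).
Hypothesis cls : rclass_ok nc R.
Hypothesis EE0 : EE e0.
Hypothesis EEprim : forall e, EE e -> primitive e.
Hypothesis P_irr : forall e, EE e -> ~ P e e.
Hypothesis P_tr : forall e1 e2 e3, EE e1 -> EE e2 -> EE e3 -> P e1 e2 -> P e2 e3 -> P e1 e3.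
Hypothesis P_tot : forall e1 e2, EE e1 -> EE e2 -> [\/ P e1 e2, e1 = e2 | P e2 e1].
Hypothesis P_nomax : forall e1, EE e1 -> exists e2, EE e2 /\ P e1 e2.
Hypothesis iso : forall e1 e2, EE e1 -> EE e2 -> exists u v, v * u = e1 /\ u * v = e2.

(** Otherwise the diagonal entries [n y] of [e0] square to zero, and polarisation gives
    [w = - (sum of the n y) w] for every [w] in the image. The sum is nilpotent, so the image is
    zero. *)
Lemma self_pairing : commutative_ring R -> exists (h : V -> R^o) w, [/\ linear h, app e0 w = w & h w *: w <> 0].
Proof.
move=> comR; apply: contrapT => no; have [ee ne _] := EEprim EE0; apply: ne.
have hw h w : linear (h : V -> R^o) -> app e0 w = w -> h w *: w = 0.
  by move=> hl ew; apply: contrapT => n; apply: no; exists h, w.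
have eev v : app e0 (app e0 v) = app e0 v by rewrite -appM ee.
apply: endo_ext => v; rewrite app0; set w := app e0 v; have ew : app e0 w = w by exact: eev.
have [s [_ wE _]] := basis_expand bB w.
pose x y := app e0 (b y); pose n y := coord bB (x y) y.
have hl y : linear (fun v : V => coord bB v y : R^o) by move=> a u u'; rewrite coordP.
have nx y : n y *: x y = 0 by apply: (hw (fun v => coord bB v y)) => //; exact: eev.
have wx y : coord bB w y *: x y = - (n y *: w).
  have := hw _ (w + x y) (hl y); rewrite (linD _ _ (app_lin e0)) ew eev => /(_ erefl) /=.
  rewrite coordD scalerDl !scalerDr -/(n y) nx addr0 (hw _ w (hl y) ew) add0r.
  by move/eqP; rewrite addr_eq0 => /eqP.
have w1 : w = - (\sum_(y <- s) n y) *: w.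
  rewrite -{1}ew {1}wE (lin_sum (app_lin e0)) scaleNr scaler_suml -sumrN.
  by apply: eq_bigr => y _; rewrite -wx.
have [m mP] : exists m, (\sum_(y <- s) n y) ^+ m = 0.
  apply: (rad_sum comR (Z := fun r => r = 0)) => [//|r r' -> ->|a r ->|y]; rewrite ?addr0 ?mulr0 //.
  exists 2%N; have := congr1 (fun u => coord bB u y) (nx y).
  by rewrite /= coordZ coord0 expr2.
have wm k : w = (- \sum_(y <- s) n y) ^+ k *: w.
  by elim: k => [|k IH]; rewrite ?scale1r // exprSr -scalerA -w1.
by rewrite (wm m) exprNn mP mulr0 scale0r.
Qed.

(** The functional built in [no_opposite] has values in the multiples of [w] and has to see many
    idempotents at once. One [w] must therefore survive multiplication by coordinates from every
    image, even where [R] has zero divisors. *)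
Lemma uniform_vector : exists w, app e0 w = w /\
  forall e, EE e -> exists a, app e a = a /\ exists y, coord bB a y *: w <> 0.
Proof.
have [ee ne ep] := EEprim EE0; case: nc cls => [[cyc _]|comR].
  have [G [phi [w [_ phl ew ph1 _]]]] := primitive_rank1 bB cyc (EEprim EE0).
  exists w; split=> // e /EEprim[eee en _].
  have [v ev] : exists v, app e v <> 0.
    apply: contrapT => /forallNP h; apply: en; apply: endo_ext => v; exact: contrapT (h v).
  exists (app e v); split; first by rewrite -appM eee.
  apply: contrapT => /forallNP h; apply: ev; apply: (coord_inj bB) => y; rewrite coord0.
  have /contrapT/(congr1 phi) := h y.
  by rewrite (linZ _ _ phl) (lin_zero phl) ph1 -[_ *: 1]/(_ * 1) mulr1.
have [h [w [hl ew hw]]] := self_pairing comR; exists w; split=> // e he.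
have [u [v [vu uv]]] := iso he EE0.
exists (app v w); split; first by rewrite -appM -vu -mulrA uv appM ew.
apply: contrapT => /forallNP no; apply: hw.
have -> : h w = h (app u (app v w)) by rewrite -[in RHS]appM uv ew.
have [s [_ _ ->]] := linear_coord bB (app v w) (app_lin u).
rewrite (lin_sum hl) scaler_suml big1 // => y _.
have /contrapT z := no y.
by rewrite -[_ *: h _]/(_ * _) comR -scalerA z scaler0.
Qed.

Lemma finite_max (lt : X -> X -> Prop) (s : seq X) (D : X -> Prop) : is_wo lt ->
  (forall x, D x -> x \in s) -> (exists x, D x) -> exists x, D x /\ forall y, D y -> ~ lt x y.
Proof.
move=> wo; elim: s D => [|z s IH] D Ds [x Dx]; first by have := Ds _ Dx.
have [[x' [Dx' x'z]]|no] := pselect (exists x', D x' /\ x' <> z); last first.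
  exists x; split=> // y Dy; have -> : y = z by apply: contrapT => h; apply: no; exists y.
  have -> : x = z by apply: contrapT => h; apply: no; exists x.
  exact: wo_irr.
have [||m [[Dm mz] mP]] := IH (fun y => D y /\ y <> z).
- by move=> y [/Ds]; rewrite inE => /orP[/eqP|//].
- by exists x'.
have [[Dz mz']|nz] := pselect (D z /\ lt m z).
  exists z; split=> // y Dy zy; have [yz|yz] := pselect (y = z).
    by move: zy; rewrite yz; exact: wo_irr.
  exact: (mP y (conj Dy yz) (wo_tr wo mz' zy)).
exists m; split=> // y Dy my; have [yz|yz] := pselect (y = z).
  by apply: nz; rewrite -yz.
exact: (mP y (conj Dy yz)).
Qed.

(** Choose a vector in the image of each idempotent and label it by the last basis index whose
    coordinate does not kill [w]. On an unbounded set this label is constant or injective; in both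
    cases a map [F] with [e0 * F = F] is nonzero on all the chosen vectors of that set, so it is not
    bounded in the order. *)
Theorem no_opposite : ~ (forall x, e0 * x = x -> exists k, EE k /\ forall e, EE e -> P k e -> x * e = 0).
Proof.
move=> small; have [w [ew wP]] := uniform_vector; have [lt wo] := well_order_exists X.
pose T := {e | EE e}; pose t0 : T := exist _ e0 EE0.
have /ex_choice[a aP] : forall t : T, exists a, app (sval t) a = a /\ exists y, coord bB a y *: w <> 0.
  by move=> [e he]; exact: wP.
have /ex_choice[i iP] : forall t : T, exists x, coord bB (a t) x *: w <> 0 /\
    forall y, coord bB (a t) y *: w <> 0 -> ~ lt x y.
  move=> t; have [_ ex] := aP t; have [s [_ _ sup]] := basis_expand bB (a t).
  apply: (finite_max (s := s) wo) ex => y h; apply: sup => c0; by apply: h; rewrite c0 scale0r.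
have [||||C [Cu Ci]] := @unbounded_selection T X (fun t t' => P (sval t) (sval t')) i _ _ _ _ t0.
- by move=> [e he]; exact: P_irr.
- by move=> [e1 h1] [e2 h2] [e3 h3]; exact: P_tr.
- move=> [e1 h1] [e2 h2]; case: (P_tot h1 h2) => /= h; [by constructor 1|constructor 2|by constructor 3].
  exact: sval_inj.
- by move=> [e he]; have [e' [he' h]] := P_nomax he; exists (exist _ e' he').
suff [F [eF FC]] : exists F : E, e0 * F = F /\ forall t, C t -> app F (a t) <> 0.
  have [k [hk kP]] := small F eF; have [t [Ct kt]] := Cu (exist _ k hk).
  have [eat _] := aP t; apply: (FC t Ct); rewrite -eat -appM kP //; exact: svalP.
pose mk (phi : X -> bool) : E := lifte bB (fun x => if phi x then w else 0).
have mkE phi v (s : seq X) : uniq s -> (forall x, coord bB v x <> 0 -> x \in s) ->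
    app (mk phi) v = \sum_(x <- s) (if phi x then coord bB v x *: w else 0).
  move=> us sup; rewrite {1}(expandF us sup) (lin_sum (app_lin _)); apply: eq_bigr => x _.
  by rewrite lifteE; case: ifP; rewrite ?scaler0.
have emk phi : e0 * mk phi = mk phi.
  apply: (endo_extb bB) => x; rewrite appM lifteE; case: ifP => _ //.
  exact: (lin_zero (app_lin e0)).
have sup t : exists s, uniq s /\ forall x, coord bB (a t) x <> 0 -> x \in s.
  by have [s [us _ h]] := basis_expand bB (a t); exists s.
case: Ci => [[x xP]|inj].
  exists (mk (pred1 x)); split=> // t Ct; have [s [us ss]] := sup t.
  have [ix _] := iP t; rewrite (mkE _ _ s us ss); rewrite xP // in ix.
  have xs : x \in s by apply: ss => c0; apply: ix; rewrite c0 scale0r.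
  rewrite (bigD1_seq x) //= eqxx big1 ?addr0 // => y yx.
  by rewrite (negbTE yx).
(* At [x = i t] the smaller indices have already contributed and larger ones will not, so the value
   at [x] can be chosen to make the sum nonzero. By injectivity [t] is the only condition at this
   index. *)
have [||phi phiP] := @wf_choice X bool true lt (fun x phi c => forall t, C t -> i t = x ->
   forall s, uniq s -> (forall x, coord bB (a t) x <> 0 -> x \in s) ->
   \sum_(y <- s | `[< lt y x >]) (if phi y then coord bB (a t) y *: w else 0) + (if c then coord bB (a t) x *: w else 0) <> 0) wo.
- move=> x h h' c hh' Q t Ct it s us ss; have := Q t Ct it s us ss.
  congr (_ + _ <> 0); apply: eq_bigr => y /asboolP yx; by rewrite hh'.
- move=> x phi; have [[t [Ct it]]|no] := pselect (exists t, C t /\ i t = x); last first.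
    by exists true => t Ct it; case: no; exists t.
  have [s [us ss]] := sup t.
  have indep s' : uniq s' -> (forall x, coord bB (a t) x <> 0 -> x \in s') ->
     \sum_(y <- s' | `[< lt y x >]) (if phi y then coord bB (a t) y *: w else 0) =
     \sum_(y <- s | `[< lt y x >]) (if phi y then coord bB (a t) y *: w else 0).
    move=> us' ss'; have E1 s1 : uniq s1 -> (forall x, coord bB (a t) x <> 0 -> x \in s1) ->
        \sum_(y <- s1 | `[< lt y x >]) (if phi y then coord bB (a t) y *: w else 0) =
        app (mk (fun y => phi y && `[< lt y x >])) (a t).
      move=> u1 h1; rewrite (mkE _ _ _ u1 h1) big_mkcond; apply: eq_bigr => y _.
      by case: (phi y); case: asboolP.
    by rewrite !E1.
  have tt t' : C t' -> i t' = x -> t' = t by move=> Ct' it'; apply: inj => //; rewrite it it'.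
  have [S0|S0] := pselect (\sum_(y <- s | `[< lt y x >]) (if phi y then coord bB (a t) y *: w else 0) = 0).
    exists true => t' Ct' it' s' us' ss'; rewrite (tt t') // in ss' *.
    by rewrite indep // S0 add0r -it; case: (iP t).
  by exists false => t' Ct' it' s' us' ss'; rewrite (tt t') // in ss' *; rewrite indep // addr0.
exists (mk phi); split=> // t Ct; have [s [us ss]] := sup t.
have [ix im] := iP t; have := phiP (i t) t Ct erefl s us ss; rewrite (mkE _ _ s us ss).
have xs : i t \in s by apply: ss => c0; apply: ix; rewrite c0 scale0r.
rewrite [X in _ -> X <> 0](bigD1_seq (i t)) //= addrC.
suff -> : \sum_(y <- s | y != i t) (if phi y then coord bB (a t) y *: w else 0) =
    \sum_(y <- s | `[< lt y (i t) >]) (if phi y then coord bB (a t) y *: w else 0) by [].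
rewrite big_mkcond [RHS]big_mkcond; apply: eq_bigr => y _; case: eqP => [->|yi].
  by case: asboolP => // /(wo_irr wo).
case: asboolP => //= nl; have [e|il] := wo_nlt wo nl; first by case: yi.
case: (phi y) => //; apply: contrapT => h; exact: (im y h il).
Qed.
End NoOpposite.

Lemma rgood_converse (R : nzRingType) (V : lmodType R) (X : eqType) (b : X -> V) (nc : bool)
    (s s' o p tau T1 T2 : (endo V)^c) : is_basis b -> rclass_ok nc R ->
  ~ rgood nc s s' o p tau T1 T2.
Proof.
move=> bB cls [_ _ _ _ [[irr tr tot nomax] [e0 he0] _ iso small]].
apply: (@no_opposite R V X b bB (rEE s s' o p) (rlt s s' o p T1 T2) nc e0 cls he0) => //.
- by move=> e [_ ee en ep]; split=> // g gg ge eg; apply: ep.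
- by move=> x xe; exact: small x e0 he0 xe.
Qed.
(** * Definability *)

Definition scons (T : Type) (x : T) (e : nat -> T) (n : nat) : T := if n is m.+1 then e m else x.
Definition upd (T : Type) (e : nat -> T) (i : nat) (x : T) : nat -> T := [eta e with i |-> x].

Lemma updE (T : Type) (e : nat -> T) i x n : upd e i x n = if n == i then x else e n.
Proof. by []. Qed.

(** Definability is treated semantically, as a predicate on valuations uniform in the group. The
    closure lemmas follow the shape of the predicate, and [gd] applies them mechanically. *)
Definition GD (P : forall G : groupType, (nat -> G) -> Prop) : Prop :=
  exists f, forall (G : groupType) (e : nat -> G), gholds e f <-> P G e.
Definition GT (t : forall G : groupType, (nat -> G) -> G) : Prop :=
  exists u, forall (G : groupType) (e : nat -> G), geval e u = t G e.

Section GroupFormulas.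
Implicit Types P Q : forall G : groupType, (nat -> G) -> Prop.

Lemma gterm_bound u : exists N, forall (G : groupType) (e e' : nat -> G), (forall k, (k < N)%N -> e k = e' k) -> geval e u = geval e' u.
Proof.
elim: u => [k||u [N uN] v [M vM]|u [N uN]].
- by exists k.+1 => G e e' h /=; apply: h.
- by exists 0%N.
- exists (maxn N M) => G e e' h /=; rewrite (uN G e e') ?(vM G e e') // => k kN; apply: h; rewrite leq_max kN ?orbT //.
- by exists N => G e e' h /=; rewrite (uN G e e').
Qed.

Lemma gformula_bound f : exists N, forall (G : groupType) (e e' : nat -> G), (forall k, (k < N)%N -> e k = e' k) ->
  (gholds e f <-> gholds e' f).
Proof.
have two N M (G : groupType) (e e' : nat -> G) : (forall k, (k < maxn N M)%N -> e k = e' k) ->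
    (forall k, (k < N)%N -> e k = e' k) /\ (forall k, (k < M)%N -> e k = e' k).
  by move=> h; split=> k kN; apply: h; rewrite leq_max kN ?orbT.
elim: f => [u v|f [N fN]|f [N fN] g [M gM]|f [N fN] g [M gM]|f [N fN] g [M gM]|i f [N fN]|i f [N fN]].
- have [N uN] := gterm_bound u; have [M vM] := gterm_bound v.
  by exists (maxn N M) => G e e' /two[h1 h2] /=; rewrite (uN G e e') ?(vM G e e').
- by exists N => G e e' h /=; rewrite (fN G e e').
- by exists (maxn N M) => G e e' /two[h1 h2] /=; rewrite (fN G e e') ?(gM G e e').
- by exists (maxn N M) => G e e' /two[h1 h2] /=; rewrite (fN G e e') ?(gM G e e').
- by exists (maxn N M) => G e e' /two[h1 h2] /=; rewrite (fN G e e') ?(gM G e e').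
- exists N => G e e' h /=; split=> H x; move: (H x); apply fN => k kN /=; case: eqP => // _; rewrite h //.
- exists N => G e e' h /=; split=> -[x H]; exists x; move: H; apply fN => k kN /=; case: eqP => // _; rewrite h //.
Qed.

Lemma gterm_ren u (r : nat -> nat) : exists u', forall (G : groupType) (e : nat -> G), geval e u' = geval (e \o r) u.
Proof.
elim: u => [k||u [u' uE] v [v' vE]|u [u' uE]].
- by exists (GVar (r k)).
- by exists GOne.
- by exists (GMul u' v') => G e /=; rewrite uE vE.
- by exists (GInv u') => G e /=; rewrite uE.
Qed.

(** The new bound name exceeds the images of all relevant variables, so renaming captures
    nothing. *)
Lemma ren_fresh (r : nat -> nat) i N : exists j, forall (G : groupType) (e : nat -> G) x k, (k < N)%N ->
  (upd e j x \o (fun k => if k == i then j else r k)) k = upd (e \o r) i x k.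
Proof.
exists (\max_(k < N) r k).+1 => G e x k kN; rewrite /= /upd /=; case: (k == i); first by rewrite eqxx.
case: eqP => // rk; have := leq_bigmax (F := fun k : 'I_N => r k) (Ordinal kN).
by rewrite /= rk ltnn.
Qed.

Lemma gformula_ren f : forall r : nat -> nat, exists f', forall (G : groupType) (e : nat -> G), gholds e f' <-> gholds (e \o r) f.
Proof.
elim: f => [u v|f IH|f IHf g IHg|f IHf g IHg|f IHf g IHg|i f IH|i f IH] r.
- have [u' uE] := gterm_ren u r; have [v' vE] := gterm_ren v r.
  by exists (GEq u' v') => G e /=; rewrite uE vE.
- by have [f' fE] := IH r; exists (GNot f') => G e /=; rewrite fE.
- by have [f' fE] := IHf r; have [g' gE] := IHg r; exists (GAnd f' g') => G e /=; rewrite fE gE.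
- by have [f' fE] := IHf r; have [g' gE] := IHg r; exists (GOr f' g') => G e /=; rewrite fE gE.
- by have [f' fE] := IHf r; have [g' gE] := IHg r; exists (GImp f' g') => G e /=; rewrite fE gE.
- have [N fN] := gformula_bound f; have [j jP] := ren_fresh r i N.
  have [f' fE] := IH (fun k => if k == i then j else r k); exists (GForall j f') => G e /=.
  by split=> H x; move: (H x); rewrite fE; apply fN => k kN; rewrite (jP G e x k kN).
- have [N fN] := gformula_bound f; have [j jP] := ren_fresh r i N.
  have [f' fE] := IH (fun k => if k == i then j else r k); exists (GExists j f') => G e /=.
  by split=> -[x H]; exists x; move: H; rewrite fE; apply fN => k kN; rewrite (jP G e x k kN).
Qed.

Lemma GD_ext P Q : (forall G e, P G e <-> Q G e) -> GD P -> GD Q.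
Proof. by move=> PQ [f fP]; exists f => G e; rewrite fP. Qed.
Lemma GD_ren P (r : nat -> nat) : GD P -> GD (fun G e => P G (fun n => e (r n))).
Proof. by move=> [f fP]; have [f' fE] := gformula_ren f r; exists f' => G e; rewrite fE fP. Qed.
Lemma GD_not P : GD P -> GD (fun G e => ~ P G e).
Proof. by move=> [f fP]; exists (GNot f) => G e /=; rewrite fP. Qed.
Lemma GD_and P Q : GD P -> GD Q -> GD (fun G e => P G e /\ Q G e).
Proof. by move=> [f fP] [g gP]; exists (GAnd f g) => G e /=; rewrite fP gP. Qed.
Lemma GD_and3 P Q P3 : GD P -> GD Q -> GD P3 -> GD (fun G e => [/\ P G e, Q G e & P3 G e]).
Proof.
move=> a c d; apply: GD_ext (GD_and a (GD_and c d)) => G e.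
by split=> [[? []]|[]].
Qed.
Lemma GD_and4 P Q P3 P4 : GD P -> GD Q -> GD P3 -> GD P4 -> GD (fun G e => [/\ P G e, Q G e, P3 G e & P4 G e]).
Proof.
move=> a c d f; apply: GD_ext (GD_and a (GD_and3 c d f)) => G e.
by split=> [[? []]|[]].
Qed.
Lemma GD_and5 P Q P3 P4 P5 : GD P -> GD Q -> GD P3 -> GD P4 -> GD P5 ->
  GD (fun G e => [/\ P G e, Q G e, P3 G e, P4 G e & P5 G e]).
Proof.
move=> a c d f g; apply: GD_ext (GD_and a (GD_and4 c d f g)) => G e.
by split=> [[? []]|[]].
Qed.
Lemma GD_imp P Q : GD P -> GD Q -> GD (fun G e => P G e -> Q G e).
Proof. by move=> [f fP] [g gP]; exists (GImp f g) => G e /=; rewrite fP gP. Qed.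
Lemma GD_exn P i : GD P -> GD (fun G e => exists x, P G (upd e i x)).
Proof. by move=> [f fP]; exists (GExists i f) => G e /=; split=> -[x h]; exists x; apply/fP. Qed.
Lemma GD_ex (Q : forall G : groupType, (nat -> G) -> G -> Prop) :
  GD (fun G e => Q G (fun n => e n.+1) (e 0%N)) -> GD (fun G e => exists x, Q G e x).
Proof.
move=> [f fP]; have [N fN] := gformula_bound f.
have [f' fE] := gformula_ren f (fun n => if n is m.+1 then m else N).
exists (GExists N f') => G e /=; split=> -[x h]; exists x; move: h; rewrite fE.
  have -> : Q G e x = Q G (fun n => scons x e n.+1) (scons x e 0%N) by [].
  rewrite -fP; apply fN => -[|k] kN /=; first by rewrite eqxx.
  by case: eqP => // kE; move: kN; rewrite kE ltnNge leqnSn.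
have -> : Q G e x = Q G (fun n => scons x e n.+1) (scons x e 0%N) by [].
rewrite -fP; apply fN => -[|k] kN /=; first by rewrite eqxx.
by case: eqP => // kE; move: kN; rewrite kE ltnNge leqnSn.
Qed.
Lemma GD_all (Q : forall G : groupType, (nat -> G) -> G -> Prop) :
  GD (fun G e => Q G (fun n => e n.+1) (e 0%N)) -> GD (fun G e => forall x, Q G e x).
Proof.
move=> h; apply: GD_ext (GD_not (@GD_ex (fun G e x => ~ Q G e x) (GD_not h))) => G e.
by split=> [H x|H [x]//]; apply: contrapT => n; apply: H; exists x.
Qed.
Lemma GT_var k : GT (fun G e => e k). Proof. by exists (GVar k). Qed.
Lemma GT_one : GT (fun G e => 1%g). Proof. by exists GOne. Qed.
Lemma GT_mul t u : GT t -> GT u -> GT (fun G e => (t G e * u G e)%g).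
Proof. by move=> [f fP] [g gP]; exists (GMul f g) => G e /=; rewrite fP gP. Qed.
Lemma GT_inv t : GT t -> GT (fun G e => (t G e)^-1%g).
Proof. by move=> [f fP]; exists (GInv f) => G e /=; rewrite fP. Qed.
Lemma GD_eq t u : GT t -> GT u -> GD (fun G e => t G e = u G e).
Proof. by move=> [f fP] [g gP]; exists (GEq f g) => G e /=; rewrite fP gP. Qed.
End GroupFormulas.

Ltac gd_step := first
  [ apply: GD_all => /= | apply: GD_ex => /= | apply: GD_and5 | apply: GD_and4 | apply: GD_and3 | apply: GD_and
  | apply: GD_not | apply: GD_eq | apply: GT_mul | apply: GT_inv | apply: GT_one | apply: GT_var | apply: GD_imp ].
Ltac gd := cbv beta zeta delta [ggood0 gshrink gmul gK gY gcz gtransv gpauli gpair gcm]; repeat gd_step.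

(** The ten entries are [m], [d1], [w1], [t1], [d2], [w2], [t2], [d3], [w3], [c], in this order. *)
Definition gparams_ok (G : groupType) (q : nat -> G) : Prop :=
  ggood0 (q 0%N) (q 1%N) (q 2) (q 3) (q 4) (q 5) (q 6) (q 7) (q 8) (q 9) /\
  gshrink (q 1%N) (q 2) (q 3) (q 4) (q 5) (q 6) (q 9).

Lemma GD_params : GD (fun G e => gparams_ok e).
Proof. by apply: GD_and; gd. Qed.

(* The ring O is coded by the group G with parameters q. *)
Definition gcoded (O : pzRingType) (G : groupType) (q : nat -> G) (g : O -> G) : Prop :=
  [/\ injective g, forall x, gY (q 1%N) (q 3) (q 4) (q 5) x <-> exists y, x = g y,
      forall x y, g (x + y) = (g x * g y)%g &
      forall x y z, gmul (q 1%N) (q 2) (q 3) (q 4) (q 6) (q 9) (g x) (g y) (g z) <-> z = x * y].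

Definition genv (O : pzRingType) (G : groupType) (q : nat -> G) (g : O -> G) (e : nat -> O) (n : nat) : G :=
  if (n < 10)%N then q n else g (e (n - 10)%N).

(** Ring predicates whose transport to any group coding the ring is definable there; [genv] lists
    the ten parameters first and then the codes of the ring variables. *)
Definition RG (P : forall O : pzRingType, (nat -> O) -> Prop) : Prop :=
  exists Q, GD Q /\ forall (O : pzRingType) (G : groupType) (q : nat -> G) (g : O -> G), gcoded q g ->
    forall e, Q G (genv q g e) <-> P O e.

Section RingFormulas.
Implicit Types P Q : forall O : pzRingType, (nat -> O) -> Prop.

Lemma genv10 (O : pzRingType) (G : groupType) (q : nat -> G) (g : O -> G) e k : genv q g e (10 + k) = g (e k).
Proof. by rewrite /genv ltnNge leq_addr /= addKn. Qed.

Lemma RG_add i j k : RG (fun O e => e i = e j + e k).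
Proof.
exists (fun G e => e (10 + i)%N = (e (10 + j) * e (10 + k))%g); split; first by gd.
move=> O G q g [gi _ gA _] e; rewrite !genv10 -gA; split=> [/gi//|->//].
Qed.

Lemma RG_mul i j k : RG (fun O e => e i = e j * e k).
Proof.
exists (fun G e => gmul (e 1%N) (e 2) (e 3) (e 4) (e 6) (e 9) (e (10 + j)%N) (e (10 + k)%N) (e (10 + i)%N)).
split; first by gd.
by move=> O G q g [gi _ gA gM] e; rewrite !genv10 -gM.
Qed.

Lemma RG_ext P Q : (forall O e, P O e <-> Q O e) -> RG P -> RG Q.
Proof. by move=> PQ [f [fd fP]]; exists f; split=> // O G q g h e; rewrite fP. Qed.
Lemma RG_ren P (r : nat -> nat) : RG P -> RG (fun O e => P O (fun n => e (r n))).
Proof.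
move=> [f [fd fP]]; exists (fun G e => f G (fun n => e (if (n < 10)%N then n else (10 + r (n - 10))%N))).
split; first exact: GD_ren.
move=> O G q g h e; rewrite -(fP _ _ _ _ h).
have -> // : (fun n => genv q g e (if (n < 10)%N then n else (10 + r (n - 10))%N)) = genv q g (fun n => e (r n)).
apply/funext => n; case: ifP => n10; last by rewrite genv10 /genv n10.
by rewrite /genv n10.
Qed.
Lemma RG_not P : RG P -> RG (fun O e => ~ P O e).
Proof. by move=> [f [fd fP]]; exists (fun G e => ~ f G e); split; [exact: GD_not|move=> O G q g h e; rewrite fP]. Qed.
Lemma RG_and P Q : RG P -> RG Q -> RG (fun O e => P O e /\ Q O e).
Proof.
move=> [f [fd fP]] [f' [fd' fP']]; exists (fun G e => f G e /\ f' G e).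
by split; [exact: GD_and|move=> O G q g h e; rewrite fP ?fP'].
Qed.
Lemma RG_ex (Q : forall O : pzRingType, (nat -> O) -> O -> Prop) :
  RG (fun O e => Q O (fun n => e n.+1) (e 0%N)) -> RG (fun O e => exists x, Q O e x).
Proof.
move=> [f [fd fP]].
(* The new variable is inserted at position 10, just behind the parameters. *)
pose r n := if (n < 10)%N then n.+1 else if n == 10 then 0%N else n.
exists (fun G e => exists x, gY (e 1%N) (e 3) (e 4) (e 5) x /\ f G (fun n => scons x e (r n))); split.
  apply: GD_ex; apply: GD_and; first by gd.
  apply: GD_ext (GD_ren r fd) => G e; suff -> : scons (e 0%N) (fun n => e n.+1) = e by [].
  by apply/funext => -[].
move=> O G q g h e.
have E1 x : (fun n => scons (g x) (genv q g e) (r n)) = genv q g (scons x e).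
  apply/funext => n; rewrite /r; have [n10|n10] := ltnP n 10; first by rewrite /= /genv n10.
  case: eqP => [->//|n10']; have [k nE] : exists k, n = (10 + k).+1 by exists (n - 11)%N; lia.
  by rewrite nE /scons genv10 -addnS genv10.
have [_ gYE _ _] := h; split=> [[x [/gYE[y ->]]]|[y]]; last first.
  by move=> Qy; exists (g y); split; [apply/gYE; exists y|rewrite E1 (fP _ _ _ _ h)].
by rewrite E1 (fP _ _ _ _ h) => Qy; exists y.
Qed.
Lemma RG_imp P Q : RG P -> RG Q -> RG (fun O e => P O e -> Q O e).
Proof.
move=> hP hQ; apply: RG_ext (RG_not (RG_and hP (RG_not hQ))) => O e.
by split=> [H p|H [p]]; [apply: contrapT => n; apply: H|apply; exact: H].
Qed.
Lemma RG_or P Q : RG P -> RG Q -> RG (fun O e => P O e \/ Q O e).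
Proof.
move=> hP hQ; apply: RG_ext (RG_imp (RG_not hP) hQ) => O e.
by split=> [H|[p []//|//]]; have [p|n] := pselect (P O e); [left|right; exact: H].
Qed.
Lemma RG_all (Q : forall O : pzRingType, (nat -> O) -> O -> Prop) :
  RG (fun O e => Q O (fun n => e n.+1) (e 0%N)) -> RG (fun O e => forall x, Q O e x).
Proof.
move=> h; apply: RG_ext (RG_not (@RG_ex (fun O e x => ~ Q O e x) (RG_not h))) => O e.
by split=> [H x|H [x]//]; apply: contrapT => n; apply: H; exists x.
Qed.
Lemma RG_exn P i : RG P -> RG (fun O e => exists x, P O (upd e i x)).
Proof.
move=> h; apply: RG_ex; apply: RG_ext (RG_ren (fun n => if n == i then 0%N else n.+1) h) => O e.
suff -> : (fun n => e (if n == i then 0%N else n.+1)) = upd (fun n => e n.+1) i (e 0%N) by [].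
by apply/funext => n; rewrite updE; case: eqP.
Qed.
Lemma RG_alln P i : RG P -> RG (fun O e => forall x, P O (upd e i x)).
Proof.
move=> h; apply: RG_ext (RG_not (RG_exn i (RG_not h))) => O e.
by split=> [H x|H [x]//]; apply: contrapT => n; apply: H; exists x.
Qed.
Lemma RG_exL P (L : seq nat) : RG P -> RG (fun O e => exists e', (forall n, n \notin L -> e' n = e n) /\ P O e').
Proof.
move=> h; elim: L => [|i L IH].
  apply: RG_ext h => O e; split=> [p|[e' [/(_ _ isT) he]]]; first by exists e.
  by have -> : e' = e by apply/funext => n; apply: he.
apply: RG_ext (RG_exn i IH) => O e; split=> [[x [e' [he p]]]|[e' [he p]]].
  exists e'; split=> // n; rewrite inE negb_or => /andP[ni nL]; rewrite he //.
  by rewrite updE (negbTE ni).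
exists (e' i), e'; split=> // n nL; rewrite updE; case: eqP => [->//|/eqP ni].
by apply: he; rewrite inE negb_or ni.
Qed.

Definition RT (t : forall O : pzRingType, (nat -> O) -> O) : Prop :=
  RG (fun O e => e 0%N = t O (fun n => e n.+1)).

Lemma RT_ren t (r : nat -> nat) m : RT t -> RG (fun O e => e m = t O (fun n => e (r n))).
Proof. by move=> h; apply: RG_ext (RG_ren (fun n => if n is k.+1 then r k else m) h) => O e. Qed.
Lemma RG_zero m : RG (fun O e => e m = 0).
Proof.
apply: RG_ext (RG_add m m m) => O e; split=> [h|->]; last by rewrite addr0.
by apply: (addrI (e m)); rewrite addr0 -h.
Qed.
Lemma RT_zero : RT (fun O e => 0). Proof. exact: RG_zero. Qed.
Lemma RG_eqv i j : RG (fun O e => e i = e j).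
Proof.
apply: RG_ext (RG_ex (Q := fun O e z => z = 0 /\ e i = e j + z) (RG_and (RG_zero 0) (RG_add i.+1 j.+1 0))) => O e.
by split=> [[z [-> ->]]|->]; [rewrite addr0|exists 0; rewrite addr0].
Qed.
Lemma RT_var k : RT (fun O e => e k). Proof. exact: RG_eqv. Qed.
Lemma RG_one m : RG (fun O e => e m = 1).
Proof.
apply: RG_ext (RG_all (Q := fun O e z => z = e m * z) (RG_mul 0 m.+1 0)) => O e.
by split=> [h|-> z]; rewrite ?mul1r // -[e m]mulr1 -h.
Qed.
Lemma RT_one : RT (fun O e => 1). Proof. exact: RG_one. Qed.
Lemma RT_mul t u : RT t -> RT u -> RT (fun O e => t O e * u O e).
Proof.
move=> ht hu; rewrite /RT.
apply: RG_ext (RG_ex (Q := fun O e y => exists z, y = t O (fun n => e n.+1) /\ z = u O (fun n => e n.+1) /\ e 0%N = y * z) _) => [O e|].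
  by split=> [[y [z [-> [-> ->]]]]//|->]; exists (t O (fun n => e n.+1)), (u O (fun n => e n.+1)).
apply: RG_ex; apply: RG_and; first exact: (RT_ren (fun n => n.+3) 1 ht).
by apply: RG_and; [exact: (RT_ren (fun n => n.+3) 0 hu)|exact: RG_mul].
Qed.
Lemma RG_eq t u : RT t -> RT u -> RG (fun O e => t O e = u O e).
Proof.
move=> ht hu; apply: RG_ext (RG_ex (Q := fun O e y => y = t O e /\ y = u O e) (RG_and ht hu)) => O e.
by split=> [[y [<- ]]//|h]; exists (t O e).
Qed.
Lemma RG_and3 P Q P3 : RG P -> RG Q -> RG P3 -> RG (fun O e => [/\ P O e, Q O e & P3 O e]).
Proof.
move=> a c d; apply: RG_ext (RG_and a (RG_and c d)) => G e.
by split=> [[? []]|[]].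
Qed.
Lemma RG_and4 P Q P3 P4 : RG P -> RG Q -> RG P3 -> RG P4 -> RG (fun O e => [/\ P O e, Q O e, P3 O e & P4 O e]).
Proof.
move=> a c d f; apply: RG_ext (RG_and a (RG_and3 c d f)) => G e.
by split=> [[? []]|[]].
Qed.
Lemma RG_and5 P Q P3 P4 P5 : RG P -> RG Q -> RG P3 -> RG P4 -> RG P5 ->
  RG (fun O e => [/\ P O e, Q O e, P3 O e, P4 O e & P5 O e]).
Proof.
move=> a c d f g; apply: RG_ext (RG_and a (RG_and4 c d f g)) => G e.
by split=> [[? []]|[]].
Qed.
Lemma RG_or3 P Q P3 : RG P -> RG Q -> RG P3 -> RG (fun O e => [\/ P O e, Q O e | P3 O e]).
Proof.
move=> a c d; apply: RG_ext (RG_or a (RG_or c d)) => G e.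
by split=> [[?|[?|?]]|[?|?|?]]; [constructor 1|constructor 2|constructor 3|left|right; left|right; right].
Qed.
End RingFormulas.

Ltac rg_step := lazymatch goal with
  | |- RT _ => first [ apply: RT_var | apply: RT_mul | apply: RT_one | apply: RT_zero ]
  | |- RG _ => first
    [ apply: RG_all => /= | apply: RG_ex => /= | apply: RG_and5 | apply: RG_and4 | apply: RG_and3 | apply: RG_or3
    | apply: RG_and | apply: RG_or | apply: RG_not | apply: RG_eq | apply: RG_imp ]
  end.
Ltac rg := cbv beta zeta delta [rgood rorder rclass rlt rCC rEE rD central]; repeat rg_step.

Lemma RG_EE i : RG (fun O e => rEE (e 0%N) (e 1%N) (e 2) (e 3) (e i)). Proof. by rg. Qed.
Lemma RG_CC nc i : RG (fun O e => rCC nc (e 0%N) (e 1%N) (e 2) (e 3) (e 4) (e i)).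
Proof. by case: nc; rg. Qed.
Lemma RG_good nc : RG (fun O e => rgood nc (e 0%N) (e 1%N) (e 2) (e 3) (e 4) (e 5) (e 6)).
Proof. by case: nc; rg. Qed.
(** * From the two-sorted language to the language of groups *)

(* Positions 0 to 6 are for the parameters s, s', o, p, tau, T1, T2; the codes of the
   three sorts of variables are interleaved above them. *)
Definition posS (i : nat) : nat := (7 + 3 * i)%N.
Definition posR (i : nat) : nat := (8 + 3 * i)%N.
Definition posP (p : pvar) (j : nat) : nat := (9 + 3 * pickle ((p : nat * nat * nat), j))%N.
Definition Lp (p : pvar) : seq nat := [seq posP p j | j <- iota 0 (set_arity p + ring_arity p).+1].

Lemma posP_inj p j p' j' : posP p j = posP p' j' -> p = p' /\ j = j'.
Proof.
move=> h; have /(pcan_inj pickleK)[-> ->//] : pickle ((p : nat * nat * nat), j) = pickle ((p' : nat * nat * nat), j').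
by move: h; rewrite /posP; lia.
Qed.

Lemma Lp_posP p p' j : posP p' j \in Lp p -> p' = p /\ (j < (set_arity p + ring_arity p).+1)%N.
Proof. by move=> /mapP[j']; rewrite mem_iota add0n => /andP[_ jn] /posP_inj[-> ->]. Qed.
Lemma Lp_posS p i : posS i \notin Lp p.
Proof. by apply/negP => /mapP[j _]; rewrite /posS /posP; lia. Qed.
Lemma Lp_posR p i : posR i \notin Lp p.
Proof. by apply/negP => /mapP[j _]; rewrite /posR /posP; lia. Qed.
Lemma Lp_base p n : (n < 7)%N -> n \notin Lp p.
Proof. by move=> n7; apply/negP => /mapP[j _]; rewrite /posP; lia. Qed.

(* A relation of size at most K is coded by elements c 0, c 1, etc: its members
   are listed by the k with c 0 * io k <> 0, the maps c j.+1 giving the entries. *)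
Definition trel (p : pvar) (s : (set_arity p).-tuple nat) (r : (ring_arity p).-tuple nat)
    (O : pzRingType) (e : nat -> O) : Prop :=
  exists i, [/\ rEE (e 0%N) (e 1%N) (e 2) (e 3) i, e (posP p 0) * i <> 0,
    forall j : 'I_(set_arity p), e (posS (tnth s j)) * e (posP p j.+1) * i = e (posP p j.+1) * i /\
      e (posP p j.+1) * i <> 0 &
    forall j : 'I_(ring_arity p), e (posP p (set_arity p + j).+1) * i = e (posR (tnth r j)) * i].

(* The products in RMul are reversed since ka is an anti-homomorphism. *)
Fixpoint tr (nc : bool) (f : formula2) (O : pzRingType) (e : nat -> O) {struct f} : Prop :=
  match f with
  | RAdd i j k => e (posR i) = e (posR j) + e (posR k)
  | RMul i j k => e (posR i) = e (posR k) * e (posR j)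
  | REq i j => e (posR i) = e (posR j)
  | SEq i j => e (posS i) = e (posS j)
  | Rel p s r => trel s r e
  | FNot f1 => ~ tr nc f1 e
  | FAnd f1 f2 => tr nc f1 e /\ tr nc f2 e
  | FOr f1 f2 => tr nc f1 e \/ tr nc f2 e
  | FImp f1 f2 => tr nc f1 e -> tr nc f2 e
  | SForall i f1 => forall x, rEE (e 0%N) (e 1%N) (e 2) (e 3) x -> tr nc f1 (upd e (posS i) x)
  | SExists i f1 => exists x, rEE (e 0%N) (e 1%N) (e 2) (e 3) x /\ tr nc f1 (upd e (posS i) x)
  | RForall i f1 => forall x, rCC nc (e 0%N) (e 1%N) (e 2) (e 3) (e 4) x -> tr nc f1 (upd e (posR i) x)
  | RExists i f1 => exists x, rCC nc (e 0%N) (e 1%N) (e 2) (e 3) (e 4) x /\ tr nc f1 (upd e (posR i) x)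
  | PForall p f1 => forall e', (forall n, n \notin Lp p -> e' n = e n) -> tr nc f1 e'
  | PExists p f1 => exists e', (forall n, n \notin Lp p -> e' n = e n) /\ tr nc f1 e'
  end.

Lemma RG_ord n (P : 'I_n -> forall O : pzRingType, (nat -> O) -> Prop) : (forall j, RG (P j)) ->
  RG (fun O e => forall j, P j O e).
Proof.
move=> h; suff H (l : seq 'I_n) : RG (fun O e => forall j, j \in l -> P j O e).
  apply: RG_ext (H (enum 'I_n)) => O e; split=> [H1 j|H1 j _]; last exact: H1.
  by apply: H1; rewrite mem_enum.
elim: l => [|j l IH].
  by apply: RG_ext (RG_eqv 0 0) => O e; split.
apply: RG_ext (RG_and (h j) IH) => O e; split=> [[h1 h2] j'|H1].
  by rewrite inE => /orP[/eqP ->//|]; exact: h2.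
by split=> [|j' jl]; apply: H1; rewrite inE ?eqxx // jl orbT.
Qed.

Lemma RG_tr nc f : RG (fun O e => tr nc f e).
Proof.
elim: f => [i j k|i j k|i j|i j|p s r|f IH|f IHf g IHg|f IHf g IHg|f IHf g IHg|i f IH|i f IH|i f IH|i f IH|p f IH|p f IH].
- exact: RG_add.
- exact: RG_mul.
- exact: RG_eqv.
- exact: RG_eqv.
- change (RG (fun O e => trel s r e)); rewrite /trel; apply: RG_ex => /=; apply: RG_and4; [exact: (RG_ren (fun n => if n is 4 then 0%N else n.+1) (RG_EE 4))|by rg| |].
    by apply: RG_ord => j; rg.
  by apply: RG_ord => j; rg.
- exact: RG_not.
- exact: RG_and.
- exact: RG_or.
- exact: RG_imp.
- exact: (RG_alln (posS i) (RG_imp (RG_EE (posS i)) IH)) || (apply: RG_ext (RG_alln (posS i) (RG_imp (RG_EE (posS i)) IH)) => O e /=;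
    by split=> H x; have := H x; rewrite !updE eqxx).
- by apply: RG_ext (RG_exn (posS i) (RG_and (RG_EE (posS i)) IH)) => O e /=;
    split=> -[x]; [rewrite !updE eqxx|] => H; exists x; rewrite ?updE ?eqxx.
- by apply: RG_ext (RG_alln (posR i) (RG_imp (RG_CC nc (posR i)) IH)) => O e /=;
    split=> H x; have := H x; rewrite !updE eqxx.
- by apply: RG_ext (RG_exn (posR i) (RG_and (RG_CC nc (posR i)) IH)) => O e /=;
    split=> -[x]; [rewrite !updE eqxx|] => H; exists x; rewrite ?updE ?eqxx.
- apply: RG_ext (RG_not (RG_exL (Lp p) (RG_not IH))) => O e /=.
  split=> [H e' he|H [e' [he n]]]; last by apply: n; exact: H.
  by apply: contrapT => n; apply: H; exists e'.
- exact: RG_exL.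
Qed.

Definition agr (ss rs : seq nat) (ps : seq pvar) (O : pzRingType) (e e' : nat -> O) : Prop :=
  [/\ forall n, (n < 7)%N -> e n = e' n, forall i, i \in ss -> e (posS i) = e' (posS i),
      forall i, i \in rs -> e (posR i) = e' (posR i) &
      forall p j, p \in ps -> (j < (set_arity p + ring_arity p).+1)%N -> e (posP p j) = e' (posP p j)].

Section Agreement.
Variables (ss rs : seq nat) (ps : seq pvar) (O : pzRingType) (e e' : nat -> O).
Hypothesis ee' : agr ss rs ps e e'.

Lemma agr_sym : agr ss rs ps e' e.
Proof.
case: ee' => h1 h2 h3 h4; split=> [n hn|i hi|i hi|p j hp hj]; apply/esym;
  [exact: h1|exact: h2|exact: h3|exact: h4].
Qed.

Lemma agr_upd i x n : (n != i -> e n = e' n) -> upd e i x n = upd e' i x n.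
Proof. by rewrite !updE; case: eqP => // _; apply. Qed.

Lemma agrS i x : agr (i :: ss) rs ps (upd e (posS i) x) (upd e' (posS i) x).
Proof.
case: ee' => h1 h2 h3 h4; split=> [n hn|k|k hk|p j hp hj]; try by apply: agr_upd => _; auto.
by rewrite inE => /orP[/eqP ->|hk]; [rewrite !updE eqxx|apply: agr_upd => _; exact: h2].
Qed.

Lemma agrR i x : agr ss (i :: rs) ps (upd e (posR i) x) (upd e' (posR i) x).
Proof.
case: ee' => h1 h2 h3 h4; split=> [n hn|k hk|k|p j hp hj]; try by apply: agr_upd => _; auto.
by rewrite inE => /orP[/eqP ->|hk]; [rewrite !updE eqxx|apply: agr_upd => _; exact: h3].
Qed.

Lemma agrP p (e1 : nat -> O) : (forall n, n \notin Lp p -> e1 n = e' n) ->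
  exists e2, (forall n, n \notin Lp p -> e2 n = e n) /\ agr ss rs (p :: ps) e2 e1.
Proof.
case: ee' => h1 h2 h3 h4 he1; exists (fun n => if n \in Lp p then e1 n else e n).
split=> [n /negbTE -> //|]; split=> [n hn|i hi|i hi|p' j].
- by rewrite (negbTE (Lp_base p hn)) he1 ?Lp_base // h1.
- by rewrite (negbTE (Lp_posS p i)) he1 ?Lp_posS // h2.
- by rewrite (negbTE (Lp_posR p i)) he1 ?Lp_posR // h3.
rewrite inE; have [//|nL /orP[/eqP pp hj|hp hj]] := boolP (posP p' j \in Lp p); last by rewrite he1 // h4.
by case/negP: nL; rewrite pp; apply: map_f; rewrite mem_iota -pp.
Qed.
End Agreement.

Lemma tr_agree nc f : forall ss rs ps (O : pzRingType) (e e' : nat -> O), free_in2 ss rs ps f ->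
  agr ss rs ps e e' -> tr nc f e -> tr nc f e'.
Proof.
elim: f => [i j k|i j k|i j|i j|p s r|f IH|f IHf g IHg|f IHf g IHg|f IHf g IHg|i f IH|i f IH|i f IH|i f IH|p f IH|p f IH] ss rs ps O e e' /= fr a;
  have [hb hS hR hP] := a; have [b0 b1 b2 b3 b4] : [/\ e 0%N = e' 0%N, e 1%N = e' 1%N, e 2 = e' 2, e 3 = e' 3 & e 4 = e' 4]
    by split; exact: hb.
- by move: fr => /and3P[hi hj hk]; rewrite !hR.
- by move: fr => /and3P[hi hj hk]; rewrite !hR.
- by move: fr => /andP[hi hj]; rewrite !hR.
- by move: fr => /andP[hi hj]; rewrite !hS.
- move: fr => /and3P[hp /allP hs /allP hr] [i [h1 h2 h3 h4]].
  have ha (j : 'I_(set_arity p)) : (j.+1 < (set_arity p + ring_arity p).+1)%N by rewrite ltnS ltn_addr.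
  have hb' (j : 'I_(ring_arity p)) : ((set_arity p + j).+1 < (set_arity p + ring_arity p).+1)%N by rewrite ltnS ltn_add2l.
  exists i; rewrite -b0 -b1 -b2 -b3 -(hP p 0%N hp (ltn0Sn _)); split=> // j.
    by rewrite -(hP p _ hp (ha j)) -hS ?hs ?mem_tnth //; exact: h3.
  by rewrite -(hP p _ hp (hb' j)) -hR ?hr ?mem_tnth //; exact: h4.
- by move=> n t; apply: n; exact: IH fr (agr_sym a) t.
- by move: fr => /andP[h1 h2] [t1 t2]; split; [exact: IHf h1 a t1|exact: IHg h2 a t2].
- by move: fr => /andP[h1 h2] [t1|t2]; [left; exact: IHf h1 a t1|right; exact: IHg h2 a t2].
- by move: fr => /andP[h1 h2] t t1; apply: (IHg _ _ _ _ _ _ h2 a); apply: t; exact: IHf h1 (agr_sym a) t1.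
- by move=> t x; rewrite -b0 -b1 -b2 -b3 => /t; apply: IH fr (agrS a _ _).
- by move=> [x]; rewrite b0 b1 b2 b3 => -[hx t]; exists x; split=> //; exact: IH fr (agrS a _ _) t.
- by move=> t x; rewrite -b0 -b1 -b2 -b3 -b4 => /t; apply: IH fr (agrR a _ _).
- by move=> [x]; rewrite b0 b1 b2 b3 b4 => -[hx t]; exists x; split=> //; exact: IH fr (agrR a _ _) t.
- by move=> t e1 /(agrP a)[e2 [h2 a2]]; apply: IH fr a2 (t _ h2).
- move=> [e1 [h1 t]]; have [e2 [h2 a2]] := agrP (agr_sym a) h1.
  by exists e2; split=> //; exact: IH fr (agr_sym a2) t.
Qed.

Lemma holds2_agree (K : Type) (R : nzRingType) f : forall ss rs ps (es es' : nat -> K) (er er' : nat -> R)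
    (ep ep' : forall p, relation2 K R p), free_in2 ss rs ps f -> {in ss, es =1 es'} -> {in rs, er =1 er'} ->
    (forall p, p \in ps -> ep p = ep' p) -> holds2 es er ep f -> holds2 es' er' ep' f.
Proof.
have U (T : Type) (l : seq nat) (e e' : nat -> T) i x : {in l, e =1 e'} -> {in i :: l, [eta e with i |-> x] =1 [eta e' with i |-> x]}.
  by move=> h n; rewrite inE /=; case: eqP => //= _; exact: h.
have UP (l : seq pvar) (ep ep' : forall p, relation2 K R p) p P : (forall p, p \in l -> ep p = ep' p) ->
    forall p', p' \in p :: l -> dfwith ep P p' = @dfwith pvar (relation2 K R) ep' p P p'.
  move=> h p'; rewrite inE; have [->|pp] := eqVneq p' p; first by rewrite !dfwith_in.
  by rewrite !dfwith_out 1?eq_sym //=; exact: h.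
have S (T : Type) (l : seq nat) (e e' : nat -> T) : {in l, e =1 e'} -> {in l, e' =1 e} by move=> h n hn; rewrite h.
elim: f => [i j k|i j k|i j|i j|p s r|f IH|f IHf g IHg|f IHf g IHg|f IHf g IHg|i f IH|i f IH|i f IH|i f IH|p f IH|p f IH] ss rs ps es es' er er' ep ep' /= fr hS hR hP.
- by move: fr => /and3P[hi hj hk]; rewrite !hR.
- by move: fr => /and3P[hi hj hk]; rewrite !hR.
- by move: fr => /andP[hi hj]; rewrite !hR.
- by move: fr => /andP[hi hj]; rewrite !hS.
- move: fr => /and3P[hp /allP hs /allP hr]; rewrite hP //.
  have -> : map_tuple es s = map_tuple es' s.
    by apply: eq_from_tnth => j; rewrite !tnth_map hS ?hs ?mem_tnth.
  by have -> : map_tuple er r = map_tuple er' r by apply: eq_from_tnth => j; rewrite !tnth_map hR ?hr ?mem_tnth.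
- move=> n t; apply: n; apply: (IH _ _ _ _ _ _ _ _ _ fr _ _ _ t); [exact: S|exact: S|by move=> p hp; rewrite hP].
- by move: fr => /andP[h1 h2] [t1 t2]; split; [exact: IHf h1 hS hR hP t1|exact: IHg h2 hS hR hP t2].
- by move: fr => /andP[h1 h2] [t1|t2]; [left; exact: IHf h1 hS hR hP t1|right; exact: IHg h2 hS hR hP t2].
- move: fr => /andP[h1 h2] t t1; apply: (IHg _ _ _ _ _ _ _ _ _ h2 hS hR hP); apply: t.
  by apply: (IHf _ _ _ _ _ _ _ _ _ h1 _ _ _ t1); [exact: S|exact: S|by move=> p hp; rewrite hP].
- by move=> t x; apply: IH fr (U _ _ _ _ _ _ hS) hR hP (t x).
- by move=> [x t]; exists x; apply: IH fr (U _ _ _ _ _ _ hS) hR hP t.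
- by move=> t x; apply: IH fr hS (U _ _ _ _ _ _ hR) hP (t x).
- by move=> [x t]; exists x; apply: IH fr hS (U _ _ _ _ _ _ hR) hP t.
- by move=> t P hK; apply: IH fr hS hR (UP _ _ _ _ _ hP) (t P hK).
- by move=> [P [hK t]]; exists P; split=> //; apply: IH fr hS hR (UP _ _ _ _ _ hP) t.
Qed.

(** * Faithfulness of the translation *)

Section Translation.
Variables (O : pzRingType) (nc : bool) (q : nat -> O) (K : Type) (R : nzRingType) (io : K -> O) (ka : R -> O).
Let EE := rEE (q 0%N) (q 1%N) (q 2) (q 3).
Let CC := rCC nc (q 0%N) (q 1%N) (q 2) (q 3) (q 4).
Hypothesis EEio : forall e, EE e <-> exists k, e = io k.
Hypothesis CCka : forall c, CC c <-> exists r, c = ka r.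
Hypothesis kaD : forall x y, ka (x + y) = ka x + ka y.
Hypothesis kaM : forall x y, ka (x * y) = ka y * ka x.
Hypothesis io_idem : forall k, io k * io k = io k.
Hypothesis io_neq0 : forall k, io k <> 0.
Hypothesis io_orth : forall k l, k <> l -> io k * io l = 0.
Hypothesis ka_inj : forall k x y, ka x * io k = ka y * io k -> x = y.
Hypothesis F1 : forall a : K -> K, exists T, forall k, io (a k) * T * io k = T * io k /\ T * io k <> 0.
Hypothesis F2 : forall r : K -> R, exists D, forall k, D * io k = ka (r k) * io k.

Lemma io_inj : injective io.
Proof.
move=> k l h; apply: contrapT => kl; have := @io_neq0 k; apply.
by rewrite -io_idem {2}h io_orth.
Qed.

Lemma ka_injective : K -> injective ka.
Proof. by move=> k x y h; apply: (ka_inj (k := k)); rewrite h. Qed.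

Lemma ka0 : ka 0 = 0.
Proof. by apply: (addrI (ka 0)); rewrite -kaD !addr0. Qed.

Definition codes (p : pvar) (c : nat -> O) (k : K) (x : (set_arity p).-tuple K * (ring_arity p).-tuple R) : Prop :=
  [/\ c 0%N * io k <> 0,
    forall j : 'I_(set_arity p), io (tnth x.1 j) * c j.+1 * io k = c j.+1 * io k /\ c j.+1 * io k <> 0 &
    forall j : 'I_(ring_arity p), c (set_arity p + j).+1 * io k = ka (tnth x.2 j) * io k].

Lemma codes_ext p (c c' : nat -> O) k x : (forall j, (j < (set_arity p + ring_arity p).+1)%N -> c j = c' j) ->
  @codes p c k x -> codes c' k x.
Proof.
move=> cc [h1 h2 h3]; split=> [|j|j]; first by rewrite -cc.
  by rewrite -cc ?ltnS ?ltn_addr //; exact: h2.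
by rewrite -cc ?ltnS ?ltn_add2l //; exact: h3.
Qed.

(** An index lists at most one member. Hence arbitrary elements code a relation of size at most that
    of [K], and [tr] can let relation codes range freely. *)
Lemma codes_inj p c k x x' : @codes p c k x -> codes c k x' -> x = x'.
Proof.
case: x x' => a r [a' r'] [_ h1 h2] [_ h1' h2']; congr (_, _); apply: eq_from_tnth => j.
  apply: contrapT => n; have [e1 n1] := h1 j; have [e2 _] := h1' j; apply: n1.
  by rewrite -e1 -mulrA -e2 !mulrA io_orth // !mul0r.
by apply: (ka_inj (k := k)); rewrite -h2 -h2'.
Qed.

Lemma codes_card p c : [set x | exists k, @codes p c k x] #<= [set: K].
Proof.
apply/card_le_embP.
have /ex_choice[f fP] : forall x : {x | [set x | exists k, @codes p c k x] x}, exists k, codes c k (sval x).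
  by move=> [x [k kx]]; exists k.
exists f => x y xy; apply: sval_inj; apply: (codes_inj (fP x)); rewrite xy; exact: fP.
Qed.

(** The partial inverse [g] of an injection of [P] into [K] turns the entries of the members into
    families indexed by [K], which [F1] and [F2] realise. Off the image of the injection values are
    arbitrary, since [D0] vanishes there. *)
Lemma codes_exist p (P : relation2 K R p) : P #<= [set: K] ->
  exists c, forall x, P x <-> exists k, codes c k x.
Proof.
move=> /card_le_embP[f fi].
have dec k : (exists x, f x = k) \/ ~ (exists x, f x = k) by exact: EM.
have /ex_choice[g gP] : forall k, exists y : option {x | P x}, if y is Some x then f x = k else forall x, f x <> k.
  move=> k; have [[x xk]|n] := dec k; first by exists (Some x).
  by exists None => x xk; apply: n; exists x.
have gf x : g (f x) = Some x.
  by have := gP (f x); case: (g (f x)) => [y /fi -> //|/(_ x)].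
have [D0 D0P] := F2 (fun k => if g k is Some _ then 1 else 0).
have /ex_choice[T TP] : forall j : 'I_(set_arity p), exists T, forall x : {x | P x},
    io (tnth (sval x).1 j) * T * io (f x) = T * io (f x) /\ T * io (f x) <> 0.
  move=> j; have [T TP] := F1 (fun k => if g k is Some x then tnth (sval x).1 j else k).
  by exists T => x; have := TP (f x); rewrite gf.
have /ex_choice[D DP] : forall j : 'I_(ring_arity p), exists D, forall x : {x | P x},
    D * io (f x) = ka (tnth (sval x).2 j) * io (f x).
  move=> j; have [D DP] := F2 (fun k => if g k is Some x then tnth (sval x).2 j else 0).
  by exists D => x; have := DP (f x); rewrite gf.
pose c n := if n is m.+1 then if insub m is Some j then T j else if insub (m - set_arity p)%N is Some j then D j else 0 else D0.
have cT (j : 'I_(set_arity p)) : c j.+1 = T j by rewrite /c valK.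
have cD (j : 'I_(ring_arity p)) : c (set_arity p + j).+1 = D j.
  by rewrite /c insubF ?ltnNge ?leq_addr // addKn valK.
have good x : codes c (f x) (sval x).
  split=> [|j|j]; rewrite ?cT ?cD //= D0P gf => h.
  have := @ka_inj (f x) 1 0; rewrite h ka0 mul0r => /(_ erefl)/eqP; by rewrite oner_eq0.
exists c => x; split=> [px|[k kx]].
  by exists (f (exist _ x px)); exact: (good (exist _ x px)).
case gk: (g k) => [y|]; last first.
  by case: kx => + _ _; rewrite /= D0P gk ka0 mul0r.
by have := gP k; rewrite gk => yk; rewrite (codes_inj kx (_ : codes c k (sval y))) -?yk //; exact: svalP.
Qed.

Definition env_ok (e : nat -> O) (es : nat -> K) (er : nat -> R) (ep : forall p, relation2 K R p) : Prop :=
  [/\ forall n, (n < 7)%N -> e n = q n, forall i, e (posS i) = io (es i), forall i, e (posR i) = ka (er i) &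
      forall p x, ep p x <-> exists k, codes (fun j => e (posP p j)) k x].

Lemma tr_sound f : forall e es er ep, env_ok e es er ep -> tr nc f e <-> holds2 es er ep f.
Proof.
have posRS i j : (posR i == posS j) = false by apply/eqP; rewrite /posR /posS; lia.
have posSR i j : (posS i == posR j) = false by apply/eqP; rewrite /posR /posS; lia.
have posPS p i j : (posP p i == posS j) = false by apply/eqP; rewrite /posP /posS; lia.
have posPR p i j : (posP p i == posR j) = false by apply/eqP; rewrite /posP /posR; lia.
have posb n j : (n < 7)%N -> (n == posS j) = false /\ (n == posR j) = false.
  by move=> n7; split; apply/eqP; rewrite /posS /posR; lia.
have okS e es er ep i k : env_ok e es er ep -> env_ok (upd e (posS i) (io k)) [eta es with i |-> k] er ep.
  move=> [h1 h2 h3 h4]; split=> [n n7|j|j|p x].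
  - by rewrite updE (posb n i n7).1 h1.
  - by rewrite updE /= /posS eqn_add2l eqn_pmul2l //; case: eqP => // _; exact: h2.
  - by rewrite updE posRS.
  - rewrite h4; suff -> : (fun j => upd e (posS i) (io k) (posP p j)) = (fun j => e (posP p j)) by [].
    by apply/funext => j; rewrite updE posPS.
have okR e es er ep i k : env_ok e es er ep -> env_ok (upd e (posR i) (ka k)) es [eta er with i |-> k] ep.
  move=> [h1 h2 h3 h4]; split=> [n n7|j|j|p x].
  - by rewrite updE (posb n i n7).2 h1.
  - by rewrite updE posSR.
  - by rewrite updE /= /posR eqn_add2l eqn_pmul2l //; case: eqP => // _; exact: h3.
  - rewrite h4; suff -> : (fun j => upd e (posR i) (ka k) (posP p j)) = (fun j => e (posP p j)) by [].
    by apply/funext => j; rewrite updE posPR.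
have okP e e' es er ep p (P : relation2 K R p) : env_ok e es er ep -> (forall n, n \notin Lp p -> e' n = e n) ->
    (forall x, P x <-> exists k, codes (fun j => e' (posP p j)) k x) ->
    env_ok e' es er (@dfwith pvar (relation2 K R) ep p P).
  move=> [h1 h2 h3 h4] he hP; split=> [n n7|j|j|p' x].
  - by rewrite he ?Lp_base // h1.
  - by rewrite he ?Lp_posS.
  - by rewrite he ?Lp_posR.
  - have [pp|pp] := eqVneq p p'; first by subst p'; rewrite dfwith_in.
    rewrite dfwith_out // h4; suff -> : (fun j => e' (posP p' j)) = (fun j => e (posP p' j)) by [].
    apply/funext => j; apply: he; apply/negP => /Lp_posP[p'p _]; by rewrite p'p eqxx in pp.
(* Only the finitely many positions [Lp p] change, so a relation quantifier becomes a finite block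
   of ring quantifiers. *)
have put (e : nat -> O) p (P : relation2 K R p) c : (forall x, P x <-> exists k, codes c k x) ->
    exists e', (forall n, n \notin Lp p -> e' n = e n) /\ forall x, P x <-> exists k, codes (fun j => e' (posP p j)) k x.
  move=> cP; exists (fun n => if n \in Lp p then c (index n (Lp p)) else e n); split=> [n /negbTE -> //|x].
  have E1 j : (j < (set_arity p + ring_arity p).+1)%N ->
      c j = (if posP p j \in Lp p then c (index (posP p j) (Lp p)) else e (posP p j)).
    move=> hj; have jL : posP p j \in Lp p by apply: map_f; rewrite mem_iota.
    rewrite jL /Lp index_map; last by move=> u v /posP_inj[].
    by rewrite -{2}[j]add0n -(nth_iota 0%N 0 hj) index_uniq ?size_iota ?iota_uniq.
  rewrite cP; split=> -[k kx]; exists k; apply: codes_ext kx => j hj; first exact: E1.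
  by rewrite -E1.
elim: f => [i j k|i j k|i j|i j|p s r|f IH|f IHf g IHg|f IHf g IHg|f IHf g IHg|i f IH|i f IH|i f IH|i f IH|p f IH|p f IH] e es er ep ok /=;
  have [hb hS hR hP] := ok; have [b0 b1 b2 b3 b4] : [/\ e 0%N = q 0%N, e 1%N = q 1%N, e 2 = q 2, e 3 = q 3 & e 4 = q 4]
    by split; exact: hb.
- have [k0 _] : exists k0 : K, True by exists (es 0%N).
  by rewrite !hR -kaD; split=> [/(ka_injective k0)|->].
- by rewrite !hR -kaM; split=> [/(ka_injective (es 0%N))|->].
- by rewrite !hR; split=> [/(ka_injective (es 0%N))|->].
- by rewrite !hS; split=> [/io_inj|->].
- rewrite hP /trel b0 b1 b2 b3; split=> [[x [/EEio[k ->] h1 h2 h3]]|[k [h1 h2 h3]]].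
    exists k; split=> // j; rewrite tnth_map; first by rewrite -hS; exact: h2.
    by rewrite -hR; exact: h3.
  exists (io k); split=> // [|j|j]; first by apply/EEio; exists k.
    by rewrite hS; have := h2 j; rewrite tnth_map.
  by rewrite hR; have := h3 j; rewrite tnth_map.
- by rewrite (IH _ _ _ _ ok).
- by rewrite (IHf _ _ _ _ ok) (IHg _ _ _ _ ok).
- by rewrite (IHf _ _ _ _ ok) (IHg _ _ _ _ ok).
- by rewrite (IHf _ _ _ _ ok) (IHg _ _ _ _ ok).
- rewrite b0 b1 b2 b3; split=> [t k|t x /EEio[k ->]]; last by apply/(IH _ _ _ _ (okS _ _ _ _ _ _ ok)).
  by apply/(IH _ _ _ _ (okS _ _ _ _ _ _ ok)); apply: t; apply/EEio; exists k.
- rewrite b0 b1 b2 b3; split=> [[x [/EEio[k ->] t]]|[k t]]; first by exists k; apply/(IH _ _ _ _ (okS _ _ _ _ _ _ ok)).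
  by exists (io k); split; [apply/EEio; exists k|apply/(IH _ _ _ _ (okS _ _ _ _ _ _ ok))].
- rewrite b0 b1 b2 b3 b4; split=> [t k|t x /CCka[k ->]]; last by apply/(IH _ _ _ _ (okR _ _ _ _ _ _ ok)).
  by apply/(IH _ _ _ _ (okR _ _ _ _ _ _ ok)); apply: t; apply/CCka; exists k.
- rewrite b0 b1 b2 b3 b4; split=> [[x [/CCka[k ->] t]]|[k t]]; first by exists k; apply/(IH _ _ _ _ (okR _ _ _ _ _ _ ok)).
  by exists (ka k); split; [apply/CCka; exists k|apply/(IH _ _ _ _ (okR _ _ _ _ _ _ ok))].
- split=> [t P PK|t e' he].
    have [c cP] := codes_exist PK.
    have [e' [he e'P]] := put e _ P c cP.
    by apply/(IH _ _ _ _ (okP _ _ _ _ _ _ P ok he e'P)); exact: t.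
  have ok' := okP e e' es er ep p [set x | exists k, codes (fun j => e' (posP p j)) k x] ok he (fun x => iff_refl _).
  by have := t _ (@codes_card p (fun j => e' (posP p j))); move/(IH _ _ _ _ ok').
- split=> [[e' [he t]]|[P [PK t]]].
    exists [set x | exists k, codes (fun j => e' (posP p j)) k x]; split; first exact: codes_card.
    by apply/(IH _ _ _ _ (okP e e' es er ep p [set x | exists k, codes (fun j => e' (posP p j)) k x] ok he (fun x => iff_refl _))).
  have [c cP] := codes_exist PK; have [e' [he e'P]] := put e _ P c cP.
  by exists e'; split=> //; apply/(IH _ _ _ _ (okP _ _ _ _ _ _ P ok he e'P)).
Qed.
End Translation.

Fixpoint gterm_vars (t : gterm) : seq nat :=
  match t with
  | GVar i => [:: i]
  | GOne => [::]
  | GMul t u => gterm_vars t ++ gterm_vars u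
  | GInv t => gterm_vars t
  end.
Fixpoint gformula_vars (f : gformula) : seq nat :=
  match f with
  | GEq t u => gterm_vars t ++ gterm_vars u
  | GNot f => gformula_vars f
  | GAnd f g | GOr f g | GImp f g => gformula_vars f ++ gformula_vars g
  | GForall _ f | GExists _ f => gformula_vars f
  end.
Definition gclose (f : gformula) : gformula := foldr GForall f (gformula_vars f).

Lemma gterm_vars_subset t xs : {subset gterm_vars t <= xs} -> gterm_vars_in xs t.
Proof.
elim: t => [i||t IHt u IHu|t IH] //= h; first by apply: h; rewrite inE.
by rewrite IHt ?IHu // => i iL; apply: h; rewrite mem_cat iL ?orbT.
Qed.

Lemma gformula_vars_subset f : forall xs, {subset gformula_vars f <= xs} -> gfree_in xs f.
Proof.
have two (l l' xs : seq nat) : {subset l ++ l' <= xs} -> {subset l <= xs} /\ {subset l' <= xs}.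
  by move=> h; split=> i iL; apply: h; rewrite mem_cat iL ?orbT.
elim: f => [t u|f IH|f IHf g IHg|f IHf g IHg|f IHf g IHg|i f IH|i f IH] xs /=; try by move=> /two[h1 h2]; rewrite ?IHf ?IHg ?gterm_vars_subset.
- exact: IH.
- by move=> h; apply: IH => j /h jx; rewrite inE jx orbT.
- by move=> h; apply: IH => j /h jx; rewrite inE jx orbT.
Qed.

Lemma gclose_sentence f : gsentence (gclose f).
Proof.
suff H l : forall xs, {subset gformula_vars f <= l ++ xs} -> gfree_in xs (foldr GForall f l).
  by apply: H => i; rewrite cats0.
elim: l => [|i l IH] xs h /=; first exact: gformula_vars_subset.
apply: IH => j /h; rewrite !mem_cat !inE -orbA => /or3P[->|->|->]; by rewrite ?orbT.
Qed.

Lemma gclose_holds (G : groupType) f : (forall e : nat -> G, gholds e (gclose f)) <-> forall e : nat -> G, gholds e f.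
Proof.
rewrite /gclose; elim: (gformula_vars f) => [//|i l IH] /=; rewrite -IH; split=> [h e|h e x]; last exact: h.
have : gholds (upd e i (e i)) (foldr GForall f l) := h e (e i).
suff -> : upd e i (e i) = e by [].
by apply/funext => n; rewrite updE; case: eqP => [->|].
Qed.

Lemma GD_sentence P : GD P -> exists f, forall G : groupType, group_theory G f <-> forall e, P G e.
Proof.
move=> [f fP]; exists (gclose f) => G; split=> [[_ /gclose_holds h] e|h]; first exact/fP.
by split; [exact: gclose_sentence|apply/gclose_holds => e; apply/fP].
Qed.

Lemma GD_exL P (L : seq nat) : GD P -> GD (fun G e => exists e', (forall n, n \notin L -> e' n = e n) /\ P G e').
Proof.
move=> h; elim: L => [|i L IH].
  apply: GD_ext h => O e; split=> [p|[e' [/(_ _ isT) he]]]; first by exists e.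
  by have -> : e' = e by apply/funext => n; apply: he.
apply: GD_ext (GD_exn i IH) => O e; split=> [[x [e' [he p]]]|[e' [he p]]].
  exists e'; split=> // n; rewrite inE negb_or => /andP[ni nL]; rewrite he //.
  by rewrite updE (negbTE ni).
exists (e' i), e'; split=> // n nL; rewrite updE; case: eqP => [->//|/eqP ni].
by apply: he; rewrite inE negb_or ni.
Qed.

(** * The interpreting sentence *)

Section Interpretation.
Variables (nc : bool) (psi : formula2).
Hypothesis psiS : sentence2 psi.

Definition rinterp (O : pzRingType) (e : nat -> O) : Prop :=
  exists e', (forall n, n \notin iota 0 7 -> e' n = e n) /\
    (rgood nc (e' 0%N) (e' 1%N) (e' 2) (e' 3) (e' 4) (e' 5) (e' 6) /\ tr nc psi e').

Lemma RG_rinterp : RG rinterp.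
Proof. by apply: RG_exL; apply: RG_and; [exact: RG_good|exact: RG_tr]. Qed.

(** Position 10 holds [1%g], the code of 0, and all variables beyond the parameters are read from
    it, so each has a code as its value. *)
Definition ginterp (Q : forall G : groupType, (nat -> G) -> Prop) (G : groupType) (e : nat -> G) : Prop :=
  exists q, (forall n, n \notin iota 0 11 -> q n = e n) /\
    [/\ gparams_ok q, q 10 = 1%g & Q G (fun n => q (if (n < 10)%N then n else 10))].

Lemma GD_ginterp Q : GD Q -> GD (ginterp Q).
Proof.
move=> hQ; apply: GD_exL; apply: GD_and3; [exact: GD_params|by apply: GD_eq; [exact: GT_var|exact: GT_one]|].
exact: (GD_ren (fun n => if (n < 10)%N then n else 10) hQ).
Qed.

Variables (R : nzRingType) (V : lmodType R) (X : eqType) (b : X -> V).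
Hypotheses (bB : is_basis b) (nX : emb nat X) (cls : rclass_ok nc R).

Lemma tr_theory (e : nat -> endo V) :
  rgood nc (e 0%N) (e 1%N) (e 2) (e 3) (e 4) (e 5) (e 6) -> tr nc psi e <-> Th2 X R psi.
Proof.
move=> /(ring_decode bB nX cls)[io [ka [[hE hC] [kD kM] [ii i0 io_o] kinj [F1 F2]]]].
have k0 : X by apply: (sval (cid (_ : exists _ : X, True))); case: nX => f _; exists (f 0%N).
(* Residues modulo 3 separate [posS], [posR] and [posP]; each kind gets a default code, where 0
   codes the empty relation. *)
pose e1 n := if (n < 7)%N then e n else if (n %% 3 == 1)%N then io k0 else if (n %% 3 == 2)%N then ka 0 else 0.
have eb n : (n < 7)%N -> e n = e1 n by rewrite /e1 => ->.
have ag : agr [::] [::] [::] e e1 by split.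
have ok : @env_ok (endo V) e X R io ka e1 (fun=> k0) (fun=> 0) (fun p => set0).
  have mS j : (posS j %% 3 = 1)%N by rewrite /posS mulnC addnC modnMDl.
  have mR j : (posR j %% 3 = 2)%N by rewrite /posR mulnC addnC modnMDl.
  have mP p j : (posP p j %% 3 = 0)%N by rewrite /posP mulnC addnC modnMDl.
  have nS j : (posS j < 7)%N = false by apply/negbTE; rewrite -leqNgt /posS leq_addr.
  have nR j : (posR j < 7)%N = false by apply/negbTE; rewrite -leqNgt /posR ltnW // leq_addr.
  have nP p j : (posP p j < 7)%N = false by apply/negbTE; rewrite -leqNgt /posP ltnW // ltnW // leq_addr.
  split=> [n n7|j|j|p x]; first by rewrite -eb.
  - by rewrite /e1 nS mS.
  - by rewrite /e1 nR mR.
  by split=> // -[k []]; rewrite /e1 nP mP mul0r.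
have S := tr_sound hE hC kD kM ii i0 io_o kinj F1 F2 psi ok.
split=> [t|[_ t]].
  split=> // es er ep; apply: (holds2_agree psiS (es := fun=> k0) (er := fun=> 0) (ep := fun p => set0)) => //.
  by apply/S; exact: tr_agree psiS ag t.
apply: (tr_agree psiS (agr_sym ag)); apply/S; exact: t.
Qed.

Hypotheses (nR : noidem R) (half : invertible (2%:R : R)).

Lemma rinterp_theory (e : nat -> endo V) : rinterp e <-> Th2 X R psi.
Proof.
split=> [[e' [_ [/tr_theory -> ]]]//|h].
have [s [s' [o [p [tau [T1 [T2 g]]]]]]] := rgood_exists bB nX nR cls.
pose e' n := if n is 0 then s else if n is 1 then s' else if n is 2 then o else if n is 3 then p
  else if n is 4 then tau else if n is 5 then T1 else if n is 6 then T2 else e n.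
exists e'; split; last by split=> //; apply/tr_theory.
by move=> n; do 7 (case: n => [//|n]).
Qed.

Lemma rinterp_converse (e : nat -> (endo V)^c) : ~ rinterp e.
Proof. by move=> [e' [_ [g _]]]; exact: (rgood_converse bB cls g). Qed.

(** Parameters may code [endo V] or its opposite, but in the second case [rinterp] is false. So the
    sentence can hold only through a coding of [endo V] itself, and [std_params] guarantees that one
    exists. *)
Lemma ginterp_theory Q : (forall (O : pzRingType) (G : groupType) (q : nat -> G) (g : O -> G), gcoded q g ->
    forall e, Q G (genv q g e) <-> rinterp e) ->
  (forall e, @ginterp Q (Aut V) e) <-> Th2 X R psi.
Proof.
move=> hQ.
have k0 : X by apply: (sval (cid (_ : exists _ : X, True))); case: nX => f _; exists (f 0%N).
have iu := @aut_unit_group R V.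
have [k kh] := endo_half V half.
have conn := endo_conn bB k0 nR.
have E10 := endo_one_neq0 bB k0.
have [x1 [x2 [y1 [y2 [r1 r2 r3 r4 r5]]]]] := endo_split bB nX.
have P0 := munits_pauli (std_munits r1 r2 r3 r4 r5).
have genvE (O : pzRingType) (q : nat -> Aut V) (g : O -> Aut V) : gcoded q g -> q 10 = 1%g ->
    (fun n => q (if (n < 10)%N then n else 10)) = genv q g (fun=> 0).
  move=> [_ _ gA _] q10; apply/funext => n; rewrite /genv; case: ifP => // _; rewrite q10.
  by apply: (mulgI (g 0)); rewrite -gA mulg1 addr0.
split=> [/(_ (fun=> 1%g))[q [_ [[good shr] q10 Qq]]]|h e].
  have [f [fi fY fD [fM|[_ fM]]]] := decode_mul iu kh P0 conn E10 good shr.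
    have gc : @gcoded (endo V) _ q f by split.
    by move: Qq; rewrite (genvE _ _ _ gc q10) (hQ _ _ _ _ gc) rinterp_theory.
  have gc : @gcoded (endo V)^c _ q f by split.
  by move: Qq; rewrite (genvE _ _ _ gc q10) (hQ _ _ _ _ gc) => /rinterp_converse.
have [m [d1 [w1 [t1 [d2 [w2 [t2 [d3 [w3 [c [good shr ori]]]]]]]]]]] := std_params iu kh conn E10 r1 r2 r3 r4 r5.
have [f [fi fY fD [fM|[//]]]] := decode_mul iu kh P0 conn E10 good shr.
pose q n := nth (e n) [:: m; d1; w1; t1; d2; w2; t2; d3; w3; c; 1%g] n.
have gc : @gcoded (endo V) _ q f by split.
exists q; split; last split=> //.
  by move=> n; rewrite mem_iota add0n /= => n11; rewrite /q nth_default // leqNgt.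
by rewrite (genvE _ _ _ gc) // (hQ _ _ _ _ gc) rinterp_theory.
Qed.
End Interpretation.

Theorem group_interprets (nc : bool) (psi : formula2) : sentence2 psi ->
  exists phi, forall (R : nzRingType) (V : lmodType R) (K : Type), rclass_ok nc R -> noidem R ->
    invertible (2%:R : R) -> infinite_set [set: K] -> free_of_rank V K ->
    group_theory (Aut V) phi <-> Th2 K R psi.
Proof.
move=> psiS; have [Q [QD hQ]] := RG_rinterp nc psi.
have [phi phiP] := GD_sentence (GD_ginterp QD); exists phi => R V K cls nR half /emb_nat_infinite nK [b bB].
rewrite phiP; pose X : eqType := HB.pack_for eqType K (gen_eqMixin K).
exact: (@ginterp_theory nc psi psiS R V X b bB nK cls nR half).
Qed.
(** * From the language of groups to the two-sorted language *)

(* Formulas of the two-sorted language with de Bruijn indices, the only predicate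
   variables being those for relations with two arguments in the set and one in the ring. *)
Inductive mformula : Type :=
| MAdd of nat & nat & nat
| MMul of nat & nat & nat
| MEqS of nat & nat
| MEqR of nat & nat
| MRel of nat & nat & nat & nat
| MNot of mformula
| MAnd of mformula & mformula
| MExS of mformula
| MExR of mformula
| MExP of mformula.

Definition pM (i : nat) : pvar := (2%N, 1%N, i).

(* Variables bound by the d enclosing quantifiers get even names, the other ones odd names. *)
Definition dbname (d k : nat) : nat := if (k < d)%N then (2 * (d - k.+1))%N else (2 * (k - d)).+1.

Fixpoint mtr (d m l : nat) (f : mformula) : formula2 :=
  match f with
  | MAdd i j k => RAdd (dbname m i) (dbname m j) (dbname m k)
  | MMul i j k => RMul (dbname m i) (dbname m j) (dbname m k)
  | MEqS i j => SEq (dbname d i) (dbname d j)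
  | MEqR i j => REq (dbname m i) (dbname m j)
  | MRel p i j k => @Rel (pM (dbname l p)) [tuple dbname d i; dbname d j] [tuple dbname m k]
  | MNot f => FNot (mtr d m l f)
  | MAnd f g => FAnd (mtr d m l f) (mtr d m l g)
  | MExS f => SExists (2 * d)%N (mtr d.+1 m l f)
  | MExR f => RExists (2 * m)%N (mtr d m.+1 l f)
  | MExP f => PExists (pM (2 * l)%N) (mtr d m l.+1 f)
  end.

Lemma dbname0 d : dbname d.+1 0 = (2 * d)%N.
Proof. by rewrite /dbname /= subn1. Qed.
Lemma dbnameS d k : dbname d.+1 k.+1 = dbname d k.
Proof. by rewrite /dbname ltnS !subSS. Qed.
Lemma dbname_fresh d k : (dbname d k == 2 * d)%N = false.
Proof. by apply/eqP; rewrite /dbname; case: ltnP; lia. Qed.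

Lemma upd_dbname (T : Type) (e : nat -> T) d x :
  (fun k => upd e (2 * d)%N x (dbname d.+1 k)) = scons x (fun k => e (dbname d k)).
Proof.
by apply/funext => -[|k]; rewrite updE ?dbname0 ?eqxx // dbnameS dbname_fresh.
Qed.

Section MSemantics.
Variables (K : Type) (R : nzRingType).
Definition rel3 : Type := K -> K -> R -> Prop.
Definition small (P : rel3) : Prop := [set x : K * K * R | P x.1.1 x.1.2 x.2] #<= [set: K].

Fixpoint mholds (es : nat -> K) (er : nat -> R) (ep : nat -> rel3) (f : mformula) : Prop :=
  match f with
  | MAdd i j k => er i = er j + er k
  | MMul i j k => er i = er j * er k
  | MEqS i j => es i = es j
  | MEqR i j => er i = er j
  | MRel p i j k => ep p (es i) (es j) (er k)
  | MNot f => ~ mholds es er ep f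
  | MAnd f g => mholds es er ep f /\ mholds es er ep g
  | MExS f => exists a, mholds (scons a es) er ep f
  | MExR f => exists x, mholds es (scons x er) ep f
  | MExP f => exists P, small P /\ mholds es er (scons P ep) f
  end.

Lemma card_le_transfer (T U : Type) (A : set T) (B : set U) (h : T -> U) : injective h ->
  (forall x, A x -> B (h x)) -> B #<= [set: K] -> A #<= [set: K].
Proof.
move=> hi AB /card_le_embP[g gi]; apply/card_le_embP.
exists (fun x => g (exist _ (h (sval x)) (AB _ (svalP x)))) => x y /gi [] /hi; exact: sval_inj.
Qed.

Lemma mtr_sound f : forall d m l es er (ep : forall p, relation2 K R p),
  holds2 es er ep (mtr d m l f) <->
  mholds (fun k => es (dbname d k)) (fun k => er (dbname m k))
    (fun k a c r => ep (pM (dbname l k)) ([tuple a; c], [tuple r])) f.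
Proof.
elim: f => [i j k|i j k|i j|i j|p i j k|f IH|f IHf g IHg|f IH|f IH|f IH] d m l es er ep //=.
- suff [-> ->] : map_tuple es [tuple dbname d i; dbname d j] = [tuple es (dbname d i); es (dbname d j)] /\
    map_tuple er [tuple dbname m k] = [tuple er (dbname m k)] by [].
  by split; apply: val_inj.
- by rewrite IH.
- by rewrite IHf IHg.
- split=> -[x h]; exists x; move: h; rewrite IH.
    by rewrite -[X in mholds X _ _ _]/(fun k => upd es (2 * d)%N x (dbname d.+1 k)) upd_dbname.
  by rewrite -[X in _ -> mholds X _ _ _]/(fun k => upd es (2 * d)%N x (dbname d.+1 k)) upd_dbname.
- split=> -[x h]; exists x; move: h; rewrite IH.
    by rewrite -[X in mholds _ X _ _]/(fun k => upd er (2 * m)%N x (dbname m.+1 k)) upd_dbname.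
  by rewrite -[X in _ -> mholds _ X _ _]/(fun k => upd er (2 * m)%N x (dbname m.+1 k)) upd_dbname.
have E (P : relation2 K R (pM (2 * l))) :
    (fun k a c r => @dfwith pvar (relation2 K R) ep _ P (pM (dbname l.+1 k)) ([tuple a; c], [tuple r])) =
    scons (fun a c r => P ([tuple a; c], [tuple r]) : Prop) (fun k a c r => ep (pM (dbname l k)) ([tuple a; c], [tuple r])).
  apply/funext => -[|k]; first by rewrite dbname0 dfwith_in.
  rewrite dbnameS dfwith_out //; apply/eqP => -[]; apply/eqP; rewrite eq_sym.
  by rewrite dbname_fresh.
split=> [[P [PK]]|[P [PK]]].
  rewrite IH E => h; exists (fun a c r => P ([tuple a; c], [tuple r])); split=> //.
  apply: (card_le_transfer (h := fun x : K * K * R => ([tuple x.1.1; x.1.2], [tuple x.2])) _ _ PK) => //.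
  by move=> [[a c] r] [[a' c'] r'] [-> -> ->].
pose P' : relation2 K R (pM (2 * l)) := fun x =>
  P (tnth x.1 (@Ordinal 2 0 isT)) (tnth x.1 (@Ordinal 2 1 isT)) (tnth x.2 (@Ordinal 1 0 isT)).
move=> h; exists P'; split.
  apply: (card_le_transfer (h := fun x : 2.-tuple K * 1.-tuple R =>
    (tnth x.1 (@Ordinal 2 0 isT), tnth x.1 (@Ordinal 2 1 isT), tnth x.2 (@Ordinal 1 0 isT))) _ _ PK) => // -[u v] [u' v'] /= [h0 h1 h2].
  congr (_, _); apply: eq_from_tnth => -[[|[|j]] jn] //.
  - by rewrite (_ : Ordinal jn = @Ordinal 2 0 isT) //; apply: val_inj.
  - by rewrite (_ : Ordinal jn = @Ordinal 2 1 isT) //; apply: val_inj.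
  by rewrite (_ : Ordinal jn = @Ordinal 1 0 isT) //; apply: val_inj.
by rewrite IH E.
Qed.
End MSemantics.

Definition HD (P : forall (K : Type) (R : nzRingType), (nat -> K) -> (nat -> R) -> (nat -> rel3 K R) -> Prop) : Prop :=
  exists f, forall K R es er ep, @mholds K R es er ep f <-> P K R es er ep.

Section MFormulas.
Implicit Types P Q : forall (K : Type) (R : nzRingType), (nat -> K) -> (nat -> R) -> (nat -> rel3 K R) -> Prop.

Lemma HD_ext P Q : (forall K R es er ep, P K R es er ep <-> Q K R es er ep) -> HD P -> HD Q.
Proof. by move=> PQ [f fP]; exists f => *; rewrite fP. Qed.
Lemma HD_add i j k : HD (fun K R es er ep => er i = er j + er k). Proof. by exists (MAdd i j k). Qed.
Lemma HD_mul i j k : HD (fun K R es er ep => er i = er j * er k). Proof. by exists (MMul i j k). Qed.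
Lemma HD_eqS i j : HD (fun K R es er ep => es i = es j). Proof. by exists (MEqS i j). Qed.
Lemma HD_eqR i j : HD (fun K R es er ep => er i = er j). Proof. by exists (MEqR i j). Qed.
Lemma HD_rel p i j k : HD (fun K R es er ep => ep p (es i) (es j) (er k)). Proof. by exists (MRel p i j k). Qed.
Lemma HD_not P : HD P -> HD (fun K R es er ep => ~ P K R es er ep).
Proof. by move=> [f fP]; exists (MNot f) => * /=; rewrite fP. Qed.
Lemma HD_and P Q : HD P -> HD Q -> HD (fun K R es er ep => P K R es er ep /\ Q K R es er ep).
Proof. by move=> [f fP] [g gP]; exists (MAnd f g) => * /=; rewrite fP gP. Qed.
Lemma HD_imp P Q : HD P -> HD Q -> HD (fun K R es er ep => P K R es er ep -> Q K R es er ep).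
Proof.
move=> hP hQ; apply: HD_ext (HD_not (HD_and hP (HD_not hQ))) => K R es er ep.
by split=> [H p|H [p]]; [apply: contrapT => n; apply: H|apply; exact: H].
Qed.
Lemma HD_or P Q : HD P -> HD Q -> HD (fun K R es er ep => P K R es er ep \/ Q K R es er ep).
Proof.
move=> hP hQ; apply: HD_ext (HD_imp (HD_not hP) hQ) => K R es er ep.
by split=> [H|[p []//|//]]; have [p|n] := pselect (P K R es er ep); [left|right; exact: H].
Qed.
Lemma HD_exS (Q : forall (K : Type) (R : nzRingType), (nat -> K) -> (nat -> R) -> (nat -> rel3 K R) -> K -> Prop) :
  HD (fun K R es er ep => Q K R (fun n => es n.+1) er ep (es 0%N)) -> HD (fun K R es er ep => exists a, Q K R es er ep a).
Proof. by move=> [f fP]; exists (MExS f) => K R es er ep; split=> -[a h]; exists a; exact/(fP K R (scons a es) er ep). Qed.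
Lemma HD_exR (Q : forall (K : Type) (R : nzRingType), (nat -> K) -> (nat -> R) -> (nat -> rel3 K R) -> R -> Prop) :
  HD (fun K R es er ep => Q K R es (fun n => er n.+1) ep (er 0%N)) -> HD (fun K R es er ep => exists a, Q K R es er ep a).
Proof. by move=> [f fP]; exists (MExR f) => K R es er ep; split=> -[a h]; exists a; exact/(fP K R es (scons a er) ep). Qed.
Lemma HD_exP (Q : forall (K : Type) (R : nzRingType), (nat -> K) -> (nat -> R) -> (nat -> rel3 K R) -> rel3 K R -> Prop) :
  HD (fun K R es er ep => Q K R es er (fun n => ep n.+1) (ep 0%N)) ->
  HD (fun K R es er ep => exists P : rel3 K R, small P /\ Q K R es er ep P).
Proof. by move=> [f fP]; exists (MExP f) => K R es er ep; split=> -[a [h1 h2]]; exists a; split=> //; exact/(fP K R es er (scons a ep)). Qed.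
Lemma HD_allS (Q : forall (K : Type) (R : nzRingType), (nat -> K) -> (nat -> R) -> (nat -> rel3 K R) -> K -> Prop) :
  HD (fun K R es er ep => Q K R (fun n => es n.+1) er ep (es 0%N)) -> HD (fun K R es er ep => forall a, Q K R es er ep a).
Proof.
move=> h; apply: HD_ext (HD_not (@HD_exS (fun K R es er ep a => ~ Q K R es er ep a) (HD_not h))) => K R es er ep.
by split=> [H x|H [x]//]; apply: contrapT => n; apply: H; exists x.
Qed.
Lemma HD_allR (Q : forall (K : Type) (R : nzRingType), (nat -> K) -> (nat -> R) -> (nat -> rel3 K R) -> R -> Prop) :
  HD (fun K R es er ep => Q K R es (fun n => er n.+1) ep (er 0%N)) -> HD (fun K R es er ep => forall a, Q K R es er ep a).
Proof.
move=> h; apply: HD_ext (HD_not (@HD_exR (fun K R es er ep a => ~ Q K R es er ep a) (HD_not h))) => K R es er ep.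
by split=> [H x|H [x]//]; apply: contrapT => n; apply: H; exists x.
Qed.
Lemma HD_allP (Q : forall (K : Type) (R : nzRingType), (nat -> K) -> (nat -> R) -> (nat -> rel3 K R) -> rel3 K R -> Prop) :
  HD (fun K R es er ep => Q K R es er (fun n => ep n.+1) (ep 0%N)) ->
  HD (fun K R es er ep => forall P : rel3 K R, small P -> Q K R es er ep P).
Proof.
move=> h; apply: HD_ext (HD_not (@HD_exP (fun K R es er ep a => ~ Q K R es er ep a) (HD_not h))) => K R es er ep.
by split=> [H x sx|H [x [sx]]]; [apply: contrapT => n; apply: H; exists x|apply; exact: H].
Qed.
End MFormulas.

Definition mem2 K R (N : rel3 K R) y z := exists r, N y z r.
(** Second-order reachability: a set is represented by the diagonal of a relation [X], and the walk
    stops at [x1], so it cannot run on past the end of the chain. *)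
Definition reach K R (N : rel3 K R) x0 x1 x := forall X : rel3 K R, small X -> (mem2 X x0 x0 ->
  (forall y z, mem2 X y y -> y <> x1 -> mem2 N y z -> mem2 X z z) -> mem2 X x x).
(* The elements reachable from x0 before x1 form a finite set: this is how finiteness is expressed. *)
Definition ischain K R (N : rel3 K R) x0 x1 := (forall y z z', mem2 N y z -> mem2 N y z' -> z = z') /\ reach N x0 x1 x1.
(** [z = z + z] stands for [z = 0]: the chain passes through the whole support of row [a]. *)
Definition pcover K R (P N : rel3 K R) a x0 x1 :=
  ischain N x0 x1 /\ forall d, ~ (exists z, z = z + z /\ P a d z) -> reach N x0 x1 d.
Definition pEndo K R (P : rel3 K R) :=
  (forall a c, exists r, P a c r /\ forall r', P a c r' -> r' = r) /\
  forall a, exists N : rel3 K R, small N /\ exists x0 x1, pcover P N a x0 x1.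
(** Row [a] holds the coordinates of the image of the basis vector [a] in a left module. The
    coefficient from [Q] therefore stands on the left, and the product is [P] after [Q]. *)
Definition pTerm K R (P Q : rel3 K R) a c x t := exists u v, Q a x u /\ P x c v /\ t = u * v.
(* The entry of the product is computed by partial sums s along a chain. *)
Definition pMul K R (P Q S : rel3 K R) := forall a c, exists N : rel3 K R, small N /\ exists s : rel3 K R, small s /\ exists x0 x1,
  pcover Q N a x0 x1 /\ (forall y, exists r, s y y r) /\ (forall r, s x0 x0 r -> pTerm P Q a c x0 r) /\
  (forall y z r r', y <> x1 -> mem2 N y z -> s y y r -> s z z r' -> exists t, pTerm P Q a c z t /\ r' = r + t) /\
  forall r, s x1 x1 r -> S a c r.
(** The constants 1 and 0 are not in the language and are described by [x = x * r] for all [x] and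
    by [r = r + r]. *)
Definition pOne K R (I : rel3 K R) :=
  forall a c r, I a c r <-> (a = c /\ forall x, x = x * r) \/ (a <> c /\ r = r + r).
Definition pAut K R (P : rel3 K R) := pEndo P /\ exists Q : rel3 K R, small Q /\ (pEndo Q /\ exists I : rel3 K R, small I /\
  (pOne I /\ pMul P Q I /\ pMul Q P I)).

Ltac hd_step := first
  [ apply: HD_allP => /= | apply: HD_exP => /= | apply: HD_allS => /= | apply: HD_allR => /= | apply: HD_exS => /= | apply: HD_exR => /=
  | apply: HD_and | apply: HD_or | apply: HD_not | apply: HD_rel | apply: HD_eqS | apply: HD_add | apply: HD_mul | apply: HD_eqR
  | apply: HD_imp ].
Ltac hd := cbv beta zeta delta [pAut pMul pEndo pcover ischain reach pTerm pOne mem2 iff]; repeat hd_step.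

Lemma HD_pAut i : HD (fun K R es er ep => pAut (ep i)). Proof. by hd. Qed.
Lemma HD_pMul i j k : HD (fun K R es er ep => pMul (ep i) (ep j) (ep k)). Proof. by hd. Qed.
Lemma HD_pOne i : HD (fun K R es er ep => pOne (ep i)). Proof. by hd. Qed.
Lemma HD_same i j : HD (fun K R es er ep => forall a c r, ep i a c r <-> ep j a c r). Proof. by hd. Qed.

Lemma mtr_free F : exists N, forall d m l ss rs ps, (forall i, (i < N)%N -> dbname d i \in ss) ->
  (forall i, (i < N)%N -> dbname m i \in rs) -> (forall i, (i < N)%N -> pM (dbname l i) \in ps) ->
  free_in2 ss rs ps (mtr d m l F).
Proof.
have S (L : seq nat) d N : (forall i, (i < N)%N -> dbname d i \in L) ->
    forall i, (i < N)%N -> dbname d.+1 i \in (2 * d)%N :: L.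
  by move=> h [|i] iN; rewrite inE ?dbname0 ?eqxx // dbnameS h ?orbT // ltnW.
elim: F => [i j k|i j k|i j|i j|p i j k|f [N IH]|f [N IHf] g [M IHg]|f [N IH]|f [N IH]|f [N IH]].
- by exists (i + j + k).+1 => d m l ss rs ps hs hr hp /=; rewrite !hr //; lia.
- by exists (i + j + k).+1 => d m l ss rs ps hs hr hp /=; rewrite !hr //; lia.
- by exists (i + j).+1 => d m l ss rs ps hs hr hp /=; rewrite !hs //; lia.
- by exists (i + j).+1 => d m l ss rs ps hs hr hp /=; rewrite !hr //; lia.
- by exists (p + i + j + k).+1 => d m l ss rs ps hs hr hp /=; rewrite hp ?hs ?hr //; lia.
- by exists N => d m l ss rs ps hs hr hp /=; exact: IH.
- exists (N + M)%N => d m l ss rs ps hs hr hp /=; rewrite IHf ?IHg // => i iN; rewrite ?hs ?hr ?hp //; lia.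
- by exists N => d m l ss rs ps hs hr hp /=; apply: IH => //; exact: S.
- by exists N => d m l ss rs ps hs hr hp /=; apply: IH => //; exact: S.
exists N => d m l ss rs ps hs hr hp /=; apply: IH => // -[|i] iN; rewrite inE ?dbname0 ?eqxx //.
by rewrite dbnameS hp ?orbT // ltnW.
Qed.

(** The truth of [F] may not depend on its free variables, so closing it by universal quantifiers is
    harmless: an element of [K], the ring element 0 and the empty relation are available as
    instances. *)
Lemma HD_sentence F : exists psi, sentence2 psi /\ forall (K : Type) (R : nzRingType) (S : Prop), K ->
  (forall es er ep, @mholds K R es er ep F <-> S) -> Th2 K R psi <-> S.
Proof.
have [N hN] := mtr_free F.
pose ss := [seq dbname 0 i | i <- iota 0 N]; pose ps : seq pvar := [seq pM (dbname 0 i) | i <- iota 0 N].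
pose f := foldr SForall (foldr RForall (foldr PForall (mtr 0 0 0 F) ps) ss) ss.
have fS : sentence2 f.
  have A1 (l xs rs : seq nat) (qs : seq pvar) g : free_in2 (rev l ++ xs) rs qs g -> free_in2 xs rs qs (foldr SForall g l).
    by elim: l xs => [//|i l IH] xs h /=; apply: IH; rewrite -cat_rcons -rev_cons.
  have A2 (l xs rs : seq nat) (qs : seq pvar) g : free_in2 xs (rev l ++ rs) qs g -> free_in2 xs rs qs (foldr RForall g l).
    by elim: l rs => [//|i l IH] rs h /=; apply: IH; rewrite -cat_rcons -rev_cons.
  have A3 (xs rs : seq nat) (l qs : seq pvar) g : free_in2 xs rs (rev l ++ qs) g -> free_in2 xs rs qs (foldr PForall g l).
    by elim: l qs => [//|i l IH] qs h /=; apply: IH; rewrite -cat_rcons -rev_cons.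
  apply: A1; apply: A2; apply: A3; apply: hN => i iN; rewrite cats0 mem_rev; apply/mapP; exists i => //; by rewrite mem_iota.
exists f; split=> // K R S k0 h.
have H0 es er (ep : forall p, relation2 K R p) : holds2 es er ep (mtr 0 0 0 F) <-> S by rewrite mtr_sound.
have H1 l : forall es er (ep : forall p, relation2 K R p), holds2 es er ep (foldr PForall (mtr 0 0 0 F) l) <-> S.
  elim: l => [//|p l IH] es er ep /=; split=> [t|s P _]; last exact/IH.
  by apply/(IH es er (dfwith ep (set0 : relation2 K R p))); apply: t; apply: card_ge0.
have H2 l : forall es er (ep : forall p, relation2 K R p), holds2 es er ep (foldr RForall (foldr PForall (mtr 0 0 0 F) ps) l) <-> S.
  by elim: l => [|i l IH] es er ep /=; [exact: H1|split=> [/(_ 0) /IH|s x]; last exact/IH].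
have H3 l : forall es er (ep : forall p, relation2 K R p), holds2 es er ep (foldr SForall (foldr RForall (foldr PForall (mtr 0 0 0 F) ps) ss) l) <-> S.
  by elim: l => [|i l IH] es er ep /=; [exact: H2|split=> [/(_ k0) /IH|s x]; last exact/IH].
split=> [[_ /(_ (fun=> k0) (fun=> 0) (fun=> set0)) /H3 //]|s].
by split=> // es er ep; apply/H3.
Qed.

(** * Endomorphisms as matrices with finitely supported rows *)

Section Matrices.
Variables (R : nzRingType) (V : lmodType R) (X : eqType) (b : X -> V).
Hypotheses (bB : is_basis b) (nX : emb nat X).
Notation E := (endo V).

Definition mat (f : E) : rel3 X R := fun a c r => coord bB (app f (b a)) c = r.

Lemma mat_inj f g : mat f = mat g -> f = g.
Proof.
move=> h; apply: (endo_extb bB) => x; apply: (coord_inj bB) => c.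
by have : mat f x c (coord bB (app f (b x)) c) by []; rewrite h => /esym.
Qed.

Lemma small_fun (P : rel3 X R) : (forall a c r r', P a c r -> P a c r' -> r = r') -> small P.
Proof.
move=> Pf; apply/card_le_embP; apply: emb_trans (emb_square nX).
exists (fun x => (sval x).1) => -[[[a c] r] /= Px] [[[a' c'] r'] /= Px'] [ea ec]; apply: sval_inj => /=.
by subst a' c'; rewrite (Pf _ _ _ _ Px Px').
Qed.

Lemma mat_small f : small (mat f).
Proof. by apply: small_fun => a c r r' <- <-. Qed.

(** A binary relation in the guise of a ternary one: fixing the ring entry at 0 keeps its size
    within that of [X]. *)
Definition chain_of (x0 : X) (l : seq X) : rel3 X R := fun y z r =>
  r = 0 /\ exists i, [/\ (i < size l)%N, y = nth x0 (x0 :: l) i & z = nth x0 l i].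

Lemma chain_of_small x0 l : small (chain_of x0 l).
Proof. by apply: small_fun => a c r r' [-> _] [-> _]. Qed.

Lemma chain_ofP x0 l y z : mem2 (chain_of x0 l) y z <->
  exists i, [/\ (i < size l)%N, y = nth x0 (x0 :: l) i & z = nth x0 l i].
Proof. by split=> [[r []]|h]; [|exists 0]. Qed.

Lemma chain_of_reach x0 l d : uniq (x0 :: l) -> d \in x0 :: l -> reach (chain_of x0 l) x0 (last x0 l) d.
Proof.
move=> ul dl Y _ Y0 YS; rewrite -(nth_index x0 dl); move: (index d (x0 :: l)) (index_mem d (x0 :: l)).
rewrite dl => i; elim: i => [//|i IH] il.
apply: (YS (nth x0 (x0 :: l) i)); first by apply: IH; apply: ltnW.
  rewrite (last_nth x0) => /eqP; rewrite nth_uniq //=; last exact: ltnW.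
  by move: il; rewrite /= ltnS => + /eqP e; rewrite e ltnn.
by apply/chain_ofP; exists i.
Qed.

Lemma chain_ofC x0 l : uniq (x0 :: l) -> ischain (chain_of x0 l) x0 (last x0 l).
Proof.
move=> ul; split; last by apply: chain_of_reach => //; exact: mem_last.
move=> y z z' /chain_ofP[i [il -> ->]] /chain_ofP[j [jl + ->]] => /eqP.
by rewrite nth_uniq //= ?ltnS ?(ltnW il) ?(ltnW jl) // => /eqP ->.
Qed.

Definition stepb (N : rel3 X R) : rel X := fun y z => `[< mem2 N y z >].

(** The set of points lying on finite paths from [x0] is itself an admissible value of the
    quantifier in [reach], which yields a path to [x1]. Functionality of the relation then confines
    everything reachable to this path. *)
Lemma ischain_path N x0 x1 : ischain N x0 x1 -> exists l, [/\ uniq (x0 :: l), last x0 l = x1,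
  path (stepb N) x0 l & forall d, reach N x0 x1 d -> d \in x0 :: l].
Proof.
move=> [Nf Nr].
have ind (C : X -> Prop) d : reach N x0 x1 d -> C x0 -> (forall y z, C y -> y <> x1 -> mem2 N y z -> C z) -> C d.
  move=> hd C0 CS; pose Y : rel3 X R := fun x y r => r = 0 /\ x = y /\ C x.
  have mY x : mem2 Y x x <-> C x by split=> [[r [_ [_]]]//|h]; exists 0.
  have sY : small Y by apply: small_fun => a c r r' [-> _] [-> _].
  have := hd Y sY; rewrite !mY; apply=> // y z; rewrite !mY; exact: CS.
have [l [pl ll]] : exists l, path (stepb N) x0 l /\ last x0 l = x1.
  apply: (ind (fun x => exists l, path (stepb N) x0 l /\ last x0 l = x) _ Nr); first by exists [::].
  move=> y z [l [pl ll]] _ yz; exists (rcons l z); rewrite rcons_path pl last_rcons ll; split=> //=.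
  exact/asboolP.
move: ll; case/shortenP: pl => l' pl' ul' _ ll; exists l'; split=> // d hd.
apply: (ind (fun x => x \in x0 :: l') _ hd); first exact: mem_head.
move=> y z yl yx yz.
have iy : (index y (x0 :: l') < size l')%N.
  have := yl; rewrite -index_mem /= ltnS leq_eqVlt => /orP[/eqP e|//].
  by case: yx; rewrite -ll (last_nth x0) -e nth_index.
have /(pathP x0)/(_ _ iy)/asboolP := pl'; rewrite nth_index // => yz'.
by rewrite (Nf _ _ _ yz yz'); apply: (@mem_behead _ (x0 :: l')); exact: mem_nth.
Qed.

Lemma mat_nonzero f a d : (exists z, z = z + z /\ mat f a d z) <-> coord bB (app f (b a)) d = 0.
Proof.
split=> [[z [zz ->]]|h]; last by exists 0; rewrite addr0.
by apply: (addrI z); rewrite -zz addr0.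
Qed.

Lemma mat_cover f a : exists x0 l, [/\ uniq (x0 :: l), pcover (mat f) (chain_of x0 l) a x0 (last x0 l) &
  forall d, coord bB (app f (b a)) d <> 0 -> d \in x0 :: l].
Proof.
have [s [us _ sup]] := basis_expand bB (app f (b a)).
have [k _] : exists k : X, True by case: nX => g _; exists (g 0%N).
have [l [ul sl]] : exists l, uniq (k :: l) /\ {subset s <= k :: l}.
  exists (rem k s); split; first by rewrite /= mem_rem_uniqF // rem_uniq.
  move=> x xs; rewrite inE; have [//|xk] := eqVneq x k.
  by rewrite (rem_filter _ us) mem_filter /= xk xs.
exists k, l; split=> // [|d /sup /sl //]; split; first exact: chain_ofC.
move=> d nd; apply: chain_of_reach => //; apply: sl; apply: sup => h; apply: nd; exact/mat_nonzero.
Qed.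

Lemma mat_endo f : pEndo (mat f).
Proof.
split=> [a c|a]; first by exists (coord bB (app f (b a)) c); split.
have [x0 [l [ul cov _]]] := mat_cover f a; exists (chain_of x0 l); split; first exact: chain_of_small.
by exists x0, (last x0 l).
Qed.

Lemma coord_sumb (l : seq X) (c : X -> R) y : uniq l -> (y \notin l -> c y = 0) ->
  coord bB (\sum_(x <- l) c x *: b x) y = c y.
Proof.
move=> ul cy; rewrite coord_sum; have [yl|/[dup] yl /cy ->] := boolP (y \in l).
  rewrite (bigD1_seq y) //= coord_b eqxx mulr1 big1 ?addr0 // => x xy.
  by rewrite coord_b (negbTE xy) mulr0.
rewrite big_seq big1 // => x xl; rewrite coord_b; case: eqP => [e|_]; last by rewrite mulr0.
by rewrite -e xl in yl.
Qed.

Lemma endo_mat P : pEndo P -> exists f, P = mat f.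
Proof.
move=> [tot fin].
have /ex_choice[p pP] : forall x : X * X, exists r, P x.1 x.2 r /\ forall r', P x.1 x.2 r' -> r' = r.
  by move=> [a c]; exact: tot.
have /ex_choice[l lP] : forall a, exists l, uniq l /\ forall d, d \notin l -> p (a, d) = 0.
  move=> a; have [N [_ [x0 [x1 [cN cov]]]]] := fin a.
  have [l [ul _ _ hl]] := ischain_path cN; exists (x0 :: l); split=> // d dl.
  apply: contrapT => n; case/negP: dl; apply: hl; apply: cov => -[z [zz Pz]]; apply: n.
  have [_ u] := pP (a, d); rewrite -(u _ Pz).
  by apply: (addrI z); rewrite -zz addr0.
exists (lifte bB (fun a => \sum_(x <- l a) p (a, x) *: b x)).
apply/funext => a; apply/funext => c; apply/funext => r; apply/propext; rewrite /mat lifteE.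
have [ul l0] := lP a; rewrite (@coord_sumb (l a) (fun x => p (a, x))) //; last exact: l0.
by have [h1 h2] := pP (a, c); split=> [/h2|<-].
Qed.

Lemma coord_comp f g a c (l : seq X) : uniq l -> (forall d, coord bB (app g (b a)) d <> 0 -> d \in l) ->
  coord bB (app (f * g) (b a)) c = \sum_(d <- l) coord bB (app g (b a)) d * coord bB (app f (b d)) c.
Proof.
move=> ul hl; have e : \sum_(d <- l) coord bB (app g (b a)) d *: b d = app g (b a).
  apply: (coord_inj bB) => y; rewrite (@coord_sumb l (fun d => coord bB (app g (b a)) d)) // => yl.
  by apply: contrapT => /hl; rewrite (negbTE yl).
by rewrite appM -[in LHS]e (lin_sum (app_lin f)) coord_sum.
Qed.

Lemma mat_term f g a c x t : pTerm (mat f) (mat g) a c x t <->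
  t = coord bB (app g (b a)) x * coord bB (app f (b x)) c.
Proof. by split=> [[u [v [-> [-> ->]]]]//|->]; do 2 eexists. Qed.

(** In one direction the partial sums are added up along the path. In the other, [S y] sums the
    terms of the chain up to and including [y]. *)
Lemma mat_mul f g h : pMul (mat f) (mat g) (mat h) <-> h = f * g.
Proof.
split=> [H|-> a c].
  apply: (endo_extb bB) => a; apply: (coord_inj bB) => c.
  have [N [_ [s [_ [x0 [x1 [[cN cov] [stot [s0 [sS s1]]]]]]]]]] := H a c.
  have [l [ul ll pl hl]] := ischain_path cN.
  have hl' d : coord bB (app g (b a)) d <> 0 -> d \in x0 :: l.
    by move=> nd; apply: hl; apply: cov => /mat_nonzero.
  pose T d := coord bB (app g (b a)) d * coord bB (app f (b d)) c.
  rewrite (coord_comp f c ul hl' : _ = \sum_(d <- x0 :: l) T d).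
  have ind : forall l x r, path (stepb N) x l -> (forall y, y \in belast x l -> y <> x1) -> s x x r ->
      exists r', s (last x l) (last x l) r' /\ r' = r + \sum_(d <- l) T d.
    elim=> [|z l' IH] x r /=; first by move=> _ _ sr; exists r; rewrite big_nil addr0.
    move=> /andP[/asboolP xz pl'] nl sr; have [rz srz] := stot z.
    have [t [/mat_term tE rzE]] := sS x z r rz (nl _ (mem_head _ _)) xz sr srz.
    have [|r' [sr' r'E]] := IH z rz pl' _ srz; first by move=> y yl; apply: nl; rewrite inE yl orbT.
    by exists r'; split=> //; rewrite r'E big_cons rzE tE addrA.
  have [r0 sr0] := stot x0; have [|r' [sr' r'E]] := ind l x0 r0 pl _ sr0.
    move=> y yl yx; move: ul; rewrite lastI rcons_uniq ll => /andP[/negP nx _]; apply: nx; by rewrite -yx.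
  rewrite ll in sr'; have -> : coord bB (app h (b a)) c = r' by exact: s1.
  by rewrite r'E big_cons; move/mat_term: (s0 _ sr0) => ->.
have [x0 [l [ul cov hl]]] := mat_cover g a.
pose T d := coord bB (app g (b a)) d * coord bB (app f (b d)) c.
have fgE : coord bB (app (f * g) (b a)) c = \sum_(d <- x0 :: l) T d := coord_comp f c ul hl.
pose L := x0 :: l; pose S y := \sum_(d <- take (index y L).+1 L) T d.
exists (chain_of x0 l); split; first exact: chain_of_small.
exists (fun y y' r => y = y' /\ r = S y); split; first by apply: small_fun => u v r r' [_ ->] [_ ->].
exists x0, (last x0 l); split=> //; split; first by move=> y; exists (S y).
split; first by move=> r [_ ->]; apply/mat_term; rewrite /S /L /= eqxx take0 big_seq1.
split=> [y z r r' _ /chain_ofP[i [il yE zE]] [_ ->] [_ ->]|r [_ ->]].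
  exists (T z); split; first exact/mat_term.
  have iy : index y L = i by rewrite yE index_uniq // ltnW.
  have iz : index z L = i.+1 by rewrite zE -[nth x0 l i]/(nth x0 L i.+1) index_uniq.
  by rewrite /S iy iz (take_nth x0 (n := i.+1)) // -cats1 big_cat big_seq1 /= zE.
rewrite /mat fgE /S (_ : (index (last x0 l) L).+1 = size L) ?take_size //.
by rewrite (last_nth x0) index_uniq.
Qed.

Lemma pOneP (P : rel3 X R) : pOne P <-> P = mat 1.
Proof.
have h a c r : mat 1 a c r <-> (a = c /\ forall x, x = x * r) \/ (a <> c /\ r = r + r).
  rewrite /mat app1 coord_b; have [->|ac] := eqVneq a c.
    split=> [<-|[[_ /(_ 1)]|[//]]]; last by rewrite mul1r.
    by left; split=> // x; rewrite mulr1.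
  split=> [<-|[[/eqP]|[_ rr]]]; [by right; split; [exact/eqP|rewrite addr0]|by rewrite (negbTE ac)|].
  by apply: (addrI r); rewrite -rr addr0.
split=> [h'|-> //]; apply/funext => a; apply/funext => c; apply/funext => r; apply/propext.
by rewrite h'; apply: iff_sym; exact: h.
Qed.

Lemma pAutP (P : rel3 X R) : pAut P <-> exists g : Aut V, P = mat (aut_val g).
Proof.
have [_ _ iS] := @aut_unit_group R V.
split=> [[/endo_mat[f ->] [Q [_ [/endo_mat[g ->] [I [_ [/pOneP -> [/mat_mul fg /mat_mul gf]]]]]]]]|[g ->]].
  by have [u <-] := iS f g (esym fg) (esym gf); exists u.
have iu := @aut_unit_group R V.
split; first exact: mat_endo.
exists (mat (aut_val (g^-1)%g)); split; first exact: mat_small.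
split; first exact: mat_endo.
exists (mat 1); split; first exact: mat_small.
split; first exact/pOneP.
by split; apply/mat_mul; apply/esym; [exact: (uiVr iu g)|exact: (uiV iu g)].
Qed.
End Matrices.

(** * Interpreting group formulas by matrices *)

Lemma gterm_defined t : forall r : nat -> nat, exists F,
  forall (R : nzRingType) (V : lmodType R) (X : eqType) (b : X -> V) (bB : is_basis b), emb nat X ->
  forall es er ep (e : nat -> Aut V) (g : Aut V), (forall i, ep (r i).+1 = mat bB (aut_val (e i))) ->
  ep 0%N = mat bB (aut_val g) -> mholds es er ep F <-> g = geval e t.
Proof.
have mI (R : nzRingType) (V : lmodType R) (X : eqType) (b : X -> V) (bB : is_basis b) (g h : Aut V) :
    mat bB (aut_val g) = mat bB (aut_val h) <-> g = h.
  by split=> [/mat_inj /(ui_inj (@aut_unit_group R V))|->].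
have Hm (R : nzRingType) (V : lmodType R) (X : eqType) (b : X -> V) (bB : is_basis b) (g h k : Aut V) : emb nat X ->
    pMul (mat bB (aut_val g)) (mat bB (aut_val h)) (mat bB (aut_val k)) <-> k = (g * h)%g.
  move=> nX; rewrite (mat_mul _ nX) -(uiM (@aut_unit_group R V)).
  by split=> [/(ui_inj (@aut_unit_group R V))|->].
have H1 (R : nzRingType) (V : lmodType R) (X : eqType) (b : X -> V) (bB : is_basis b) (g : Aut V) : emb nat X ->
    pOne (mat bB (aut_val g)) <-> g = 1%g.
  by move=> nX; rewrite (pOneP bB) -(ui1 (@aut_unit_group R V)) mI.
elim: t => [i||t IHt u IHu|t IH] r.
- have [F FP] := HD_same 0 (r i).+1; exists F => R V X b bB nX es er ep e g he hg.
  rewrite FP hg he -mI; split=> [h|-> //].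
  by apply/funext => a; apply/funext => c; apply/funext => x; apply/propext.
- have [F FP] := HD_pOne 0; exists F => R V X b bB nX es er ep e g he hg.
  by rewrite FP hg H1.
- have [F FP] := IHt (fun i => (r i).+1); have [H HP] := IHu (fun i => (r i).+2).
  have [A AP] := HD_pAut 0; have [M MP] := HD_pMul 1 0 2.
  exists (MExP (MAnd A (MAnd F (MExP (MAnd A (MAnd H M)))))) => R V X b bB nX es er ep e g he hg.
  split=> [[P [_ [/AP /(pAutP bB nX)[g1 /= PE] [hF [Q [_ [/AP /(pAutP bB nX)[g2 /= QE] [hH /MP /= hM]]]]]]]]|h].
    move: hM; rewrite PE QE hg Hm // => ->; congr (_ * _)%g.
      by apply/(FP R V X b bB nX es er _ e g1 _ _).1: hF.
    by apply/(HP R V X b bB nX es er _ e g2 _ _).1: hH.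
  exists (mat bB (aut_val (geval e t))); split; first exact: mat_small.
  split; first by apply/AP/(pAutP bB nX); exists (geval e t).
  split; first by apply/(FP R V X b bB nX es er _ e (geval e t)).
  exists (mat bB (aut_val (geval e u))); split; first exact: mat_small.
  split; first by apply/AP/(pAutP bB nX); exists (geval e u).
  split; first by apply/(HP R V X b bB nX es er _ e (geval e u)).
  by apply/MP; rewrite /= hg Hm.
have [F FP] := IH (fun i => (r i).+1).
have [A AP] := HD_pAut 0; have [M MP] := HD_pMul 1 2 0; have [O OP] := HD_pOne 0.
exists (MExP (MAnd A (MAnd F (MExP (MAnd O M))))) => R V X b bB nX es er ep e g he hg.
split=> [[P [_ [/AP /(pAutP bB nX)[g1 /= PE] [hF [Q [_ [/OP /= /(pOneP bB) QE /MP /= hM]]]]]]]|h].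
  have <- : g1 = geval e t by apply/(FP R V X b bB nX es er _ e g1 _ _).1: hF.
  move: hM; rewrite PE QE hg -(ui1 (@aut_unit_group R V)) Hm // => /esym h1.
  by apply: (mulgI g1); rewrite h1 mulgV.
exists (mat bB (aut_val (geval e t))); split; first exact: mat_small.
split; first by apply/AP/(pAutP bB nX); exists (geval e t).
split; first by apply/(FP R V X b bB nX es er _ e (geval e t)).
exists (mat bB 1); split; first exact: mat_small.
split; first exact/OP/(pOneP bB).
by apply/MP; rewrite /= hg -(ui1 (@aut_unit_group R V)) Hm // h mulgV.
Qed.

(** Quantifiers over the group become relation quantifiers restricted by [pAut]; [r] records which
    relation variable holds the matrix of each group variable. *)
Lemma gformula_defined f : forall r : nat -> nat, exists F,
  forall (R : nzRingType) (V : lmodType R) (X : eqType) (b : X -> V) (bB : is_basis b), emb nat X ->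
  forall es er ep (e : nat -> Aut V), (forall i, ep (r i) = mat bB (aut_val (e i))) ->
  mholds es er ep F <-> gholds e f.
Proof.
have [A AP] := HD_pAut 0.
have ren (R : nzRingType) (V : lmodType R) (X : eqType) (b : X -> V) (bB : is_basis b) (r : nat -> nat) ep
    (e : nat -> Aut V) i g : (forall i, ep (r i) = mat bB (aut_val (e i))) ->
    forall j, scons (mat bB (aut_val g)) ep (if j == i then 0%N else (r j).+1) = mat bB (aut_val (upd e i g j)).
  by move=> he j; rewrite updE; case: eqP => //= _; exact: he.
have ex (h : gformula) i : (forall r : nat -> nat, exists F, forall (R : nzRingType) (V : lmodType R) (X : eqType) (b : X -> V) (bB : is_basis b),
      emb nat X -> forall es er ep (e : nat -> Aut V), (forall i, ep (r i) = mat bB (aut_val (e i))) ->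
      mholds es er ep F <-> gholds e h) ->
    forall r : nat -> nat, exists F, forall (R : nzRingType) (V : lmodType R) (X : eqType) (b : X -> V) (bB : is_basis b),
      emb nat X -> forall es er ep (e : nat -> Aut V), (forall i, ep (r i) = mat bB (aut_val (e i))) ->
      mholds es er ep F <-> exists g, gholds (upd e i g) h.
  move=> IH r; have [F FP] := IH (fun j => if j == i then 0%N else (r j).+1).
  exists (MExP (MAnd A F)) => R V X b bB nX es er ep e he; split=> [[P [_ [/AP /(pAutP bB nX)[g /= PE] hF]]]|[g hg]].
    exists g; apply/(FP R V X b bB nX es er _ _ (ren _ _ _ _ bB r ep e i g he)).
    by rewrite -PE.
  exists (mat bB (aut_val g)); split; first exact: mat_small.
  split; first by apply/AP/(pAutP bB nX); exists g.
  exact/(FP R V X b bB nX es er _ _ (ren _ _ _ _ bB r ep e i g he)).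
elim: f => [t u|f IH|f IHf g IHg|f IHf g IHg|f IHf g IHg|i f IH|i f IH] r.
- have [F FP] := gterm_defined t r; have [H HP] := gterm_defined u r.
  exists (MExP (MAnd A (MAnd F H))) => R V X b bB nX es er ep e he /=.
  split=> [[P [_ [/AP /(pAutP bB nX)[g /= PE] []]]]|h].
    rewrite (FP R V X b bB nX _ _ _ e g) // (HP R V X b bB nX _ _ _ e g) // => <-; exact: id.
  exists (mat bB (aut_val (geval e t))); split; first exact: mat_small.
  split; first by apply/AP/(pAutP bB nX); exists (geval e t).
  by rewrite (FP R V X b bB nX _ _ _ e (geval e t)) // (HP R V X b bB nX _ _ _ e (geval e t)).
- have [F FP] := IH r; exists (MNot F) => R V X b bB nX es er ep e he /=.
  by rewrite (FP R V X b bB nX _ _ _ e).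
- have [F FP] := IHf r; have [H HP] := IHg r; exists (MAnd F H) => R V X b bB nX es er ep e he /=.
  by rewrite (FP R V X b bB nX _ _ _ e) // (HP R V X b bB nX _ _ _ e).
- have [F FP] := IHf r; have [H HP] := IHg r.
  exists (MNot (MAnd (MNot F) (MNot H))) => R V X b bB nX es er ep e he /=.
  rewrite (FP R V X b bB nX _ _ _ e) // (HP R V X b bB nX _ _ _ e) //.
  split=> [n|[h|h] [] //]; have [h|nh] := pselect (gholds e f); [by left|right].
  by apply: contrapT => n'; apply: n.
- have [F FP] := IHf r; have [H HP] := IHg r.
  exists (MNot (MAnd F (MNot H))) => R V X b bB nX es er ep e he /=.
  rewrite (FP R V X b bB nX _ _ _ e) // (HP R V X b bB nX _ _ _ e) //.
  by split=> [n h|h [h1]]; [apply: contrapT => n'; apply: n|apply; exact: h].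
- have [r'|F FP] := ex (GNot f) i _ r.
    have [F FP] := IH r'; exists (MNot F) => R V X b bB nX es er ep e he /=.
    by rewrite (FP R V X b bB nX _ _ _ e).
  exists (MNot F) => R V X b bB nX es er ep e he /=; rewrite (FP R V X b bB nX _ _ _ e) //.
  by split=> [n x|h [x]]; [apply: contrapT => n'; apply: n; exists x|apply; exact: h].
by have [F FP] := ex f i IH r; exists F.
Qed.

Lemma geval_agree (G : groupType) t (e e' : nat -> G) xs : gterm_vars_in xs t -> {in xs, e =1 e'} -> geval e t = geval e' t.
Proof.
move=> + h; elim: t => [i /h //|//|t IHt u IHu /andP[/IHt + /IHu]|t IH /IH] /=; first by move=> -> ->.
by move=> ->.
Qed.

Lemma gholds_agree (G : groupType) f : forall xs (e e' : nat -> G), gfree_in xs f -> {in xs, e =1 e'} ->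
  gholds e f <-> gholds e' f.
Proof.
have U (xs : seq nat) (e e' : nat -> G) i x : {in xs, e =1 e'} -> {in i :: xs, upd e i x =1 upd e' i x}.
  by move=> h j; rewrite inE !updE; case: eqP => //= _; exact: h.
elim: f => [t u|f IH|f IHf g IHg|f IHf g IHg|f IHf g IHg|i f IH|i f IH] xs e e' /=.
- by move=> /andP[ht hu] h; rewrite (geval_agree ht h) (geval_agree hu h).
- by move=> hf h; rewrite (IH _ _ _ hf h).
- by move=> /andP[hf hg] h; rewrite (IHf _ _ _ hf h) (IHg _ _ _ hg h).
- by move=> /andP[hf hg] h; rewrite (IHf _ _ _ hf h) (IHg _ _ _ hg h).
- by move=> /andP[hf hg] h; rewrite (IHf _ _ _ hf h) (IHg _ _ _ hg h).
- by move=> hf h; split=> H x; apply/(IH _ _ _ hf (U _ _ _ i x h)); exact: H.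
- by move=> hf h; split=> -[x H]; exists x; apply/(IH _ _ _ hf (U _ _ _ i x h)).
Qed.

(** A sentence ignores its valuation, so all group variables are read from one relation variable,
    set to the identity matrix. *)
Theorem structure_interprets (phi : gformula) : gsentence phi ->
  exists psi, sentence2 psi /\ forall (R : nzRingType) (V : lmodType R) (K : Type),
    infinite_set [set: K] -> free_of_rank V K -> Th2 K R psi <-> group_theory (Aut V) phi.
Proof.
move=> phiS; have [F FP] := gformula_defined phi (fun=> 0%N); have [O OP] := HD_pOne 0.
have [psi [psiS psiP]] := HD_sentence (MExP (MAnd O F)); exists psi; split=> // R V K /emb_nat_infinite nK [b bB].
pose X : eqType := HB.pack_for eqType K (gen_eqMixin K).
have [k _] : exists k : K, True by case: nK => g _; exists (g 0%N).
apply: (psiP K R _ k) => es er ep.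
have E1 : mat (X := X) bB 1 = mat (X := X) bB (aut_val (1%g : Aut V)) by [].
split=> [[P [_ [/OP /= /(pOneP (X := X) bB) PE hF]]]|[_ h]].
  split=> // e; apply/(gholds_agree phiS (e' := fun=> 1%g)) => //.
  by apply/(FP R V X b bB nK es er (scons P ep)) => // _; rewrite /= PE.
exists (mat (X := X) bB 1); split; first exact: (@mat_small R V X b bB nK).
split; first exact/OP/(pOneP (X := X) bB).
apply/(FP R V X b bB nK es er (scons (mat (X := X) bB 1) ep) (fun=> 1%g)) => //; exact: h.
Qed.

Theorem corollary10
  (F1 F2 : nzRingType)
  (half1 : invertible (2%:R : F1)) (half2 : invertible (2%:R : F2))
  (class12 :
     (skewfield F1 /\ skewfield F2) \/
     (principal_domain F1 /\ principal_domain F2) \/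
     ((commutative_ring F1 /\ no_nontrivial_central_idempotents F1) /\
      (commutative_ring F2 /\ no_nontrivial_central_idempotents F2)) \/
     ((local_ring F1 /\ no_nontrivial_central_idempotents F1) /\
      (local_ring F2 /\ no_nontrivial_central_idempotents F2)))
  (K1 K2 : Type)
  (infK1 : infinite_set [set: K1]) (infK2 : infinite_set [set: K2])
  (V1 : lmodType F1) (V2 : lmodType F2)
  (freeV1 : free_of_rank V1 K1) (freeV2 : free_of_rank V2 K2)
  (max1 : has_maximal_left_ideal_generated_by_at_most F1 K1) :
  elementarily_equivalent (Aut V1) (Aut V2) <-> Th2 K1 F1 = Th2 K2 F2.
Proof.
have loc (R : nzRingType) : local_ring R -> rclass_ok true R /\ noidem R.
  by move=> h; split; [split; [exact: loc_cyc|exact: loc_rank]|exact: loc_noidem].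
have pid (R : nzRingType) : principal_domain R -> rclass_ok true R /\ noidem R.
  by move=> h; split; [split; [exact: pd_cyc|exact: pd_rank]|exact: pd_noidem].
have com (R : nzRingType) : commutative_ring R -> no_nontrivial_central_idempotents R -> rclass_ok false R /\ noidem R.
  by move=> h1 h2; split=> // r rr; apply: h2 => // x; exact: h1.
(* One flag has to serve both rings, because the interpreting sentence [phi] depends on it; here it
   matters that the rings belong to the same class. *)
have [nc [[c1 n1] [c2 n2]]] : exists nc, (rclass_ok nc F1 /\ noidem F1) /\ (rclass_ok nc F2 /\ noidem F2).
  case: class12 => [[/skewfield_local/loc h1 /skewfield_local/loc h2]|[[/pid h1 /pid h2]|[[[a1 b1] [a2 b2]]|[[/loc h1 _] [/loc h2 _]]]]].
  - by exists true.
  - by exists true.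
  - by exists false; split; exact: com.
  - by exists true.
split=> e; apply/seteqP; split=> f.
- move=> h; have [phi phiP] := group_interprets nc (proj1 h).
  by apply/(phiP F2 V2 K2) => //; rewrite -e; apply/(phiP F1 V1 K1).
- move=> h; have [phi phiP] := group_interprets nc (proj1 h).
  by apply/(phiP F1 V1 K1) => //; rewrite e; apply/(phiP F2 V2 K2).
- move=> h; have [psi [_ psiP]] := structure_interprets (proj1 h).
  by apply/(psiP F2 V2 K2) => //; rewrite -e; apply/(psiP F1 V1 K1).
- move=> h; have [psi [_ psiP]] := structure_interprets (proj1 h).
  by apply/(psiP F1 V1 K1) => //; rewrite e; apply/(psiP F2 V2 K2).
Qed.
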